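(* Let $(M,g)$ be a complete gradient shrinking Kähler-Ricci soliton of real dimension $n$, normalized so that $Ric+Hess(f)=\frac12 g$, whose scalar curvature satisfies $$R\le\alpha<\frac n2-1$$ on $M$ for some constant $\alpha$. Then $M$ is connected at infinity.
   Context: A gradient shrinking Kähler-Ricci soliton is a (connected) complete Kähler manifold $(M,g)$ with a smooth real function $f$ such that $R_{\alpha\bar\beta}+f_{\alpha\bar\beta}=g_{\alpha\bar\beta}$ and $f_{\alpha\beta}=f_{\bar\alpha\bar\beta}=0$. The convention for complex frames is that $\langle\nabla u,\nabla v\rangle=\frac12(u_\alpha v_{\bar\alpha}+u_{\bar\alpha}v_\alpha)$ and $\Delta u=u_{\alpha\bar\alpha}$ (summing over $\alpha$), so that in real terms the soliton equation is $Ric+Hess(f)=\frac12 g$. $R$ is the Riemannian scalar curvature (so $R+\Delta f=\frac n2$). ''Connected at infinity'' means that $M$ has exactly one end, i.e. for every compact set $K\subset M$, $M\setminus K$ has exactly one unbounded connected component. *)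

(* Defs.v *)
From HB Require Import structures.
From mathcomp Require Import all_boot all_order all_algebra.
From mathcomp Require Import all_classical all_reals all_analysis.
Import Order.TTheory GRing.Theory Num.Theory.
Import numFieldNormedType.Exports.

Set Implicit Arguments.
Unset Strict Implicit.
Unset Printing Implicit Defensive.

Local Open Scope classical_set_scope.
Local Open Scope ring_scope.

(* Calculus on open subsets of R^n *)

Definition partial (R : realType) (n : nat) (i : 'I_n)
    (h : 'rV[R]_n -> R) (x : 'rV[R]_n) : R :=
  'D_(delta_mx 0 i) h x.

Fixpoint Ck (R : realType) (n k : nat) (U : set 'rV[R]_n)
    (h : 'rV[R]_n -> R) : Prop :=
  match k with
  | 0 => forall x, U x -> {for x, continuous h}
  | k'.+1 =>
      (forall (i : 'I_n) x, U x -> derivable h x (delta_mx 0 i)) /\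
      (forall i : 'I_n, Ck k' U (partial i h))
  end.

Definition smooth (R : realType) (n : nat) (U : set 'rV[R]_n)
    (h : 'rV[R]_n -> R) : Prop :=
  forall k : nat, Ck k U h.

(* Matrices act on row vectors on the right: the differential of F at x is
   v |-> v *m jac F x. *)
Definition jac (R : realType) (n : nat) (F : 'rV[R]_n -> 'rV[R]_n)
    (x : 'rV[R]_n) : 'M[R]_n :=
  \matrix_(i, j) partial i (fun y => F y 0 j) x.

(* C^m is identified with R^(m+m) by z = x + iy |-> (x, y); multiplication by
   the imaginary unit is v |-> v *m Jstd. *)
Definition Jstd (R : realType) (m : nat) : 'M[R]_(m + m) :=
  block_mx 0 1%:M (- 1%:M) 0.

(* Levi-Civita calculus of a metric g given by its matrix in coordinates.
   Sign convention: the round sphere has positive Ricci curvature. *)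

Section LeviCivita.
Variables (R : realType) (n : nat) (g : 'rV[R]_n -> 'M[R]_n).

Definition christoffel (k i j : 'I_n) (x : 'rV[R]_n) : R :=
  2^-1 * \sum_(l < n) invmx (g x) k l *
    (partial i (fun y => g y j l) x + partial j (fun y => g y i l) x
     - partial l (fun y => g y i j) x).

Definition coord_hessian (h : 'rV[R]_n -> R) (x : 'rV[R]_n) : 'M[R]_n :=
  \matrix_(i, j) (partial i (partial j h) x
                  - \sum_(k < n) christoffel k i j x * partial k h x).

Definition coord_ricci (x : 'rV[R]_n) : 'M[R]_n :=
  \matrix_(i, j)
    (\sum_(k < n) (partial k (christoffel k i j) x
                   - partial j (christoffel k i k) x)
     + \sum_(k < n) \sum_(l < n)
         (christoffel k k l x * christoffel l i j x
          - christoffel k j l x * christoffel l i k x)).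

Definition coord_scal (x : 'rV[R]_n) : R :=
  \tr (invmx (g x) *m coord_ricci x).

End LeviCivita.

(* Complex manifolds of complex dimension m (real dimension m + m), given by a
   holomorphic atlas; the Cauchy-Riemann equations say that the differentials
   of the transition maps commute with Jstd.  [icoord i] is the inverse of the
   chart [coord i] and is only meaningful on the chart image; [chart_at p] is
   some chart around p. *)

Record complexManifold (R : realType) (m : nat) := ComplexManifold {
  points :> topologicalType;
  points_hausdorff : hausdorff_space points;
  points_second_countable : @second_countable points;
  chart_idx : Type;
  dom : chart_idx -> set points;
  coord : chart_idx -> points -> 'rV[R]_(m + m);
  icoord : chart_idx -> 'rV[R]_(m + m) -> points;
  chart_at : points -> chart_idx;
  dom_chart_at : forall p, dom (chart_at p) p;
  dom_open : forall i, open (dom i);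
  coord_open : forall i, open (coord i @` dom i);
  coordK : forall i p, dom i p -> icoord i (coord i p) = p;
  coord_continuous : forall i p, dom i p -> {for p, continuous (coord i)};
  icoord_continuous : forall i x,
    (coord i @` dom i) x -> {for x, continuous (icoord i)};
  transition_smooth : forall i j (k : 'I_(m + m)),
    smooth (coord i @` (dom i `&` dom j))
           (fun x => coord j (icoord i x) 0 k);
  transition_holomorphic : forall i j x,
    (coord i @` (dom i `&` dom j)) x ->
    Jstd R m *m jac (fun y => coord j (icoord i y)) x
    = jac (fun y => coord j (icoord i y)) x *m Jstd R m
}.

(* A Kaehler metric: a Riemannian metric, given by its matrices [met i] in the
   charts, which is Hermitian and whose fundamental form omega(u, v) = g(Ju, v),
   of matrix Jstd *m met i, is closed. *)

Record kahlerManifold (R : realType) (m : nat) := KahlerManifold {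
  complex_mfd :> complexManifold R m;
  met : chart_idx complex_mfd -> 'rV[R]_(m + m) -> 'M[R]_(m + m);
  met_smooth : forall i (a b : 'I_(m + m)),
    smooth (coord i @` dom i) (fun x => met i x a b);
  met_sym : forall i x, (coord i @` dom i) x -> (met i x)^T = met i x;
  met_pos : forall i x (v : 'rV[R]_(m + m)),
    (coord i @` dom i) x -> v != 0 -> 0 < (v *m met i x *m v^T) 0 0;
  met_transition : forall i j x,
    (coord i @` (dom i `&` dom j)) x ->
    met i x = jac (fun y => coord j (icoord i y)) x
              *m met j (coord j (icoord i x))
              *m (jac (fun y => coord j (icoord i y)) x)^T;
  met_hermitian : forall i x, (coord i @` dom i) x ->
    Jstd R m *m met i x *m (Jstd R m)^T = met i x;
  met_closed : forall i x (a b c : 'I_(m + m)), (coord i @` dom i) x ->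
    partial a (fun y => (Jstd R m *m met i y) b c) x
    + partial b (fun y => (Jstd R m *m met i y) c a) x
    + partial c (fun y => (Jstd R m *m met i y) a b) x = 0
}.

Section KahlerManifolds.
Variables (R : realType) (m : nat) (M : kahlerManifold R m).

(* Distance.  A curve is parametrized by [0, 1] and is required to be C^1 on a
   neighbourhood of each point of [0, 1]; any C^1 curve on [0, 1] extends to
   such a curve.  Piecewise C^1 curves are finite concatenations. *)

Definition C1_curve (c : R -> M) : Prop :=
  forall t : R, 0 <= t <= 1 ->
    {for t, continuous c} /\
    forall i : chart_idx M, dom i (c t) ->
      (\forall s \near t, derivable (fun u => coord i (c u)) s 1) /\
      {for t, continuous (derive1 (fun u => coord i (c u)))}.

Definition speed (c : R -> M) (t : R) : R :=
  let i := chart_at (c t) in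
  let v := derive1 (fun u => coord i (c u)) t in
  Num.sqrt ((v *m met i (coord i (c t)) *m v^T) 0 0).

Definition curve_length (c : R -> M) : R :=
  \int[lebesgue_measure]_(t in `[0, 1]) speed c t.

Inductive path_length : M -> M -> R -> Prop :=
  | path_length_nil p : path_length p p 0
  | path_length_cons c q l : C1_curve c -> path_length (c 1) q l ->
      path_length (c 0) q (curve_length c + l).

Definition dist (p q : M) : R := inf [set l | path_length p q l].

Definition complete_metric : Prop :=
  forall u : nat -> M,
    (forall e : R, 0 < e -> exists N : nat, forall k l : nat,
       (N <= k)%N -> (N <= l)%N -> dist (u k) (u l) < e) ->
    exists p : M, (fun k => dist (u k) p) @ \oo --> (0 : R).

Definition dist_bounded (A : set M) : Prop :=
  exists r : R, forall p q, A p -> A q -> dist p q <= r.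

Definition unbounded_component (A C : set M) : Prop :=
  (exists2 p, A p & C = connected_component A p) /\ ~ dist_bounded C.

Definition connected_at_infinity : Prop :=
  forall K : set M, compact K -> exists! C : set M,
    unbounded_component (~` K) C.

(* Curvature and solitons *)

Definition smooth_fun (f : M -> R) : Prop :=
  forall i : chart_idx M,
    smooth (coord i @` dom i) (fun x => f (icoord i x)).

Definition scalar_curvature (p : M) : R :=
  coord_scal (met (chart_at p)) (coord (chart_at p) p).

Definition hessian (f : M -> R) (i : chart_idx M) (x : 'rV[R]_(m + m)) :
    'M[R]_(m + m) :=
  coord_hessian (met i) (fun y => f (icoord i y)) x.

(* In the second equation, the vanishing of f_{alpha beta} and of its conjugate
   is the invariance of the real Hessian under the complex structure: for
   Z = u - iJu and W = v - iJv,
   Hess f (Z, W) = (H(u, v) - H(Ju, Jv)) - i (H(Ju, v) + H(u, Jv)). *)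
Definition gradient_shrinking_KR_soliton (f : M -> R) : Prop :=
  [/\ [set: M] !=set0 /\ connected [set: M],
      complete_metric,
      smooth_fun f,
      (forall (i : chart_idx M) x, (coord i @` dom i) x ->
         coord_ricci (met i) x + hessian f i x = 2^-1 *: met i x) &
      (forall (i : chart_idx M) x, (coord i @` dom i) x ->
         Jstd R m *m hessian f i x *m (Jstd R m)^T = hessian f i x)].

End KahlerManifolds.

(* Main.v *)
(** Tracing the soliton equation and using the Bianchi identity, [R + |grad f|^2 - f] is constant,
    and the Hessian of [f] commutes with the complex structure [J].

    The distance to a base point is controlled without geodesics.  Transport a unitary frame along
    a fine chain of points of a minimizing path, by the Christoffel symbols of the charts, and look
    at the distances from [p] to the [4 n] points displaced by [s] times the vectors
    [e, J e, - e, - J e], corrected at order [s^2].  Summing over the frame, the second variation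
    formula appears with the Ricci curvature replaced by [g / 2 - Hess f], and the drift
    [- grad f / (2 n)] in the displacement absorbs [Hess f].  This gives the barrier inequality
    [Delta_f dist <= C - dist / 2] at unit distance from [p], and, when the displacement is brought
    back to zero at the far end, a linear lower bound for [sup |grad f|] on unit balls.

    The barrier and the maximum principle for [Delta_f R = R - 2 |Ric|^2], localized by
    [(A - dist)^2], bound [R] from below.  So [|grad f|^2 <= f + C], the function [sqrt (f + C)] is
    Lipschitz, and [f] is proper.

    Since [Delta f = n / 2 - R > 1] and the Hessian is [J]-invariant, at every critical point the
    Hessian of [f] is positive on a complex line.  So near each point of a level set [{f = c}] the
    set [{f > c}] is locally connected, and [f] has no local maximum; a mountain pass argument
    shows that all the sets [{f > c}] are connected.  As the sets [{f <= c}] are compact, there is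
    exactly one end. *)

From HB Require Import structures.
From Pilot Require Import Defs.
From mathcomp Require Import all_boot all_order all_algebra.
From mathcomp Require Import all_classical all_reals all_analysis.
From mathcomp Require Import ring lra.
Import Pilot.Defs.
Import Order.TTheory GRing.Theory Num.Theory.
Import numFieldNormedType.Exports.
Set Implicit Arguments.
Unset Strict Implicit.
Unset Printing Implicit Defensive.
Local Open Scope classical_set_scope.
Local Open Scope ring_scope.

(** * Differential calculus on open subsets of R^n *)

(** The distance is an infimum of lengths of C1 curves and need not be differentiable, so comparison
    statements are inequalities between distances at nearby points, up to order [s ^ 3]. Exact
    intermediate points, supplied by compactness of balls, stand for a minimizing path. The steps of
    the chain have length at most [s ^ 3 / 2]: a step of length [d] costs an error of order
    [d * s ^ 3], and the total error, of order [s ^ 3], is negligible against the second variation,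
    of order [s ^ 2]. Opposite signs of [e] cancel the first variation. Pairing [e] with [J e] lets
    the Kaehler identity turn second derivatives of the metric into a form whose trace is the Ricci
    curvature, so that no curvature tensor, Jacobi field or exponential map enters. The second-order
    correction has opposite signs for [e] and [J e] and cancels in the sum; it is carried along
    because a change of holomorphic chart creates such a term. The weight [1 / (2 n)] comes from the
    number [4 n] of points: the total drift is [- 2 s ^ 2 grad f], in the normalization [2 s ^ 2] of
    the barrier. *)

Section Prelim.
Variable (R : realType).

Lemma nbhs_norm_ex (V : normedModType R) (x : V) (P : set V) :
  (\forall y \near x, P y) <-> exists2 r : R, 0 < r & forall y, `|y - x| < r -> P y.
Proof.
split=> [/nbhs_ballP[r /= r0 H]|[r r0 H]].
  by exists r => // y yr; apply: H; rewrite -ball_normE /= distrC.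
by apply/nbhs_ballP; exists r => //= y; rewrite -ball_normE /= distrC; exact: H.
Qed.

Lemma differentiable_epsilon (V W : normedModType R) (f : V -> W)
    (df : {linear V -> W}) (x : V) :
  continuous df ->
  (forall e : R, 0 < e -> exists2 r : R, 0 < r & forall v, `|v| < r ->
    `|f (v + x) - f x - df v| <= e * `|v|) ->
  differentiable f x /\ 'd f x = df :> (V -> W).
Proof.
move=> dfc H.
have E : f \o shift x = cst (f x) + df +o_ 0 id.
  apply/eqaddoP => _/posnumP[e] /=.
  have [r r0 {}H] := H e%:num [gt0 of e%:num]; apply/nbhs_norm_ex; exists r => // v.
  by rewrite subr0 !fctE /= opprD addrA => /H.
have Ed := diff_unique dfc E.
split=> //.
apply/diff_locallyP; split; last by rewrite Ed.
by rewrite Ed.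
Qed.

End Prelim.

Section Differentiability.
Variables (R : realType) (n : nat).
Implicit Types (U : set 'rV[R]_n) (h : 'rV[R]_n -> R) (x v : 'rV[R]_n).

Definition lin_form (a : 'I_n -> R) v : R^o := \sum_i v 0 i * a i.
Lemma lin_form_linear a : linear (lin_form a).
Proof.
move=> k u v; rewrite /lin_form scaler_sumr -big_split/=.
by apply: eq_bigr => i _; rewrite !mxE mulrDl -mulrA.
Qed.
HB.instance Definition _ a := GRing.isLinear.Build R 'rV[R]_n R^o _ (lin_form a) (lin_form_linear a).

Lemma normv_coord x i : `|x 0 i| <= `|x|.
Proof.
rewrite [leRHS]/Num.Def.normr/= mx_normrE.
exact: (le_bigmax _ (fun ij : 'I_1 * 'I_n => `|x ij.1 ij.2|) (0, i)).
Qed.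

Lemma normv_le x (e : R) : 0 <= e -> (forall i, `|x 0 i| <= e) -> `|x| <= e.
Proof.
move=> e0 H; rewrite [leLHS]/Num.Def.normr/= mx_normrE (bigmax_le _ e0)//= => -[i j] _ /=.
by rewrite ord1.
Qed.

Lemma lin_form_continuous a : continuous (lin_form a).
Proof.
move=> v; rewrite /lin_form; apply: continuous_big => [|i _ u].
  exact: add_continuous.
have H (w : 'rV[R]_n) : {for w, continuous (fun w : 'rV[R]_n => w 0 i * a i : R)}.
  by apply: (@continuousM R 'rV[R]_n); [exact: matrix_normedtype.coord_continuous|exact: cst_continuous].
exact: H.
Qed.

Lemma line_derivable h x v (t : R) : derivable h (x + t *: v) v ->
  is_derive t (1 : R) (fun s => h (x + s *: v)) ('D_v h (x + t *: v)).
Proof.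
move=> H; have E : (fun e : R => e^-1 *: (((fun s => h (x + s *: v)) \o shift t) (e *: 1) - h (x + t *: v)))
   = (fun e => e^-1 *: ((h \o shift (x + t *: v)) (e *: v) - h (x + t *: v))).
  apply/funext => e /=; congr (_ *: (h _ - _)).
  by rewrite /= scaler1 scalerDl addrC -addrA [X in _ + X]addrC.
split; first by rewrite /derivable E.
by rewrite /derive E.
Qed.

Lemma line_mvt h x v (c : R) :
  (forall t, 0 <= t <= 1 -> derivable h (x + (t * c) *: v) v) ->
  exists2 t, 0 <= t <= 1 & h (x + c *: v) - h x = c * 'D_v h (x + (t * c) *: v).
Proof.
have main y (b : R) : 0 < b -> (forall t, 0 <= t <= 1 -> derivable h (y + (t * b) *: v) v) ->
  exists2 t, 0 <= t <= 1 & h (y + b *: v) - h y = b * 'D_v h (y + (t * b) *: v).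
  move=> b0 H.
  have D s : 0 <= s <= b -> is_derive s (1 : R) (fun s => h (y + s *: v)) ('D_v h (y + s *: v)).
    move=> /andP[s0 sb]; apply: line_derivable.
    have /H : 0 <= s / b <= 1 by rewrite divr_ge0 ?(ltW b0)//= ler_pdivrMr ?mul1r.
    by rewrite divfK ?gt_eqF.
  have D1 s : s \in `]0, b[%R -> is_derive s (1 : R) (fun s => h (y + s *: v)) ('D_v h (y + s *: v)).
    by rewrite in_itv /= => /andP[s0 sb]; apply: D; rewrite !ltW.
  have D2 : {within `[0, b], continuous (fun s => h (y + s *: v))}.
    by apply: derivable_within_continuous => s; rewrite in_itv/= => /D[].
  have [s sb E] := @MVT R (fun s => h (y + s *: v)) _ 0 b b0 D1 D2.
  exists (s / b).
    by move: sb; rewrite in_itv /= => /andP[/ltW s0 /ltW sb]; rewrite divr_ge0 ?(ltW b0)//= ler_pdivrMr ?mul1r.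
  by move: E; rewrite scale0r addr0 subr0 => ->; rewrite divfK ?gt_eqF// mulrC.
move=> H; have [c0|c0|c0] := ltrgtP c 0; last first.
- exists 0; first by rewrite lexx ler01.
  by rewrite c0 scale0r addr0 subrr mul0r.
- exact: main.
(* For [c < 0] the segment is traversed backwards from [x + c *: v], which replaces [t] by
   [1 - t]. *)
- have [t /andP[t0 t1] E] : exists2 t, 0 <= t <= 1 & h (x + c *: v + (- c) *: v) - h (x + c *: v) =
      (- c) * 'D_v h (x + c *: v + (t * - c) *: v).
    apply: main; first by rewrite oppr_gt0.
    move=> t /andP[t0 t1]; rewrite -addrA -scalerDl.
    have -> : c + t * - c = (1 - t) * c by ring.
    by apply: H; lra.
  exists (1 - t); first by lra.
  move: E; rewrite -!addrA -!scalerDl subrr scale0r addr0.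
  have -> : c + t * - c = (1 - t) * c by ring.
  lra.
Qed.

Definition trunc v (k : nat) : 'rV[R]_n := \row_i (if (i < k)%N then v 0 i else 0).

Lemma truncS v (k : 'I_n) : trunc v k.+1 = trunc v k + v 0 k *: delta_mx 0 k.
Proof.
apply/rowP => i; rewrite !mxE eqxx /= ltnS leq_eqVlt.
case: eqP => [/val_inj ->|/eqP ki]; first by rewrite ltnn eqxx/= mulr1 add0r.
have /negbTE -> : i != k by apply: contraNneq ki => ->.
by rewrite mulr0 addr0.
Qed.

Lemma trunc_head0 v : trunc v 0 = 0.
Proof. by apply/rowP => i; rewrite !mxE. Qed.
Lemma truncn v : trunc v n = v.
Proof. by apply/rowP => i; rewrite !mxE ltn_ord. Qed.

Lemma normv_trunc v (k : 'I_n) (t : R) : 0 <= t <= 1 ->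
  `|trunc v k + (t * v 0 k) *: delta_mx 0 k| <= `|v|.
Proof.
move=> /andP[t0 t1]; apply: normv_le => // i; rewrite !mxE eqxx /=.
have vi := normv_coord v i.
case: (ltngtP i k) => ik.
- have /negbTE -> : i != k by apply/eqP => E; rewrite E ltnn in ik.
  by rewrite mulr0 addr0.
- have /negbTE -> : i != k by apply/eqP => E; rewrite E ltnn in ik.
  by rewrite mulr0 addr0 normr0.
- rewrite (val_inj ik) eqxx mulr1 add0r normrM ger0_norm//.
  by rewrite (le_trans _ (normv_coord v k)) // ler_piMl.
Qed.

(** The increment telescopes along the broken line through the points [x + trunc v k], which changes
    one coordinate at a time. The mean value theorem on each piece compares it with the partial
    derivative at [x]. *)
Lemma C1_differentiable U h x : open U -> U x ->
  (forall i y, U y -> derivable h y (delta_mx 0 i)) ->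
  (forall i, {for x, continuous (partial i h)}) ->
  differentiable h x /\ 'd h x = lin_form (fun i => partial i h x) :> ('rV[R]_n -> R^o).
Proof.
move=> oU Ux hd hc; apply: differentiable_epsilon; first exact: lin_form_continuous.
move=> e e0.
have n0 : 0 < n%:R + 1 :> R by rewrite ltr_wpDl.
have e' : 0 < e / (n%:R + 1) by rewrite divr_gt0.
have near1 : \forall y \near x, U y /\ forall i, `|partial i h x - partial i h y| <= e / (n%:R + 1).
  near=> y; split; first by near: y; exact: open_nbhs_nbhs.
  near: y; apply: filter_forall => i.
  by have /cvgrPdist_le/(_ _ e') := hc i.
have [r r0 rP] := (@nbhs_norm_ex R _ x _).1 near1.
exists r => // v vr.
have inU w : `|w| <= `|v| -> U (x + w) /\ forall i, `|partial i h x - partial i h (x + w)| <= e / (n%:R + 1).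
  by move=> wv; apply: rP; rewrite addrC addKr; exact: le_lt_trans vr.
have -> : h (v + x) - h x - lin_form (fun i => partial i h x) v =
   \sum_(k < n) (h (x + trunc v k.+1) - h (x + trunc v k) - v 0 k * partial k h x).
  rewrite [RHS]big_split/= sumrN /lin_form; congr (_ - _).
  rewrite -(big_mkord xpredT (fun k => h (x + trunc v k.+1) - h (x + trunc v k))).
  by rewrite (telescope_sumr (fun k => h (x + trunc v k)))// truncn trunc_head0 addr0 [v + x]addrC.
apply: le_trans (ler_norm_sum _ _ _) _.
apply: (@le_trans _ _ (\sum_(k < n) (e / (n%:R + 1)) * `|v|)).
  apply: ler_sum => k _; rewrite truncS addrA.
  have [|t t01 ->] := @line_mvt h (x + trunc v k) (delta_mx 0 k) (v 0 k).
    move=> t t01; apply: hd; rewrite -addrA; apply: (inU _ _).1.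
    exact: normv_trunc.
  rewrite -/(partial k h _) -mulrBr normrM mulrC distrC -addrA.
  apply: ler_pM => //; last exact: normv_coord.
  by apply: (inU _ _).2; exact: normv_trunc.
have le1 : n%:R * (e / (n%:R + 1)) <= e.
  by rewrite mulrA ler_pdivrMr// mulrC ler_wpM2l ?ltW// ltr_pwDr.
rewrite sumr_const card_ord -[leLHS]mulr_natl mulrA ler_wpM2r//.
Unshelve. all: by end_near. Qed.

End Differentiability.

Section Smooth.
Variables (R : realType) (n : nat).
Implicit Types (U : set 'rV[R]_n) (f g h : 'rV[R]_n -> R) (x v : 'rV[R]_n).

Lemma near_open U x (P : set 'rV[R]_n) : open U -> U x -> (forall y, U y -> P y) ->
  \forall y \near x, P y.
Proof. by move=> oU Ux H; near=> y; apply: H; near: y; exact: open_nbhs_nbhs.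
Unshelve. all: by end_near. Qed.

Lemma derivable_ext U f g x v : open U -> U x -> (forall y, U y -> f y = g y) ->
  derivable f x v -> derivable g x v.
Proof.
move=> oU Ux H; have [->|v0] := eqVneq v 0; first by move=> _; exact: derivable0.
by apply: near_eq_derivable => //; exact: (near_open oU Ux H).
Qed.

Lemma derive_ext U f g x v : open U -> U x -> (forall y, U y -> f y = g y) ->
  'D_v f x = 'D_v g x.
Proof.
move=> oU Ux H; have [->|v0] := eqVneq v 0; first by rewrite !derive0.
by apply: near_eq_derive => //; exact: (near_open oU Ux H).
Qed.

Lemma continuous_ext U f g x : open U -> U x -> (forall y, U y -> f y = g y) ->
  {for x, continuous f} -> {for x, continuous g}.
Proof.
move=> oU Ux H cf; have E : g x = f x by rewrite H.
rewrite /prop_for /continuous_at E; apply: cvg_trans cf; apply: (@near_eq_cvg _ _ (nbhs x)).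
exact: (@near_open U x (fun y => f y = g y) oU Ux H).
Qed.

Lemma Ck_ext k U f g : open U -> (forall y, U y -> f y = g y) -> Ck k U f -> Ck k U g.
Proof.
move=> oU; elim: k f g => [|k IH] f g H /=.
  by move=> cf x Ux; exact: (continuous_ext oU Ux H (cf x Ux)).
move=> [df cf]; split=> [i x Ux|i]; first exact: (derivable_ext oU Ux H (df i x Ux)).
by apply: IH (cf i) => y Uy; exact: (derive_ext _ oU Uy H).
Qed.

Lemma Ck1_diff U f x : open U -> U x -> Ck 1 U f ->
  differentiable f x /\ 'd f x = lin_form (fun i => partial i f x) :> ('rV[R]_n -> R^o).
Proof. by move=> oU Ux [df cf]; apply: (C1_differentiable oU) => // i; exact: cf. Qed.

Lemma CkS k U f : open U -> Ck k.+1 U f -> Ck k U f.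
Proof.
move=> oU; elim: k f => [|k IH] f.
  by move=> H x Ux; apply: differentiable_continuous; apply: (Ck1_diff oU Ux H).1.
by move=> [df cf]; split=> // i; apply: IH; exact: cf.
Qed.

Lemma Ck_cst k U (c : R) : Ck k U (fun=> c).
Proof.
elim: k c => [|k IH] c /=; first by move=> x _; exact: cst_continuous.
split=> [i x _|i]; first exact: derivable_cst.
have -> : partial i (fun=> c) = fun=> 0 by apply/funext => x; rewrite /partial derive_cst.
exact: IH.
Qed.

Lemma CkD k U f g : open U -> Ck k U f -> Ck k U g -> Ck k U (fun x => f x + g x).
Proof.
move=> oU; elim: k f g => [|k IH] f g.
  by move=> cf cg x Ux; apply: continuousD; [exact: cf|exact: cg].
move=> [df cf] [dg cg]; split=> [i x Ux|i]; first by apply: derivableD; [exact: df|exact: dg].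
apply: Ck_ext (IH _ _ (cf i) (cg i)) => // y Uy.
by rewrite /partial -deriveD; [|exact: df|exact: dg].
Qed.

Lemma CkM k U f g : open U -> Ck k U f -> Ck k U g -> Ck k U (fun x => f x * g x).
Proof.
move=> oU; elim: k f g => [|k IH] f g.
  by move=> cf cg x Ux; apply: continuousM; [exact: cf|exact: cg].
move=> Hf Hg; have [df cf] := Hf; have [dg cg] := Hg.
split=> [i x Ux|i]; first by apply: derivableM; [exact: df|exact: dg].
have := CkD oU (IH _ _ (CkS oU Hf) (cg i)) (IH _ _ (CkS oU Hg) (cf i)).
apply: Ck_ext => // y Uy.
by rewrite /partial (_ : (fun x => f x * g x) = f * g)// deriveM; [|exact: df|exact: dg].
Qed.

Lemma CkV k U f : open U -> (forall x, U x -> f x != 0) -> Ck k U f -> Ck k U (fun x => (f x)^-1).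
Proof.
move=> oU f0; elim: k => [|k IH].
  by move=> cf x Ux; apply: continuousV; [exact: f0|exact: cf].
move=> Hf; have [df cf] := Hf.
split=> [i x Ux|i]; first by apply: derivableV; [exact: f0|exact: df].
have V := IH (CkS oU Hf).
have := CkM oU (Ck_cst k U (-1)) (CkM oU (CkM oU V V) (cf i)).
apply: Ck_ext => // y Uy.
rewrite /partial (@deriveV _ _ f y _ (f0 y Uy) (df _ _ Uy)) /GRing.scale /= -exprVn expr2.
ring.
Qed.

Lemma smooth_ext U f g : open U -> (forall y, U y -> f y = g y) -> smooth U f -> smooth U g.
Proof. by move=> oU H sf k; exact: Ck_ext (sf k). Qed.
Lemma smooth_cst U (c : R) : smooth U (fun=> c).
Proof. by move=> k; exact: Ck_cst. Qed.
Lemma smoothD U f g : open U -> smooth U f -> smooth U g -> smooth U (fun x => f x + g x).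
Proof. by move=> oU sf sg k; exact: CkD. Qed.
Lemma smoothM U f g : open U -> smooth U f -> smooth U g -> smooth U (fun x => f x * g x).
Proof. by move=> oU sf sg k; exact: CkM. Qed.
Lemma smoothZ U (c : R) f : open U -> smooth U f -> smooth U (fun x => c * f x).
Proof. by move=> oU sf; apply: smoothM => //; exact: smooth_cst. Qed.
Lemma smoothN U f : open U -> smooth U f -> smooth U (fun x => - f x).
Proof. by move=> oU sf; apply: (smooth_ext oU _ (smoothZ (-1) oU sf)) => y _; rewrite mulN1r. Qed.
Lemma smoothB U f g : open U -> smooth U f -> smooth U g -> smooth U (fun x => f x - g x).
Proof. by move=> oU sf sg; apply: smoothD => //; exact: smoothN. Qed.
Lemma smoothV U f : open U -> (forall x, U x -> f x != 0) -> smooth U f -> smooth U (fun x => (f x)^-1).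
Proof. by move=> oU f0 sf k; exact: CkV. Qed.
Lemma smooth_sum U (I : Type) (r : seq I) (P : pred I) (F : I -> 'rV[R]_n -> R) : open U ->
  (forall i, smooth U (F i)) -> smooth U (fun x => \sum_(i <- r | P i) F i x).
Proof.
move=> oU H; elim: r => [|i r IH].
  by apply: (smooth_ext oU _ (smooth_cst U 0)) => y _; rewrite big_nil.
case Pi: (P i); last by apply: (smooth_ext oU _ IH) => y _; rewrite big_cons Pi.
by apply: (smooth_ext oU _ (smoothD oU (H i) IH)) => y _; rewrite big_cons Pi.
Qed.
Lemma smooth_prod U (I : Type) (r : seq I) (P : pred I) (F : I -> 'rV[R]_n -> R) : open U ->
  (forall i, smooth U (F i)) -> smooth U (fun x => \prod_(i <- r | P i) F i x).
Proof.
move=> oU H; elim: r => [|i r IH].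
  by apply: (smooth_ext oU _ (smooth_cst U 1)) => y _; rewrite big_nil.
case Pi: (P i); last by apply: (smooth_ext oU _ IH) => y _; rewrite big_cons Pi.
by apply: (smooth_ext oU _ (smoothM oU (H i) IH)) => y _; rewrite big_cons Pi.
Qed.
Lemma smooth_partial U f i : smooth U f -> smooth U (partial i f).
Proof. by move=> sf k; exact: (sf k.+1).2. Qed.

Lemma smooth_diff U f x : open U -> smooth U f -> U x -> differentiable f x.
Proof. by move=> oU sf Ux; exact: (Ck1_diff oU Ux (sf 1%N)).1. Qed.
Lemma smooth_continuous U f x : smooth U f -> U x -> {for x, continuous f}.
Proof. by move=> sf Ux; exact: (sf 0%N). Qed.
Lemma smooth_derivable U f x v : open U -> smooth U f -> U x -> derivable f x v.
Proof. by move=> oU sf Ux; apply: diff_derivable; exact: smooth_diff Ux. Qed.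
Lemma smoothDE U f x v : open U -> smooth U f -> U x ->
  'D_v f x = \sum_i v 0 i * partial i f x.
Proof.
by move=> oU sf Ux; have [d e] := Ck1_diff oU Ux (sf 1%N); rewrite deriveE// e.
Qed.
Lemma smooth_dir U f v : open U -> smooth U f -> smooth U ('D_v f).
Proof.
move=> oU sf; have : smooth U (fun x => \sum_i v 0 i * partial i f x).
  by apply: smooth_sum => // i; apply: smoothZ => //; exact: smooth_partial.
by apply: smooth_ext => // y Uy; rewrite (smoothDE _ oU sf).
Qed.

Lemma smooth_dirDl U f x (a b : R) u v : open U -> smooth U f -> U x ->
  'D_(a *: u + b *: v) f x = a * 'D_u f x + b * 'D_v f x.
Proof.
move=> oU sf Ux; rewrite !(smoothDE _ oU sf Ux) !big_distrr -big_split/=.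
by apply: eq_bigr => i _; rewrite !mxE; ring.
Qed.
End Smooth.

(** * Taylor estimates with uniform constants *)

Section Taylor.
Variables (R : realType) (n : nat).
Implicit Types (U : set 'rV[R]_n) (f g h : 'rV[R]_n -> R) (x v : 'rV[R]_n).

Lemma derive_bound (G dG : R -> R) (M : R) :
  (forall t : R, 0 <= t <= 1 -> is_derive t (1 : R) G (dG t)) ->
  (forall t : R, 0 <= t <= 1 -> `|dG t| <= M) ->
  forall t : R, 0 <= t <= 1 -> `|G t - G 0| <= M.
Proof.
move=> dGP dGM t /andP[t0 t1].
have D1 s : s \in `]0, t[%R -> is_derive s (1 : R) G (dG s).
  by rewrite in_itv /= => /andP[s0 st]; apply: dGP; rewrite ltW//= (le_trans (ltW st)).
have D2 : {within `[0, t], continuous G}.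
  apply: derivable_within_continuous => s; rewrite in_itv/= => /andP[s0 st].
  by have [] : is_derive s (1 : R) G (dG s) by apply: dGP; rewrite s0 (le_trans st).
have [s sb ->] := MVT_segment t0 D1 D2.
move: sb; rewrite in_itv /= => /andP[s0 st].
have M0 : 0 <= M by apply: le_trans (dGM 0 _); rewrite ?normr_ge0 ?lexx ?ler01.
rewrite subr0 normrM (ger0_norm t0); apply: le_trans (_ : `|dG s| * 1 <= _).
  by rewrite ler_wpM2l.
by rewrite mulr1 dGM// s0 (le_trans st).
Qed.

Lemma smooth_locally_bounded U f x : open U -> smooth U f -> U x ->
  exists2 r : R, 0 < r & exists2 B : R, 0 <= B & forall y, `|y - x| < r -> U y /\ `|f y| <= B.
Proof.
move=> oU sf Ux.
have [r1 r10 H1] := (@nbhs_norm_ex R _ x U).1 (open_nbhs_nbhs (conj oU Ux)).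
have /cvgrPdist_le/(_ 1 ltr01)/nbhs_norm_ex[r2 r20 H2] := smooth_continuous sf Ux.
exists (Num.min r1 r2); first by rewrite lt_min r10.
exists (`|f x| + 1) => [|y]; first by rewrite addr_ge0.
rewrite lt_min => /andP[/H1 Uy /H2 Hy]; split => //.
have -> : f y = f x - (f x - f y) by ring.
by apply: le_trans (ler_normB _ _) _; rewrite lerD2l.
Qed.

Lemma locally_bounded_all U (I : finType) (F : I -> 'rV[R]_n -> R) x : open U -> U x ->
  (forall i, smooth U (F i)) ->
  exists2 r : R, 0 < r & exists2 B : R, 0 <= B & forall y, `|y - x| < r -> U y /\ forall i, `|F i y| <= B.
Proof.
move=> oU Ux sF.
have [r1 r10 H1] := (@nbhs_norm_ex R _ x U).1 (open_nbhs_nbhs (conj oU Ux)).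
suff [r r0 [B B0 H]] : exists2 r : R, 0 < r & exists2 B : R, 0 <= B &
    forall y, `|y - x| < r -> forall i, i \in enum I -> `|F i y| <= B.
  exists (Num.min r1 r); first by rewrite lt_min r10.
  exists B => // y; rewrite lt_min => /andP[/H1 Uy /H Hy]; split=> // i.
  by apply: Hy; rewrite mem_enum.
elim: (enum I) => [|i s [r r0 [B B0 H]]]; first by exists 1 => //; exists 0.
have [r2 r20 [B2 B20 H2]] := smooth_locally_bounded oU (sF i) Ux.
exists (Num.min r2 r); first by rewrite lt_min r20.
exists (Num.max B2 B) => [|y]; first by rewrite le_max B20.
rewrite lt_min => /andP[/H2[_ Hi] /H Hs] j; rewrite inE => /orP[/eqP ->|/Hs jB].
  by rewrite le_max Hi.
by rewrite le_max jB orbT.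
Qed.

Lemma sum_bound (a : 'I_n -> R) v (B : R) : 0 <= B -> (forall i, `|a i| <= B) ->
  `|\sum_i v 0 i * a i| <= n%:R * B * `|v|.
Proof.
move=> B0 H; apply: le_trans (ler_norm_sum _ _ _) _.
apply: (@le_trans _ _ (\sum_(i < n) (B * `|v|))); last first.
  by rewrite sumr_const card_ord -[leLHS]mulr_natl mulrA.
apply: ler_sum => i _; rewrite normrM mulrC ler_pM//; exact: normv_coord.
Qed.

(* All the constants needed at once: bounds for the derivatives up to order two and the three Taylor estimates. *)
Record controlled U f x (r C : R) : Prop := Controlled {
  ctrl_r : 0 < r; ctrl_C : 0 <= C;
  ctrl_U : forall y, `|y - x| < r -> U y;
  ctrl_0 : forall y, `|y - x| < r -> `|f y| <= C;
  ctrl_1 : forall y v, `|y - x| < r -> `|'D_v f y| <= C * `|v|;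
  ctrl_2 : forall y u v, `|y - x| < r -> `|'D_u ('D_v f) y| <= C * `|u| * `|v|;
  taylor_1 : forall y v, `|y - x| < r -> `|y + v - x| < r -> `|f (y + v) - f y| <= C * `|v|;
  taylor_2 : forall y v, `|y - x| < r -> `|y + v - x| < r ->
    `|f (y + v) - f y - 'D_v f y| <= C * `|v| ^+ 2;
  taylor_3 : forall y v, `|y - x| < r -> `|y + v - x| < r ->
    `|f (y + v) - f y - 'D_v f y - 2^-1 * 'D_v ('D_v f) y| <= C * `|v| ^+ 3 }.

Lemma ball_segment x y v (r t : R) : `|y - x| < r -> `|y + v - x| < r -> 0 <= t <= 1 ->
  `|y + t *: v - x| < r.
Proof.
move=> H1 H2 /andP[t0 t1].
have -> : y + t *: v - x = (1 - t) *: (y - x) + t *: (y + v - x).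
  by apply/rowP => i; rewrite !mxE; ring.
apply: le_lt_trans (ler_normD _ _) _; rewrite !normrZ ger0_norm ?subr_ge0// ger0_norm//.
have [->|t0'] := eqVneq t 0; first by rewrite subr0 mul1r mul0r addr0.
have : t * `|y + v - x| < t * r by rewrite ltr_pM2l// lt_def t0' t0.
have : (1 - t) * `|y - x| <= (1 - t) * r by rewrite ler_wpM2l ?subr_ge0// ltW.
lra.
Qed.

(** Along the segment from [y] to [y + v], the derivative of each Taylor remainder of [f] is a
    lower-order remainder of ['D_v f]. Repeated use of [derive_bound] thus reduces the three
    estimates to bounds on the partial derivatives of order at most three, which hold by continuity
    near [x]. *)
Lemma smooth_controlled U f x : open U -> smooth U f -> U x ->
  exists r C, controlled U f x r C.
Proof.
move=> oU sf Ux.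
have s1 i : smooth U (partial i f) by exact: smooth_partial.
have s2 i j : smooth U (partial i (partial j f)) by apply: smooth_partial; exact: smooth_partial.
have s3 i j k : smooth U (partial i (partial j (partial k f))).
  by do 2 apply: smooth_partial; exact: smooth_partial.
have [r0 r00 [B0 B00 H0]] := smooth_locally_bounded oU sf Ux.
have [r1 r10 [B1 B10 H1]] := locally_bounded_all (F := fun i => partial i f) oU Ux s1.
have [r2 r20 [B2 B20 H2]] := locally_bounded_all
  (F := fun ij : 'I_n * 'I_n => partial ij.1 (partial ij.2 f)) oU Ux (fun ij => s2 ij.1 ij.2).
have [r3 r30 [B3 B30 H3]] := locally_bounded_all
  (F := fun ij : 'I_n * 'I_n * 'I_n => partial ij.1.1 (partial ij.1.2 (partial ij.2 f))) oU Ux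
  (fun ij => s3 ij.1.1 ij.1.2 ij.2).
set r := Num.min (Num.min r0 r1) (Num.min r2 r3).
set C := B0 + n%:R * B1 + n%:R * (n%:R * B2) + n%:R * (n%:R * (n%:R * B3)).
have n0 : 0 <= n%:R :> R by [].
have C1 : 0 <= n%:R * B1 by rewrite mulr_ge0.
have C2 : 0 <= n%:R * (n%:R * B2) by rewrite !mulr_ge0.
have C3 : 0 <= n%:R * (n%:R * (n%:R * B3)) by rewrite !mulr_ge0.
have inr y : `|y - x| < r -> [/\ `|y - x| < r0, `|y - x| < r1, `|y - x| < r2 & `|y - x| < r3].
  by rewrite !lt_min => /andP[/andP[-> ->] /andP[-> ->]].
have inU y : `|y - x| < r -> U y by move=> /inr[/H0[]].
have b1 y v : `|y - x| < r -> `|'D_v f y| <= (n%:R * B1) * `|v|.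
  move=> yr; rewrite (smoothDE _ oU sf (inU _ yr)); apply: sum_bound => // i.
  by have [_ /H1[_]] := inr _ yr.
have b2 y u v : `|y - x| < r -> `|'D_u ('D_v f) y| <= (n%:R * (n%:R * B2)) * `|u| * `|v|.
  move=> yr; rewrite (smoothDE _ oU (smooth_dir v oU sf) (inU _ yr)).
  apply: le_trans (_ : n%:R * (n%:R * B2 * `|v|) * `|u| <= _); last first.
    by rewrite le_eqVlt; apply/orP; left; apply/eqP; ring.
  apply: sum_bound => [|i]; first by rewrite !mulr_ge0.
  have -> : partial i ('D_v f) y = \sum_j v 0 j * partial i (partial j f) y.
    rewrite {1}/partial (derive_ext _ oU (inU _ yr) (fun z Uz => smoothDE v oU sf Uz)).
    rewrite (_ : (fun z => _) = \sum_j (fun z => v 0 j *: partial j f z)); last first.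
      by apply/funext => z; rewrite fct_sumE.
    rewrite derive_sum => [|j]; last by apply: derivableZ; exact: smooth_derivable (inU _ yr).
    by apply: eq_bigr => j _; rewrite deriveZ//; exact: smooth_derivable (inU _ yr).
  by apply: sum_bound => // j; have [_ _ /H2[_ /(_ (i, j))]] := inr _ yr.
have b3 y v : `|y - x| < r -> `|'D_v ('D_v ('D_v f)) y| <= (n%:R * (n%:R * (n%:R * B3))) * `|v| ^+ 3.
  move=> yr.
  have e1 z : U z -> 'D_v f z = \sum_i v 0 i * partial i f z by move=> Uz; exact: (smoothDE _ oU sf Uz).
  have dsum (F : 'I_n -> 'rV[R]_n -> R) z : U z -> (forall i, smooth U (F i)) ->
      'D_v (fun z => \sum_i v 0 i * F i z) z = \sum_i v 0 i * 'D_v (F i) z.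
    move=> Uz sF; rewrite (_ : (fun z => _) = \sum_j (fun z => v 0 j *: F j z)); last first.
      by apply/funext => w; rewrite fct_sumE.
    rewrite derive_sum => [|j]; last by apply: derivableZ; exact: smooth_derivable Uz.
    by apply: eq_bigr => j _; rewrite deriveZ//; exact: smooth_derivable Uz.
  have e2 z : U z -> 'D_v ('D_v f) z = \sum_i v 0 i * \sum_j v 0 j * partial j (partial i f) z.
    move=> Uz; rewrite (derive_ext _ oU Uz e1) dsum//.
    by apply: eq_bigr => i _; rewrite (smoothDE _ oU (s1 i)).
  rewrite (derive_ext _ oU (inU _ yr) e2) dsum//; last first.
  - by move=> i; apply: smooth_sum => // j; apply: smoothZ.
  - exact: inU.
  have -> : n%:R * (n%:R * (n%:R * B3)) * `|v| ^+ 3 = n%:R * (n%:R * (n%:R * B3 * `|v|) * `|v|) * `|v| by ring.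
  apply: sum_bound => [|i]; first by rewrite !mulr_ge0.
  rewrite dsum//; last exact: inU.
  apply: sum_bound => [|j]; first by rewrite !mulr_ge0.
  rewrite (smoothDE _ oU (s2 _ _) (inU _ yr)).
  by apply: sum_bound => // k; have [_ _ _ /H3[_ /(_ (k, j, i))]] := inr _ yr.
have line k (F : 'rV[R]_n -> R) y v t : k = k :> nat -> smooth U F -> U (y + t *: v) ->
    is_derive t (1 : R) (fun s => F (y + s *: v)) ('D_v F (y + t *: v)).
  by move=> _ sF Ut; apply: line_derivable; exact: smooth_derivable Ut.
exists r, C; split.
- by rewrite !lt_min r00 r10 r20 r30.
- by rewrite /C; lra.
- exact: inU.
- by move=> y /inr[/H0[_ H] _ _ _]; apply: le_trans H _; rewrite /C; lra.
- by move=> y v yr; apply: le_trans (b1 _ _ yr) _; rewrite ler_wpM2r// /C; lra.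
- move=> y u v yr; apply: le_trans (b2 _ _ _ yr) _.
  by rewrite !ler_wpM2r// /C; lra.
- move=> y v y1 y2.
  have S (t : R) : 0 <= t <= 1 -> `|y + t *: v - x| < r by exact: ball_segment.
  have := @derive_bound (fun t => f (y + t *: v)) (fun t => 'D_v f (y + t *: v)) (C * `|v|)
    (fun t t01 => line 0%N f y v t erefl sf (inU _ (S t t01))) _ 1.
  rewrite scale1r scale0r addr0; apply; last by rewrite lexx ler01.
  by move=> t t01; apply: le_trans (b1 _ _ (S t t01)) _; rewrite ler_wpM2r// /C; lra.
- move=> y v y1 y2.
  have S (t : R) : 0 <= t <= 1 -> `|y + t *: v - x| < r by exact: ball_segment.
  have M2 (t : R) : 0 <= t <= 1 -> `|'D_v f (y + t *: v) - 'D_v f y| <= C * `|v| ^+ 2.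
    have := @derive_bound (fun t => 'D_v f (y + t *: v)) (fun t => 'D_v ('D_v f) (y + t *: v)) (C * `|v| ^+ 2)
      (fun t t01 => line 0%N _ y v t erefl (smooth_dir v oU sf) (inU _ (S t t01))).
    rewrite scale0r addr0; apply=> s s01; apply: le_trans (b2 _ _ _ (S s s01)) _.
    by rewrite expr2 [leRHS]mulrA !ler_wpM2r// /C; lra.
  have D (t : R) : 0 <= t <= 1 -> is_derive t (1 : R) (fun t => f (y + t *: v) - t * 'D_v f y)
      ('D_v f (y + t *: v) - 'D_v f y).
    move=> t01; have I1 := line 0%N f y v t erefl sf (inU _ (S t t01)).
    by apply: is_derive_eq; rewrite /GRing.scale /=; ring.
  have := derive_bound D M2 (t := 1); rewrite lexx ler01 => /(_ isT).
  by rewrite scale1r scale0r addr0 mul1r mul0r subr0 addrAC.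
- move=> y v y1 y2.
  have S (t : R) : 0 <= t <= 1 -> `|y + t *: v - x| < r by exact: ball_segment.
  have M3 (t : R) : 0 <= t <= 1 -> `|'D_v ('D_v f) (y + t *: v) - 'D_v ('D_v f) y| <= C * `|v| ^+ 3.
    have := @derive_bound (fun t => 'D_v ('D_v f) (y + t *: v)) (fun t => 'D_v ('D_v ('D_v f)) (y + t *: v)) (C * `|v| ^+ 3)
      (fun t t01 => line 0%N _ y v t erefl (smooth_dir v oU (smooth_dir v oU sf)) (inU _ (S t t01))).
    rewrite scale0r addr0; apply=> s s01; apply: le_trans (b3 _ _ (S s s01)) _.
    by rewrite ler_wpM2r ?exprn_ge0// /C; lra.
  have D2 (t : R) : 0 <= t <= 1 -> is_derive t (1 : R) (fun t => 'D_v f (y + t *: v) - t * 'D_v ('D_v f) y)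
      ('D_v ('D_v f) (y + t *: v) - 'D_v ('D_v f) y).
    move=> t01; have I1 := line 0%N _ y v t erefl (smooth_dir v oU sf) (inU _ (S t t01)).
    apply: is_derive_eq; rewrite /GRing.scale /=.
    by move: ('D_v ('D_v f) (y + t *: v)) ('D_v ('D_v f) y) => a b; ring.
  have M2 (t : R) : 0 <= t <= 1 -> `|'D_v f (y + t *: v) - 'D_v f y - t * 'D_v ('D_v f) y| <= C * `|v| ^+ 3.
    move=> /(derive_bound D2 M3).
    by rewrite scale0r addr0 mul0r subr0 addrAC.
  have D1 (t : R) : 0 <= t <= 1 -> is_derive t (1 : R)
      (fun t => f (y + t *: v) - t * 'D_v f y - 2^-1 * t ^+ 2 * 'D_v ('D_v f) y)
      ('D_v f (y + t *: v) - 'D_v f y - t * 'D_v ('D_v f) y).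
    move=> t01; have I1 := line 0%N f y v t erefl sf (inU _ (S t t01)).
    by apply: is_derive_eq; rewrite /GRing.scale /=; field.
  have := derive_bound D1 M2 (t := 1); rewrite lexx ler01 => /(_ isT).
  rewrite scale1r scale0r addr0 mul1r mul0r expr0n /= !mulr0 mul0r !subr0 expr1n mulr1.
  by rewrite (_ : f (y + v) - 'D_v f y - _ - f y = f (y + v) - f y - 'D_v f y - 2^-1 * 'D_v ('D_v f) y)//; ring.
Qed.
End Taylor.

(** * Symmetry of second derivatives *)

Section Schwarz.
Variables (R : realType) (n : nat).
Implicit Types (U : set 'rV[R]_n) (f g h : 'rV[R]_n -> R) (x u v w : 'rV[R]_n).

Lemma smooth_dirZ U f x (a : R) v : open U -> smooth U f -> U x -> 'D_(a *: v) f x = a * 'D_v f x.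
Proof.
move=> oU sf Ux; rewrite !(smoothDE _ oU sf Ux) big_distrr/=.
by apply: eq_bigr => i _; rewrite !mxE mulrA.
Qed.

Lemma smooth_dirD U f x u v : open U -> smooth U f -> U x -> 'D_(u + v) f x = 'D_u f x + 'D_v f x.
Proof.
move=> oU sf Ux; rewrite !(smoothDE _ oU sf Ux) -big_split/=.
by apply: eq_bigr => i _; rewrite !mxE mulrDl.
Qed.

(** The difference in the direction [u] is differentiated along [v]; its derivative is an increment
    of ['D_v f], which Taylor's estimate identifies with [s * 'D_u ('D_v f) x] up to order
    [s ^ 2]. *)
Lemma second_difference U f x u v : open U -> smooth U f -> U x ->
  exists2 s0 : R, 0 < s0 & exists K : R, forall s : R, 0 < s < s0 ->
   `|(f (x + s *: u + s *: v) - f (x + s *: v)) - (f (x + s *: u) - f x)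
      - s ^+ 2 * 'D_u ('D_v f) x| <= K * s ^+ 3.
Proof.
move=> oU sf Ux.
have [ra [Ca Ka]] := smooth_controlled oU sf Ux.
have sv := smooth_dir v oU sf; have suv := smooth_dir u oU sv.
have [r1 [C1 K1]] := smooth_controlled oU sv Ux.
have [r2 [C2 K2]] := smooth_controlled oU suv Ux.
set r := Num.min ra (Num.min r1 r2).
have r0 : 0 < r by rewrite !lt_min (ctrl_r Ka) (ctrl_r K1) (ctrl_r K2).
set N := `|u| + `|v| + 1.
have N0 : 0 < N by rewrite ltr_wpDl // addr_ge0.
exists (r / N); first by rewrite divr_gt0.
exists (C1 * `|u| ^+ 2 + C2 * `|v|) => s /andP[s0 sr].
have sN : s * N < r by rewrite -ltr_pdivlMr.
have small (a b : R) : 0 <= a <= 1 -> 0 <= b <= 1 -> `|x + a *: (s *: u) + b *: (s *: v) - x| < r.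
  move=> /andP[a0 a1] /andP[b0 b1]; rewrite -[x + _ + _]addrA addrAC subrr add0r.
  apply: le_lt_trans (ler_normD _ _) _; apply: le_lt_trans sN.
  rewrite !normrZ !ger0_norm ?(ltW s0)// /N.
  have : a * (s * `|u|) <= s * `|u| by rewrite ler_piMl// mulr_ge0 ?(ltW s0).
  have : b * (s * `|v|) <= s * `|v| by rewrite ler_piMl// mulr_ge0 ?(ltW s0).
  lra.
have ra' y : `|y - x| < r -> [/\ `|y - x| < ra, `|y - x| < r1 & `|y - x| < r2].
  by rewrite !lt_min => /andP[-> /andP[-> ->]].
have inU y : `|y - x| < r -> U y by move=> /ra'[/(ctrl_U Ka)].
have i01 : ((0:R) <= (0:R) <= (1:R))%R by rewrite lexx ler01.
have i11 : ((0:R) <= (1:R) <= (1:R))%R by rewrite ler01 lexx.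
set A := 'D_u ('D_v f) x.
have D (t : R) : 0 <= t <= 1 -> is_derive t (1 : R)
   (fun t => f (x + s *: u + t *: (s *: v)) - f (x + t *: (s *: v)) - t * (s ^+ 2 * A))
   (s * ('D_v f (x + s *: u + t *: (s *: v)) - 'D_v f (x + t *: (s *: v))) - s ^+ 2 * A).
  move=> t01.
  have U1 : U (x + s *: u + t *: (s *: v)).
    by apply: inU; have := small 1 t i11 t01; rewrite scale1r.
  have U2 : U (x + t *: (s *: v)).
    by apply: inU; have := small 0 t i01 t01; rewrite scale0r addr0.
  have I1 := line_derivable (smooth_derivable (v := s *: v) oU sf U1).
  have I2 := line_derivable (smooth_derivable (v := s *: v) oU sf U2).
  apply: is_derive_eq.
  by rewrite !(smooth_dirZ _ _ oU sf)// /GRing.scale /=; ring.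
have B (t : R) : 0 <= t <= 1 ->
   `|s * ('D_v f (x + s *: u + t *: (s *: v)) - 'D_v f (x + t *: (s *: v))) - s ^+ 2 * A|
     <= (C1 * `|u| ^+ 2 + C2 * `|v|) * s ^+ 3.
  move=> t01.
  have y1 : `|x + t *: (s *: v) - x| < r by have := small 0 t i01 t01; rewrite scale0r addr0.
  have y2 : `|x + t *: (s *: v) + s *: u - x| < r.
    by rewrite [x + _ + _]addrAC; have := small 1 t i11 t01; rewrite scale1r.
  have xr : `|x - x| < r by rewrite subrr normr0.
  have [_ y11 y12] := ra' _ y1; have [_ y21 y22] := ra' _ y2; have [_ _ x2] := ra' _ xr.
  have T1 := taylor_2 K1 y11 y21.
  have T2 := taylor_1 K2 x2 y12.
  rewrite !(smooth_dirZ _ _ oU sv)// in T1; last exact: inU.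
  rewrite !normrZ (gtr0_norm s0) in T1 T2.
  have t1 : `|t| <= 1 by rewrite ger0_norm; case/andP: t01.
  have {}T2 : `|'D_u ('D_v f) (x + t *: (s *: v)) - A| <= C2 * (s * `|v|).
    apply: le_trans T2 _; rewrite ler_wpM2l ?(ctrl_C K2)// ler_piMl// mulr_ge0 ?(ltW s0)//.
  rewrite (_ : x + s *: u + t *: (s *: v) = x + t *: (s *: v) + s *: u); last by rewrite addrAC.
  set a := 'D_v f (_ + s *: u) in T1 *; set b := 'D_v f _ in T1 *.
  set c := 'D_u _ _ in T1 T2.
  have -> : s * (a - b) - s ^+ 2 * A = s * (a - b - s * c) + s ^+ 2 * (c - A) by ring.
  apply: le_trans (ler_normD _ _) _; rewrite 2!normrM (gtr0_norm s0) (gtr0_norm (exprn_gt0 2 s0)).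
  have := ler_wpM2l (ltW s0) T1.
  have := ler_wpM2l (sqr_ge0 s) T2.
  rewrite exprMn; lra.
have := derive_bound D B (t := 1); rewrite lexx ler01 => /(_ isT).
rewrite !scale1r !scale0r !addr0 mul1r mul0r subr0.
by rewrite [X in `|X|]addrAC.
Qed.

Lemma small_cubic_eq0 (a K s0 : R) : 0 < s0 -> (forall s : R, 0 < s < s0 -> `|s ^+ 2 * a| <= K * s ^+ 3) -> a = 0.
Proof.
move=> s00 H; apply/eqP; rewrite -normr_eq0; apply/eqP/le_anti; rewrite normr_ge0 andbT.
apply/ler_addgt0Pr => e e0; rewrite add0r.
pose s := Num.min (s0 / 2) (e / (`|K| + 1)).
have K1 : 0 < `|K| + 1 by rewrite ltr_wpDl.
have sp : 0 < s by rewrite lt_min !divr_gt0.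
have ss0 : s < s0 by rewrite gt_min; apply/orP; left; lra.
have := H s; rewrite sp ss0 => /(_ isT).
rewrite normrM (gtr0_norm (exprn_gt0 2 sp)) => h.
have h2 : `|a| <= K * s.
  by rewrite -(ler_pM2l (exprn_gt0 2 sp)) (le_trans h)// (_ : K * s ^+ 3 = s ^+ 2 * (K * s))//; ring.
have : s * (`|K| + 1) <= e by rewrite -ler_pdivlMr// ge_min lexx orbT.
have := ler_wpM2r (ltW sp) (ler_norm K); lra.
Qed.

(** The second difference is symmetric in [u] and [v], so the two mixed derivatives differ, after
    multiplication by [s ^ 2], by a term of order [s ^ 3]. *)
Lemma Schwarz U f x u v : open U -> smooth U f -> U x -> 'D_u ('D_v f) x = 'D_v ('D_u f) x.
Proof.
move=> oU sf Ux.
have [s1 s10 [K1 H1]] := second_difference u v oU sf Ux.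
have [s2 s20 [K2 H2]] := second_difference v u oU sf Ux.
apply/eqP; rewrite -subr_eq0; apply/eqP.
apply: (@small_cubic_eq0 _ (K1 + K2) (Num.min s1 s2)); first by rewrite lt_min s10.
move=> s /andP[s0]; rewrite lt_min => /andP[ss1 ss2].
have := H1 s; have := H2 s; rewrite s0 ss1 ss2 => /(_ isT) h2 /(_ isT) h1.
move: h2; rewrite (_ : x + s *: v + s *: u = x + s *: u + s *: v); last by rewrite addrAC.
move: h1; generalize ('D_u ('D_v f) x) ('D_v ('D_u f) x) => A B.
move: (f (x + s *: u + s *: v)) (f (x + s *: u)) (f (x + s *: v)) (f x) => p q a b h1 h2.
have -> : s ^+ 2 * (A - B) = (p - q - (a - b) - s ^+ 2 * B) - (p - a - (q - b) - s ^+ 2 * A) by ring.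
apply: le_trans (ler_normB _ _) _; rewrite mulrDl addrC; exact: lerD.
Qed.

End Schwarz.

(** * Bilinear forms and orthonormal frames *)

Section Bilinear.
Variables (R : realType).

Definition bil n (A : 'M[R]_n) (u v : 'rV[R]_n) : R := (u *m A *m v^T) 0 0.

Section Fixed.
Variable n : nat.
Implicit Types (A B G : 'M[R]_n) (u v w : 'rV[R]_n).

Lemma bilE A u v : bil A u v = \sum_i \sum_j u 0 i * A i j * v 0 j.
Proof.
rewrite /bil mxE exchange_big/=; apply: eq_bigr => j _; rewrite !mxE big_distrl/=.
by apply: eq_bigr.
Qed.
Lemma bilDl A u v w : bil A (u + v) w = bil A u w + bil A v w.
Proof. by rewrite /bil !mulmxDl mxE. Qed.
Lemma bilDr A u v w : bil A w (u + v) = bil A w u + bil A w v.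
Proof. by rewrite /bil linearD /= mulmxDr mxE. Qed.
Lemma bilZl A u v (a : R) : bil A (a *: u) v = a * bil A u v.
Proof. by rewrite /bil -!scalemxAl mxE. Qed.
Lemma bilZr A u v (a : R) : bil A u (a *: v) = a * bil A u v.
Proof. by rewrite /bil linearZ /= -scalemxAr mxE. Qed.
Lemma bilNl A u v : bil A (- u) v = - bil A u v.
Proof. by rewrite -scaleN1r bilZl mulN1r. Qed.
Lemma bilNr A u v : bil A u (- v) = - bil A u v.
Proof. by rewrite -scaleN1r bilZr mulN1r. Qed.
Lemma bil0l A u : bil A 0 u = 0.
Proof. by rewrite /bil !mul0mx mxE. Qed.
Lemma bil0r A u : bil A u 0 = 0.
Proof. by rewrite /bil trmx0 mulmx0 mxE. Qed.
Lemma bilDm A B u v : bil (A + B) u v = bil A u v + bil B u v.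
Proof. by rewrite /bil mulmxDr mulmxDl mxE. Qed.
Lemma bilZm A u v (a : R) : bil (a *: A) u v = a * bil A u v.
Proof. by rewrite /bil -scalemxAr -scalemxAl mxE. Qed.
Lemma bilT A u v : bil A^T u v = bil A v u.
Proof.
rewrite /bil; have -> : u *m A^T *m v^T = (v *m A *m u^T)^T by rewrite !trmx_mul trmxK mulmxA.
by rewrite mxE.
Qed.
Lemma bil_mull A B u v : bil (B *m A) u v = bil A (u *m B) v.
Proof. by rewrite /bil mulmxA. Qed.
Lemma bil_mulr A B u v : bil (A *m B^T) u v = bil A u (v *m B).
Proof. by rewrite /bil trmx_mul !mulmxA. Qed.
Lemma bil_delta A i j : bil A (delta_mx 0 i) (delta_mx 0 j) = A i j.
Proof.
rewrite bilE (bigD1 i)//= (bigD1 j)//= !mxE !eqxx mul1r mulr1.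
rewrite big1 ?addr0 => [|k /negbTE ki]; last by rewrite !mxE ki mulr0.
rewrite big1 ?addr0// => k /negbTE ki; rewrite big1// => l _.
by rewrite !mxE ki !mul0r.
Qed.
Lemma bil_eq A B : (forall u v, bil A u v = bil B u v) -> A = B.
Proof. by move=> H; apply/matrixP => i j; rewrite -!bil_delta H. Qed.

Definition posdef A := A^T = A /\ forall v, v != 0 -> 0 < bil A v v.

Lemma posdef_unit A : posdef A -> A \in unitmx.
Proof.
move=> [As Ap]; rewrite -row_free_unit; apply/row_freeP; apply/row_freeP.
rewrite -kermx_eq0; apply/eqP/row_matrixP => i; rewrite row0.
apply/eqP; apply: contraT => /Ap.
have /sub_kermxP E : (row i (kermx A) <= kermx A)%MS by exact: row_sub.
by rewrite /bil E mul0mx mxE ltxx.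
Qed.

Lemma bil_sqr_ge0 A v : posdef A -> 0 <= bil A v v.
Proof. by move=> [_ H]; have [->|/H/ltW//] := eqVneq v 0; rewrite bil0l. Qed.

Lemma bil_CauchySchwarz A u v : posdef A -> bil A u v ^+ 2 <= bil A u u * bil A v v.
Proof.
move=> Ap; have [->|v0] := eqVneq v 0; first by rewrite !bil0r mulr0 expr2 mulr0.
have vv := Ap.2 _ v0; have vu : bil A v u = bil A u v by rewrite -bilT Ap.1.
have := bil_sqr_ge0 (bil A v v *: u - bil A u v *: v) Ap.
rewrite !(bilDl, bilDr, bilNl, bilNr, bilZl, bilZr) vu.
move: vv; move: (bil A v v) (bil A u u) (bil A u v) => a b c a0 H.
rewrite -(ler_pM2l a0) -subr_ge0; apply: le_trans H _.
by rewrite le_eqVlt; apply/orP; left; apply/eqP; ring.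
Qed.
End Fixed.

(** Block form of Gram-Schmidt: an orthonormal frame of the Schur complement [S] of the top left
    entry [a] is corrected to be orthogonal to the first vector, which is divided by the square root
    of [a]. *)
Lemma orthonormal_frame_step n (A : 'M[R]_(1 + n)) :
  (forall B : 'M[R]_n, posdef B -> exists E : 'M[R]_n, E *m B *m E^T = 1%:M) ->
  posdef A -> exists E : 'M[R]_(1 + n), E *m A *m E^T = 1%:M.
Proof.
move=> IH [As Ap].
pose a := A 0 0; pose b : 'rV[R]_n := ursubmx A; pose D : 'M[R]_n := drsubmx A.
have EA : A = block_mx a%:M b b^T D.
  rewrite -[LHS]submxK; congr block_mx.
    by apply/matrixP => i j; rewrite !ord1 !mxE /= mulr1n; congr (A _ _); apply/val_inj.
  by rewrite /b trmx_ursub As.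
have a0 : 0 < a.
  have := Ap (delta_mx 0 0); rewrite bil_delta; apply.
  by apply/eqP => /rowP/(_ 0); rewrite !mxE !eqxx => /eqP; rewrite oner_eq0.
have DT : D^T = D by rewrite /D trmx_drsub As.
pose S := D - a^-1 *: (b^T *m b).
have Sp : posdef S.
  split; first by rewrite /S linearB /= linearZ /= trmx_mul trmxK DT.
  (* On the vectors [w], orthogonal to the first basis vector, the form [A] restricts to [S]. *)
  move=> v v0; pose w : 'rV[R]_(1 + n) := row_mx (- a^-1 *: (v *m b^T)) v.
  have w0 : w != 0.
    by apply: contraNneq v0; rewrite /w -row_mx0 => /eq_row_mx[_ ->].
  have := Ap w w0; rewrite /bil EA mul_row_block.
  rewrite /w tr_row_mx mul_row_col mul_mx_scalar scalerA mulrN mulfV ?gt_eqF//.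
  rewrite scaleN1r addNr mul0mx add0r -scalemxAl -mulmxA.
  rewrite /S mulmxBr mulmxBl -scalemxAr -scalemxAl !mulmxA scaleNr.
  by rewrite mulmxDl mulNmx -scalemxAl addrC.
have [E EE] := IH S Sp.
pose s := Num.sqrt a.
have ss : s * s = a by rewrite -expr2 sqr_sqrtr// ltW.
have s0 : s != 0 by apply: contraTneq a0 => s0; rewrite -ss s0 mulr0 ltxx.
exists (block_mx (scalar_mx s^-1) 0 ((- a^-1) *: (E *m b^T)) E).
have Z : ((- a^-1) *: (E *m b^T)) *m (a%:M) + E *m b^T = 0.
  by rewrite mul_mx_scalar scalerA mulrN mulfV ?gt_eqF// scaleN1r addNr.
have D4 : ((- a^-1) *: (E *m b^T)) *m b + E *m D = E *m S.
  by rewrite /S mulmxBr -scalemxAr -scalemxAl mulmxA scaleNr addrC.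
rewrite EA mulmx_block !mul0mx !addr0 Z D4.
rewrite tr_block_mx tr_scalar_mx trmx0 mulmx_block !mul0mx !mulmx0 !addr0 !add0r EE.
rewrite [RHS]scalar_mx_block.
have -> : (s^-1)%:M *m a%:M *m (s^-1)%:M = scalar_mx (n := 1) 1.
  by rewrite -!scalar_mxM; congr (_%:M); rewrite -ss; field.
congr block_mx.
rewrite linearZ /= trmx_mul trmxK -scalar_mxM !mul_scalar_mx -scalemxAl.
rewrite scalerA -scalerDl (_ : _ + _ = 0) ?scale0r//.
by field; rewrite s0 gt_eqF.
Qed.

Lemma orthonormal_frame n (A : 'M[R]_n) : posdef A -> exists E : 'M[R]_n, E *m A *m E^T = 1%:M.
Proof.
elim: n A => [|n IH] A Ap; first by exists 0; rewrite [LHS]flatmx0 [RHS]flatmx0.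
exact: (orthonormal_frame_step IH Ap).
Qed.
End Bilinear.

(** * Linear algebra of the complex structure and of the derivative of a Kaehler metric *)

Section ComplexStructure.
Variables (R : realType) (m : nat).
Local Notation n := (m + m)%N.
Local Notation J := (Jstd R m).

Lemma JstdT : J^T = - J.
Proof. by rewrite /Jstd tr_block_mx !trmx0 linearN /= trmx1 opp_block_mx !oppr0 opprK. Qed.
Lemma JstdJ : J *m J = - 1%:M.
Proof.
rewrite /Jstd mulmx_block !mul0mx !mulmx0 !add0r !addr0.
by rewrite (@scalar_mx_block _ m m 1) opp_block_mx !oppr0 mulmxN mulNmx mulmx1.
Qed.
Lemma mulJJ (v : 'rV[R]_n) : v *m J *m J = - v.
Proof. by rewrite -mulmxA JstdJ mulmxN mulmx1. Qed.

Lemma hermitian_comm (G : 'M[R]_n) : J *m G *m J^T = G <-> J *m G = G *m J.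
Proof.
rewrite JstdT mulmxN; split=> [H|->].
  by rewrite -[in RHS]H mulNmx -!mulmxA JstdJ !mulmxN mulmx1 opprK.
by rewrite -mulmxA JstdJ mulmxN mulmx1 opprK.
Qed.

Lemma bil_comm_J (G : 'M[R]_n) u v : J *m G = G *m J -> bil G (u *m J) v = - bil G u (v *m J).
Proof.
move=> H; rewrite -bil_mull H.
have E : J = (- J)^T by rewrite linearN /= JstdT opprK.
by rewrite {1}E bil_mulr mulmxN bilNr.
Qed.

Section Trilinear.
Variable T : 'rV[R]_n -> 'rV[R]_n -> 'rV[R]_n -> R.
Hypothesis Tsym : forall a b c, T a b c = T a c b.
Hypothesis TN2 : forall a b c, T a (- b) c = - T a b c.
Hypothesis TN1 : forall a b c, T (- a) b c = - T a b c.
Hypothesis Therm : forall a b c, T a (b *m J) (c *m J) = T a b c.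
Hypothesis Tclosed : forall a b c, T a (b *m J) c + T b (c *m J) a + T c (a *m J) b = 0.

(** [T a b c] models the derivative of [g b c] in the direction [a]; this combination is twice the
    Christoffel symbol of the first kind. *)
Definition Kcov u e X := T u e X + T e u X - T X u e.

Let TN3 a b c : T a b (- c) = - T a b c.
Proof. by rewrite Tsym TN2 Tsym. Qed.
Let TJ a b c : T a (b *m J) c = - T a b (c *m J).
Proof. by rewrite -(Therm a b (c *m J)) mulJJ TN3 opprK. Qed.

Lemma Kcov_sym u e X : Kcov u e X = Kcov e u X.
Proof. by rewrite /Kcov (Tsym X) [T u e X + _]addrC. Qed.
Lemma Kcov_compat u b c : Kcov u b c + Kcov u c b = 2 * T u b c.
Proof. by rewrite /Kcov [T u c b]Tsym; ring. Qed.

(** Closedness of the fundamental form at [J e], [X], [u], combined with the hermitian symmetry,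
    turns a derivative averaged over [e] and [J e] into a Christoffel symbol. Closedness enters the
    later computations only through this identity. *)
Lemma cross_term e u X : T e u X + T (e *m J) u (X *m J) = Kcov u e X.
Proof.
rewrite /Kcov.
have := Tclosed (e *m J) X u; rewrite mulJJ TN2 Therm [T _ (X *m J) u]Tsym.
lra.
Qed.

Lemma cross_term_sym e u X :
  T e u X + T (e *m J) u (X *m J) = T u e X + T (u *m J) e (X *m J).
Proof. by rewrite !cross_term Kcov_sym. Qed.

(** This is the parallelism of [J], in the form: the Christoffel symbol is complex linear in its
    second argument. *)
Lemma Kcov_J u e X : Kcov u (e *m J) X = - Kcov u e (X *m J).
Proof.
by rewrite -!cross_term !mulJJ TN1 TN3; ring.
Qed.
End Trilinear.
End ComplexStructure.

(** * Kaehler charts *)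

Section SmoothMatrix.
Variables (R : realType) (n : nat) (U : set 'rV[R]_n).
Hypothesis oU : open U.

Lemma smooth_det k (A : 'rV[R]_n -> 'M[R]_k) : (forall a b, smooth U (fun x => A x a b)) ->
  smooth U (fun x => \det (A x)).
Proof.
move=> sA; apply: smooth_sum => // s; apply: smoothM => //; first exact: smooth_cst.
by apply: smooth_prod.
Qed.

Lemma smooth_invmx k (A : 'rV[R]_n -> 'M[R]_k) : (forall x, U x -> A x \in unitmx) ->
  (forall a b, smooth U (fun x => A x a b)) -> forall a b, smooth U (fun x => invmx (A x) a b).
Proof.
move=> uA sA a b.
have S : smooth U (fun x => (\det (A x))^-1 * ((-1) ^+ (b + a) * \det (row' b (col' a (A x))))).
  apply: smoothM => //.
    apply: smoothV => //; last exact: smooth_det.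
    by move=> x Ux; rewrite -unitfE -unitmxE; exact: uA.
  apply: smoothM => //; first exact: smooth_cst.
  by apply: smooth_det => c d; apply: smooth_ext (sA _ _) => // y _; rewrite !mxE.
by apply: (smooth_ext oU _ S) => y Uy; rewrite /invmx (uA y Uy) !mxE.
Qed.
End SmoothMatrix.

Section KahlerChart.
Variables (R : realType) (m : nat).
Local Notation n := (m + m)%N.
Local Notation J := (Jstd R m).
Implicit Types (U : set 'rV[R]_n) (g A : 'rV[R]_n -> 'M[R]_n) (u v b c : 'rV[R]_n).

Record kahler_chart U g : Prop := KahlerChart {
  kc_open : open U;
  kc_smooth : forall i j, smooth U (fun x => g x i j);
  kc_posdef : forall x, U x -> posdef (g x);
  kc_J : forall x, U x -> J *m g x = g x *m J;
  kc_closed : forall x (i j k : 'I_n), U x ->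
    partial i (fun y => (J *m g y) j k) x
    + partial j (fun y => (J *m g y) k i) x
    + partial k (fun y => (J *m g y) i j) x = 0 }.

Lemma linear_eq0 (F : 'rV[R]_n -> R) : (forall (a : R) u v, F (a *: u + v) = a * F u + F v) ->
  (forall i, F (delta_mx 0 i) = 0) -> forall u, F u = 0.
Proof.
move=> lF F0 u; have F00 : F 0 = 0 by have := lF 1 0 0; rewrite scaler0 addr0; lra.
rewrite (row_sum_delta u); elim: (index_enum _) => [|i s IH]; first by rewrite big_nil.
by rewrite big_cons lF F0 IH mulr0 addr0.
Qed.

Lemma trilinear_closed (T : 'rV[R]_n -> 'rV[R]_n -> 'rV[R]_n -> R) :
  (forall (k : R) u v w z, T (k *: u + v) w z = k * T u w z + T v w z) ->
  (forall (k : R) u v w z, T w (k *: u + v) z = k * T w u z + T w v z) ->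
  (forall (k : R) u v w z, T w z (k *: u + v) = k * T w z u + T w z v) ->
  (forall i j k, T (delta_mx 0 i) (delta_mx 0 j *m J) (delta_mx 0 k)
    + T (delta_mx 0 j) (delta_mx 0 k *m J) (delta_mx 0 i)
    + T (delta_mx 0 k) (delta_mx 0 i *m J) (delta_mx 0 j) = 0) ->
  forall a b c, T a (b *m J) c + T b (c *m J) a + T c (a *m J) b = 0.
Proof.
move=> lin1 lin2 lin3 H a b c.
move: a; apply: linear_eq0 => [k u v|i].
  by rewrite mulmxDl -scalemxAl !(lin1, lin2, lin3); ring.
move: b; apply: linear_eq0 => [k u v|j].
  by rewrite mulmxDl -scalemxAl !(lin1, lin2, lin3); ring.
by move: c; apply: linear_eq0 => [k u v|k]; rewrite ?H// mulmxDl -scalemxAl !(lin1, lin2, lin3); ring.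
Qed.

Variables (U : set 'rV[R]_n) (g : 'rV[R]_n -> 'M[R]_n).
Hypothesis kc : kahler_chart U g.
Let oU := kc_open kc.
Let gs := kc_smooth kc.

Lemma smooth_bil A b c : (forall i j, smooth U (fun x => A x i j)) ->
  smooth U (fun y => bil (A y) b c).
Proof.
move=> sA; have S : smooth U (fun y => \sum_i \sum_j b 0 i * A y i j * c 0 j).
  do 2 (apply: smooth_sum => // ?); apply: smoothM => //; last exact: smooth_cst.
  exact: smoothZ.
by apply: (smooth_ext oU _ S) => y _; rewrite bilE.
Qed.

Lemma derive_wsum (I : finType) (a : I -> R) (F : I -> 'rV[R]_n -> R) x u : U x ->
  (forall i, smooth U (F i)) ->
  'D_u (fun y => \sum_i a i * F i y) x = \sum_i a i * 'D_u (F i) x.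
Proof.
move=> Ux sF; rewrite /index_enum; elim: (Finite.enum I) => [|i s IH].
  rewrite big_nil (_ : (fun y => _) = cst 0) ?derive_cst//.
  by apply/funext => y; rewrite big_nil.
rewrite big_cons -IH.
have S1 : smooth U (fun y => a i * F i y) by exact: smoothZ.
have S2 : smooth U (fun y => \sum_(i <- s) a i * F i y) by apply: smooth_sum => // j; exact: smoothZ.
rewrite (_ : (fun y => \sum_(i <- i :: s) _) = (fun y => a i * F i y) + (fun y => \sum_(i <- s) a i * F i y)).
  rewrite deriveD; [|exact: smooth_derivable Ux|exact: smooth_derivable Ux].
  congr (_ + _); rewrite (_ : (fun y => a i * F i y) = a i *: F i)// deriveZ//.
  exact: smooth_derivable Ux.
by apply/funext => y; rewrite big_cons.
Qed.

Definition dmx (A : 'rV[R]_n -> 'M[R]_n) x u : 'M[R]_n := \matrix_(i, j) 'D_u (fun y => A y i j) x.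

Lemma bil_dmx A x u b c : U x -> (forall i j, smooth U (fun y => A y i j)) ->
  bil (dmx A x u) b c = 'D_u (fun y => bil (A y) b c) x.
Proof.
move=> Ux sA; rewrite bilE pair_big /=.
have -> : (fun y => bil (A y) b c) =
          (fun y => \sum_(p : 'I_n * 'I_n) (b 0 p.1 * c 0 p.2) * (fun y => A y p.1 p.2) y).
  apply/funext => y; rewrite bilE pair_big /=.
  by apply: eq_bigr => p _; rewrite mulrAC.
rewrite (@derive_wsum _ (fun p => b 0 p.1 * c 0 p.2) (fun p y => A y p.1 p.2))//.
by apply: eq_bigr => -[i j] _ /=; rewrite mxE mulrAC.
Qed.

Definition T3 x u b c := bil (dmx g x u) b c.

Lemma T3E x u b c : U x -> T3 x u b c = 'D_u (fun y => bil (g y) b c) x.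
Proof. by move=> Ux; rewrite /T3 bil_dmx. Qed.

Lemma dmxD A x u v : U x -> (forall i j, smooth U (fun y => A y i j)) ->
  dmx A x (u + v) = dmx A x u + dmx A x v.
Proof. by move=> Ux sA; apply/matrixP => i j; rewrite !mxE (smooth_dirD _ _ oU). Qed.
Lemma dmxZ A x (a : R) u : U x -> (forall i j, smooth U (fun y => A y i j)) ->
  dmx A x (a *: u) = a *: dmx A x u.
Proof. by move=> Ux sA; apply/matrixP => i j; rewrite !mxE (smooth_dirZ _ _ oU). Qed.
Lemma dmxN A x u : U x -> (forall i j, smooth U (fun y => A y i j)) ->
  dmx A x (- u) = - dmx A x u.
Proof. by move=> Ux sA; rewrite -scaleN1r dmxZ// scaleN1r. Qed.
Section AtPoint.
Variables (x : 'rV[R]_n).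
Hypothesis Ux : U x.
Local Notation T := (T3 x).

Lemma T3sym a b c : T a b c = T a c b.
Proof.
rewrite !T3E//; apply: (derive_ext _ oU Ux) => y Uy.
by rewrite -bilT (kc_posdef kc Uy).1.
Qed.
Lemma T3N1 a b c : T (- a) b c = - T a b c.
Proof. by rewrite /T3 dmxN// /bil mulmxN mulNmx mxE. Qed.
Lemma T3N2 a b c : T a (- b) c = - T a b c.
Proof. exact: bilNl. Qed.
Lemma T3herm a b c : T a (b *m J) (c *m J) = T a b c.
Proof.
rewrite !T3E//; apply: (derive_ext _ oU Ux) => y Uy.
by rewrite (bil_comm_J _ _ (kc_J kc Uy)) mulJJ bilNr opprK.
Qed.
Lemma T3closed a b c : T a (b *m J) c + T b (c *m J) a + T c (a *m J) b = 0.
Proof.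
apply: trilinear_closed.
- by move=> k u v w z; rewrite /T3 dmxD// dmxZ// bilDm bilZm.
- by move=> k u v w z; rewrite /T3 bilDl bilZl.
- by move=> k u v w z; rewrite /T3 bilDr bilZr.
have E p q r : T (delta_mx 0 p) (delta_mx 0 q *m J) (delta_mx 0 r) = partial p (fun y => (J *m g y) q r) x.
  rewrite T3E// /partial; congr ('D_ _ _ _); apply/funext => y.
  by rewrite -bil_mull bil_delta.
by move=> i j k; rewrite !E; exact: (kc_closed kc).
Qed.
End AtPoint.
End KahlerChart.

(** * The Levi-Civita connection of a Kaehler chart *)

Section Christoffel.
Variables (R : realType) (m : nat).
Local Notation n := (m + m)%N.
Local Notation J := (Jstd R m).
Variables (U : set 'rV[R]_n) (g : 'rV[R]_n -> 'M[R]_n).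
Hypothesis kc : kahler_chart U g.
Let oU := kc_open kc.
Let gs := kc_smooth kc.
Implicit Types (A : 'rV[R]_n -> 'M[R]_n) (x u v w b c e X : 'rV[R]_n).

Lemma kc_unit x : U x -> g x \in unitmx.
Proof. by move=> Ux; apply: posdef_unit; exact: (kc_posdef kc). Qed.

Lemma smooth_ginv i j : smooth U (fun x => invmx (g x) i j).
Proof. by apply: smooth_invmx => // x; exact: kc_unit. Qed.

Lemma smooth_christoffel k i j : smooth U (christoffel g k i j).
Proof.
apply: smoothZ => //; apply: smooth_sum => // l; apply: smoothM => //; first exact: smooth_ginv.
by apply: smoothB => //; first apply: smoothD => //; apply: smooth_partial.
Qed.

Lemma ginv_sym x : U x -> (invmx (g x))^T = invmx (g x).
Proof. by move=> Ux; rewrite trmx_inv (kc_posdef kc Ux).1. Qed.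

Lemma ginv_J x : U x -> J *m invmx (g x) = invmx (g x) *m J.
Proof.
move=> Ux; have uG := kc_unit Ux; have H := kc_J kc Ux.
have := congr1 (fun M => invmx (g x) *m M *m invmx (g x)) H.
by rewrite /= !mulmxA mulVmx// mul1mx -[_ *m J *m g x *m _]mulmxA mulmxV// mulmx1 => ->.
Qed.

(** The connection matrix in the direction [u]; like the differentials, it acts on row vectors from
    the right. *)
Definition CM x u : 'M[R]_n := \matrix_(j, k) \sum_i u 0 i * christoffel g k i j x.
Definition Gam x u e : 'rV[R]_n := e *m CM x u.

Section AtPoint.
Variables (x : 'rV[R]_n).
Hypothesis Ux : U x.
Local Notation T := (T3 g x).
Local Notation K := (Kcov T).
Let T3s := T3sym kc Ux.
Let T3n1 := T3N1 kc Ux.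
Let T3n2 := @T3N2 R m g x.
Let T3h := T3herm kc Ux.
Let T3c := T3closed kc Ux.

Lemma bil_g_inj u v : (forall X, bil (g x) u X = bil (g x) v X) -> u = v.
Proof.
move=> H; apply/eqP; rewrite -subr_eq0; apply: contraT => uv0.
by have := (kc_posdef kc Ux).2 _ uv0; rewrite bilDl bilNl H subrr ltxx.
Qed.

Lemma bil_gC u v : bil (g x) u v = bil (g x) v u.
Proof. by rewrite -bilT (kc_posdef kc Ux).1. Qed.

Lemma dmx_sum u j l : dmx g x u j l = \sum_i u 0 i * partial i (fun y => g y j l) x.
Proof. by rewrite mxE (smoothDE _ oU). Qed.

(** Koszul's formula: pairing with the metric removes the inverse metric from the Christoffel
    symbols. *)
Lemma GamE u e X : bil (g x) (Gam x u e) X = 2^-1 * K u e X.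
Proof.
pose KM : 'M[R]_n := \matrix_(j, l) \sum_i u 0 i * (partial i (fun y => g y j l) x
   + partial j (fun y => g y i l) x - partial l (fun y => g y i j) x).
have EC : CM x u = 2^-1 *: (KM *m invmx (g x)).
  apply/matrixP => j k; rewrite !mxE big_distrr /=.
  under eq_bigr do rewrite /christoffel mulrCA big_distrr /=.
  rewrite -big_distrr/=; under [in RHS]eq_bigr do rewrite mxE.
  rewrite -big_distrr/=; congr (_ * _).
  rewrite exchange_big/=; apply: eq_bigr => l _; rewrite big_distrl /=.
  apply: eq_bigr => i _.
  have -> : invmx (g x) k l = invmx (g x) l k by rewrite -{1}(ginv_sym Ux) mxE.
  by move: (invmx _ _ _) (_ - _) => a b; ring.
rewrite /Gam /bil EC -scalemxAr -!scalemxAl -!mulmxA (mulmxA _ (g x)) mulVmx ?kc_unit// mul1mx.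
rewrite mxE mulmxA -/(bil KM e X); congr (_ * _).
rewrite /K /T3 !bilE.
have -> : \sum_i \sum_j u 0 i * dmx g x e i j * X 0 j =
   \sum_j \sum_l e 0 j * (\sum_i u 0 i * partial j (fun y => g y i l) x) * X 0 l.
  under eq_bigr do under eq_bigr do rewrite dmx_sum big_distrr big_distrl /=.
  under eq_bigr do rewrite exchange_big/=.
  rewrite exchange_big/=; apply: eq_bigr => j _.
  rewrite exchange_big/=; apply: eq_bigr => l _; rewrite big_distrr big_distrl/=.
  by apply: eq_bigr => i _; move: (partial _ _ _) => p; ring.
have -> : \sum_i \sum_j u 0 i * dmx g x X i j * e 0 j =
   \sum_j \sum_l e 0 j * (\sum_i u 0 i * partial l (fun y => g y i j) x) * X 0 l.
  rewrite exchange_big/=; apply: eq_bigr => j _.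
  under eq_bigr do rewrite dmx_sum big_distrr big_distrl /=.
  rewrite exchange_big/=; apply: eq_bigr => l _; rewrite big_distrr big_distrl/=.
  by apply: eq_bigr => i _; move: (partial _ _ _) => p; ring.
rewrite -big_split -sumrB/=; apply: eq_bigr => j _.
rewrite -big_split -sumrB/=; apply: eq_bigr => l _.
rewrite mxE dmx_sum -!mulrDl -!mulrDr -mulrBl -mulrBr; congr (_ * _ * _).
by rewrite -big_split -sumrB; apply: eq_bigr => i _ /=; rewrite -mulrDr -mulrBr.
Qed.

Lemma Gam_sym u e : Gam x u e = Gam x e u.
Proof. by apply: bil_g_inj => X; rewrite !GamE Kcov_sym. Qed.

Lemma Gam_J u e : Gam x u (e *m J) = Gam x u e *m J.
Proof.
apply: bil_g_inj => X; rewrite (bil_comm_J _ _ (kc_J kc Ux)) !GamE Kcov_J//.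
by rewrite mulrN.
Qed.
Lemma Gam_Jl u e : Gam x (u *m J) e = Gam x u e *m J.
Proof. by rewrite Gam_sym Gam_J Gam_sym. Qed.
Lemma Gam_JJ u e : Gam x (u *m J) (e *m J) = - Gam x u e.
Proof. by rewrite Gam_J Gam_Jl mulJJ. Qed.

Lemma CM_J u : J *m CM x u = CM x u *m J.
Proof.
apply/row_matrixP => i; rewrite !row_mul.
have := Gam_J u (delta_mx 0 i); rewrite /Gam -!rowE => <-.
by rewrite rowE.
Qed.
Lemma CM_Jl u : CM x (u *m J) = CM x u *m J.
Proof.
apply/row_matrixP => i; rewrite row_mul.
by have := Gam_Jl u (delta_mx 0 i); rewrite /Gam -!rowE.
Qed.

Lemma Gam_compat u b c : T u b c = bil (g x) (Gam x u b) c + bil (g x) b (Gam x u c).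
Proof.
rewrite [bil (g x) b _]bil_gC !GamE -mulrDr Kcov_compat//.
by rewrite mulrA mulVf ?mul1r ?pnatr_eq0.
Qed.

Lemma dmx_compat u : dmx g x u = CM x u *m g x + g x *m (CM x u)^T.
Proof.
apply: bil_eq => b c; rewrite -[LHS]/(T u b c) Gam_compat bilDm bil_mull bil_mulr.
by [].
Qed.

Lemma cross_T e u X : T e u X + T (e *m J) u (X *m J) = 2 * bil (g x) (Gam x u e) X.
Proof. by rewrite cross_term// GamE mulrA mulfV ?mul1r ?pnatr_eq0. Qed.
End AtPoint.
End Christoffel.

(** * Derivatives of matrix-valued functions *)

Section MatrixCalculus.
Variables (R : realType) (d : nat) (U : set 'rV[R]_d).
Hypothesis oU : open U.

Definition smx p q (A : 'rV[R]_d -> 'M[R]_(p, q)) := forall i j, smooth U (fun x => A x i j).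
Definition dM p q (A : 'rV[R]_d -> 'M[R]_(p, q)) x u : 'M[R]_(p, q) :=
  \matrix_(i, j) 'D_u (fun y => A y i j) x.

Lemma smx_mul p q r (A : 'rV[R]_d -> 'M[R]_(p, q)) (B : 'rV[R]_d -> 'M[R]_(q, r)) :
  smx A -> smx B -> smx (fun x => A x *m B x).
Proof.
move=> sA sB i j; have S : smooth U (fun x => \sum_k A x i k * B x k j).
  by apply: smooth_sum => // k; exact: smoothM.
by apply: (smooth_ext oU _ S) => y _; rewrite mxE.
Qed.
Lemma smx_const p q (A : 'M[R]_(p, q)) : smx (fun=> A).
Proof. by move=> i j; exact: smooth_cst. Qed.
Lemma smx_tr p q (A : 'rV[R]_d -> 'M[R]_(p, q)) : smx A -> smx (fun x => (A x)^T).
Proof. by move=> sA i j; apply: (smooth_ext oU _ (sA j i)) => y _; rewrite mxE. Qed.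
Lemma smooth_tr p (A : 'rV[R]_d -> 'M[R]_p) : smx A -> smooth U (fun x => \tr (A x)).
Proof. by move=> sA; apply: smooth_sum. Qed.
Section AtPoint.
Variable x : 'rV[R]_d.
Hypothesis Ux : U x.

Lemma derive_sum_smooth (I : finType) (F : I -> 'rV[R]_d -> R) u :
  (forall i, smooth U (F i)) ->
  'D_u (fun y => \sum_i F i y) x = \sum_i 'D_u (F i) x.
Proof.
move=> sF; rewrite /index_enum; elim: (Finite.enum I) => [|i s IH].
  rewrite big_nil (_ : (fun y => _) = cst 0) ?derive_cst//.
  by apply/funext => y; rewrite big_nil.
rewrite big_cons -IH.
have S2 : smooth U (fun y => \sum_(i <- s) F i y) by apply: smooth_sum.
rewrite (_ : (fun y => \sum_(i <- i :: s) _) = F i + (fun y => \sum_(i <- s) F i y)).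
  by rewrite deriveD//; exact: smooth_derivable Ux.
by apply/funext => y; rewrite big_cons.
Qed.

Lemma deriveM_smooth (f h : 'rV[R]_d -> R) u : smooth U f -> smooth U h ->
  'D_u (fun y => f y * h y) x = 'D_u f x * h x + f x * 'D_u h x.
Proof.
move=> sf sh; rewrite (_ : (fun y => _) = f * h)// deriveM; [|exact: smooth_derivable Ux..].
by rewrite /GRing.scale /= addrC mulrC [in RHS]mulrC mulrC.
Qed.

Lemma dM_mul p q r (A : 'rV[R]_d -> 'M[R]_(p, q)) (B : 'rV[R]_d -> 'M[R]_(q, r)) u :
  smx A -> smx B -> dM (fun y => A y *m B y) x u = dM A x u *m B x + A x *m dM B x u.
Proof.
move=> sA sB; apply/matrixP => i j; rewrite !mxE.
rewrite (_ : (fun y => _) = (fun y => \sum_k A y i k * B y k j)); last first.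
  by apply/funext => y; rewrite mxE.
rewrite (@derive_sum_smooth _ (fun k y => A y i k * B y k j)); last by move=> k; exact: smoothM.
rewrite -big_split; apply: eq_bigr => k _ /=.
by rewrite deriveM_smooth// !mxE.
Qed.

Lemma dM_add p q (A B : 'rV[R]_d -> 'M[R]_(p, q)) u :
  smx A -> smx B -> dM (fun y => A y + B y) x u = dM A x u + dM B x u.
Proof.
move=> sA sB; apply/matrixP => i j; rewrite !mxE.
rewrite (_ : (fun y => _) = (fun y => A y i j) + (fun y => B y i j)); last first.
  by apply/funext => y; rewrite mxE.
by rewrite deriveD//; exact: smooth_derivable Ux.
Qed.

Lemma dM_const p q (A : 'M[R]_(p, q)) u : dM (fun=> A) x u = 0.
Proof. by apply/matrixP => i j; rewrite !mxE derive_cst. Qed.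

Lemma dM_tr p q (A : 'rV[R]_d -> 'M[R]_(p, q)) u : dM (fun y => (A y)^T) x u = (dM A x u)^T.
Proof.
apply/matrixP => i j; rewrite !mxE; congr ('D_ _ _ _).
by apply/funext => y; rewrite mxE.
Qed.

Lemma dM_ext p q (A B : 'rV[R]_d -> 'M[R]_(p, q)) u : (forall y, U y -> A y = B y) ->
  dM A x u = dM B x u.
Proof.
by move=> H; apply/matrixP => i j; rewrite !mxE; apply: (derive_ext _ oU Ux) => y /H ->.
Qed.

Lemma derive_tr p (A : 'rV[R]_d -> 'M[R]_p) u : smx A ->
  'D_u (fun y => \tr (A y)) x = \tr (dM A x u).
Proof.
move=> sA; rewrite (@derive_sum_smooth _ (fun k y => A y k k))//.
by apply: eq_bigr => k _; rewrite mxE.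
Qed.

Lemma dM_dirD p q (A : 'rV[R]_d -> 'M[R]_(p, q)) u v : smx A -> dM A x (u + v) = dM A x u + dM A x v.
Proof. by move=> sA; apply/matrixP => i j; rewrite !mxE (smooth_dirD _ _ oU). Qed.
Lemma dM_dirZ p q (A : 'rV[R]_d -> 'M[R]_(p, q)) (a : R) u : smx A -> dM A x (a *: u) = a *: dM A x u.
Proof. by move=> sA; apply/matrixP => i j; rewrite !mxE (smooth_dirZ _ _ oU). Qed.
End AtPoint.

Lemma smx_dM p q (A : 'rV[R]_d -> 'M[R]_(p, q)) u : smx A -> smx (fun y => dM A y u).
Proof. by move=> sA i j; apply: (smooth_ext oU _ (smooth_dir u oU (sA i j))) => y _; rewrite mxE. Qed.

Lemma dM_Schwarz p q (A : 'rV[R]_d -> 'M[R]_(p, q)) x u v : U x -> smx A ->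
  dM (fun y => dM A y u) x v = dM (fun y => dM A y v) x u.
Proof.
move=> Ux sA; apply/matrixP => i j; rewrite [LHS]mxE [RHS]mxE.
rewrite (_ : (fun y => dM A y u i j) = 'D_u (fun y => A y i j)); last by apply/funext => y; rewrite mxE.
rewrite (_ : (fun y => dM A y v i j) = 'D_v (fun y => A y i j)); last by apply/funext => y; rewrite mxE.
exact: (Schwarz _ _ oU).
Qed.

Definition gradm (h : 'rV[R]_d -> R) x : 'rV[R]_d := \row_i partial i h x.
Definition D2 (h : 'rV[R]_d -> R) x : 'M[R]_d := \matrix_(i, j) partial i (partial j h) x.

Lemma smx_gradm h : smooth U h -> smx (gradm h).
Proof.
by move=> sh i j; apply: (smooth_ext oU _ (smooth_partial j sh)) => y _; rewrite mxE.
Qed.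
Lemma smx_D2 h : smooth U h -> smx (D2 h).
Proof.
move=> sh i j; apply: (smooth_ext oU _ (smooth_partial i (smooth_partial j sh))) => y _.
by rewrite mxE.
Qed.
Lemma gradmE h x v : U x -> smooth U h -> (gradm h x *m v^T) 0 0 = 'D_v h x.
Proof.
move=> Ux sh; rewrite mxE (smoothDE _ oU sh Ux); apply: eq_bigr => i _.
by rewrite !mxE mulrC.
Qed.
Lemma dM_gradm h x u : U x -> smooth U h -> dM (gradm h) x u = u *m D2 h x.
Proof.
move=> Ux sh; apply/rowP => j; rewrite !mxE.
rewrite (_ : (fun y => _) = partial j h); last by apply/funext => y; rewrite mxE.
by rewrite (smoothDE _ oU (smooth_partial j sh) Ux); apply: eq_bigr => i _; rewrite mxE.
Qed.
Lemma bil_D2 h x u v : U x -> smooth U h -> bil (D2 h x) u v = 'D_u ('D_v h) x.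
Proof.
move=> Ux sh; rewrite /bil -dM_gradm//.
rewrite (derive_ext _ oU Ux (fun y Uy => esym (gradmE v Uy sh))).
rewrite (_ : dM (gradm h) x u *m v^T = dM (fun y => gradm h y *m v^T) x u).
  by rewrite mxE.
rewrite dM_mul//; last 2 first.
- exact: smx_gradm.
- exact: smx_const.
by rewrite dM_const mulmx0 addr0.
Qed.
Lemma D2_sym h x : U x -> smooth U h -> (D2 h x)^T = D2 h x.
Proof.
move=> Ux sh; apply: bil_eq => u v; rewrite bilT (bil_D2 _ _ Ux sh) (bil_D2 _ _ Ux sh).
exact: (Schwarz _ _ oU).
Qed.
End MatrixCalculus.

Opaque derive.

(** * Ricci curvature of a Kaehler chart *)

Section Ricci.
Variables (R : realType) (m : nat).
Local Notation n := (m + m)%N.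
Local Notation J := (Jstd R m).
Variables (U : set 'rV[R]_n) (g : 'rV[R]_n -> 'M[R]_n).
Hypothesis kc : kahler_chart U g.
Let oU := kc_open kc.
Let gs : smx U g := kc_smooth kc.
Implicit Types (x y u v w b c e X : 'rV[R]_n).

(** The contracted Christoffel symbols, that is, the differential of half the logarithm of the
    determinant of the metric. *)
Definition lamc y : 'cV[R]_n := \col_i \sum_k christoffel g k i k y.

Lemma lamE y u : (u *m lamc y) 0 0 = \tr (CM g y u).
Proof.
rewrite mxE /mxtrace; under eq_bigr do rewrite mxE big_distrr/=.
by rewrite exchange_big/=; apply: eq_bigr => k _; rewrite mxE.
Qed.

Lemma smx_CM u : smx U (fun y => CM g y u).
Proof.
move=> j k; have S : smooth U (fun y => \sum_i u 0 i * christoffel g k i j y).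
  by apply: smooth_sum => // i; apply: smoothZ => //; exact: (smooth_christoffel kc).
by apply: (smooth_ext oU _ S) => y _; rewrite mxE.
Qed.

Lemma smx_lamc : smx U lamc.
Proof.
move=> i j; have S : smooth U (fun y => \sum_k christoffel g k i k y).
  by apply: smooth_sum => // k; exact: (smooth_christoffel kc).
by apply: (smooth_ext oU _ S) => y _; rewrite mxE.
Qed.

Lemma smx_Gam u e : smx U (fun y => Gam g y u e).
Proof. by apply: smx_mul => //; [exact: smx_const|exact: smx_CM]. Qed.

Section AtPoint.
Variable x : 'rV[R]_n.
Hypothesis Ux : U x.

Lemma GamE_sum y u e k : Gam g y u e 0 k =
  \sum_(p : 'I_n * 'I_n) (u 0 p.1 * e 0 p.2) * christoffel g k p.1 p.2 y.
Proof.
rewrite -(pair_big xpredT xpredT (fun i j => u 0 i * e 0 j * christoffel g k i j y))/=.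
rewrite exchange_big/= /Gam mxE; apply: eq_bigr => j _; rewrite mxE big_distrr/=.
by apply: eq_bigr => i _; move: (christoffel _ _ _ _ _) => a; ring.
Qed.

Lemma christoffel_sym k i j : christoffel g k i j x = christoffel g k j i x.
Proof.
have E p q : christoffel g k p q x = Gam g x (delta_mx 0 p) (delta_mx 0 q) 0 k.
  rewrite GamE_sum (bigD1 (p, q))//= !mxE !eqxx !mul1r big1 ?addr0// => -[a b] /=.
  rewrite xpair_eqE negb_and => /orP[] /negbTE ab; rewrite !mxE ab ?mul0r ?andbF//.
  by rewrite mulr0 mul0r.
by rewrite !E (Gam_sym kc Ux).
Qed.

Let ring_aux (a b p q r s : R) :
  a * p * b - a * q * b + a * r * b - a * s * b = a * (p - q + (r - s)) * b.
Proof. by ring. Qed.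

Let ring_aux2 (a p q t p' : R) : a - p + q - t + (- a - p' - q - - t) = - (p + p').
Proof. by ring. Qed.

Lemma ricci_expand u v : bil (coord_ricci g x) u v =
  \sum_k (dM (fun y => Gam g y u v) x (delta_mx 0 k)) 0 k
  - (u *m dM lamc x v) 0 0 + (Gam g x u v *m lamc x) 0 0 - \tr (CM g x v *m CM g x u).
Proof.
have E1 : \sum_k (dM (fun y => Gam g y u v) x (delta_mx 0 k)) 0 k =
   \sum_i \sum_j u 0 i * (\sum_k partial k (christoffel g k i j) x) * v 0 j.
  under eq_bigr => k _.
    rewrite mxE (_ : (fun y => Gam g y u v 0 k) =
      (fun y => \sum_(p : 'I_n * 'I_n) (u 0 p.1 * v 0 p.2) * (fun p y => christoffel g k p.1 p.2 y) p y)); last first.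
      by apply/funext => y; rewrite GamE_sum.
    rewrite (derive_wsum kc _ _ Ux); last by move=> p; exact: (smooth_christoffel kc).
    over.
  rewrite exchange_big/= [RHS]pair_big/=; apply: eq_bigr => -[i j] _ /=.
  by rewrite -big_distrr/= mulrAC.
have E2 : (u *m dM lamc x v) 0 0 =
   \sum_i \sum_j u 0 i * (\sum_k partial j (christoffel g k i k) x) * v 0 j.
  rewrite mxE; apply: eq_bigr => i _.
  have -> : dM lamc x v i 0 = \sum_k \sum_j v 0 j * partial j (christoffel g k i k) x.
    rewrite mxE (_ : (fun y => lamc y i 0) = (fun y => \sum_k (fun k y => christoffel g k i k y) k y)); last first.
      by apply/funext => y; rewrite mxE.
    rewrite (derive_sum_smooth oU Ux); last by move=> k; exact: (smooth_christoffel kc).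
    apply: eq_bigr => k _; exact: (smoothDE v oU (smooth_christoffel kc k i k) Ux).
  rewrite exchange_big/= big_distrr/=; apply: eq_bigr => j _.
  by rewrite -big_distrr/= mulrCA mulrC.
have E3 : (Gam g x u v *m lamc x) 0 0 =
   \sum_i \sum_j u 0 i * (\sum_k \sum_l christoffel g k k l x * christoffel g l i j x) * v 0 j.
  rewrite mxE; under eq_bigr do rewrite GamE_sum mxE big_distrl /=.
  rewrite exchange_big/= [RHS]pair_big/=; apply: eq_bigr => -[i j] _ /=.
  rewrite exchange_big/= big_distrr big_distrl/=; apply: eq_bigr => l _.
  rewrite -big_distrl/=; under [in RHS]eq_bigr do rewrite christoffel_sym.
  by move: (\sum_k _) (christoffel _ _ _ _ _) => a b; ring.
have E4 : \tr (CM g x v *m CM g x u) =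
   \sum_i \sum_j u 0 i * (\sum_k \sum_l christoffel g k j l x * christoffel g l i k x) * v 0 j.
  rewrite /mxtrace; under eq_bigr do rewrite mxE.
  under eq_bigr do under eq_bigr do rewrite !mxE big_distrl/=.
  under eq_bigr do under eq_bigr do under eq_bigr do rewrite big_distrr/=.
  under [RHS]eq_bigr do under eq_bigr do rewrite big_distrr big_distrl/=.
  under [RHS]eq_bigr do under eq_bigr do under eq_bigr do rewrite big_distrr big_distrl/=.
  under [RHS]eq_bigr do rewrite exchange_big/=.
  rewrite [RHS]exchange_big/=.
  under [RHS]eq_bigr do under eq_bigr do rewrite exchange_big/=.
  under [RHS]eq_bigr do rewrite exchange_big/=.
  rewrite [LHS]exchange_big/=.
  apply: eq_bigr => k _; apply: eq_bigr => l _.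
  rewrite exchange_big/=; apply: eq_bigr => i _; apply: eq_bigr => j _.
  by move: (christoffel _ _ _ _ _) (christoffel _ _ _ _ _) => a b; ring.
rewrite E1 E2 E3 E4 bilE -sumrB -big_split -sumrB; apply: eq_bigr => i _.
rewrite -sumrB -big_split -sumrB; apply: eq_bigr => j _ /=.
have -> : coord_ricci g x i j =
   (\sum_k partial k (christoffel g k i j) x - \sum_k partial j (christoffel g k i k) x) +
   (\sum_k \sum_l christoffel g k k l x * christoffel g l i j x -
    \sum_k \sum_l christoffel g k j l x * christoffel g l i k x).
  rewrite mxE; congr (_ + _); first by rewrite sumrB.
  by rewrite -sumrB; apply: eq_bigr => k _; rewrite sumrB.
apply/esym; exact: ring_aux.
Qed.

(** The values at [u, v] and at [J u, J v] are added. Since [Gam] changes sign when [J] is applied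
    to both arguments, and the quadratic terms change sign as well, only derivatives of [lamc]
    remain: the Ricci form is a second derivative of the logarithm of the volume density. *)
Lemma ricci_kahler u v :
  bil (coord_ricci g x) (u *m J) (v *m J) = bil (coord_ricci g x) u v ->
  2 * bil (coord_ricci g x) u v =
  - ((u *m dM lamc x v) 0 0 + (u *m J *m dM lamc x (v *m J)) 0 0).
Proof.
move=> H; rewrite mulr_natl mulr2n -{2}H !ricci_expand.
have -> : dM (fun y => Gam g y (u *m J) (v *m J)) x = (fun w => - dM (fun y => Gam g y u v) x w).
  apply/funext => w; rewrite (dM_ext oU Ux (B := fun y => (- 1%:M) *m Gam g y u v)) => [|y Uy].
    rewrite (dM_mul oU Ux); [|exact: smx_const|exact: smx_Gam].
    by rewrite dM_const mul0mx add0r mulNmx mul1mx.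
  by rewrite (Gam_JJ kc Uy) mulNmx mul1mx.
rewrite (Gam_JJ kc Ux) !(CM_Jl kc Ux).
have -> : CM g x v *m J *m (CM g x u *m J) = - (CM g x v *m CM g x u).
  by rewrite -mulmxA (mulmxA J) (CM_J kc Ux) -mulmxA JstdJ !mulmxN mulmx1.
have oppE (A : 'M[R]_1) : (- A) 0 0 = - A 0 0 by rewrite mxE.
rewrite mulNmx oppE linearN /=.
rewrite [X in _ + (X - _ + _ + _)](_ : _ = - \sum_k (dM (fun y => Gam g y u v) x (delta_mx 0 k)) 0 k); last first.
  by rewrite -sumrN; apply: eq_bigr => k _; rewrite mxE.
exact: ring_aux2.
Qed.
End AtPoint.
End Ricci.

(** * Gradient, Laplacian and the soliton equation in a chart *)

Section Potential.
Variables (R : realType) (m : nat).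
Local Notation n := (m + m)%N.
Local Notation J := (Jstd R m).
Variables (U : set 'rV[R]_n) (g : 'rV[R]_n -> 'M[R]_n).
Hypothesis kc : kahler_chart U g.
Let oU := kc_open kc.
Let gs : smx U g := kc_smooth kc.
Implicit Types (h : 'rV[R]_n -> R) (x y u v w b c e X : 'rV[R]_n).

Definition ginv y := invmx (g y).
Definition gradV h y := gradm h y *m ginv y.
(** No Christoffel term occurs: in holomorphic coordinates its trace against the inverse metric
    vanishes, see [tr_hessian]. *)
Definition lap h y := \tr (ginv y *m D2 h y).
(** The covariant derivative of the gradient, that is, the Hessian with one index raised. *)
Definition Nab h y u := dM (gradV h) y u + Gam g y u (gradV h y).
Definition normgrad h y := bil (g y) (gradV h y) (gradV h y).

Lemma smx_ginv : smx U ginv.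
Proof. by move=> i j; exact: (smooth_ginv kc). Qed.
Lemma smx_gradV h : smooth U h -> smx U (gradV h).
Proof. by move=> sh; apply: smx_mul => //; [exact: smx_gradm|exact: smx_ginv]. Qed.
Lemma smooth_lap h : smooth U h -> smooth U (lap h).
Proof. by move=> sh; apply: smooth_tr => //; apply: smx_mul => //; [exact: smx_ginv|exact: smx_D2]. Qed.

Section AtPoint.
Variable x : 'rV[R]_n.
Hypothesis Ux : U x.

Lemma gradV_g h : gradV h x *m g x = gradm h x.
Proof. by rewrite /gradV -mulmxA mulVmx ?mulmx1//; exact: (kc_unit kc). Qed.
Lemma bil_gradV h v : smooth U h -> bil (g x) (gradV h x) v = 'D_v h x.
Proof. by move=> sh; rewrite /bil gradV_g (gradmE oU). Qed.

Let aux4 (a b c p : R) : a * b * c * p = a * (c * p) * b.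
Proof. by ring. Qed.

Lemma bil_hessian h u v : smooth U h ->
  bil (coord_hessian g h x) u v = 'D_u ('D_v h) x - 'D_(Gam g x u v) h x.
Proof.
move=> sh; rewrite -(bil_D2 oU)// (smoothDE _ oU sh Ux).
have -> : \sum_k Gam g x u v 0 k * partial k h x =
   bil (\matrix_(i, j) \sum_k christoffel g k i j x * partial k h x) u v.
  rewrite bilE pair_big/=; under eq_bigr do rewrite GamE_sum big_distrl/=.
  rewrite exchange_big/=; apply: eq_bigr => -[i j] _ /=; rewrite mxE big_distrr big_distrl/=.
  by apply: eq_bigr => k _; exact: aux4.
rewrite -mulN1r -bilZm -bilDm; congr (bil _ _ _).
by apply/matrixP => i j; rewrite !mxE mulN1r.
Qed.

Lemma hessian_sym h : smooth U h -> (coord_hessian g h x)^T = coord_hessian g h x.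
Proof.
move=> sh; apply: bil_eq => u v; rewrite bilT (bil_hessian v u sh) (bil_hessian u v sh) (Gam_sym kc Ux).
by rewrite (Schwarz v u oU sh Ux).
Qed.

Let kcov_aux (T1 K1 K2 : R) : K1 + K2 = 2 * T1 -> T1 - 2^-1 * K1 = 2^-1 * K2.
Proof. lra. Qed.

Lemma hessian_Nab h u v : smooth U h ->
  bil (coord_hessian g h x) u v = bil (g x) (Nab h x u) v.
Proof.
move=> sh; rewrite (bil_hessian _ _ sh) -(bil_D2 oU _ _ Ux sh).
rewrite -(bil_gradV _ sh) bilDl (GamE kc Ux) (bil_gC kc Ux) (GamE kc Ux).
have -> : bil (D2 h x) u v = bil (g x) (dM (gradV h) x u) v + T3 g x u (gradV h x) v.
  rewrite /bil -(dM_gradm oU)//.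
  have E y : U y -> gradm h y = gradV h y *m g y.
    by move=> Uy; rewrite /gradV -mulmxA mulVmx ?mulmx1//; exact: (kc_unit kc).
  rewrite (dM_ext oU Ux _ E) (dM_mul oU Ux _ (smx_gradV sh) gs) mulmxDl mxE.
  by [].
rewrite -addrA; congr (_ + _); apply: kcov_aux.
rewrite addrC [RHS](_ : _ = 2 * T3 g x u v (gradV h x)); last by rewrite (T3sym kc Ux).
by rewrite addrC; apply: Kcov_compat; exact: (T3sym kc Ux).
Qed.

Definition Nmx h := coord_hessian g h x *m ginv x.
Definition DVm h y : 'M[R]_n := \matrix_(i, k) partial i (fun z => gradV h z 0 k) y.

Lemma Nab_mx h u : smooth U h -> u *m Nmx h = Nab h x u.
Proof.
move=> sh; apply: (bil_g_inj kc Ux) => X; rewrite -hessian_Nab//.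
by rewrite /Nmx /bil /ginv -!mulmxA (mulmxA (invmx _)) mulVmx ?mul1mx//; exact: (kc_unit kc).
Qed.

Lemma DVm_row h u : smooth U h -> dM (gradV h) x u = u *m DVm h x.
Proof.
move=> sh; apply/rowP => k; rewrite !mxE (smoothDE _ oU (smx_gradV sh 0 k) Ux).
by apply: eq_bigr => i _; rewrite mxE.
Qed.

Lemma Nmx_DVm h : smooth U h -> Nmx h = DVm h x + CM g x (gradV h x).
Proof.
move=> sh; apply/row_matrixP => i; rewrite linearD /= !rowE Nab_mx// /Nab DVm_row//.
by rewrite (Gam_sym kc Ux).
Qed.

Lemma tr_ginv_J (A : 'M[R]_n) : \tr (ginv x *m (J *m A *m J^T)) = \tr (ginv x *m A).
Proof.
rewrite /ginv !mulmxA mxtrace_mulC !mulmxA JstdT !mulNmx (ginv_J kc Ux).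
by rewrite -[invmx _ *m J *m J]mulmxA JstdJ mulmxN mulmx1 mulNmx opprK.
Qed.

Let neg_aux (a : R) : - a = a -> a = 0.
Proof. lra. Qed.

(** The coordinate Hessian and the matrix of second partial derivatives differ by the derivative of
    [h] along [Gam], which changes sign when [J] is applied to both arguments. Its trace against the
    [J]-invariant inverse metric is zero. *)
Lemma tr_hessian h : smooth U h -> \tr (ginv x *m coord_hessian g h x) = lap h x.
Proof.
move=> sh; pose Q := D2 h x - coord_hessian g h x.
have QJ : J *m Q *m J^T = - Q.
  apply: bil_eq => u v; rewrite bil_mulr bil_mull /Q.
  have E a b : bil (D2 h x - coord_hessian g h x) a b = 'D_(Gam g x a b) h x.
    rewrite bilDm -scaleN1r bilZm (bil_hessian _ _ sh) (bil_D2 oU _ _ Ux sh).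
    by rewrite mulN1r opprB addrCA subrr addr0.
  rewrite E -scaleN1r bilZm E (Gam_JJ kc Ux) -scaleN1r.
  exact: (smooth_dirZ _ _ oU).
have := tr_ginv_J Q; rewrite QJ mulmxN linearN /= => /neg_aux.
by rewrite /Q mulmxBr linearB /= => /eqP; rewrite subr_eq0 => /eqP <-.
Qed.

Lemma div_gradV h : smooth U h -> \tr (DVm h x) + (gradV h x *m lamc g x) 0 0 = lap h x.
Proof.
move=> sh; rewrite lamE -linearD /= -Nmx_DVm// -tr_hessian//.
by rewrite /Nmx mxtrace_mulC.
Qed.

(** The divergence of the gradient turned by [J]: the trace of a symmetric operator composed with
    the skew operator [J] is zero. [d_lap] differentiates this equation together with
    [div_gradV]. *)
Lemma div_gradVJ h : smooth U h -> \tr (DVm h x *m J) + (gradV h x *m J *m lamc g x) 0 0 = 0.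
Proof.
move=> sh; rewrite lamE (CM_Jl kc Ux) -linearD /= -mulmxDl -Nmx_DVm//.
have H : \tr (Nmx h *m J) = - \tr (Nmx h *m J).
  rewrite -{1}mxtrace_tr !trmx_mul JstdT (hessian_sym sh) (ginv_sym kc Ux) -/(ginv x).
  by rewrite mulNmx linearN /= mulmxA /ginv (ginv_J kc Ux) mxtrace_mulC mulmxA.
exact: neg_aux (esym H).
Qed.
End AtPoint.
End Potential.

Lemma dME (R : realType) (d p q : nat) (A : 'rV[R]_d -> 'M[R]_(p, q)) x u i j :
  dM A x u i j = 'D_u (fun y => A y i j) x.
Proof. by rewrite mxE. Qed.

Lemma derive_add (R : realType) (d : nat) (U : set 'rV[R]_d) x (A B : 'rV[R]_d -> R) : open U -> U x ->
  forall u, smooth U A -> smooth U B -> ('D_u (fun y => A y + B y) x : R) = ('D_u A x : R) + ('D_u B x : R).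
Proof.
move=> oU Ux u sA sB; have := @deriveD R _ _ A B x u; apply; exact: smooth_derivable oU _ Ux.
Qed.

Section MetricDerivative.
Variables (R : realType) (m : nat).
Local Notation n := (m + m)%N.
Variables (U : set 'rV[R]_n) (g : 'rV[R]_n -> 'M[R]_n).
Hypothesis kc : kahler_chart U g.
Let oU := kc_open kc.
Let gs : smx U g := kc_smooth kc.
Implicit Types (x y u v w b c e X : 'rV[R]_n).
Local Notation Gi := (ginv g).
Let sGi : smx U Gi := smx_ginv kc.

Lemma T3_dM x u b c : bil (dM g x u) b c = T3 g x u b c.
Proof. by []. Qed.

Lemma dM_ginv x u : U x -> dM Gi x u = - (Gi x *m dM g x u *m Gi x).
Proof.
move=> Ux; have E y : U y -> Gi y *m g y = 1%:M by move=> Uy; rewrite mulVmx// (kc_unit kc).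
have F1 := dM_ext oU Ux u E; have F2 := dM_mul oU Ux u sGi gs.
rewrite F2 dM_const in F1.
have ug := kc_unit kc Ux.
have : (dM Gi x u *m g x + Gi x *m dM g x u) *m Gi x = 0 by rewrite F1 mul0mx.
rewrite mulmxDl -mulmxA mulmxV// mulmx1 => /eqP; rewrite addr_eq0 => /eqP ->.
by [].
Qed.

Lemma dM_g x u : U x -> dM g x u = CM g x u *m g x + g x *m (CM g x u)^T.
Proof.
move=> Ux; apply: bil_eq => b c.
by rewrite T3_dM (Gam_compat kc Ux) bilDm bil_mull bil_mulr.
Qed.

End MetricDerivative.

Section SolitonChart.
Variables (R : realType) (m : nat).
Local Notation n := (m + m)%N.
Local Notation J := (Jstd R m).

Record soliton_chart (U : set 'rV[R]_n) (g : 'rV[R]_n -> 'M[R]_n) (f : 'rV[R]_n -> R) : Prop := SolitonChart {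
  sc_kc : kahler_chart U g;
  sc_f : smooth U f;
  sc_eq : forall x, U x -> coord_ricci g x + coord_hessian g f x = 2^-1 *: g x;
  sc_J : forall x, U x -> J *m coord_hessian g f x = coord_hessian g f x *m J }.

Variables (U : set 'rV[R]_n) (g : 'rV[R]_n -> 'M[R]_n) (f : 'rV[R]_n -> R).
Hypothesis sc : soliton_chart U g f.
Let kc := sc_kc sc.
Let sf := sc_f sc.
Let oU := kc_open kc.
Let gs : smx U g := kc_smooth kc.
Implicit Types (h : 'rV[R]_n -> R) (x y u v w b c e X : 'rV[R]_n).
Local Notation V := (gradV g f).
Local Notation H := (coord_hessian g f).
Local Notation Gi := (ginv g).
Let sV : smx U V := smx_gradV kc sf.
Let sGi : smx U Gi := smx_ginv kc.

Lemma ricci_herm x u v : U x -> bil (coord_ricci g x) (u *m J) (v *m J) = bil (coord_ricci g x) u v.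
Proof.
move=> Ux; have -> : coord_ricci g x = 2^-1 *: g x - H x by rewrite -(sc_eq sc Ux) addrK.
have HJ : J *m (2^-1 *: g x - H x) = (2^-1 *: g x - H x) *m J.
  by rewrite mulmxBr mulmxBl (sc_J sc Ux) -scalemxAr -scalemxAl (kc_J kc Ux).
by rewrite (bil_comm_J _ _ HJ) mulJJ bilNr opprK.
Qed.

(** A [J]-invariant Hessian makes the gradient a real holomorphic vector field. The Christoffel part
    of [Nab] already commutes with [J], so the plain derivative does too. *)
Lemma dV_J x u : U x -> dM V x (u *m J) = dM V x u *m J.
Proof.
move=> Ux; have E : Nab g f x (u *m J) = Nab g f x u *m J.
  apply: (bil_g_inj kc Ux) => X; rewrite -(hessian_Nab kc Ux _ _ sf).
  rewrite (bil_comm_J _ _ (sc_J sc Ux)) (bil_comm_J _ _ (kc_J kc Ux)).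
  by rewrite -(hessian_Nab kc Ux _ _ sf).
by move: E; rewrite /Nab (Gam_Jl kc Ux) mulmxDl => /addIr.
Qed.

Lemma ddV_J x u v : U x ->
  dM (fun y => dM V y (u *m J)) x (v *m J) = - dM (fun y => dM V y u) x v.
Proof.
move=> Ux; have E w z : dM (fun y => dM V y (w *m J)) x z = dM (fun y => dM V y w) x z *m J.
  rewrite (dM_ext oU Ux _ (fun y Uy => dV_J w Uy)).
  rewrite (dM_mul oU Ux _ (smx_dM oU w sV) (smx_const U J)).
  by rewrite dM_const mulmx0 addr0.
by rewrite E (dM_Schwarz oU _ _ Ux sV) E mulJJ (dM_Schwarz oU _ _ Ux sV).
Qed.

Lemma smx_DVm : smx U (DVm g f).
Proof.
by move=> i k; apply: (smooth_ext oU _ (smooth_partial i (sV 0 k))) => y _; rewrite mxE.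
Qed.

Lemma row_opp p q (A : 'M[R]_(p, q)) i : row i (- A) = - row i A.
Proof. by rewrite linearN. Qed.

Lemma row_dDVm x u i : row i (dM (DVm g f) x u) = dM (fun y => dM V y (delta_mx 0 i)) x u.
Proof.
apply/rowP => k; rewrite !mxE; congr ('D_ _ _ _).
by apply/funext => y; rewrite !mxE.
Qed.

Opaque dM.

Lemma dDVm_J x u : U x -> dM (DVm g f) x (u *m J) *m J = - dM (DVm g f) x u.
Proof.
move=> Ux; apply/row_matrixP => i.
have calc (a b c d : 'rV[R]_n) : a = c -> b = d -> c *m J = - d -> a *m J = - b by move=> -> ->.
rewrite [RHS]row_opp [LHS]row_mul; apply: (calc _ _ _ _ (row_dDVm x (u *m J) i) (row_dDVm x u i)).
have E1 := dM_Schwarz oU (delta_mx 0 i) (u *m J) Ux sV.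
have E2 := dM_ext oU Ux (delta_mx 0 i) (fun y Uy => dV_J u Uy).
have E3 := dM_mul oU Ux (delta_mx 0 i) (smx_dM oU u sV) (smx_const U J).
rewrite dM_const mulmx0 addr0 in E3.
have E4 := dM_Schwarz oU (delta_mx 0 i) u Ux sV.
have calc2 (a b c d e : 'rV[R]_n) : a = b -> b = c -> c = d *m J -> e = d -> a *m J = - e.
  by move=> -> -> -> ->; rewrite mulJJ.
exact: (calc2 _ _ _ _ _ E1 E2 E3 E4).
Qed.

Let aux1 (a b c d : R) : - a + (- b + c) = 0 -> a + (b + d) = d + c.
Proof. lra. Qed.
Let aux2 (a b c : R) : 2 * a = - (b + c) -> b + c = - 2 * a.
Proof. lra. Qed.

(** The contracted Bianchi identity for a soliton. Differentiating [div_gradV] along [u] and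
    [div_gradVJ] along [J u], the second derivatives of the holomorphic field [V] cancel, and the
    remaining derivatives of [lamc] form the Ricci curvature by [ricci_kahler]. *)
Lemma d_lap x u : U x -> 'D_u (lap g f) x = - 2 * bil (coord_ricci g x) (V x) u.
Proof.
move=> Ux; have sL := smx_lamc kc.
have sVJ : smx U (fun y => V y *m J) by apply: smx_mul => //; exact: smx_const.
have tr00 (A : 'rV[R]_n -> 'M[R]_1) (w : 'rV[R]_n) : 'D_w (fun y => A y 0 0) x = dM A x w 0 0 by rewrite dME.
have addE (A B : 'M[R]_1) : (A + B) 0 0 = A 0 0 + B 0 0 by rewrite mxE.
have E1 : 'D_u (lap g f) x = \tr (dM (DVm g f) x u) +
    ((dM V x u *m lamc g x) 0 0 + (V x *m dM (lamc g) x u) 0 0).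
  rewrite -(derive_ext _ oU Ux (fun y Uy => div_gradV kc Uy sf)).
  have F1 := derive_add oU Ux u (smooth_tr oU smx_DVm) (smx_mul oU sV sL 0 0).
  by rewrite F1 (derive_tr oU Ux _ smx_DVm) tr00 (dM_mul oU Ux _ sV sL) addE.
have E2 : 'D_(u *m J) (fun y => \tr (DVm g f y *m J) + (V y *m J *m lamc g y) 0 0) x =
    \tr (dM (DVm g f) x (u *m J) *m J) +
    ((dM V x (u *m J) *m J *m lamc g x) 0 0 + (V x *m J *m dM (lamc g) x (u *m J)) 0 0).
  have sDJ : smx U (fun y => DVm g f y *m J) by apply: smx_mul => //; [exact: smx_DVm|exact: smx_const].
  have F1 := derive_add oU Ux (u *m J) (smooth_tr oU sDJ) (smx_mul oU sVJ sL 0 0).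
  have F2 := derive_tr oU Ux (u *m J) sDJ.
  have F3 := dM_mul oU Ux (u *m J) smx_DVm (smx_const U J).
  have F4 := dM_mul oU Ux (u *m J) sVJ sL.
  have F5 := dM_mul oU Ux (u *m J) sV (smx_const U J).
  rewrite dM_const mulmx0 addr0 in F3; rewrite dM_const mulmx0 addr0 in F5.
  rewrite F1 F2 F3 tr00 F4 F5 addE.
  apply: f_equal2.
  apply: erefl.
  apply: f_equal2.
  apply: erefl.
 apply: erefl.

have E3 : 'D_(u *m J) (fun y => \tr (DVm g f y *m J) + (V y *m J *m lamc g y) 0 0) x = 0.
  rewrite (derive_ext _ oU Ux (fun y Uy => div_gradVJ kc Uy sf)).
  exact: derive_cst.
move: E2; rewrite E3 (dDVm_J _ Ux) (dV_J _ Ux) mulJJ mulNmx linearN /=.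
have oppE (A : 'M[R]_1) : (- A) 0 0 = - A 0 0 by rewrite mxE.
rewrite oppE => /esym /aux1 E4.
have := ricci_kahler kc Ux (ricci_herm (V x) u Ux) => /aux2 <-.
rewrite E1; exact: E4.
Qed.

Lemma d_normgrad x u : U x -> 'D_u (normgrad g f) x = 2 * bil (H x) u (V x).
Proof.
move=> Ux; rewrite (hessian_Nab kc Ux _ _ sf) /Nab bilDl.
have -> : 'D_u (normgrad g f) x = dM (fun y => V y *m g y *m (V y)^T) x u 0 0 by rewrite dME.
rewrite (dM_mul oU Ux _ (smx_mul oU sV gs) (smx_tr oU sV)) (dM_mul oU Ux _ sV gs).
have addE (A B : 'M[R]_1) : (A + B) 0 0 = A 0 0 + B 0 0 by rewrite mxE.
rewrite mulmxDl !addE dM_tr -!/(bil _ _ _).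
rewrite T3_dM (Gam_compat kc Ux).
rewrite !(bil_gC kc Ux (V x)).
by move: (bil (g x) (dM V x u) (V x)) (bil (g x) (Gam g x u (V x)) (V x)) => a b; ring.
Qed.

(** By [d_lap] and [d_normgrad] the derivative is [g] minus twice the sum of Ricci curvature and
    Hessian, evaluated at the gradient and [u]. With [scal_lap] this is Hamilton's identity in a
    chart. *)
Lemma d_invariant x u : U x -> 'D_u (fun y => f y + lap g f y - normgrad g f y) x = 0.
Proof.
move=> Ux.
have sl := smooth_lap kc sf.
have sn : smooth U (normgrad g f) by exact: (smx_mul oU (smx_mul oU sV gs) (smx_tr oU sV) 0 0).
have df : derivable f x u by exact: smooth_derivable oU sf Ux.
have dl : derivable (lap g f) x u by exact: smooth_derivable oU sl Ux.
have dn : derivable (normgrad g f) x u by exact: smooth_derivable oU sn Ux.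
rewrite (_ : (fun y => _) = f + lap g f - normgrad g f)//.
rewrite deriveB//; last exact: derivableD.
rewrite deriveD// (d_lap _ Ux) (d_normgrad _ Ux) -(bil_gradV kc Ux _ sf).
have -> : bil (H x) u (V x) = bil (H x) (V x) u.
  by rewrite -bilT (hessian_sym kc Ux sf).
have := congr1 (fun A => bil A (V x) u) (sc_eq sc Ux).
rewrite /= bilDm bilZm.
move: (bil (g x) _ _) (bil (H x) _ _) (bil (coord_ricci g x) _ _) => a b c.
lra.
Qed.

Lemma scal_lap x : U x -> coord_scal g x = n%:R / 2 - lap g f x.
Proof.
move=> Ux; rewrite -(tr_hessian kc Ux sf) /coord_scal.
have -> : coord_ricci g x = 2^-1 *: g x - H x by rewrite -(sc_eq sc Ux) addrK.
rewrite mulmxBr linearB /= -scalemxAr mulVmx ?(kc_unit kc)// linearZ /= mxtrace1.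
by rewrite mulrC.
Qed.
End SolitonChart.

(** * The Bochner formula *)

Section Bochner.
Variables (R : realType) (m : nat).
Local Notation n := (m + m)%N.
Local Notation J := (Jstd R m).
Variables (U : set 'rV[R]_n) (g : 'rV[R]_n -> 'M[R]_n) (f : 'rV[R]_n -> R).
Hypothesis sc : soliton_chart U g f.
Let kc := sc_kc sc.
Let sf := sc_f sc.
Let oU := kc_open kc.
Let gs : smx U g := kc_smooth kc.
Implicit Types (h : 'rV[R]_n -> R) (x y u v w b c e X : 'rV[R]_n).
Local Notation V := (gradV g f).
Local Notation H := (coord_hessian g f).
Local Notation Gi := (ginv g).
Let sV : smx U V := smx_gradV kc sf.
Let sGi : smx U Gi := smx_ginv kc.
Let sG : smx U (gradm f) := smx_gradm oU sf.
Let sD : smx U (D2 f) := smx_D2 oU sf.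

Let addE (A B : 'M[R]_1) : (A + B) 0 0 = A 0 0 + B 0 0.
Proof. by rewrite mxE. Qed.

Lemma smooth_normgrad : smooth U (normgrad g f).
Proof. exact: (smx_mul oU (smx_mul oU sV gs) (smx_tr oU sV) 0 0). Qed.

Lemma bil_dD2 x u v w : U x -> bil (dM (D2 f) x u) v w = 'D_u ('D_v ('D_w f)) x.
Proof.
move=> Ux; rewrite -(derive_ext u oU Ux (fun y Uy => bil_D2 oU v w Uy sf)).
have s1 : smx U (fun y => v *m D2 f y) by exact: smx_mul (smx_const U v) sD.
have E : 'D_u (fun y => bil (D2 f y) v w) x = dM (fun y => v *m D2 f y *m w^T) x u 0 0.
  by rewrite dME.
rewrite E (dM_mul oU Ux u s1 (smx_const U _)) dM_const mulmx0 addr0.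
by rewrite (dM_mul oU Ux u (smx_const U v) sD) dM_const mul0mx add0r.
Qed.

Lemma bil_dD2_sym x u v w : U x -> bil (dM (D2 f) x u) v w = bil (dM (D2 f) x w) u v.
Proof.
move=> Ux.
have sv := smooth_dir v oU sf.
have E1 := derive_ext u oU Ux (fun y Uy => Schwarz v w oU sf Uy).
exact: etrans (bil_dD2 u v w Ux) (etrans E1 (etrans (Schwarz u w oU sv Ux) (esym (bil_dD2 w u v Ux)))).
Qed.

Lemma normgradE y : U y -> normgrad g f y = (V y *m (gradm f y)^T) 0 0.
Proof.
move=> Uy; have E : V y *m (gradm f y)^T = (V y *m g y *m (V y)^T)^T.
  by rewrite [RHS]trmx_mul trmxK (gradV_g kc Uy).
by rewrite E mxE.
Qed.

Lemma bil_D2_normgrad x u v : U x -> bil (D2 (normgrad g f) x) u v =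
  (dM (fun y => dM V y v) x u *m (gradm f x)^T) 0 0
  + bil (DVm g f x *m D2 f x) v u + bil (DVm g f x *m D2 f x) u v
  + bil (dM (D2 f) x (V x)) u v.
Proof.
move=> Ux; rewrite (bil_D2 oU u v Ux smooth_normgrad).
pose S' y := dM V y v *m (gradm f y)^T + V y *m (v *m D2 f y)^T.
have E1 y : U y -> 'D_v (normgrad g f) y = S' y 0 0.
  move=> Uy; have E2 := derive_ext v oU Uy normgradE.
  have E3 := dME (fun y => V y *m (gradm f y)^T) y v 0 0.
  have E4 := dM_mul oU Uy v sV (smx_tr oU sG).
  rewrite dM_tr (dM_gradm oU v Uy sf) in E4.
  by rewrite E2 -E3 E4.
have E2 := derive_ext u oU Ux E1.
have s1 := smx_dM oU v sV.
have s2 : smx U (fun y => v *m D2 f y) by exact: smx_mul (smx_const U v) sD.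
have E3 : dM S' x u = dM (fun y => dM V y v) x u *m (gradm f x)^T + dM V x v *m (u *m D2 f x)^T
   + (dM V x u *m (v *m D2 f x)^T + V x *m (v *m dM (D2 f) x u)^T).
  have F1 := dM_add oU Ux u (smx_mul oU s1 (smx_tr oU sG)) (smx_mul oU sV (smx_tr oU s2)).
  have F2 := dM_mul oU Ux u s1 (smx_tr oU sG).
  have F3 := dM_mul oU Ux u sV (smx_tr oU s2).
  have F4 := dM_mul oU Ux u (smx_const U v) sD.
  rewrite dM_const mul0mx add0r in F4.
  rewrite dM_tr (dM_gradm oU u Ux sf) in F2.
  rewrite dM_tr F4 in F3.
  by rewrite F1 F2 F3.
have E4 := dME S' x u 0 0.
rewrite E2 -E4 E3 !addE.
have D2T := D2_sym oU Ux sf.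
have G (w z : 'rV[R]_n) : (dM V x w *m (z *m D2 f x)^T) 0 0 = bil (DVm g f x *m D2 f x) w z.
  by rewrite (DVm_row kc Ux w sf) trmx_mul D2T /bil !mulmxA.
have L : (V x *m (v *m dM (D2 f) x u)^T) 0 0 = bil (dM (D2 f) x (V x)) u v.
  rewrite -(bil_dD2_sym u v (V x) Ux) /bil.
  have -> : v *m dM (D2 f) x u *m (V x)^T = (V x *m (v *m dM (D2 f) x u)^T)^T.
    by rewrite [RHS]trmx_mul trmxK.
  by rewrite [RHS]mxE.
have calc (a b b' c c' d d' : R) : b = b' -> c = c' -> d = d' -> a + b + (c + d) = a + b' + c' + d'.
  by move=> -> -> ->; rewrite addrA.
exact: (calc _ _ _ _ _ _ _ (G v u) (G u v) L).
Qed.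

Lemma tr_anti x (A : 'M[R]_n) : U x -> J *m A *m J^T = - A -> \tr (Gi x *m A) = 0.
Proof.
move=> Ux HA; have := tr_ginv_J kc Ux A; rewrite HA mulmxN linearN /=.
move: (\tr _) => t; lra.
Qed.

(** The usual Ricci term is hidden in the coefficient 1, instead of 2, of the derivative of
    [lap g f], since by [d_lap] the Ricci curvature at the gradient is minus half that derivative.
    The computation discards every matrix that changes sign under conjugation by [J], as its trace
    vanishes. *)
Lemma bochner x : U x -> lap g (normgrad g f) x =
  'D_(V x) (lap g f) x + 2 * \tr (Gi x *m H x *m (Gi x *m H x)).
Proof.
move=> Ux.
pose A1 := DVm g f x *m D2 f x; pose Tm := dM (D2 f) x (V x).
(* What is left of the second derivatives of the squared gradient are second derivatives of [V],
   which change sign under [J] by [ddV_J]. *)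
pose Am := D2 (normgrad g f) x - (A1^T + A1 + Tm).
have E0 : \tr (Gi x *m Am) = 0.
  have Ea u v : bil Am u v = (dM (fun y => dM V y v) x u *m (gradm f x)^T) 0 0.
    rewrite /Am bilDm -scaleN1r bilZm (bil_D2_normgrad u v Ux) !bilDm bilT.
    rewrite -/A1 -/Tm.
    by move: (bil A1 u v) (bil A1 v u) (bil Tm u v) ((_ *m _) 0 0) => a b c d; ring.
  apply: (tr_anti Ux); apply: bil_eq => u v.
  rewrite bil_mulr bil_mull Ea -scaleN1r bilZm Ea (ddV_J sc v u Ux) mulNmx mulN1r.
  by rewrite mxE.
have E1 : lap g (normgrad g f) x = \tr (Gi x *m A1^T) + \tr (Gi x *m A1) + \tr (Gi x *m Tm).
  have trE (a b c d : 'M[R]_n) : \tr (Gi x *m (a - (b + c + d))) = 0 ->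
      \tr (Gi x *m a) = \tr (Gi x *m b) + \tr (Gi x *m c) + \tr (Gi x *m d).
    rewrite mulmxBr !mulmxDr => h; rewrite -!mxtraceD; apply/eqP; rewrite -subr_eq0 -raddfB.
    by apply/eqP.
  exact: trE E0.
have E2 : 'D_(V x) (lap g f) x = \tr (- (Gi x *m dM g x (V x) *m Gi x) *m D2 f x) + \tr (Gi x *m Tm).
  have F1 := derive_tr oU Ux (V x) (smx_mul oU sGi sD).
  have F2 := dM_mul oU Ux (V x) sGi sD.
  rewrite F2 linearD /= (dM_ginv kc _ Ux) in F1.
  exact: F1.
have giT : (Gi x)^T = Gi x := ginv_sym kc Ux.
have D2T := D2_sym oU Ux sf.
have E3 : \tr (Gi x *m A1^T) = \tr (Gi x *m A1).
  by rewrite -mxtrace_tr trmx_mul trmxK giT mxtrace_mulC.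
have ug := kc_unit kc Ux.
pose C := CM g x (V x).
have E4 : A1 = H x *m Gi x *m D2 f x - C *m D2 f x.
  rewrite /A1 -mulmxBl; congr (_ *m _).
  by have := Nmx_DVm kc Ux sf; rewrite /Nmx => ->; rewrite addrK.
have E5 : \tr (Gi x *m dM g x (V x) *m Gi x *m D2 f x) = 2 * \tr (Gi x *m (C *m D2 f x)).
  rewrite (dM_g kc _ Ux) -/C mulmxDr !mulmxA mulVmx// mul1mx !mulmxDl linearD /=.
  rewrite -[Gi x *m C *m g x *m _]mulmxA mulmxV// mulmx1.
  have -> : \tr (C^T *m Gi x *m D2 f x) = \tr (Gi x *m C *m D2 f x).
    by rewrite -[LHS]mxtrace_tr !trmx_mul trmxK giT D2T mxtrace_mulC.
  by rewrite mulr_natl mulr2n.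
have E6 : \tr (Gi x *m (H x *m Gi x *m D2 f x)) = \tr (Gi x *m H x *m (Gi x *m H x)).
  pose Q := D2 f x - H x.
  have QJ : J *m Q *m J^T = - Q.
    apply: bil_eq => u v; rewrite bil_mulr bil_mull /Q.
    have E a b : bil (D2 f x - H x) a b = 'D_(Gam g x a b) f x.
      rewrite bilDm -scaleN1r bilZm (bil_hessian kc Ux a b sf) (bil_D2 oU a b Ux sf).
      by rewrite mulN1r opprB addrCA subrr addr0.
    rewrite E -scaleN1r bilZm E (Gam_JJ kc Ux) -scaleN1r.
    exact: (smooth_dirZ _ _ oU).
  have Q0 : \tr (Gi x *m (H x *m Gi x *m Q)) = 0.
    apply: (tr_anti Ux); rewrite -mulmxN -QJ !mulmxA (sc_J sc Ux) -[H x *m J *m Gi x]mulmxA.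
    by rewrite /ginv (ginv_J kc Ux) !mulmxA.
  move: Q0; rewrite /Q mulmxBr mulmxBr linearB /= => /eqP; rewrite subr_eq0 => /eqP ->.
  by rewrite !mulmxA.
have E7 : \tr (Gi x *m A1) = \tr (Gi x *m H x *m (Gi x *m H x)) - \tr (Gi x *m (C *m D2 f x)).
  by rewrite E4 mulmxBr linearB /= E6.
rewrite E1 E3 E7; apply: etrans; last first.
  by apply: (f_equal2 +%R); [exact: esym E2|exact: erefl].
rewrite mulNmx linearN /= E5.
move: (\tr (Gi x *m H x *m _)) (\tr (Gi x *m (C *m _))) (\tr (Gi x *m Tm)) => a b c.
ring.
Qed.
End Bochner.

Section Traces.
Variable R : realType.

Lemma sum_sqr_le (k : nat) (a : 'I_k -> R) : (\sum_i a i) ^+ 2 <= k%:R * \sum_i a i ^+ 2.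
Proof.
case: k a => [|k] a; first by rewrite !big_ord0 expr2 !mulr0.
set s := \sum_i a i; set q := \sum_i a i ^+ 2.
have : 0 <= \sum_i (k.+1%:R * a i - s) ^+ 2 by apply: sumr_ge0 => i _; exact: sqr_ge0.
have -> : \sum_i (k.+1%:R * a i - s) ^+ 2 = k.+1%:R * (k.+1%:R * q - s ^+ 2).
  have E i : (k.+1%:R * a i - s) ^+ 2 = k.+1%:R ^+ 2 * a i ^+ 2 - (2 * k.+1%:R * s) * a i + s ^+ 2 by ring.
  rewrite (eq_bigr _ (fun i _ => E i)) big_split sumrB /= -!mulr_sumr -/q -/s sumr_const card_ord.
  rewrite -[s *+ _]mulr_natl; move: (k.+1%:R) => K; ring.
by rewrite pmulr_rge0 ?ltr0n// subr_ge0.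
Qed.

(** The frame [E] conjugates [G *m H] to a symmetric matrix [B]. The trace of its square dominates
    the sum of the squared diagonal entries, to which the Cauchy-Schwarz inequality applies. *)
Lemma tr_sqr_ge (k : nat) (G H E : 'M[R]_k) : E^T *m E = G -> H^T = H ->
  \tr (G *m H) ^+ 2 <= k%:R * \tr (G *m H *m (G *m H)).
Proof.
move=> <- HT; pose B := E *m H *m E^T.
have BT : B^T = B by rewrite /B !trmx_mul trmxK HT mulmxA.
have -> : \tr (E^T *m E *m H) = \tr B by rewrite -!mulmxA mxtrace_mulC.
have -> : \tr (E^T *m E *m H *m (E^T *m E *m H)) = \tr (B *m B).
  by rewrite -!mulmxA mxtrace_mulC !mulmxA.
apply: le_trans (sum_sqr_le _) _; rewrite ler_wpM2l// /mxtrace; apply: ler_sum => i _.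
have -> : (B *m B) i i = \sum_j B i j ^+ 2.
  rewrite [LHS]mxE; apply: eq_bigr => j _.
  by have := congr1 (fun M : 'M[R]_k => M i j) BT; rewrite /= [LHS]mxE => ->; rewrite expr2.
by rewrite (bigD1 i)//= lerDl; apply: sumr_ge0 => j _; exact: sqr_ge0.
Qed.

Lemma tr_frame (k : nat) (E A : 'M[R]_k) : \tr (E^T *m E *m A) = \sum_i bil A (row i E) (row i E).
Proof.
rewrite -mulmxA mxtrace_mulC /mxtrace; apply: eq_bigr => i _.
by rewrite /bil -row_mul !mxE; apply: eq_bigr => j _; rewrite !mxE.
Qed.

Lemma frame_gram (k : nat) (A E : 'M[R]_k) : E *m A *m E^T = 1%:M -> E^T *m E = invmx A.
Proof.
move=> H; have uA : A \in unitmx.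
  have : \det (E *m A *m E^T) = 1 by rewrite H det1.
  rewrite !det_mulmx unitmxE unitfE => h; apply: contra_eq_neq h => ->.
  by rewrite mulr0 mul0r eq_sym oner_eq0.
have H2 : A *m E^T *m E = 1%:M by apply: mulmx1C; rewrite mulmxA.
by rewrite -[LHS]mul1mx -(mulVmx uA) -mulmxA [X in _ *m X]mulmxA H2 mulmx1.
Qed.
End Traces.

Lemma derive_scale (R : realType) (d : nat) (U : set 'rV[R]_d) x (A : 'rV[R]_d -> R) : open U -> U x ->
  forall (c : R) u, smooth U A -> ('D_u (fun y => c * A y) x : R) = c * ('D_u A x : R).
Proof.
move=> oU Ux c u sA.
exact: (@deriveZ R _ _ A c x u (smooth_derivable (v := u) oU sA Ux)).
Qed.

(** * Second derivatives of the metric and the Ricci trace *)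

Section Curvature.
Variables (R : realType) (m : nat).
Local Notation n := (m + m)%N.
Local Notation J := (Jstd R m).
Variables (U : set 'rV[R]_n) (g : 'rV[R]_n -> 'M[R]_n).
Hypothesis kc : kahler_chart U g.
Let oU := kc_open kc.
Let gs : smx U g := kc_smooth kc.
Implicit Types (x y u v w b c e X : 'rV[R]_n).
Local Notation Gi := (ginv g).
Let sGi : smx U Gi := smx_ginv kc.

Definition d2g x a b : 'M[R]_n := dM (fun y => dM g y b) x a.

Lemma d2g_sym x a b : U x -> d2g x a b = d2g x b a.
Proof. by move=> Ux; exact: (dM_Schwarz oU b a Ux gs). Qed.

Lemma bil_d2g x a b c e : U x -> bil (d2g x a b) c e = 'D_a (fun y => T3 g y b c e) x.
Proof.
move=> Ux; have s1 := smx_dM oU b gs.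
have s2 : smx U (fun y => c *m dM g y b) by exact: smx_mul (smx_const U c) s1.
have F1 := dM_mul oU Ux a s2 (smx_const U e^T); rewrite dM_const mulmx0 addr0 in F1.
have F2 := dM_mul oU Ux a (smx_const U c) s1; rewrite dM_const mul0mx add0r in F2.
rewrite F2 in F1; rewrite /bil -F1; exact: dME.
Qed.

Lemma d2g_mx_sym x a b : U x -> (d2g x a b)^T = d2g x a b.
Proof.
move=> Ux; apply: bil_eq => c e; rewrite bilT.
have E1 := bil_d2g a b e c Ux; have E2 := bil_d2g a b c e Ux.
exact: etrans E1 (etrans (derive_ext a oU Ux (fun y Uy => T3sym kc Uy b e c)) (esym E2)).
Qed.

Lemma d2g_cross x w e u X : U x ->
  bil (d2g x w e) u X + bil (d2g x w (e *m J)) u (X *m J) =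
  bil (d2g x w u) e X + bil (d2g x w (u *m J)) e (X *m J).
Proof.
move=> Ux.
have sT b c z : smooth U (fun y => T3 g y b c z).
  have := smooth_bil kc c z (smx_dM oU b gs); apply: (smooth_ext oU) => y Uy.
  exact: T3_dM.
have E1 := derive_add oU Ux w (sT e u X) (sT (e *m J) u (X *m J)).
have E2 := derive_add oU Ux w (sT u e X) (sT (u *m J) e (X *m J)).
have E3 := derive_ext w oU Ux (fun y Uy => cross_term_sym (T3sym kc Uy)
   (@T3N2 R m g y) (T3herm kc Uy) (T3closed kc Uy) e u X).
have calc (a b c d a' b' c' d' p q : R) : a = a' -> b = b' -> c = c' -> d = d' ->
  p = a' + b' -> q = c' + d' -> p = q -> a + b = c + d by move=> -> -> -> -> <- <-.
exact: (calc _ _ _ _ _ _ _ _ _ _ (bil_d2g w e u X Ux) (bil_d2g w (e *m J) u (X *m J) Ux)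
  (bil_d2g w u e X Ux) (bil_d2g w (u *m J) e (X *m J) Ux) E1 E2 E3).
Qed.

Lemma d2g_null x a b u : U x -> bil (d2g x a b) u (u *m J) = 0.
Proof.
move=> Ux; rewrite (bil_d2g a b u (u *m J) Ux).
have E y : U y -> T3 g y b u (u *m J) = 0.
  move=> Uy; have H := T3herm kc Uy b u (u *m J).
  rewrite mulJJ (T3sym kc Uy) T3N2 in H.
  by move: H; move: (T3 g y b u (u *m J)) => t; lra.
rewrite (derive_ext a oU Ux E); exact: derive_cst.
Qed.

(** In terms of a local Kaehler potential both sides are the same mixed fourth derivative. No
    potential is constructed: the derivative of the first-order cross identity is used for four
    choices of vectors, and the terms pairing [u] with [J u] vanish. *)
Lemma d2g_swap x e u : U x ->
  bil (d2g x e e) u u + bil (d2g x (e *m J) (e *m J)) u u =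
  bil (d2g x u u) e e + bil (d2g x (u *m J) (u *m J)) e e.
Proof.
move=> Ux.
have drop (a b c : R) : a + b = c -> b = 0 -> a = c by move=> <- ->; rewrite addr0.
have F e' u' := drop _ _ _ (d2g_cross e' e' u' u' Ux) (d2g_null e' (e' *m J) u' Ux).
have H1 := F e u; have H2 := F (e *m J) u; have H3 := F u e; have H4 := F (u *m J) e.
have swM (A B : 'M[R]_n) c z : A^T = A -> A = B -> bil A c z = bil B z c by move=> AT <-; rewrite -bilT AT.
have sw a b c z : bil (d2g x a b) c z = bil (d2g x b a) z c.
  by apply: swM; [exact: d2g_mx_sym|exact: d2g_sym].
have calc (a b c d p q r s p' q' r' s' : R) : a = p + q -> b = r + s -> c = p' + r' -> d = q' + s' ->
  p = p' -> q = q' -> r = r' -> s = s' -> a + b = c + d by move=> -> -> -> -> -> -> -> ->; ring.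
exact: (calc _ _ _ _ _ _ _ _ _ _ _ _ H1 H2 H3 H4 (sw _ _ _ _) (sw _ _ _ _) (sw _ _ _ _) (sw _ _ _ _)).
Qed.

(** Up to normalization, the holomorphic bisectional curvature of [u] with the argument. [bil_Zc]
    gives the form met in the second variation, with the second derivatives taken along [e] and
    [J e]; here [d2g_swap] has moved them to [u] and [J u], so that the trace is computable. *)
Definition Zc x u : 'M[R]_n :=
  CM g x u *m g x *m (CM g x u)^T - 4^-1 *: (d2g x u u + d2g x (u *m J) (u *m J)).

Lemma bil_Zc x u e : U x -> bil (Zc x u) e e = bil (g x) (Gam g x u e) (Gam g x u e)
  - 4^-1 * (bil (d2g x e e) u u + bil (d2g x (e *m J) (e *m J)) u u).
Proof.
move=> Ux; rewrite (d2g_swap e u Ux) /Zc bilDm -scaleN1r scalerA bilZm mulN1r mulNr bilDm.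
by rewrite bil_mulr bil_mull.
Qed.

Lemma tr_CM x w : U x -> \tr (CM g x w) = 2^-1 * \tr (Gi x *m dM g x w).
Proof.
move=> Ux; rewrite (dM_g kc w Ux) mulmxDr linearD /= mulmxA mxtrace_mulC mulmxA.
rewrite mulmxV ?(kc_unit kc)// mul1mx mulmxA mulVmx ?(kc_unit kc)// mul1mx mxtrace_tr.
by move: (\tr _) => t; field.
Qed.

Lemma d_lamc x w : U x -> (w *m dM (lamc g) x w) 0 0 =
  2^-1 * (\tr (Gi x *m d2g x w w) - \tr (Gi x *m dM g x w *m (Gi x *m dM g x w))).
Proof.
move=> Ux; have s1 := smx_dM oU w gs.
have F1 := dM_mul oU Ux w (smx_const U w) (smx_lamc kc); rewrite dM_const mul0mx add0r in F1.
have F2 := dME (fun y => w *m lamc g y) x w 0 0; rewrite F1 in F2.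
have E y : U y -> (w *m lamc g y) 0 0 = 2^-1 * \tr (Gi y *m dM g y w).
  by move=> Uy; rewrite lamE (tr_CM _ Uy).
have F3 := derive_ext w oU Ux E.
have s2 := smx_mul oU sGi s1.
have F4 := etrans (derive_scale oU Ux 2^-1 w (smooth_tr oU s2)) (congr1 (fun t : R => 2^-1 * t) (derive_tr oU Ux w s2)).
have F5 := dM_mul oU Ux w sGi s1; rewrite (dM_ginv kc w Ux) in F5.
rewrite F5 in F4; apply: etrans F2 (etrans F3 (etrans F4 _)).
congr (_ * _); rewrite linearD /= mulNmx linearN /= addrC -/(d2g x w w).
by rewrite !mulmxA.
Qed.

(** [d_lamc] rewrites the formula of [ricci_kahler] in terms of the metric. The traces of the
    squared connection matrices for [u] and [J u] are opposite and cancel; what remains is the trace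
    of [Zc]. *)
Lemma tr_Zc x u : U x -> bil (coord_ricci g x) (u *m J) (u *m J) = bil (coord_ricci g x) u u ->
  \tr (Gi x *m Zc x u) = bil (coord_ricci g x) u u.
Proof.
move=> Ux Hr; have := ricci_kahler kc Ux Hr.
have La := d_lamc u Ux; have Lb := d_lamc (u *m J) Ux.
rewrite (dM_g kc u Ux) in La; rewrite (dM_g kc (u *m J) Ux) (CM_Jl kc Ux) in Lb.
have calc (r a b a' b' : R) : a = a' -> b = b' -> 2 * r = - (a + b) -> 2 * r = - (a' + b') by move=> -> ->.
move=> /(calc _ _ _ _ _ La Lb) {La Lb}.
set C := CM g x u.
have ug := kc_unit kc Ux; have gJ := kc_J kc Ux; have CJ : J *m C = C *m J := CM_J kc Ux u.
have E D : \tr (Gi x *m (D *m g x + g x *m D^T) *m (Gi x *m (D *m g x + g x *m D^T))) =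
   2 * \tr (D *m D) + 2 * \tr (Gi x *m (D *m g x *m D^T)).
  rewrite mulmxDr mulmxA (mulmxA (Gi x) (g x)) mulVmx// mul1mx.
  rewrite mulmxDr !mulmxDl !linearD /=.
  have -> : \tr (Gi x *m D *m g x *m (Gi x *m D *m g x)) = \tr (D *m D).
    rewrite !mulmxA -[Gi x *m D *m g x *m Gi x]mulmxA mulmxV// mulmx1 mxtrace_mulC !mulmxA.
    by rewrite mulmxV// mul1mx.
  have -> : \tr (D^T *m D^T) = \tr (D *m D) by rewrite -trmx_mul mxtrace_tr.
  rewrite [\tr (D^T *m _)]mxtrace_mulC !mulmxA.
  by move: (\tr _) (\tr _) => a b; ring.
rewrite !E.
have -> : \tr (C *m J *m (C *m J)) = - \tr (C *m C).
  by rewrite -mulmxA (mulmxA J) CJ -mulmxA JstdJ !mulmxN mulmx1 linearN.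
have -> : C *m J *m g x *m (C *m J)^T = C *m g x *m C^T.
  rewrite trmx_mul JstdT -[C *m J *m _]mulmxA gJ !mulmxA mulmxN mulNmx.
  by rewrite -[_ *m J *m J]mulmxA JstdJ mulmxN mulmx1 mulNmx opprK.
rewrite /Zc -/C mulmxBr linearB /= -scalemxAr linearZ /= mulmxDr mxtraceD.
have aux (a b c d r : R) : 2 * r = - (2^-1 * (a - (2 * c + 2 * d)) + 2^-1 * (b - (2 * - c + 2 * d))) ->
  d - 4^-1 * (a + b) = r by lra.
exact: aux.
Qed.
End Curvature.

(** * Curves, charts and the distance *)

Transparent derive.

Section RowFunctions.
Variables (R : realType).

Lemma continuous_norm (V W : normedModType R) (f : V -> W) x :
  (forall e : R, 0 < e -> exists2 r : R, 0 < r & forall y, `|y - x| < r -> `|f y - f x| <= e) ->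
  {for x, continuous f}.
Proof.
move=> H; apply/cvgrPdist_le => e /H[r r0 {}H]; apply/nbhs_norm_ex; exists r => // y /H.
by rewrite distrC.
Qed.

Lemma row_diff (d k : nat) (U : set 'rV[R]_d) (F : 'rV[R]_d -> 'rV[R]_k) x : open U -> U x ->
  (forall j, smooth U (fun y => F y 0 j)) ->
  differentiable F x /\
  'd F x = (fun v => v *m \matrix_(i, j) partial i (fun y => F y 0 j) x) :> ('rV[R]_d -> 'rV[R]_k).
Proof.
move=> oU Ux sF; set A := \matrix_(i, j) _.
have mulc : continuous (mulmxr A : 'rV[R]_d -> 'rV[R]_k).
  move=> v; apply: (@continuous_norm 'rV[R]_d 'rV[R]_k) => e e0.
  pose C := \sum_i \sum_j `|A i j|.
  have C0 : 0 <= C by apply: sumr_ge0 => i _; apply: sumr_ge0.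
  have C1 : 0 < C + 1 by lra.
  exists (e / (C + 1)); first by rewrite divr_gt0.
  move=> w wv; rewrite /= -mulmxBl; apply: normv_le => [|j]; first exact: ltW.
  rewrite mxE; apply: le_trans (ler_norm_sum _ _ _) _.
  apply: (@le_trans _ _ (\sum_i `|w - v| * `|A i j|)).
    by apply: ler_sum => i _; rewrite normrM ler_wpM2r// normv_coord.
  rewrite -mulr_sumr; apply: (@le_trans _ _ (e / (C + 1) * C)).
    apply: ler_pM => //; [exact: sumr_ge0|exact: ltW|].
    rewrite /C; apply: ler_sum => i _; rewrite (bigD1 j)//= lerDl; exact: sumr_ge0.
  by rewrite mulrAC ler_pdivrMr// ler_wpM2l ?ltW// ltrDl.
apply: (@differentiable_epsilon R _ _ F (mulmxr A)) => // e e0.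
have H j : exists2 r : R, 0 < r & forall v : 'rV[R]_d, `|v| < r ->
    `|F (v + x) 0 j - F x 0 j - (v *m A) 0 j| <= e * `|v|.
  have [r0 [C K]] := smooth_controlled oU (sF j) Ux.
  exists (Num.min r0 (e / (C + 1))).
    by rewrite lt_min (ctrl_r K) divr_gt0// ltr_wpDl ?(ctrl_C K).
  move=> v; rewrite lt_min => /andP[vr ve].
  have x0 : `|x - x| < r0 by rewrite subrr normr0 (ctrl_r K).
  have xv : `|x + v - x| < r0 by rewrite addrAC subrr add0r.
  have := taylor_2 K x0 xv; rewrite (smoothDE _ oU (sF j) Ux) (addrC x v).
  have -> : (v *m A) 0 j = \sum_i v 0 i * partial i (fun y => F y 0 j) x.
    by rewrite mxE; apply: eq_bigr => i _; rewrite mxE.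
  move=> /le_trans; apply; rewrite expr2 mulrA ler_wpM2r//.
  have C1 : 0 < C + 1 by rewrite ltr_wpDl ?(ctrl_C K).
  have : `|v| * (C + 1) <= e by rewrite -ler_pdivlMr// ltW.
  apply: le_trans; rewrite mulrC ler_wpM2l// ler_wpDr//.
have [r rP] := choice (fun j => let: ex_intro2 r r0 h := H j in ex_intro _ r (conj r0 h)).
exists (\big[Num.min/1]_j r j).
  by elim/big_ind: _ => // [a b a0 b0|j _]; [rewrite lt_min a0|exact: (rP j).1].
move=> v vr; apply: normv_le => [|j]; first exact: mulr_ge0 (ltW e0) (normr_ge0 _).
have -> : (F (v + x) - F x - mulmxr A v) 0 j = F (v + x) 0 j - F x 0 j - (v *m A) 0 j.
  by rewrite !mxE.
apply: (rP j).2; apply: lt_le_trans vr _.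
exact: bigmin_le.
Qed.

Lemma curve_chain (d k : nat) (U : set 'rV[R]_d) (F : 'rV[R]_d -> 'rV[R]_k) (c : R -> 'rV[R]_d) (t : R) :
  open U -> U (c t) -> (forall j, smooth U (fun y => F y 0 j)) -> derivable c t (1 : R) ->
  derivable (F \o c) t (1 : R) /\
  derive1 (F \o c) t = derive1 c t *m \matrix_(i, j) partial i (fun y => F y 0 j) (c t).
Proof.
move=> oU Uc sF dc; have [dF eF] := row_diff oU Uc sF.
have dc' : differentiable c t by apply/derivable1_diffP.
split; first by apply/derivable1_diffP; exact: differentiable_comp.
rewrite !derive1E'//; last exact: differentiable_comp.
by rewrite diff_comp// /= eF.
Qed.

Lemma curve_chain_scalar (d : nat) (U : set 'rV[R]_d) (h : 'rV[R]_d -> R) (c : R -> 'rV[R]_d) (t : R) :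
  open U -> U (c t) -> smooth U h -> derivable c t (1 : R) ->
  is_derive t (1 : R) (h \o c) ('D_(derive1 c t) h (c t)).
Proof.
move=> oU Uc sh dc; have dh := smooth_diff oU sh Uc.
have dc' : differentiable c t by apply/derivable1_diffP.
have dhc : differentiable (h \o c) t by exact: differentiable_comp.
split; first by apply/derivable1_diffP.
have E1 := deriveE (1 : R) dhc.
have E2 := diff_comp dc' dh.
have E3 := deriveE (derive1 c t) dh.
have E4 := derive1E' dc'.
apply: (etrans E1); apply: (etrans _ (esym E3)).
by rewrite E2 E4.
Qed.
End RowFunctions.

Section Charts.
Variables (R : realType) (m : nat) (M : kahlerManifold R m).
Local Notation n := (m + m)%N.
Local Notation J := (Jstd R m).
Implicit Types (i j : chart_idx M) (p q : M) (x y v w : 'rV[R]_n).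

Definition im i : set 'rV[R]_n := coord i @` dom i.
Lemma im_open i : open (im i). Proof. exact: coord_open. Qed.
Lemma im_coord i p : dom i p -> im i (coord i p). Proof. by exists p. Qed.
Lemma icoord_dom i y : im i y -> dom i (icoord i y).
Proof. by move=> [p dp <-]; rewrite coordK. Qed.
Lemma coord_icoord i y : im i y -> coord i (icoord i y) = y.
Proof. by move=> [p dp <-]; rewrite coordK. Qed.

Lemma chart_kc i : kahler_chart (im i) (met i).
Proof.
split.
- exact: im_open.
- by move=> a b; exact: met_smooth.
- move=> x Ux; split; first exact: met_sym.
  by move=> v v0; exact: met_pos.
- by move=> x Ux; apply/hermitian_comm; exact: met_hermitian.
- by move=> x a b c Ux; exact: met_closed.
Qed.

Lemma chart_sc f i : gradient_shrinking_KR_soliton f ->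
  soliton_chart (im i) (met i) (fun y => f (icoord i y)).
Proof.
move=> [_ _ sf H1 H2]; split.
- exact: chart_kc.
- exact: sf.
- by move=> x Ux; exact: H1.
- by move=> x Ux; apply/hermitian_comm; exact: H2.
Qed.

Definition tran i j y := coord j (icoord i y).
Definition ov i j : set 'rV[R]_n := coord i @` (dom i `&` dom j).
Lemma ovE i j y : ov i j y <-> im i y /\ dom j (icoord i y).
Proof.
split=> [[p [di dj] <-]|[[p dp <-]]]; first by rewrite coordK//; split=> //; exists p.
by rewrite coordK// => dj; exists p.
Qed.
Lemma ov_open i j : open (ov i j).
Proof.
rewrite openE => y /ovE[Uy dy]; rewrite /interior.
have N1 : nbhs y (im i) by apply: open_nbhs_nbhs; split=> //; exact: im_open.
have N2 : nbhs y (icoord i @^-1` dom j).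
  apply: (icoord_continuous Uy); apply: open_nbhs_nbhs; split=> //; exact: dom_open.
by apply: filterS2 N1 N2 => z Uz dz; apply/ovE.
Qed.
Lemma tran_smooth i j k : smooth (ov i j) (fun y => tran i j y 0 k).
Proof. exact: transition_smooth. Qed.
Lemma tran_im i j y : ov i j y -> im j (tran i j y).
Proof. by move=> /ovE[Uy dy]; exact: im_coord. Qed.
Lemma icoord_tran i j y : ov i j y -> icoord j (tran i j y) = icoord i y.
Proof. by move=> /ovE[Uy dy]; rewrite /tran coordK. Qed.
Lemma ov_coord i j p : dom i p -> dom j p -> ov i j (coord i p).
Proof. by move=> di dj; exists p. Qed.

Definition nrm i x v : R := Num.sqrt (bil (met i x) v v).

Lemma met_tran i j y v w : ov i j y ->
  bil (met j (tran i j y)) (v *m jac (tran i j) y) (w *m jac (tran i j) y) = bil (met i y) v w.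
Proof. by move=> oy; rewrite (met_transition oy) bil_mulr bil_mull. Qed.

(** The speed is defined by a selected chart, but the metric transforms as a tensor, so any chart
    around the point may be used. *)
Lemma speed_chart (c : R -> M) (t : R) i : (\forall s \near t, dom i (c s)) ->
  derivable (coord i \o c) t (1 : R) ->
  speed c t = nrm i (coord i (c t)) (derive1 (coord i \o c) t).
Proof.
move=> nd dc; have dt := nbhs_singleton nd.
set j := chart_at (c t); have djt : dom j (c t) by exact: dom_chart_at.
have cont : {for t, continuous (coord i \o c)}.
  by apply: differentiable_continuous; apply/derivable1_diffP.
have ovt : ov i j (coord i (c t)) by exact: ov_coord.
have nov : \forall s \near t, ov i j (coord i (c s)).
  have : nbhs ((coord i \o c) t) (ov i j) by apply: open_nbhs_nbhs; split=> //; exact: ov_open.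
  by move=> /cont.
have E : \forall s \near t, (tran i j \o (coord i \o c)) s = (coord j \o c) s.
  by apply: filterS2 nd nov => s ds os; rewrite /= /tran coordK.
have [dF eF] := curve_chain (@ov_open i j) ovt (tran_smooth i j) dc.
have D : derive1 (coord j \o c) t = derive1 (coord i \o c) t *m jac (tran i j) (coord i (c t)).
  rewrite /jac -eF !derive1E; apply/esym; exact: near_eq_derive.
rewrite /speed /nrm -/j; congr Num.sqrt.
rewrite -[LHS]/(bil (met j (coord j (c t))) (derive1 (coord j \o c) t) (derive1 (coord j \o c) t)) D.
have -> : coord j (c t) = tran i j (coord i (c t)) by rewrite /tran coordK.
exact: met_tran.
Qed.
End Charts.

Opaque derive.

(** * One-variable calculus and arc length *)

Section Calculus1.
Variables (R : realType).

Lemma near3 (t : R) (P Q S T : R -> Prop) : (\forall s \near t, P s) -> (\forall s \near t, Q s) ->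
  (\forall s \near t, S s) -> (forall s, P s -> Q s -> S s -> T s) -> \forall s \near t, T s.
Proof. by move=> HP HQ HS H; apply: filterS3 HP HQ HS. Qed.
Lemma near1 (t : R) (P T : R -> Prop) : (\forall s \near t, P s) ->
  (forall s, P s -> T s) -> \forall s \near t, T s.
Proof. by move=> HP H; apply: filterS HP. Qed.

Lemma near_eq_continuous (V : topologicalType) (f g : R -> V) (t : R) : (\forall s \near t, f s = g s) ->
  {for t, continuous g} -> {for t, continuous f}.
Proof.
move=> E cg A; rewrite /= (nbhs_singleton E) => /cg h.
by apply: filterS2 E h => s /= ->.
Qed.

Lemma deriv_ge0_le (h dh : R -> R) (a b : R) : a <= b ->
  (forall t : R, a <= t <= b -> is_derive t (1 : R) h (dh t)) ->
  (forall t : R, a <= t <= b -> 0 <= dh t) -> h a <= h b.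
Proof.
move=> ab dH H0.
have [||t tab E] := MVT_segment ab (f := h) (df := dh).
- by move=> t; rewrite in_itv/= => /andP[t0 t1]; apply: dH; rewrite !ltW.
- apply: derivable_within_continuous => t; rewrite in_itv/= => tt.
  by have [] := dH t tt.
- by rewrite -subr_ge0 E mulr_ge0 ?subr_ge0// H0//; move: tab; rewrite in_itv.
Qed.

Lemma deriv_le (h G dh dG : R -> R) (a b : R) : a <= b ->
  (forall t : R, a <= t <= b -> is_derive t (1 : R) h (dh t)) ->
  (forall t : R, a <= t <= b -> is_derive t (1 : R) G (dG t)) ->
  (forall t : R, a <= t <= b -> `|dh t| <= dG t) -> `|h b - h a| <= G b - G a.
Proof.
move=> ab Hh HG H.
have H1 : (G - h) a <= (G - h) b.
  apply: (@deriv_ge0_le _ (fun t => dG t - dh t)) => // t tt.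
    by have := Hh t tt; have := HG t tt => i1 i2; exact: is_deriveB.
  by rewrite subr_ge0; apply: le_trans (H t tt); exact: ler_norm.
have H2 : (G + h) a <= (G + h) b.
  apply: (@deriv_ge0_le _ (fun t => dG t + dh t)) => // t tt.
    by have := Hh t tt; have := HG t tt => i1 i2; exact: is_deriveD.
  by have := H t tt; rewrite ler_norml => /andP[h1 _]; rewrite addrC -lerBlDr sub0r.
have {}H1 : G a - h a <= G b - h b := H1.
have {}H2 : G a + h a <= G b + h b := H2.
by rewrite ler_norml; apply/andP; split; lra.
Qed.

(** The retraction of the line onto the unit interval, written with absolute values so that its
    continuity is immediate. *)
Definition clamp01 (t : R) : R := (`|t| - `|t - 1| + 1) / 2.
Lemma clamp01_in (t : R) : 0 <= clamp01 t <= 1.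
Proof. by rewrite /clamp01; case: (ler0P t) => ?; case: (ler0P (t - 1)) => ?; apply/andP; split; lra. Qed.
Lemma clamp01_id (t : R) : 0 <= t <= 1 -> clamp01 t = t.
Proof.
by move=> /andP[t0 t1]; rewrite /clamp01 ger0_norm// ler0_norm ?subr_le0//; lra.
Qed.
Lemma clamp01_continuous : continuous clamp01.
Proof.
move=> t; apply: (@cvgM R R^o); last exact: (@cvg_cst R^o).
apply: (@cvgD R R^o); last exact: (@cvg_cst R^o).
apply: (@cvgB R R^o); first exact: (@cvg_norm R R^o).
apply: (@cvg_norm R R^o); apply: (@cvgB R R^o) => //; exact: (@cvg_cst R^o).
Qed.

(** The function is continuous only at the points of the unit interval; composed with [clamp01] it
    becomes continuous everywhere without changing there. *)
Lemma antiderivative01 (s : R -> R) : (forall t : R, 0 <= t <= 1 -> {for t, continuous s}) ->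
  exists G : R -> R, forall t : R, 0 <= t <= 1 -> is_derive t (1 : R) G (s (clamp01 t)).
Proof.
move=> cs; pose f t := s (clamp01 t).
have cf : continuous f.
  by move=> t; apply: continuous_comp; [exact: clamp01_continuous|exact/cs/clamp01_in].
exists (fun x => (\int[lebesgue_measure]_(t in `[-1, x]) f t)%R) => t /andP[t0 t1].
(* The interval from -1 to 2 contains the unit interval in its interior, so the derivatives at 0 and
   1 are two-sided. *)
have [||||D E] := @continuous_FTC1_closed R f (-1) t 2.
- lra.
- apply: continuous_compact_integrable; first exact: segment_compact.
  exact: continuous_subspaceT.
- lra.
- exact: cf.
split; first exact: D.
exact: (etrans (esym (derive1E _ _)) E).
Qed.

Lemma integral01 (s G : R -> R) : (forall t : R, 0 <= t <= 1 -> {for t, continuous s}) ->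
  (forall t : R, 0 <= t <= 1 -> is_derive t (1 : R) G (s t)) ->
  \int[lebesgue_measure]_(t in `[0, 1]) s t = G 1 - G 0.
Proof.
move=> cs dG; rewrite /Rintegral (@continuous_FTC2 _ s G 0 1).
- by rewrite -EFinB.
- lra.
- apply/continuous_within_itvP; first lra.
  split.
  + by move=> t; rewrite in_itv/= => /andP[t0 t1]; apply: cs; rewrite !ltW.
  + by apply: cvg_at_right_filter; apply: cs; rewrite lexx ler01.
  + by apply: cvg_at_left_filter; apply: cs; rewrite lexx ler01.
- have c t : 0 <= t <= 1 -> {for t, continuous G}.
    by move=> /dG[d _]; apply: differentiable_continuous; apply/derivable1_diffP.
  split.
  + by move=> t; rewrite in_itv/= => /andP[t0 t1]; have [|] := dG t; rewrite ?ltW.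
  + by apply: cvg_at_right_filter; apply: c; rewrite lexx ler01.
  + by apply: cvg_at_left_filter; apply: c; rewrite lexx ler01.
- move=> t; rewrite in_itv/= => /andP[t0 t1].
  by have [|d E] := dG t; rewrite ?ltW// derive1E E.
Qed.
End Calculus1.

Section Curves.
Variables (R : realType) (m : nat) (M : kahlerManifold R m).
Local Notation n := (m + m)%N.
Implicit Types (i j : chart_idx M) (p q : M) (x y v w : 'rV[R]_n) (c : R -> M).

Lemma entry_continuous (a b : nat) (T : topologicalType) (F : T -> 'M[R]_(a, b)) (t : T) (i : 'I_a) (j : 'I_b) :
  {for t, continuous F} -> {for t, continuous (fun s => F s i j)}.
Proof.
move=> cF; apply: (@continuous_comp _ _ _ F (fun A : 'M[R]_(a, b) => A i j)) => //.
exact: matrix_normedtype.coord_continuous.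
Qed.

Lemma nrm_continuous i (y v : R -> 'rV[R]_n) (t : R) : im i (y t) ->
  {for t, continuous y} -> {for t, continuous v} -> {for t, continuous (fun s => nrm i (y s) (v s))}.
Proof.
move=> Uy cy cv; rewrite /nrm.
apply: (@continuous_comp _ _ _ (fun s => bil (met i (y s)) (v s) (v s)) Num.sqrt); last exact: sqrt_continuous.
have -> : (fun s => bil (met i (y s)) (v s) (v s)) =
  (fun s => \sum_(ab : 'I_n * 'I_n) v s 0 ab.1 * met i (y s) ab.1 ab.2 * v s 0 ab.2).
  apply/funext => s; rewrite bilE pair_big/=; apply: eq_bigr => ab _; ring.
apply: (@cvg_big R^o _ (@GRing.add R) 0 xpredT _ R (nbhs t)).
  exact: (@pseudometric_normed_Zmodule.add_continuous R R^o).
move=> -[a b] _ /=.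
have cva := entry_continuous (i := 0) (j := a) cv.
have cvb := entry_continuous (i := 0) (j := b) cv.
have cg : {for t, continuous (fun s => met i (y s) a b)}.
  apply: (@continuous_comp _ _ _ y (fun z => met i z a b)) => //.
  exact: smooth_continuous (met_smooth i a b) Uy.
exact: (@cvgM R R^o _ _ _ _ _ _ (@cvgM R R^o _ _ _ _ _ _ cva cg) cvb).
Qed.

Lemma dom_near c (t : R) i : {for t, continuous c} -> dom i (c t) -> \forall s \near t, dom i (c s).
Proof. by move=> cc di; apply: cc; apply: open_nbhs_nbhs; split=> //; exact: dom_open. Qed.

Lemma speed_near c (t : R) i : C1_curve c -> 0 <= t <= 1 -> dom i (c t) ->
  \forall s \near t, dom i (c s) /\ derivable (coord i \o c) s (1 : R) /\
    speed c s = nrm i (coord i (c s)) (derive1 (coord i \o c) s).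
Proof.
move=> cc t01 di; have [cont /(_ i di)[nd _]] := cc t t01.
have n1 := near_join (dom_near cont di).
have n0 := dom_near cont di.
apply: (near3 n0 n1 nd) => s ds n1s dd.
by split; [exact: ds|split; [exact: dd|exact: (speed_chart n1s dd)]].
Qed.

Lemma speed_continuous c (t : R) : C1_curve c -> 0 <= t <= 1 -> {for t, continuous (speed c)}.
Proof.
move=> cc t01; set i := chart_at (c t); have di : dom i (c t) by exact: dom_chart_at.
have [cont /(_ i di)[nd cd]] := cc t t01.
have ns := speed_near cc t01 di.
apply: (@near_eq_continuous _ _ _ (fun s => nrm i (coord i (c s)) (derive1 (coord i \o c) s)) t).
  by apply: (near1 ns) => s [_ [_ ->]].
have cco : {for t, continuous (coord i \o c)} by apply: continuous_comp; [exact: cont|exact: coord_continuous].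
exact: (@nrm_continuous i (coord i \o c) (derive1 (coord i \o c)) t (im_coord di) cco cd).
Qed.

(** Arc length along the curve, up to a constant. Lengths of pieces are handled as increments of
    [G], which keeps integrals out of the later arguments. *)
Definition antider c (G : R -> R) : Prop :=
  forall t : R, 0 <= t <= 1 -> is_derive t (1 : R) G (speed c t).

Lemma antider_ex c : C1_curve c -> exists G, antider c G.
Proof.
move=> cc; have [G HG] := antiderivative01 (fun t t01 => speed_continuous cc t01).
by exists G => t t01; have := HG t t01; rewrite clamp01_id.
Qed.

Lemma antider_length c G : C1_curve c -> antider c G -> curve_length c = G 1 - G 0.
Proof. by move=> cc aG; apply: integral01 => // t; exact: speed_continuous. Qed.

Lemma speed_ge0 c (t : R) : 0 <= speed c t. Proof. exact: sqrtr_ge0. Qed.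

Lemma antider_mono c G (s t : R) : antider c G -> 0 <= s -> s <= t -> t <= 1 -> G s <= G t.
Proof.
move=> aG s0 st t1; apply: (@deriv_ge0_le R G (speed c)) => // u /andP[u0 u1].
  by apply: aG; rewrite (le_trans s0 u0) (le_trans u1 t1).
exact: speed_ge0.
Qed.

Lemma curve_length_ge0 c : C1_curve c -> 0 <= curve_length c.
Proof.
move=> cc; have [G aG] := antider_ex cc; rewrite (antider_length cc aG) subr_ge0.
exact: antider_mono aG _ ler01 _.
Qed.

Lemma derive1_affine (V : normedModType R) (F : R -> V) (a b t : R) : derivable F (a + b * t) (1 : R) ->
  derivable (fun s => F (a + b * s)) t (1 : R) /\
  derive1 (fun s => F (a + b * s)) t = b *: derive1 F (a + b * t).
Proof.
move=> dF; pose L : R -> R^o := fun s => a + b * s.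
have L1 : is_derive t (1 : R) L b.
  have h : is_derive t (1 : R) (id : R -> R^o) 1 by exact: is_derive_id.
  have := is_deriveD (is_derive_cst a t 1) (is_deriveZ b h).
  rewrite add0r => h'; apply: is_derive_eq h' _; by rewrite /GRing.scale/= mulr1.
have dL : differentiable L t by apply/derivable1_diffP; have [] := L1.
have dF' : differentiable F (L t) by apply/derivable1_diffP.
split; first by apply/derivable1_diffP; exact: (differentiable_comp dL dF').
rewrite [LHS](derive1E' (differentiable_comp dL dF')) diff_comp//=.
have -> : 'd L t (1 : R) = b by rewrite -deriveE//; have [] := L1.
by rewrite (derive1E' dF') -[in LHS](mulr1 b) -[b * 1]/(b *: (1 : R^o)) linearZ.
Qed.

Lemma affine_continuous (a b : R) : continuous (fun s : R => a + b * s).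
Proof.
move=> t; apply: (@cvgD R R^o); first exact: (@cvg_cst R^o).
by apply: (@cvgM R R^o); first exact: (@cvg_cst R^o).
Qed.

Lemma near_affine (a b t : R) (P : R -> Prop) : (\forall s \near a + b * t, P s) ->
  \forall s \near t, P (a + b * s).
Proof. by move=> /(@affine_continuous a b t). Qed.

(** The sign factor covers negative [b], that is, reversed curves, whose arc length still
    increases. *)
Lemma C1_affine c (a b : R) : C1_curve c -> (0 <= a <= 1)%R -> (0 <= a + b <= 1)%R ->
  C1_curve (fun t => c (a + b * t)) /\
  (forall G, antider c G -> antider (fun t => c (a + b * t)) (fun t => Num.sg b * G (a + b * t))).
Proof.
move=> cc a01 ab01.
have in01 (t : R) : 0 <= t <= 1 -> 0 <= a + b * t <= 1.
  move=> /andP[t0 t1]; have -> : a + b * t = (1 - t) * a + t * (a + b) by ring.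
  move: a01 ab01 => /andP[a0 a1] /andP[b0 b1]; have t1' : 0 <= 1 - t by rewrite subr_ge0.
  rewrite addr_ge0 ?mulr_ge0//=.
  have : (1 - t) * a <= (1 - t) * 1 by rewrite ler_wpM2l.
  have : t * (a + b) <= t * 1 by rewrite ler_wpM2l.
  lra.
have C : C1_curve (fun t => c (a + b * t)).
  move=> t /in01 t01; have [cont H] := cc _ t01; split.
    exact: (continuous_comp (@affine_continuous a b t) cont).
  move=> i /(H i)[nd cd].
  have nd' : \forall s \near t, derivable (coord i \o c) (a + b * s) (1 : R) by exact: (near_affine nd).
  split; first by apply: (near1 nd') => s /derive1_affine[].
  have E : \forall s \near t, derive1 (fun u => coord i (c (a + b * u))) s = b *: derive1 (coord i \o c) (a + b * s).
    by apply: (near1 nd') => s /derive1_affine[].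
  apply: (near_eq_continuous E).
  have := continuous_comp (@affine_continuous a b t) cd; exact: (@cvgZl_tmp).
split; first exact: C.
move=> G aG t t01; have t01' := in01 t t01.
set i := chart_at (c (a + b * t)); have di : dom i (c (a + b * t)) by exact: dom_chart_at.
have := nbhs_singleton (speed_near C t01 di) => -[_ [_ E1]].
have := nbhs_singleton (speed_near cc t01' di) => -[_ [d2 E2]].
have [d3 E3] := derive1_affine d2.
have E : speed (fun t => c (a + b * t)) t = `|b| * speed c (a + b * t).
  rewrite E1 E2 -[derive1 (coord i \o _) t]/(derive1 (fun s => (coord i \o c) (a + b * s)) t) E3.
  by rewrite /nrm bilZl bilZr mulrA -expr2 sqrtrM ?sqr_ge0// sqrtr_sqr.
have [dG eG] := aG _ t01'.
have [d4 E4] := derive1_affine dG.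
have d5 := @derivableZ R R R^o _ (Num.sg b) t 1 d4.
split; first exact: d5.
apply: (etrans (@deriveZ R R R^o _ (Num.sg b) t 1 d4)); rewrite -derive1E E4 derive1E eG E.
by rewrite /GRing.scale/= mulrA -normrEsg.
Qed.

Lemma affine_length c (a b : R) G : C1_curve c -> (0 <= a <= 1)%R -> (0 <= a + b <= 1)%R -> antider c G ->
  curve_length (fun t => c (a + b * t)) = Num.sg b * (G (a + b) - G a).
Proof.
move=> cc a01 ab01 aG; have [C H] := C1_affine cc a01 ab01.
by rewrite (antider_length C (H G aG)) mulr1 mulr0 addr0 mulrBr.
Qed.
End Curves.

(** * Chart balls with uniform constants *)

Section Good.
Variables (R : realType).

Lemma le_of_sqr (a b : R) : 0 <= b -> a ^+ 2 <= b ^+ 2 -> a <= b.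
Proof.
move=> b0; rewrite !leNgt; apply: contra => ba.
by rewrite ltrXn2r// ?ltW// (le_lt_trans b0 ba).
Qed.

Lemma bil_bound (d : nat) (A : 'M[R]_d) u v (B : R) : 0 <= B -> (forall a b, `|A a b| <= B) ->
  `|bil A u v| <= d%:R * d%:R * B * `|u| * `|v|.
Proof.
move=> B0 H; rewrite bilE; apply: le_trans (ler_norm_sum _ _ _) _.
apply: (@le_trans _ _ (\sum_(i < d) \sum_(j < d) B * `|u| * `|v|)).
  apply: ler_sum => i _; apply: le_trans (ler_norm_sum _ _ _) _; apply: ler_sum => j _.
  rewrite !normrM (mulrC B); apply: ler_pM; [by rewrite mulr_ge0|by []| |exact: normv_coord].
  by apply: ler_pM => //; exact: normv_coord.
rewrite !sumr_const !card_ord.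
have -> (X : R) : X *+ d *+ d = d%:R * d%:R * X by rewrite -mulrA !mulr_natl.
rewrite !mulrA; exact: lexx.
Qed.

(** The coordinates of [v] are its products with the dual basis [w], so the Cauchy-Schwarz
    inequality bounds each of them. *)
Lemma posdef_norm (d : nat) (A : 'M[R]_d) : posdef A ->
  exists2 c : R, 0 < c & forall v, `|v| <= c * Num.sqrt (bil A v v).
Proof.
move=> pA; pose w a : 'rV[R]_d := delta_mx 0 a *m invmx A.
exists (1 + \sum_a Num.sqrt (bil A (w a) (w a))).
  by rewrite ltr_wpDr// sumr_ge0// => a _; exact: sqrtr_ge0.
move=> v; apply: normv_le => [|a].
  by rewrite mulr_ge0 ?sqrtr_ge0// addr_ge0// sumr_ge0// => a _; exact: sqrtr_ge0.
have E : v 0 a = bil A v (w a).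
  have [sA _] := pA.
  rewrite -bil_mulr trmx_inv sA mulmxV ?posdef_unit// /bil mulmx1 trmx_delta -colE mxE//.
have H : `|v 0 a| <= Num.sqrt (bil A (w a) (w a)) * Num.sqrt (bil A v v).
  apply: le_of_sqr; first by rewrite mulr_ge0// sqrtr_ge0.
  rewrite E real_normK ?num_real// exprMn !sqr_sqrtr ?bil_sqr_ge0// mulrC.
  exact: bil_CauchySchwarz.
apply: le_trans H _; rewrite ler_wpM2r ?sqrtr_ge0// (bigD1 a)//= addrA -[leLHS]add0r -addrA.
rewrite lerD// lerDl sumr_ge0// => b _; exact: sqrtr_ge0.
Qed.

Lemma controlled_le (d : nat) (U : set 'rV[R]_d) h x (r r' C C' : R) : controlled U h x r C ->
  0 < r' -> r' <= r -> C <= C' -> controlled U h x r' C'.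
Proof.
move=> K r0 rr CC; have lt (y : 'rV[R]_d) : `|y - x| < r' -> `|y - x| < r by move=> h1; exact: lt_le_trans rr.
split=> //.
- exact: le_trans (ctrl_C K) CC.
- by move=> y /lt; exact: (ctrl_U K).
- by move=> y /lt h1; apply: le_trans (ctrl_0 K h1) CC.
- by move=> y v /lt h1; apply: le_trans (ctrl_1 K v h1) _; rewrite ler_wpM2r.
- by move=> y u v /lt h1; apply: le_trans (ctrl_2 K u v h1) _; rewrite !ler_wpM2r.
- by move=> y v /lt h1 /lt h2; apply: le_trans (taylor_1 K h1 h2) _; rewrite ler_wpM2r.
- by move=> y v /lt h1 /lt h2; apply: le_trans (taylor_2 K h1 h2) _; rewrite ler_wpM2r// exprn_ge0.
- by move=> y v /lt h1 /lt h2; apply: le_trans (taylor_3 K h1 h2) _; rewrite ler_wpM2r// exprn_ge0.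
Qed.

Lemma controlled_all (d : nat) (I : finType) (U : set 'rV[R]_d) (F : I -> 'rV[R]_d -> R) x :
  open U -> U x -> (forall k, smooth U (F k)) ->
  exists r C : R, [/\ 0 < r, 0 <= C, (forall y, `|y - x| < r -> U y) & forall k, controlled U (F k) x r C].
Proof.
move=> oU Ux sF.
have [r' [C' K']] := smooth_controlled oU (smooth_cst U 0) Ux.
have [r rP] := choice (fun k => smooth_controlled oU (sF k) Ux).
have [C CP] := choice rP.
have r0 : 0 < \big[Num.min/r']_k r k.
  by elim/big_ind: _ => [|a b a0 b0|k _]; [exact: ctrl_r K'|rewrite lt_min a0|exact: ctrl_r (CP k)].
exists (\big[Num.min/r']_k r k), (\sum_k C k); split=> //.
- by apply: sumr_ge0 => k _; exact: ctrl_C (CP k).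
- move=> y hy; apply: (ctrl_U K'); apply: lt_le_trans hy _; exact: bigmin_le_id.
- move=> k; apply: controlled_le (CP k) r0 _ _; first exact: bigmin_le.
  by rewrite (bigD1 k)//= lerDl sumr_ge0// => j _; exact: ctrl_C (CP j).
Qed.

Lemma nbhs_norm_lt (V : normedModType R) (x y : V) (r : R) : `|y - x| < r -> nbhs y [set z | `|z - x| < r].
Proof.
move=> h; apply/nbhs_norm_ex; exists (r - `|y - x|); first by rewrite subr_gt0.
move=> z hz /=; rewrite -(subrK y z) -addrA.
by apply: le_lt_trans (ler_normD _ _) _; rewrite -ltrBrDr.
Qed.
End Good.

Section GoodCharts.
Variables (R : realType) (m : nat) (M : kahlerManifold R m).
Local Notation n := (m + m)%N.
Implicit Types (i j : chart_idx M) (p q : M) (x y v w : 'rV[R]_n) (c : R -> M).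

(** A coordinate ball on which the Riemannian norm and the sup norm are comparable with the constant
    [C], and where the Riemannian norm of a fixed vector varies at most at the relative rate [C].
    The last property makes a frozen metric accurate to first order in the radius. *)
Record good i x (r C : R) : Prop := Good {
  gd_r : 0 < r; gd_C : 1 <= C;
  gd_im : forall y, `|y - x| < r -> im i y;
  gd_lo : forall y v, `|y - x| < r -> `|v| <= C * nrm i y v;
  gd_hi : forall y v, `|y - x| < r -> nrm i y v <= C * `|v|;
  gd_var : forall y y' v, `|y - x| < r -> `|y' - x| < r ->
     nrm i y v <= (1 + C * `|y - y'|) * nrm i y' v }.

Lemma good_C0 i x r C : good i x r C -> 0 <= C.
Proof. by move=> g; apply: le_trans (gd_C g). Qed.

Lemma nrm_ge0 i y v : 0 <= nrm i y v. Proof. exact: sqrtr_ge0. Qed.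
Lemma nrm_sqr i y v : im i y -> nrm i y v ^+ 2 = bil (met i y) v v.
Proof. by move=> Uy; rewrite sqr_sqrtr// bil_sqr_ge0//; exact: (kc_posdef (chart_kc i)). Qed.
Lemma nrm_CS i y v w : im i y -> `|bil (met i y) v w| <= nrm i y v * nrm i y w.
Proof.
move=> Uy; apply: le_of_sqr; first by rewrite mulr_ge0// nrm_ge0.
rewrite real_normK ?num_real// exprMn !nrm_sqr//.
by apply: bil_CauchySchwarz; exact: (kc_posdef (chart_kc i)).
Qed.
Lemma nrmZ i y v (a : R) : nrm i y (a *: v) = `|a| * nrm i y v.
Proof. by rewrite /nrm bilZl bilZr mulrA -expr2 sqrtrM ?sqr_ge0// sqrtr_sqr. Qed.

Lemma good_le i x (r r' C : R) : good i x r C -> 0 < r' -> r' <= r -> good i x r' C.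
Proof.
move=> g r0 rr; have lt (y : 'rV[R]_n) : `|y - x| < r' -> `|y - x| < r by move=> h1; exact: lt_le_trans rr.
split=> //; first exact: (gd_C g).
- by move=> y /lt; exact: (gd_im g).
- by move=> y v /lt; exact: (gd_lo g).
- by move=> y v /lt; exact: (gd_hi g).
- by move=> y y' v /lt h1 /lt; exact: (gd_var g).
Qed.

Lemma good_ex i x : im i x -> exists r C, good i x r C.
Proof.
move=> Ux.
have [r0 [C0 [r00 C00 HU H]]] := controlled_all (F := fun ab : 'I_n * 'I_n => fun y => met i y ab.1 ab.2) (@im_open _ _ M i) Ux
  (fun ab => met_smooth i ab.1 ab.2).
have [c c0 cP] := posdef_norm (kc_posdef (chart_kc i) Ux).
pose K := n%:R * n%:R * C0; have K0 : 0 <= K by rewrite !mulr_ge0.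
have var y y' v : `|y - x| < r0 -> `|y' - x| < r0 ->
    `|bil (met i y) v v - bil (met i y') v v| <= K * `|y - y'| * `|v| ^+ 2.
  move=> hy hy'; have -> : bil (met i y) v v - bil (met i y') v v = bil (met i y - met i y') v v.
    by rewrite bilDm -[- met i y']scaleN1r bilZm mulN1r.
  have -> : K * `|y - y'| * `|v| ^+ 2 = n%:R * n%:R * (C0 * `|y - y'|) * `|v| * `|v| by rewrite /K; ring.
  apply: bil_bound => [|a b]; first by rewrite mulr_ge0.
  rewrite !mxE; have h2 : `|y' + (y - y') - x| < r0 by rewrite [y' + _]addrC subrK.
  have := taylor_1 (H (a, b)) hy' h2; rewrite [y' + _]addrC subrK /=; exact.
(* On this radius the variation of the metric is at most half of its value at [x]. *)
pose r1 := Num.min r0 ((2 * K * c ^+ 2 + 1)^-1).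
have cc : 0 <= c ^+ 2 by exact: sqr_ge0.
have D0 : 0 < 2 * K * c ^+ 2 + 1 by rewrite ltr_wpDl// (mulr_ge0 _ cc)// mulr_ge0.
have r10 : 0 < r1 by rewrite lt_min r00 invr_gt0.
have lt0 (y : 'rV[R]_n) : `|y - x| < r1 -> `|y - x| < r0 by rewrite lt_min => /andP[].
have xx : `|x - x| < r0 by rewrite subrr normr0.
have Uy (y : 'rV[R]_n) : `|y - x| < r0 -> im i y.
  exact: HU.
have lo y v : `|y - x| < r1 -> `|v| <= 2 * c * nrm i y v.
  move=> hy; have hy0 := lt0 _ hy; apply: le_of_sqr; first by rewrite !mulr_ge0 ?nrm_ge0 ?ltW.
  have h1 : `|v| ^+ 2 <= c ^+ 2 * bil (met i x) v v.
    have -> : bil (met i x) v v = Num.sqrt (bil (met i x) v v) ^+ 2.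
      by rewrite sqr_sqrtr// bil_sqr_ge0//; exact: (kc_posdef (chart_kc i)).
    by rewrite -exprMn ler_pXn2r ?nnegrE ?mulr_ge0 ?sqrtr_ge0// ltW.
  have h2 := var y x v hy0 xx; move: h2; rewrite ler_norml => /andP[h2 _].
  have h3 : K * `|y - x| * `|v| ^+ 2 <= bil (met i x) v v / 2.
    have h4 : `|y - x| * (2 * K * c ^+ 2 + 1) <= 1.
      by rewrite -ler_pdivlMr// div1r ltW//; move: hy; rewrite lt_min => /andP[].
    have h5 : K * `|y - x| * `|v| ^+ 2 <= K * `|y - x| * (c ^+ 2 * bil (met i x) v v).
      by rewrite ler_wpM2l// mulr_ge0.
    have b0 : 0 <= bil (met i x) v v by apply: bil_sqr_ge0; exact: (kc_posdef (chart_kc i)).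
    have h6 : (`|y - x| * (2 * K * c ^+ 2 + 1)) * bil (met i x) v v <= 1 * bil (met i x) v v.
      by rewrite ler_wpM2r.
    have h7 : 0 <= `|y - x| * bil (met i x) v v by rewrite mulr_ge0.
    have e1 : (`|y - x| * (2 * K * c ^+ 2 + 1)) * bil (met i x) v v
       = 2 * (K * `|y - x| * (c ^+ 2 * bil (met i x) v v)) + `|y - x| * bil (met i x) v v by ring.
    lra.
  rewrite !exprMn nrm_sqr; last exact: Uy.
  have c20 : 0 <= c ^+ 2 by rewrite sqr_ge0.
  have h8 : c ^+ 2 * bil (met i x) v v <= c ^+ 2 * (2 * bil (met i y) v v).
    by rewrite ler_wpM2l//; lra.
  have b0 : 0 <= c ^+ 2 * bil (met i y) v v.
    by rewrite mulr_ge0// bil_sqr_ge0//; apply: (kc_posdef (chart_kc i)); exact: Uy.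
  lra.
have c20 : 0 <= 4 * c ^+ 2 * K by rewrite (mulr_ge0 _ K0)// (mulr_ge0 _ cc).
pose C := 1 + 2 * c + K + 4 * c ^+ 2 * K.
have C1 : 1 <= C by rewrite /C; have := c0; lra.
exists r1, C; split=> //.
- by move=> y /lt0; exact: Uy.
- move=> y v hy; apply: le_trans (lo y v hy) _; rewrite ler_wpM2r ?nrm_ge0// /C.
  by have := c0; lra.
- move=> y v hy; apply: le_of_sqr; first by rewrite mulr_ge0//; lra.
  rewrite nrm_sqr; last by apply: Uy; exact: lt0.
  apply: le_trans (ler_norm _) _.
  apply: le_trans (bil_bound v v C00 _) _; first by move=> a b; exact: (ctrl_0 (H (a, b)) (lt0 _ hy)).
  rewrite -/K exprMn -mulrA -expr2 ler_wpM2r ?sqr_ge0//.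
  apply: (@le_trans _ _ C); first by rewrite /C; have := c0; lra.
  by rewrite expr2 ler_peMl//; lra.
- move=> y y' v hy hy'; have hy0 := lt0 _ hy; have hy0' := lt0 _ hy'.
  have Y0 : 0 <= `|y - y'| by [].
  have s0 : 0 <= C * `|y - y'| by rewrite mulr_ge0//; lra.
  apply: le_of_sqr; first by rewrite mulr_ge0 ?nrm_ge0//; lra.
  rewrite exprMn !nrm_sqr; [|exact: Uy|exact: Uy].
  have h1 := var y y' v hy0 hy0'; move: h1; rewrite ler_norml => /andP[_ h1].
  have h2 : `|v| ^+ 2 <= 4 * c ^+ 2 * bil (met i y') v v.
    rewrite -nrm_sqr; last exact: Uy.
    have := lo y' v hy' => h3; have : `|v| ^+ 2 <= (2 * c * nrm i y' v) ^+ 2.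
      by rewrite ler_pXn2r ?nnegrE// !mulr_ge0 ?nrm_ge0 ?ltW.
    by rewrite !exprMn; lra.
  have b0 : 0 <= bil (met i y') v v by apply: bil_sqr_ge0; apply: (kc_posdef (chart_kc i)); exact: Uy.
  have h3 : K * `|y - y'| * `|v| ^+ 2 <= K * `|y - y'| * (4 * c ^+ 2 * bil (met i y') v v).
    by rewrite ler_wpM2l// mulr_ge0.
  have h4 : (4 * c ^+ 2 * K) * (`|y - y'| * bil (met i y') v v) <= C * (`|y - y'| * bil (met i y') v v).
    by rewrite ler_wpM2r ?mulr_ge0// /C; have := c0; lra.
  have h5 : 0 <= C * `|y - y'| * bil (met i y') v v by rewrite mulr_ge0.
  have h6 : 0 <= (C * `|y - y'|) ^+ 2 * bil (met i y') v v by rewrite mulr_ge0// sqr_ge0.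
  have e1 : (1 + C * `|y - y'|) ^+ 2 * bil (met i y') v v = bil (met i y') v v
     + 2 * (C * `|y - y'| * bil (met i y') v v) + (C * `|y - y'|) ^+ 2 * bil (met i y') v v by ring.
  have e2 : K * `|y - y'| * (4 * c ^+ 2 * bil (met i y') v v) = (4 * c ^+ 2 * K) * (`|y - y'| * bil (met i y') v v) by ring.
  have e3 : C * (`|y - y'| * bil (met i y') v v) = C * `|y - y'| * bil (met i y') v v by ring.
  lra.
Qed.

Lemma lin_form_curve (d : nat) (a : 'I_d -> R) (y : R -> 'rV[R]_d) (t : R) : derivable y t (1 : R) ->
  is_derive t (1 : R) (fun s => (lin_form a (y s) : R)) (lin_form a (derive1 y t) : R).
Proof.
move=> dy; have dy' : differentiable y t by apply/derivable1_diffP.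
have ca := @lin_form_continuous R d a.
have dl : differentiable (lin_form a) (y t) by apply: linear_differentiable.
have dc := differentiable_comp dy' dl.
split; first by apply/derivable1_diffP; exact: dc.
rewrite [LHS](deriveE (1 : R) dc) diff_comp// /= diff_lin//.
by rewrite (derive1E' dy').
Qed.

(** Lower bounds for lengths are obtained by testing displacements against linear forms: the
    derivative of the form along the curve is compared with the derivative of [k * G]. *)
Lemma lin_form_curve_bound c G i (a : 'I_n -> R) (k s t : R) : C1_curve c -> antider c G ->
  0 <= s -> s <= t -> t <= 1 -> (forall u : R, s <= u <= t -> dom i (c u)) ->
  (forall (u : R) v, s <= u <= t -> `|lin_form a v| <= k * nrm i (coord i (c u)) v) ->
  `|lin_form a (coord i (c t) - coord i (c s))| <= k * (G t - G s).
Proof.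
move=> cc aG s0 st t1 hd ha.
have in01 (u : R) : s <= u <= t -> 0 <= u <= 1.
  by move=> /andP[u0 u1]; rewrite (le_trans s0 u0) (le_trans u1 t1).
rewrite linearB mulrBr.
apply: (@deriv_le R (fun u => lin_form a (coord i (c u))) (fun u => k * G u)
  (fun u => lin_form a (derive1 (coord i \o c) u)) (fun u => k * speed c u)) => //.
- move=> u hu; have [_ [du _]] := nbhs_singleton (speed_near cc (in01 u hu) (hd u hu)).
  exact: (lin_form_curve a du).
- move=> u hu; have h := aG u (in01 u hu); exact: is_deriveZ.
- move=> u hu; have [_ [_ ->]] := nbhs_singleton (speed_near cc (in01 u hu) (hd u hu)).
  exact: ha.
Qed.

Lemma lin_form_coord (d : nat) (a : 'I_d) (v : 'rV[R]_d) : lin_form (fun b => (b == a)%:R) v = v 0 a :> R.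
Proof.
rewrite /lin_form (bigD1 a)//= eqxx mulr1 big1 ?addr0// => b /negPf ->.
by rewrite mulr0.
Qed.

Lemma curve_coord_bound c G i x (r C t : R) : C1_curve c -> antider c G -> good i x r C ->
  0 <= t <= 1 -> (forall u : R, 0 <= u <= t -> dom i (c u) /\ `|coord i (c u) - x| < r) ->
  `|coord i (c t) - coord i (c 0)| <= C * (G t - G 0).
Proof.
move=> cc aG g /andP[t0 t1] H; apply: normv_le => [|a].
  by rewrite mulr_ge0 ?(good_C0 g)// subr_ge0; exact: antider_mono aG _ t0 t1.
rewrite -lin_form_coord; apply: (lin_form_curve_bound cc aG) => // [u /H[]//|u v /H[_ hu]].
rewrite lin_form_coord; apply: le_trans (normv_coord v a) _; exact: (gd_lo g).
Qed.

Lemma cball_compact i x (r C e : R) : good i x r C -> e < r ->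
  compact (icoord i @` [set y | `|y - x| <= e]) /\ closed (icoord i @` [set y | `|y - x| <= e]).
Proof.
move=> g er; suff K : compact (icoord i @` [set y | `|y - x| <= e]).
  by split=> //; apply: compact_closed => //; exact: points_hausdorff.
apply: continuous_compact.
  apply: continuous_in_subspaceT => y; rewrite inE /= => hy.
  by apply: icoord_continuous; apply: (gd_im g); exact: le_lt_trans er.
apply: bounded_closed_compact.
  exists (`|x| + `|e|); split; first exact: num_real.
  move=> k hk y /= hy; apply: ltW; apply: le_lt_trans hk.
  rewrite -(subrK x y); apply: le_trans (ler_normD _ _) _; rewrite addrC lerD2l.
  exact: le_trans (ler_norm e).
have -> : [set y | `|y - x| <= e] = (fun y : 'rV[R]_n => `|y - x|) @^-1` [set z | z <= e] by [].
apply: preimage_closed; last exact: closed_le.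
move=> y _; apply: (@continuous_norm R 'rV[R]_n R^o) => e1 e10; exists e1 => // z hz.
apply: le_trans (ler_dist_dist _ _) _; rewrite opprB addrA subrK; exact: ltW.
Qed.

(** Continuity argument: [T] is the last time up to which the curve stays in the chart ball. As long
    as it stays, its displacement is at most [C] times its length, hence too small to reach the
    boundary; so [T] is attained and cannot be less than 1. *)
Lemma curve_in_good c G i x (r C : R) : C1_curve c -> antider c G -> good i x r C ->
  dom i (c 0) -> `|coord i (c 0) - x| + C * (G 1 - G 0) < r ->
  forall t : R, 0 <= t <= 1 -> dom i (c t) /\ `|coord i (c t) - coord i (c 0)| <= C * (G t - G 0)
    /\ `|coord i (c t) - x| < r.
Proof.
move=> cc aG g d0 hr.
pose P (t : R) := dom i (c t) /\ `|coord i (c t) - x| < r.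
have C0 := good_C0 g.
have Gm (s t : R) : 0 <= s -> s <= t -> t <= 1 -> G s <= G t by exact: antider_mono aG.
have step (t : R) : 0 <= t <= 1 -> (forall u : R, 0 <= u <= t -> P u) ->
    `|coord i (c t) - x| <= `|coord i (c 0) - x| + C * (G 1 - G 0).
  move=> t01 Pt; have h := curve_coord_bound cc aG g t01 Pt.
  have -> : coord i (c t) - x = (coord i (c 0) - x) + (coord i (c t) - coord i (c 0)).
    by rewrite [RHS]addrC addrA subrK.
  apply: le_trans (ler_normD _ _) _; rewrite lerD2l; apply: le_trans h _.
  move: t01 => /andP[t0 t1].
  by rewrite ler_wpM2l// lerB//; exact: Gm.
pose A := [set t : R | 0 <= t <= 1 /\ forall u : R, 0 <= u <= t -> P u].
have P0 : P 0.
  by split=> //; apply: le_lt_trans hr; rewrite lerDl mulr_ge0// subr_ge0; exact: Gm.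
have A0 : A 0.
  split; first by rewrite lexx ler01.
  by move=> u u0; have -> : u = 0 by apply/eqP; rewrite eq_le andbC.
have hA : has_sup A by split; [exists 0|exists 1 => t [/andP[]]].
pose T := sup A.
have T0 : 0 <= T by apply: ub_le_sup => //; have [_] := hA.
have T1 : T <= 1 by apply: ge_sup; [exists 0|move=> t [/andP[]]].
have below (s : R) : 0 <= s < T -> P s.
  move=> /andP[s0 sT]; have [t [_ At] st] := @sup_gt R A s (ex_intro _ 0 A0) sT.
  by apply: At; rewrite s0 ltW.
have T01 : 0 <= T <= 1 by rewrite T0.
have [contT _] := cc T T01.
have PT : P T.
  have [T00|Tn0] := eqVneq T 0; first by rewrite T00.
  have Tpos : 0 < T by rewrite lt_neqAle eq_sym Tn0.
  (* The closed coordinate ball of this radius, smaller than [r], is compact, hence closed in the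
     Hausdorff space [M]: the limit point [c T] cannot fall outside the chart. *)
  pose e := `|coord i (c 0) - x| + C * (G 1 - G 0).
  have [_ clK] := cball_compact g (hr : e < r).
  set K := (X in closed X) in clK.
  have KT : K (c T).
    apply: contrapT => nK; have oK := closed_openC clK.
    have : nbhs (c T) (~` K) by apply: open_nbhs_nbhs.
    move=> /contT /nbhs_norm_ex[r1 r10 h1].
    pose s := Num.max 0 (T - r1 / 2).
    have sT : 0 <= s < T by rewrite /s le_max lexx gt_max Tpos/=; lra.
    have st : `|s - T| < r1.
      move: sT => /andP[s0 sT]; rewrite distrC ger0_norm ?subr_ge0 ?ltW//.
      have : T - r1 / 2 <= s by rewrite /s le_max lexx orbT.
      by move=> h2; lra.
    apply: (h1 s st); have [ds hs] := below s sT.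
    exists (coord i (c s)); last by rewrite coordK.
    rewrite /=; move: sT => /andP[s0 sT]; apply: step; first by rewrite s0 (le_trans (ltW sT) T1).
    by move=> u /andP[u0 us]; apply: below; rewrite u0 (le_lt_trans us sT).
  move: KT => [y /= hy E]; have Uy : im i y by apply: (gd_im g); exact: le_lt_trans hr.
  by rewrite /P -E coord_icoord//; split; [exact: icoord_dom|exact: le_lt_trans hr].
have AT (u : R) : 0 <= u <= T -> P u.
  by move=> /andP[u0]; rewrite le_eqVlt => /orP[/eqP ->//|uT]; apply: below; rewrite u0.
have T11 : T = 1.
  apply/eqP; rewrite eq_le T1/= leNgt; apply/negP => Tl.
  have n1 : \forall s \near T, P s.
    have [dT hT] := PT.
    have cont : {for T, continuous (coord i \o c)} by apply: continuous_comp => //; exact: coord_continuous.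
    have n2 : \forall s \near T, dom i (c s) by exact: dom_near.
    have : nbhs (coord i (c T)) [set y | `|y - x| < r].
      exact: nbhs_norm_lt.
    by move=> /cont n3; apply: filterS2 n2 n3.
  move: n1 => /nbhs_norm_ex[r1 r10 h1].
  pose s := Num.min 1 (T + r1 / 2).
  have As : A s.
    have sT : T < s by rewrite lt_min Tl/=; lra.
    split; first by rewrite (le_trans T0 (ltW sT))/= ge_min lexx.
    move=> u /andP[u0 us]; case: (leP u T) => uT; first by apply: AT; rewrite u0.
    apply: h1; rewrite ger0_norm ?subr_ge0 ?ltW//.
    have : s <= T + r1 / 2 by rewrite ge_min lexx orbT.
    by lra.
  have : s <= T by apply: ub_le_sup => //; have [_] := hA.
  by apply/negP; rewrite -ltNge lt_min Tl/=; lra.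
move=> t t01; have Pt (u : R) : 0 <= u <= t -> P u.
  by move: t01 => /andP[t0 t1] /andP[u0 u1]; apply: AT; rewrite u0 T11 (le_trans u1 t1).
have [|dt ht] := Pt t; first by rewrite lexx andbT; case/andP: t01.
by split=> //; split=> //; exact: curve_coord_bound cc aG g t01 Pt.
Qed.
End GoodCharts.

Section Segments.
Variables (R : realType).

Lemma row_continuous (d : nat) (F : R -> 'rV[R]_d) (t : R) :
  (forall j, {for t, continuous (fun s => F s 0 j)}) -> {for t, continuous F}.
Proof.
move=> H; apply: (@continuous_norm R R^o 'rV[R]_d) => e e0.
have K j : exists r : R, 0 < r /\ forall s, `|s - t| < r -> `|F s 0 j - F t 0 j| <= e.
  have /cvgrPdist_le /(_ e e0) /nbhs_norm_ex[r r0 h] := H j.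
  by exists r; split=> // s /h; rewrite distrC.
have [r rP] := choice K.
exists (\big[Num.min/1]_j r j).
  by elim/big_ind: _ => // [a b a0 b0|j _]; [rewrite lt_min a0|exact: (rP j).1].
move=> s st; apply: normv_le => [|j]; [exact: ltW|rewrite !mxE; apply: (rP j).2].
by apply: lt_le_trans st _; exact: bigmin_le.
Qed.

Lemma line_is_derive (V : normedModType R) (y v : V) (t : R) :
  is_derive t (1 : R) (fun s : R => y + s *: v) v.
Proof.
have H : (fun h : R => h^-1 *: ((fun s : R => y + s *: v) (h *: (1 : R^o) + t) - (y + t *: v))) @ 0^' --> v.
  apply: cvg_near_cst; near=> h.
  have h0 : h != 0 by near: h; exact: nbhs_dnbhs_neq.
  rewrite -[h *: 1]/(h * 1) mulr1 scalerDl opprD addrACA subrr add0r addrK.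
  by rewrite scalerA mulVf// scale1r.
split; first exact: (cvgP _ H).
exact: cvg_lim H.
Unshelve. all: by end_near.
Qed.

(** Passage from lengths of nearly minimizing paths to the infimum. *)
Lemma approx_le (X K d e0 : R) : 0 <= K -> 0 < e0 ->
  (forall e, 0 < e -> e <= e0 -> exists2 l, l < d + e & X <= K * l) -> X <= K * d.
Proof.
move=> K0 e00 H; rewrite leNgt; apply/negP => h.
have D0 : 0 < X - K * d by rewrite subr_gt0.
have K1 : 0 < K + 1 by lra.
have e1 : 0 < Num.min e0 ((X - K * d) / (K + 1)) by rewrite lt_min e00 divr_gt0.
have [|l hl hX] := H _ e1; first by rewrite ge_min lexx.
have : K * l <= K * (d + Num.min e0 ((X - K * d) / (K + 1))) by rewrite ler_wpM2l// ltW.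
have : K * Num.min e0 ((X - K * d) / (K + 1)) <= K * ((X - K * d) / (K + 1)).
  by rewrite ler_wpM2l// ge_min lexx orbT.
have : (K + 1) * ((X - K * d) / (K + 1)) = X - K * d by rewrite mulrC divfK// gt_eqF.
have : 0 < (X - K * d) / (K + 1) by rewrite divr_gt0.
set z := (X - K * d) / (K + 1); set q := Num.min _ _.
rewrite mulrDl mul1r mulrDr; lra.
Qed.
End Segments.

(** * The distance and its comparison with coordinates *)

Section Distance.
Variables (R : realType) (m : nat) (M : kahlerManifold R m).
Local Notation n := (m + m)%N.
Implicit Types (i j : chart_idx M) (p q z : M) (x y v w : 'rV[R]_n) (c : R -> M).

Definition seg i y y' : R -> M := fun t => icoord i (y + t *: (y' - y)).

Lemma good_seg i x (r C : R) y y' : good i x r C -> `|y - x| < r -> `|y' - x| < r ->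
  forall t : R, 0 <= t <= 1 -> `|y + t *: (y' - y) - x| < r.
Proof. by move=> g hy hy' t t01; apply: ball_segment => //; rewrite [y + _]addrC subrK. Qed.

Lemma seg_near y y' (t : R) (A : set 'rV[R]_n) : open A ->
  A (y + t *: (y' - y)) -> \forall s \near t, A (y + s *: (y' - y)).
Proof.
move=> oA At; have [dL _] := line_is_derive y (y' - y) t.
have cL : {for t, continuous (fun s : R => y + s *: (y' - y))}.
  by apply: differentiable_continuous; apply/derivable1_diffP.
by apply: cL; apply: open_nbhs_nbhs.
Qed.

Lemma seg_C1 i x (r C : R) y y' : good i x r C -> `|y - x| < r -> `|y' - x| < r ->
  C1_curve (seg i y y').
Proof.
move=> g hy hy' t t01; pose L (s : R) := y + s *: (y' - y).
have hL := good_seg g hy hy' t01.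
have UL : im i (L t) by exact: (gd_im g).
have dL (s : R) : derivable L s (1 : R) by have [] := line_is_derive y (y' - y) s.
have dL1 (s : R) : derive1 L s = y' - y by rewrite derive1E; have [] := line_is_derive y (y' - y) s.
have cL (s : R) : {for s, continuous L} by apply: differentiable_continuous; apply/derivable1_diffP.
have cc : {for t, continuous (seg i y y')}.
  by apply: (@continuous_comp _ _ _ L (icoord i)); [exact: cL|exact: icoord_continuous].
split; first exact: cc.
move=> j dj.
have ovt : ov i j (L t) by apply/ovE.
have nov : \forall s \near t, ov i j (L s) by apply: seg_near => //; exact: ov_open.
have nD : \forall s \near t, derivable (tran i j \o L) s (1 : R) /\
    derive1 (tran i j \o L) s = (y' - y) *m \matrix_(a, b) partial a (fun z : 'rV[R]_n => tran i j z 0 b) (L s).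
  apply: (near1 nov) => s os; have := curve_chain (@ov_open _ _ _ i j) os (tran_smooth i j) (dL s).
  by rewrite dL1.
split; first by apply: (near1 nD) => s [].
have nE : \forall s \near t, derive1 (tran i j \o L) s = (y' - y) *m \matrix_(a, b) partial a (fun z : 'rV[R]_n => tran i j z 0 b) (L s).
  by apply: (near1 nD) => s [].
apply: (near_eq_continuous nE); apply: row_continuous => b.
have -> : (fun s => ((y' - y) *m \matrix_(a, b) partial a (fun z : 'rV[R]_n => tran i j z 0 b) (L s)) 0 b) =
   (fun s => \sum_a (y' - y) 0 a * partial a (fun z : 'rV[R]_n => tran i j z 0 b) (L s)).
  by apply/funext => s; rewrite mxE; apply: eq_bigr => a _; rewrite !mxE.
apply: (@cvg_big R^o _ (@GRing.add R) 0 xpredT _ R (nbhs t)).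
  exact: (@pseudometric_normed_Zmodule.add_continuous R R^o).
move=> a _; apply: (@cvgM R R^o); first exact: (@cvg_cst R^o).
apply: (@continuous_comp _ _ _ L (partial a (fun z : 'rV[R]_n => tran i j z 0 b))); first exact: cL.
exact: (smooth_continuous (smooth_partial a (tran_smooth i j b)) ovt).
Qed.

Lemma seg_length i x (r C : R) y y' : good i x r C -> `|y - x| < r -> `|y' - x| < r ->
  curve_length (seg i y y') <= (1 + C * `|y' - y|) * nrm i y (y' - y).
Proof.
move=> g hy hy'; have cc := seg_C1 g hy hy'.
have [G aG] := antider_ex cc; rewrite (antider_length cc aG).
set k := (X in _ <= X); have C0 := good_C0 g.
apply: le_trans (ler_norm _) _.
have -> : k = k * 1 - k * 0 by rewrite mulr1 mulr0 subr0.
apply: (@deriv_le R G (fun t => k * t) (speed (seg i y y')) (fun=> k)) => //.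
  move=> t _; have h : is_derive t (1 : R) (id : R -> R^o) 1 by exact: is_derive_id.
  have h' := is_deriveZ k h; apply: is_derive_eq h' _; by rewrite /GRing.scale/= mulr1.
move=> t t01; have hL := good_seg g hy hy' t01; have UL := gd_im g hL.
have dt : dom i (seg i y y' t) by exact: icoord_dom.
have [_ [_ ->]] := nbhs_singleton (speed_near cc t01 dt).
have E : \forall s \near t, (coord i \o seg i y y') s = y + s *: (y' - y).
  have h : \forall s \near t, im i (y + s *: (y' - y)) by apply: seg_near => //; exact: im_open.
  by apply: (near1 h) => s Us; rewrite /= coord_icoord.
have -> : derive1 (coord i \o seg i y y') t = y' - y.
  rewrite derive1E (near_eq_derive _ E); by have [] := line_is_derive y (y' - y) t.
have ec : coord i (seg i y y' t) = y + t *: (y' - y) := nbhs_singleton E.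
rewrite ger0_norm ?nrm_ge0// ec.
apply: le_trans (gd_var g _ hL hy) _; rewrite ler_wpM2r ?nrm_ge0// lerD2l ler_wpM2l//.
rewrite addrAC subrr add0r normrZ; move: t01 => /andP[t0 t1].
by rewrite ger0_norm// ler_piMl.
Qed.

Lemma path_curve c : C1_curve c -> path_length (c 0) (c 1) (curve_length c).
Proof. by move=> cc; rewrite -[curve_length c]addr0; apply: path_length_cons => //; exact: path_length_nil. Qed.

Lemma path_ge0 p q l : path_length p q l -> 0 <= l.
Proof. by elim=> // c {}q {}l cc _ l0; rewrite addr_ge0// curve_length_ge0. Qed.

Lemma path_cat p q z k l : path_length p q k -> path_length q z l -> path_length p z (k + l).
Proof.
elim=> [{}p|c {}q {}k cc _ IH]; first by rewrite add0r.
by move=> /IH h; rewrite -addrA; exact: path_length_cons.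
Qed.

Lemma affine_length_mono c (a b : R) G : C1_curve c -> (0 <= a)%R -> (0 <= b)%R -> (a + b <= 1)%R -> antider c G ->
  C1_curve (fun t => c (a + b * t)) /\ curve_length (fun t => c (a + b * t)) = G (a + b) - G a.
Proof.
move=> cc a0 b0 ab1 aG.
have a01 : 0 <= a <= 1 by rewrite a0; lra.
have b01 : 0 <= a + b <= 1 by rewrite ab1 addr_ge0.
have [C _] := C1_affine cc a01 b01; split=> //.
rewrite (affine_length cc a01 b01 aG).
move: b0; rewrite le_eqVlt => /orP[/eqP <-|b0]; first by rewrite sgr0 mul0r addr0 subrr.
by rewrite gtr0_sg// mul1r.
Qed.

Lemma path_sym p q l : path_length p q l -> path_length q p l.
Proof.
elim=> [{}p|c {}q {}l cc _ IH]; first exact: path_length_nil.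
rewrite addrC; apply: path_cat IH _.
have [G aG] := antider_ex cc.
have a01 : (0 : R) <= (1 : R) <= (1 : R) by rewrite ler01 lexx.
have b01 : (0 : R) <= (1 : R) + -1 <= (1 : R) by rewrite subrr lexx ler01.
have [C _] := C1_affine cc a01 b01.
have := path_curve C; rewrite (affine_length cc a01 b01 aG) (antider_length cc aG).
by rewrite mulr0 addr0 mulr1 subrr sgrN sgr1 mulN1r opprB.
Qed.

Lemma path_split p q l : path_length p q l -> forall t : R, 0 <= t <= l ->
  exists z, path_length p z t /\ path_length z q (l - t).
Proof.
elim=> [{}p|c {}q {}l cc Pq IH] t /andP[t0 tl].
  have -> : t = 0 by apply/eqP; rewrite eq_le t0 tl.
  by exists p; rewrite subr0; split; exact: path_length_nil.
have [G aG] := antider_ex cc; have Lc := antider_length cc aG.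
have [tc|ct] := leP t (curve_length c); last first.
  have [|z [h1 h2]] := IH (t - curve_length c).
    by rewrite subr_ge0 ltW//=; lra.
  exists z; split.
    by have := path_length_cons cc h1; rewrite addrC subrK.
  by have -> : curve_length c + l - t = l - (t - curve_length c) by ring.
have cG : {within `[0, 1], continuous G}.
  apply: derivable_within_continuous => s; rewrite in_itv/= => s01.
  by have [] := aG s s01.
have [||s s01 Gs] := @IVT R G 0 1 (G 0 + t) _ cG; [exact: ler01| |].
  have G01 : G 0 <= G 1 by rewrite -subr_ge0 -Lc curve_length_ge0.
  by rewrite min_l// max_r// lerDl t0/=; move: tc; rewrite Lc; lra.
move: s01; rewrite in_itv/= => /andP[s0 s1].
have [|C1 L1] := @affine_length_mono c 0 s G cc (lexx _) s0 _ aG; first by rewrite add0r.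
have [||C2 L2] := @affine_length_mono c s (1 - s) G cc s0 _ _ aG; first by rewrite subr_ge0.
  by rewrite addrC subrK.
exists (c s); split.
  have := path_curve C1; rewrite L1 mulr0 mulr1 !add0r Gs.
  by have -> : G 0 + t - G 0 = t by ring.
have e1 : s + (1 - s) = 1 by ring.
have h2 := path_curve C2; rewrite L2 mulr0 addr0 mulr1 e1 in h2.
have := path_cat h2 Pq; rewrite Lc.
by have -> : G 1 - G s + l = G 1 - G 0 + l - t by rewrite Gs; ring.
Qed.

Lemma path_seg i x (r C : R) y y' : good i x r C -> `|y - x| < r -> `|y' - x| < r ->
  exists2 l, path_length (icoord i y) (icoord i y') l & l <= (1 + C * `|y' - y|) * nrm i y (y' - y).
Proof.
move=> g hy hy'; exists (curve_length (seg i y y')); last exact: seg_length g hy hy'.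
have := path_curve (seg_C1 g hy hy'); rewrite /seg scale0r addr0 scale1r.
by rewrite [y + _]addrC subrK.
Qed.

(** A path too short to leave the chart ball has displacement controlled by its length. The last
    clause freezes the metric at a point [y] within [rho] of the path and tests the displacement
    against any [w]; the almost optimal factor [1 + C * rho] is what second-order comparison
    needs. *)
Lemma path_good p q l : path_length p q l -> forall i x (r C : R), good i x r C -> dom i p ->
  `|coord i p - x| + C * l < r -> dom i q /\ `|coord i q - coord i p| <= C * l /\
  forall y (rho : R) w, `|y - x| < r -> `|coord i p - y| + C * l <= rho ->
    `|bil (met i y) (coord i q - coord i p) w| <= (1 + C * rho) * nrm i y w * l.
Proof.
elim=> [{}p|c {}q {}l cc Pq IH] i x r C g dp hr.
  split=> //; rewrite subrr normr0 mulr0; split=> // y rho w _ _.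
  by rewrite bil0l normr0 mulr0.
have C0 := good_C0 g; have l0 := path_ge0 Pq; have c0 := curve_length_ge0 cc.
have [G aG] := antider_ex cc; have Lc := antider_length cc aG.
have Cc0 : 0 <= C * curve_length c by rewrite mulr_ge0.
have Cl0 : 0 <= C * l by rewrite mulr_ge0.
move: hr; rewrite mulrDr => hr.
have hr1 : `|coord i (c 0) - x| + C * (G 1 - G 0) < r by rewrite -Lc; lra.
have IN := curve_in_good cc aG g dp hr1.
have one : 0 <= (1 : R) <= 1 by rewrite ler01 lexx.
have [d1 [h1 _]] := IN 1 one.
have tri a b e : `|coord i a - e| <= `|coord i b - e| + `|coord i a - coord i b|.
  have -> : coord i a - e = (coord i a - coord i b) + (coord i b - e) by rewrite addrA subrK.
  by rewrite [leRHS]addrC ler_normD.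
have h1' : `|coord i (c 1) - coord i (c 0)| <= C * curve_length c by rewrite Lc.
have [|dq [h2 h3]] := IH i x r C g d1.
  by have := tri (c 1) (c 0) x; lra.
split=> //; split.
  by have := tri q (c 1) (coord i (c 0)); lra.
move=> y rho w hy hrho.
have k0 : 0 <= nrm i y w by exact: nrm_ge0.
have e1 : coord i q - coord i (c 0) = (coord i q - coord i (c 1)) + (coord i (c 1) - coord i (c 0)) by rewrite addrA subrK.
rewrite e1 bilDl; apply: le_trans (ler_normD _ _) _; rewrite mulrDr [leLHS]addrC; apply: lerD.
  pose a (k : 'I_n) := \sum_b met i y k b * w 0 b.
  have ea v : bil (met i y) v w = lin_form a v.
    rewrite bilE /lin_form; apply: eq_bigr => k _; rewrite mulr_sumr.
    by apply: eq_bigr => b _; rewrite mulrA.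
  rewrite ea Lc; apply: (lin_form_curve_bound cc aG) => //; first by move=> u /IN[].
  move=> u v hu; have [du [hu1 hu2]] := IN u hu; rewrite -ea.
  apply: le_trans (nrm_CS _ _ (gd_im g hy)) _.
  rewrite mulrAC ler_wpM2r//; apply: le_trans (gd_var g v hy hu2) _.
  rewrite ler_wpM2r ?nrm_ge0// lerD2l ler_wpM2l// distrC.
  have := tri (c u) (c 0) y; have : C * (G u - G 0) <= C * (G 1 - G 0).
    rewrite ler_wpM2l// lerD2r; case/andP: hu => ? ?; exact: antider_mono aG _ _ _.
  by move: hrho; rewrite Lc; lra.
apply: h3 => //.
by have := tri (c 1) (c 0) y; move: hrho; lra.
Qed.

Hypothesis conn : connected [set: M].

Lemma good_nbhs i x (r C : R) p : good i x r C -> dom i p -> `|coord i p - x| < r ->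
  nbhs p [set q | dom i q /\ `|coord i q - x| < r].
Proof.
move=> g dp hp; have n1 : nbhs p (dom i) by apply: open_nbhs_nbhs; split=> //; exact: dom_open.
have n2 : nbhs p (coord i @^-1` [set y | `|y - x| < r]).
  by move: (@nbhs_norm_lt R _ _ _ _ hp) => /(coord_continuous dp).
by apply: filterS2 n1 n2.
Qed.

Lemma reach_nbhs p : exists2 A, nbhs p A & forall q, A q -> exists l, path_length p q l.
Proof.
pose i := chart_at p; have dp : dom i p by exact: dom_chart_at.
have [r [C g]] := good_ex (im_coord dp).
have xx : `|coord i p - coord i p| < r by rewrite subrr normr0 (gd_r g).
exists [set q | dom i q /\ `|coord i q - coord i p| < r]; first exact: good_nbhs g dp xx.
move=> q [dq hq]; have [l h _] := path_seg g xx hq.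
by exists l; move: h; rewrite !coordK.
Qed.

Lemma path_ex p q : exists l, path_length p q l.
Proof.
pose B := [set z | exists l, path_length p z l].
have oB : open B.
  rewrite openE => z [k hk]; have [A nA hA] := reach_nbhs z.
  by apply: filterS nA => w /hA[l hl]; exists (k + l); exact: path_cat hl.
have cB : closed B.
  rewrite -[B]setCK; apply: open_closedC; rewrite openE => z nBz.
  have [A nA hA] := reach_nbhs z.
  apply: filterS nA => w /hA[l hl] [k hk]; apply: nBz; exists (k + l).
  by apply: path_cat hk _; exact: path_sym.
have := conn (B := B); rewrite (_ : B = setT) ?inE//; last first.
  apply: conn; [by exists p, 0; exact: path_length_nil|by exists B => //; rewrite setTI|by exists B => //; rewrite setTI].
move=> _; have : B q; last by [].
rewrite (_ : B = setT)//.
by apply: conn; [exists p, 0; exact: path_length_nil|exists B => //; rewrite setTI|exists B => //; rewrite setTI].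
Qed.

Lemma has_inf_path p q : has_inf [set l | path_length p q l].
Proof.
split; first by have [l h] := path_ex p q; exists l.
by exists 0 => l /path_ge0.
Qed.
Lemma dist_le p q l : path_length p q l -> dist p q <= l.
Proof. by move=> h; apply: ge_inf => //; have [] := has_inf_path p q. Qed.
Lemma dist_approx p q (e : R) : 0 < e -> exists2 l, path_length p q l & l < dist p q + e.
Proof. by move=> e0; apply: inf_adherent => //; exact: has_inf_path. Qed.
Lemma dist_ge0 p q : 0 <= dist p q.
Proof. by apply: lb_le_inf; [have [] := has_inf_path p q|move=> l /path_ge0]. Qed.
Lemma dist_refl p : dist p p = 0.
Proof. by apply/eqP; rewrite eq_le dist_ge0 andbT; apply: dist_le; exact: path_length_nil. Qed.
Lemma dist_sym p q : dist p q = dist q p.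
Proof. by congr inf; apply/seteqP; split=> l; exact: path_sym. Qed.
Lemma dist_triangle q p z : dist p z <= dist p q + dist q z.
Proof.
apply/ler_addgt0Pr => e e0; have e2 : 0 < e / 2 by lra.
have [k hk k1] := dist_approx p q e2; have [l hl l1] := dist_approx q z e2.
by have := dist_le (path_cat hk hl); lra.
Qed.
Lemma dist_split p q (t e : R) : 0 <= t <= dist p q -> 0 < e ->
  exists z, dist p z <= t /\ dist z q <= dist p q - t + e.
Proof.
move=> /andP[t0 td] e0; have [l hl l1] := dist_approx p q e0.
have [|z [h1 h2]] := path_split hl (t := t).
  by rewrite t0; apply: le_trans td _; exact: dist_le.
by exists z; split; [exact: dist_le|apply: le_trans (dist_le h2) _; lra].
Qed.

Lemma dist_seg i x (r C : R) y y' : good i x r C -> `|y - x| < r -> `|y' - x| < r ->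
  dist (icoord i y) (icoord i y') <= (1 + C * `|y' - y|) * nrm i y (y' - y).
Proof. by move=> g hy hy'; have [l h] := path_seg g hy hy'; apply: le_trans; exact: dist_le. Qed.

Lemma dist_good i x (r C : R) p q : good i x r C -> dom i p -> `|coord i p - x| + C * dist p q < r ->
  dom i q /\ `|coord i q - coord i p| <= C * dist p q /\
  forall y (rho : R), `|y - x| < r -> `|coord i p - y| + C * dist p q < rho ->
    nrm i y (coord i q - coord i p) <= (1 + C * rho) * dist p q.
Proof.
move=> g dp hr; have C0 := good_C0 g; have C1 := gd_C g; have d0 := dist_ge0 p q.
have small (X : R) : `|coord i p - x| + C * dist p q < X -> True by [].
(* Half of the available room, divided by [C]: lengths within this excess of the distance still
   satisfy the smallness condition. *)
pose slack (a b : R) := (b - a) / (2 * C).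
have slP a b l e : a + C * dist p q < b -> e <= slack (a + C * dist p q) b -> l < dist p q + e -> a + C * l < b.
  move=> ab he hl; have h1 : C * l <= C * (dist p q + slack (a + C * dist p q) b).
    by rewrite ler_wpM2l// ltW//; apply: lt_le_trans hl _; rewrite lerD2l.
  have h2 : C * slack (a + C * dist p q) b = (b - (a + C * dist p q)) / 2.
    by rewrite /slack invfM mulrCA mulrA mulrACA mulfV ?mulr1// gt_eqF//; lra.
  by move: h1; rewrite mulrDr h2; lra.
have sl0 a b : a < b -> 0 < slack a b by move=> ab; rewrite /slack divr_gt0 ?subr_gt0//; lra.
have e0 := sl0 _ _ hr.
have base e : 0 < e -> e <= slack (`|coord i p - x| + C * dist p q) r -> exists2 l, l < dist p q + e &
   path_length p q l /\ `|coord i p - x| + C * l < r.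
  move=> e1 he; have [l hl l1] := dist_approx p q e1; exists l => //; split=> //.
  exact: slP he l1.
split; first by have [l _ [hl hr']] := base _ e0 (lexx _); have [] := path_good hl g dp hr'.
split.
  apply: (approx_le C0 e0) => e e1 he; have [l l1 [hl hr']] := base e e1 he; exists l => //.
  by have [_ []] := path_good hl g dp hr'.
move=> y rho hy hrho; set D := coord i q - coord i p.
have Uy := gd_im g hy.
have r0 : 0 <= rho by apply: le_trans (ltW hrho); rewrite addr_ge0// mulr_ge0.
have k0 : 0 <= 1 + C * rho by rewrite addr_ge0// mulr_ge0.
(* The displacement is tested against itself, and one factor of its norm is cancelled afterwards. *)
have H : nrm i y D ^+ 2 <= ((1 + C * rho) * nrm i y D) * dist p q.
  have e2 := sl0 _ _ hrho.
  apply: (@approx_le R _ _ _ (Num.min (slack (`|coord i p - x| + C * dist p q) r) (slack (`|coord i p - y| + C * dist p q) rho))).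
  - by rewrite mulr_ge0// nrm_ge0.
  - by rewrite lt_min e0.
  - move=> e e1; rewrite le_min => /andP[he1 he2]; have [l l1 [hl hr']] := base e e1 he1; exists l => //.
    have [_ [_ h]] := path_good hl g dp hr'.
    rewrite nrm_sqr//; apply: le_trans (ler_norm _) _; apply: h => //.
    by apply: ltW; exact: slP he2 l1.
have := nrm_ge0 i y D; rewrite le_eqVlt => /orP[/eqP <-|D0]; first by rewrite mulr_ge0.
by rewrite -(ler_pM2l D0) -expr2; apply: le_trans H _; rewrite mulrAC mulrC mulrA lexx.
Qed.

(** With [nbhs_dist] this identifies the topology of the manifold with that of the distance. *)
Lemma dist_nbhs p A : nbhs p A -> exists2 e : R, 0 < e & forall q, dist p q < e -> A q.
Proof.
move=> nA; pose i := chart_at p; have dp : dom i p by exact: dom_chart_at.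
have [r [C g]] := good_ex (im_coord dp).
have nb : nbhs (coord i p) (icoord i @^-1` A).
  by apply: (icoord_continuous (im_coord dp)); rewrite coordK.
move: nb => /nbhs_norm_ex[r1 r10 h].
have C1 := gd_C g; have C0 : 0 < C by lra.
exists (Num.min r r1 / C); first by rewrite divr_gt0// lt_min (gd_r g).
move=> q; rewrite ltr_pdivlMr// mulrC lt_min => /andP[h1 h2].
have [|dq [h3 _]] := dist_good g dp (q := q); first by rewrite subrr normr0 add0r.
by have := h (coord i q) (le_lt_trans h3 h2); rewrite /= coordK.
Qed.

Lemma nbhs_dist p (e : R) : 0 < e -> nbhs p [set q | dist p q < e].
Proof.
move=> e0; pose i := chart_at p; have dp : dom i p by exact: dom_chart_at.
have [r [C g]] := good_ex (im_coord dp).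
have C1 := gd_C g; have C0 : 0 < C by lra.
pose r1 := Num.min r (Num.min 1 (e / (2 * C * C))).
have r10 : 0 < r1 by rewrite !lt_min (gd_r g) ltr01 divr_gt0// mulr_gt0// mulr_gt0.
have g1 : good i (coord i p) r1 C by apply: (good_le g r10); rewrite ge_min lexx.
have xx : `|coord i p - coord i p| < r1 by rewrite subrr normr0.
apply: filterS (good_nbhs g1 dp xx) => q [dq hq] /=.
have := dist_seg g1 xx hq; rewrite !coordK// => /le_lt_trans; apply.
set D := coord i q - coord i p in hq *.
have h1 : nrm i (coord i p) D <= C * `|D| by exact: (gd_hi g1).
have [h2 h3] : `|D| < 1 /\ `|D| < e / (2 * C * C) by move: hq; rewrite !lt_min => /and3P[].
have h4 : 1 + C * `|D| <= 2 * C.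
  have : C * `|D| <= C * 1 by rewrite ler_wpM2l// ltW.
  lra.
apply: (@le_lt_trans _ _ (2 * C * (C * `|D|))).
  by apply: ler_pM => //; [rewrite addr_ge0// mulr_ge0// ltW|exact: nrm_ge0].
by move: h3; rewrite ltr_pdivlMr ?mulr_gt0// mulrC !mulrA.
Qed.
End Distance.

(** * Hopf-Rinow *)

Section CompactInduction.
Variables (T : topologicalType).

(* If [P A] failed, the sets [B] with [P (A `\` B)] would form a proper filter without cluster point in [A]. *)
Lemma compact_ind (A : set T) (P : set T -> Prop) : compact A -> P set0 ->
  (forall B C, P B -> P C -> P (B `|` C)) -> (forall B C, B `<=` C -> P C -> P B) ->
  (forall x, A x -> exists2 N, nbhs x N & P N) -> P A.
Proof.
move=> cA P0 PU PS loc; apply: contrapT => nPA.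
pose F : set_system T := [set B | P (A `\` B)].
have FF : ProperFilter F.
  split; first by rewrite /F /= setD0.
  split.
  - by rewrite /F /= setDT.
  - by move=> B C; rewrite /F /= setDIr => h1 h2; exact: PU.
  - by move=> B C BC; rewrite /F /=; apply: PS => x [Ax nC]; split=> // /BC.
have FA : F A by rewrite /F /= setDv.
have [x [Ax clx]] := cA F FF FA.
have [N nN PN] := loc x Ax.
have FN : F (~` N) by rewrite /F /=; apply: PS PN => y [_ /contrapT].
by have [y [h1 h2]] := clx _ _ FN nN.
Qed.

Lemma compact_argmin (R : realType) (A : set T) (h : T -> R) : compact A -> A !=set0 ->
  (forall x, A x -> {for x, continuous h}) -> exists2 x, A x & forall y, A y -> h x <= h y.
Proof.
move=> cA [a Aa] ch; apply: contrapT => nmin.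
have lt x : A x -> exists2 y, A y & h y < h x.
  move=> Ax; apply: contrapT => ny; apply: nmin; exists x => // y Ay.
  by rewrite leNgt; apply/negP => hy; apply: ny; exists y.
have : exists2 y, A y & forall z, A z -> A z -> h y < h z.
  apply: (@compact_ind A (fun B => exists2 y, A y & forall z, B z -> A z -> h y < h z)) => //.
  - by exists a.
  - move=> B C [y Ay hy] [z Az hz]; case: (leP (h y) (h z)) => yz.
      by exists y => // w [/hy//|/hz h1 /h1]; exact: le_lt_trans.
    by exists z => // w [/hy h1 /h1|/hz//]; exact: lt_trans.
  - by move=> B C BC [y Ay hy]; exists y => // z /BC; exact: hy.
  - move=> x Ax; have [y Ay yx] := lt x Ax; exists (h @^-1` [set r | h y < r]).
      by apply: (ch x Ax); exact: lt_nbhsr.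
    by exists y.
by move=> [y Ay hy]; have := hy y Ay Ay; rewrite ltxx.
Qed.

Lemma compact_ubound (R : realType) (A : set T) (h : T -> R) : compact A ->
  (forall x, A x -> {for x, continuous h}) -> exists2 B : R, 0 <= B & forall y, A y -> h y <= B.
Proof.
move=> cA ch; have [[a Aa]|nA] := pselect (A !=set0); last first.
  by exists 0 => // y Ay; exfalso; apply: nA; exists y.
have [|x Ax hx] := @compact_argmin R A (fun y => - h y) cA (ex_intro _ a Aa).
  by move=> x Ax; apply: (@cvgN R R^o); exact: ch.
exists (Num.max 0 (h x)); first by rewrite le_max lexx.
by move=> y Ay; rewrite le_max -[h y <= h x]lerN2 hx// orbT.
Qed.
End CompactInduction.

Section HopfRinow.
Variables (R : realType) (m : nat) (M : kahlerManifold R m).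
Local Notation n := (m + m)%N.
Implicit Types (i j : chart_idx M) (p q z x : M).
Hypothesis conn : connected [set: M].
Hypothesis compl : complete_metric M.

Lemma dist_continuous p q : {for q, continuous (dist p)}.
Proof.
apply/cvgrPdist_le => e e0; apply: filterS (nbhs_dist conn q e0) => z /= hz.
have := dist_triangle conn q p z; have := dist_triangle conn z p q.
rewrite (dist_sym z q) ler_norml => h1 h2; apply/andP; split; lra.
Qed.

Lemma cball_closed p (rho : R) : closed [set q | dist p q <= rho].
Proof.
rewrite -[[set q | _]]/((dist p) @^-1` [set z | z <= rho]).
by apply: preimage_closed => [q _|]; [exact: dist_continuous|exact: closed_le].
Qed.

(** The ideal generated by the balls of radius [e]: its members are the sets covered by finitely
    many such balls. The inductive form replaces finite index sets by an induction principle. *)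
Inductive cov (e : R) : set M -> Prop :=
  | cov0 : cov e set0
  | cov_ball x : cov e [set q | dist x q < e]
  | covU B C : cov e B -> cov e C -> cov e (B `|` C)
  | covS B C : B `<=` C -> cov e C -> cov e B.

Definition totally (A : set M) := forall e : R, 0 < e -> cov e A.

Lemma cov_fat (e e' d : R) B : e + d <= e' -> cov e B -> cov e' [set q | exists2 z, B z & dist z q <= d].
Proof.
move=> ed; elim=> [|x|B1 C _ h1 _ h2|B1 C BC _ h].
- by apply: covS (cov0 _) => q [].
- apply: covS (cov_ball e' x) => q [z /= h1 h2].
  by have := dist_triangle conn z x q; lra.
- by apply: covS (covU h1 h2) => q [z [Bz|Cz] hz]; [left|right]; exists z.
- by apply: covS h => q [z /BC Cz hz]; exists z.
Qed.

(** An ultrafilter on [A] contains a ball of radius [1 / (k + 1)] for every [k]. Any two of these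
    balls meet, so their centres form a Cauchy sequence, and the limit given by completeness is a
    limit of the ultrafilter. *)
Lemma totally_compact A : closed A -> totally A -> compact A.
Proof.
move=> clA tA; rewrite compact_ultra => F UF FA.
have ex (e : R) : 0 < e -> exists x, F [set q | dist x q < e].
  move=> e0; elim: (tA e e0) FA => [|x|B C _ h1 _ h2|B C BC _ h].
  - by move=> F0; exfalso; exact: filter_not_empty F0.
  - by exists x.
  - move=> FBC; have [/h1//|FnB] := in_ultra_setVsetC B UF.
    by apply: h2; apply: filterS (filterI FBC FnB) => x [[]].
  - by move=> FB; apply: h; exact: filterS BC FB.
have [x xP] := choice (fun k : nat => ex (k.+1%:R^-1) (ltac:(by rewrite invr_gt0 ltr0Sn))).
have lim_inv (e : R) : 0 < e -> exists N : nat, forall k : nat, (N <= k)%N -> (k.+1%:R : R)^-1 < e.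
  move=> e0; exists (Num.truncn e^-1) => k Nk.
  rewrite invf_plt ?posrE//; apply: lt_le_trans (truncnS_gt _) _.
  by rewrite ler_nat ltnS.
have close k l : dist (x k) (x l) < k.+1%:R^-1 + l.+1%:R^-1.
  have [z [h1 h2]] := filter_ex (filterI (xP k) (xP l)).
  apply: le_lt_trans (dist_triangle conn z (x k) (x l)) _; rewrite (dist_sym z); exact: ltrD h1 h2.
have [|p xp] := compl (u := x).
  move=> e e0; have [|N NP] := lim_inv (e / 2); first by lra.
  exists N => k l Nk Nl; apply: lt_trans (close k l) _; rewrite [e]splitr.
  exact: ltrD (NP k Nk) (NP l Nl).
exists p; have Fp : F --> p.
  move=> B /(dist_nbhs conn)[e e0 h].
  have [|N NP] := lim_inv (e / 2); first by lra.
  have e2 : 0 < e / 2 by lra.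
  move/cvgrPdist_lt: xp => /(_ _ e2)[N' _ hN'].
  pose k := maxn N N'; have h1 := NP k (leq_maxl _ _); have h2 := hN' k (leq_maxr _ _).
  apply: filterS (xP k) => z /= hz; apply: h.
  move: h2; rewrite /= sub0r normrN ger0_norm ?dist_ge0// => h2.
  apply: le_lt_trans (dist_triangle conn (x k) p z) _; rewrite (dist_sym p (x k)) [e]splitr.
  exact: ltrD h2 (lt_trans hz h1).
split=> //; apply: clA => B nB; have FB := Fp B nB.
exact: filter_ex (filterI FA FB).
Qed.

Lemma compact_totally A : compact A -> totally A.
Proof.
move=> cA e e0; apply: (compact_ind cA) => [|B C|B C|x Ax]; [exact: cov0|exact: covU|exact: covS|].
by exists [set q | dist x q < e]; [exact: nbhs_dist|exact: cov_ball].
Qed.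

Lemma locally_totally p : exists2 r : R, 0 < r & totally [set q | dist p q <= r].
Proof.
pose i := chart_at p; have dp : dom i p by exact: dom_chart_at.
have [r [C g]] := good_ex (im_coord dp).
have C1 := gd_C g; have C0 : 0 < C by lra.
have r0 := gd_r g.
have rr : r / 2 < r by lra.
have [cK _] := cball_compact g rr.
exists (r / (2 * C)); first by rewrite divr_gt0// mulr_gt0.
have H := compact_totally cK => e e0; apply: covS (H e e0) => q /= hq.
have hC : C * dist p q <= r / 2.
  apply: (@le_trans _ _ (C * (r / (2 * C)))); first by rewrite ler_wpM2l// ltW.
  by rewrite invfM mulrCA mulrA mulrACA mulfV ?mulr1// gt_eqF.
have [|dq [hd _]] := dist_good conn g dp (q := q); first by rewrite subrr normr0 add0r; lra.
by exists (coord i q); [rewrite /=; exact: le_trans hC|rewrite coordK].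
Qed.

(** Hopf-Rinow by a supremum over radii. The radii of totally bounded balls include their supremum,
    because a larger ball is within a small distance of a smaller one ([fat]). At the supremum the
    ball is compact, so it has a uniform totally bounded neighbourhood, which allows a larger
    radius. *)
Lemma ball_compact p (rho : R) : compact [set q | dist p q <= rho].
Proof.
apply: totally_compact; first exact: cball_closed.
apply: contrapT => nT.
pose S := [set t : R | totally [set q | dist p q <= t]].
have S0 : S 0.
  move=> e e0; apply: covS (cov_ball e p) => q /= h; exact: le_lt_trans e0.
have down (s t : R) : s <= t -> S t -> S s.
  move=> st St e e0; apply: covS (St e e0) => q /= h; exact: le_trans st.
have ub : ubound S rho.
  by move=> t St; rewrite leNgt; apply/negP => h; apply: nT; apply: down St; exact: ltW.
have hS : has_sup S by split; [exists 0|exists rho].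
pose s := sup S; have s0 : 0 <= s by apply: ub_le_sup => //; exists rho.
have fat (t d e : R) : t < d -> 0 < e -> forall q, dist p q <= d -> exists2 z, dist p z <= Num.max 0 t & dist z q <= d - t + e.
  move=> td e0 q hq; have d0 := dist_ge0 conn p q.
  case: (leP (dist p q) (Num.max 0 t)) => h.
    by exists q => //; rewrite (dist_refl conn); lra.
  have [|z [h1 h2]] := dist_split conn (t := Num.max 0 t) (p := p) (q := q) _ e0.
    by apply/andP; split; [rewrite le_max lexx|exact: ltW].
  exists z => //; apply: le_trans h2 _.
  have h3 : t <= Num.max 0 t by rewrite le_max lexx orbT.
  by move: h3; set q0 := Num.max 0 t; lra.
have Ss : S s.
  move=> e e0; have e4 : 0 < e / 4 by lra.
  have [t St tP] := sup_adherent e4 hS; rewrite -/s in tP.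
  have St' : S (Num.max 0 t) by rewrite /Num.max; case: ifP.
  have e2 : 0 < e / 2 by lra.
  have ee : e / 2 + e / 2 <= e by lra.
  apply: covS (cov_fat ee (St' _ e2)) => q /= hq.
  have [ts|ts] := leP s t.
    by exists q; [rewrite /= le_max (le_trans hq ts) orbT|rewrite (dist_refl conn) ltW].
  have [z h1 h2] := fat t s (e / 4) ts e4 q hq; exists z => //; lra.
have cB := totally_compact (@cball_closed p s) Ss.
have [d d0 hd] : exists2 d : R, 0 < d & totally [set q | exists2 z, dist p z <= s & dist z q <= d].
  apply: (@compact_ind _ _ (fun B => exists2 d : R, 0 < d & totally [set q | exists2 z, B z & dist z q <= d]) cB).
  - by exists 1 => // e e0; apply: covS (cov0 e) => q [].
  - move=> B C [d d0 hd] [d' d0' hd']; exists (Num.min d d'); first by rewrite lt_min d0.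
    move=> e e0; apply: covS (covU (hd e e0) (hd' e e0)) => q [z BC].
    by rewrite le_min => /andP[h1 h2]; case: BC => h; [left|right]; exists z.
  - move=> B C BC [d d0 hd]; exists d => // e e0; apply: covS (hd e e0) => q [z /BC Cz h].
    by exists z.
  - move=> x _; have [r r0 hr] := locally_totally x.
    have r2 : 0 < r / 2 by lra.
    exists [set q | dist x q < r / 2]; first exact: nbhs_dist.
    exists (r / 2) => // e e0; apply: covS (hr e e0) => q [z /= h1 h2].
    by have := dist_triangle conn z x q; lra.
have : S (s + d / 2).
  move=> e e0; apply: covS (hd e e0) => q /= hq.
  have d4 : 0 < d / 2 by lra.
  have sd : s < s + d / 2 by lra.
  have [z h1 h2] := fat s (s + d / 2) (d / 2) sd d4 q hq; exists z; last lra.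
  by move: h1; rewrite max_r.
by move=> /(@ub_le_sup R S (ex_intro _ rho ub)); rewrite -/s => h; lra.
Qed.

(** Minimizing the distance to [q] on the compact ball of radius [t] gives an exact intermediate
    point. These points play the role of the points of a minimizing geodesic. *)
Lemma dist_mid p q (t : R) : 0 <= t <= dist p q -> exists z, dist p z = t /\ dist z q = dist p q - t.
Proof.
move=> t01; have t0 : 0 <= t by case/andP: t01.
have [||z /= hz hmin] := @compact_argmin _ R _ (dist q) (@ball_compact p t).
- by exists p; rewrite /= (dist_refl conn).
- by move=> x _; exact: dist_continuous.
have h2 : dist q z <= dist p q - t.
  apply/ler_addgt0Pr => e e0; have [w [h1 h2]] := dist_split conn t01 e0.
  by apply: le_trans (hmin w h1) _; rewrite dist_sym.
have := dist_triangle conn z p q; rewrite (dist_sym z) => h3.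
by exists z; rewrite (dist_sym z); split; apply/eqP; rewrite eq_le; apply/andP; split; lra.
Qed.
End HopfRinow.

(** * Second-order expansion of a displacement step *)

Section Jets.
Variables (R : realType).

Lemma norm_leD (V : normedModType R) (v w : V) (a b : R) : `|v| <= a -> `|w| <= b -> `|v + w| <= a + b.
Proof. by move=> h1 h2; apply: le_trans (ler_normD _ _) _; exact: lerD. Qed.
Lemma norm_leB (V : normedModType R) (v w : V) (a b : R) : `|v| <= a -> `|w| <= b -> `|v - w| <= a + b.
Proof. by move=> h1 h2; apply: norm_leD => //; rewrite normrN. Qed.
Lemma norm_leZ (V : normedModType R) (v : V) (k a b : R) : `|k| <= a -> `|v| <= b -> `|k *: v| <= a * b.
Proof. by move=> h1 h2; rewrite normrZ; apply: ler_pM. Qed.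

Lemma expr_bound (s a N : R) (k : nat) : 0 <= s <= 1 -> (3 <= k)%N -> `|a| <= N ->
  - (N * s ^+ 3) <= s ^+ k * a <= N * s ^+ 3.
Proof.
move=> /andP[s0 s1] k3 aN; rewrite -ler_norml normrM (ger0_norm (exprn_ge0 k s0)) mulrC.
apply: ler_pM => //; first exact: exprn_ge0.
by rewrite -(subnK k3) exprD ler_piMl ?exprn_ge0// exprn_ile1.
Qed.

(* The remainder collects the 64 - 10 monomials of degree at least 3 in [s]. *)
Lemma quad_expand (d : nat) (A A0 A1 A2 A3 : 'M[R]_d) (D u w b r : 'rV[R]_d) (s B : R) :
  0 <= s <= 1 -> A = A0 + s *: A1 + s ^+ 2 *: A2 + s ^+ 3 *: A3 ->
  D = u + s *: w + s ^+ 2 *: b + s ^+ 3 *: r ->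
  A0^T = A0 -> A1^T = A1 ->
  (forall i j, [/\ `|A0 i j| <= B, `|A1 i j| <= B, `|A2 i j| <= B & `|A3 i j| <= B]) ->
  `|u| <= B -> `|w| <= B -> `|b| <= B -> `|r| <= B ->
  `|bil A D D - (bil A0 u u + s * (2 * bil A0 u w + bil A1 u u)
     + s ^+ 2 * (bil A0 w w + 2 * bil A0 u b + 2 * bil A1 u w + bil A2 u u))|
  <= 64 * (d%:R * d%:R * B ^+ 3) * s ^+ 3.
Proof.
move=> s01 -> ED sA0 sA1 HA hu hw hb hr.
have B0 : 0 <= B by apply: le_trans hu.
pose N := d%:R * d%:R * B ^+ 3.
have bd (X : 'M[R]_d) (y z : 'rV[R]_d) : (forall i j, `|X i j| <= B) -> `|y| <= B -> `|z| <= B -> `|bil X y z| <= N.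
  move=> hX hy hz; apply: le_trans (bil_bound y z B0 hX) _.
  rewrite /N !exprS expr0 mulr1 -!mulrA; do 2 (apply: ler_wpM2l => //); apply: ler_wpM2l => //.
  exact: ler_pM.
have h0 i j : `|A0 i j| <= B by have [] := HA i j.
have h1 i j : `|A1 i j| <= B by have [] := HA i j.
have h2 i j : `|A2 i j| <= B by have [] := HA i j.
have h3 i j : `|A3 i j| <= B by have [] := HA i j.
have sy (X : 'M[R]_d) y z : X^T = X -> bil X y z = bil X z y by move=> sX; rewrite -bilT sX.
have E (X : 'M[R]_d) : bil X D D
  = bil X u u + s * (bil X u w + bil X w u) + s ^+ 2 * (bil X w w + bil X u b + bil X b u)
    + s ^+ 3 * bil X u r + s ^+ 3 * bil X r u + s ^+ 3 * bil X w b + s ^+ 3 * bil X b w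
    + s ^+ 4 * bil X w r + s ^+ 4 * bil X r w + s ^+ 4 * bil X b b
    + s ^+ 5 * bil X b r + s ^+ 5 * bil X r b + s ^+ 6 * bil X r r.
  by rewrite ED !(bilDl, bilDr) !(bilZl, bilZr); ring.
have T (X : 'M[R]_d) y z k : (3 <= k)%N -> (forall i j, `|X i j| <= B) -> `|y| <= B -> `|z| <= B ->
   - (N * s ^+ 3) <= s ^+ k * bil X y z <= N * s ^+ 3.
  by move=> k3 hX hy hz; apply: expr_bound => //; exact: bd.
have S3 (X : 'M[R]_d) : (forall i j, `|X i j| <= B) ->
   `|bil X D D
    - (bil X u u + s * (bil X u w + bil X w u) + s ^+ 2 * (bil X w w + bil X u b + bil X b u))| <= 10 * (N * s ^+ 3).
  move=> hX; rewrite E ler_norml.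
  move: (T X u r 3 isT hX hu hr) (T X r u 3 isT hX hr hu) (T X w b 3 isT hX hw hb) (T X b w 3 isT hX hb hw)
    (T X w r 4 isT hX hw hr) (T X r w 4 isT hX hr hw) (T X b b 4 isT hX hb hb)
    (T X b r 5 isT hX hb hr) (T X r b 5 isT hX hr hb) (T X r r 6 isT hX hr hr).
  set t0 := bil X u u + _ + _.
  do 10 (set t := _ * bil X _ _; move: t => ?).
  by clear; do 10 (move=> /andP[? ?]); apply/andP; split; lra.
have := S3 A0 h0; have := S3 A1 h1; have := S3 A2 h2.
rewrite !ler_norml (sy A0 w u sA0) (sy A0 b u sA0) (sy A1 w u sA1) => s2 s1' s0'.
have d3 : `|bil A3 D D| <= 16 * N.
  rewrite E; have K k X : `|X| <= N -> `|s ^+ k * X| <= N.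
    move=> hX; rewrite normrM; move: s01 => /andP[s0 s1].
    by rewrite (ger0_norm (exprn_ge0 k s0)); apply: le_trans hX; rewrite ler_piMl// exprn_ile1.
  have K1 X : `|X| <= N -> `|s * X| <= N by move=> /(K 1); rewrite expr1.
  rewrite !mulrDr.
  have := bd A3 u u h3 hu hu; have := K1 _ (bd A3 u w h3 hu hw); have := K1 _ (bd A3 w u h3 hw hu).
  have := K 2%N _ (bd A3 w w h3 hw hw); have := K 2%N _ (bd A3 u b h3 hu hb); have := K 2%N _ (bd A3 b u h3 hb hu).
  have := K 3%N _ (bd A3 u r h3 hu hr); have := K 3%N _ (bd A3 r u h3 hr hu).
  have := K 3%N _ (bd A3 w b h3 hw hb); have := K 3%N _ (bd A3 b w h3 hb hw).
  have := K 4%N _ (bd A3 w r h3 hw hr); have := K 4%N _ (bd A3 r w h3 hr hw); have := K 4%N _ (bd A3 b b h3 hb hb).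
  have := K 5%N _ (bd A3 b r h3 hb hr); have := K 5%N _ (bd A3 r b h3 hr hb); have := K 6%N _ (bd A3 r r h3 hr hr).
  rewrite !ler_norml; set t0 := bil A3 u u.
  do 15 (set t := _ * bil A3 _ _; move: t => ?).
  by move: t0 => ?; clear; do 16 (move=> /andP[? ?]); apply/andP; split; lra.
have N0 : 0 <= N by rewrite !mulr_ge0// exprn_ge0.
have s3 : 0 <= s ^+ 3 by rewrite exprn_ge0//; case/andP: s01.
have Ns : 0 <= N * s ^+ 3 by rewrite mulr_ge0.
have d3' : - (16 * (N * s ^+ 3)) <= s ^+ 3 * bil A3 D D <= 16 * (N * s ^+ 3).
  rewrite -ler_norml normrM (ger0_norm s3) mulrC mulrA; exact: ler_wpM2r.
have e2 : - (10 * (N * s ^+ 3)) <= s ^+ 2 * bil A2 D D - (s ^+ 2 * bil A2 u u + s ^+ 3 * (bil A2 u w + bil A2 w u) + s ^+ 4 * (bil A2 w w + bil A2 u b + bil A2 b u)) <= 10 * (N * s ^+ 3).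
  have -> : s ^+ 2 * bil A2 D D - (s ^+ 2 * bil A2 u u + s ^+ 3 * (bil A2 u w + bil A2 w u) + s ^+ 4 * (bil A2 w w + bil A2 u b + bil A2 b u))
     = s ^+ 2 * (bil A2 D D - (bil A2 u u + s * (bil A2 u w + bil A2 w u) + s ^+ 2 * (bil A2 w w + bil A2 u b + bil A2 b u))) by ring.
  rewrite -ler_norml normrM; move: s01 => /andP[s0 s1]; rewrite (ger0_norm (exprn_ge0 2 s0)).
  apply: (@le_trans _ _ (1 * (10 * (N * s ^+ 3)))); last by rewrite mul1r.
  by apply: ler_pM => //; [exact: exprn_ge0|exact: exprn_ile1|rewrite ler_norml].
have e1 : - (10 * (N * s ^+ 3)) <= s * bil A1 D D - (s * bil A1 u u + s ^+ 2 * (2 * bil A1 u w) + s ^+ 3 * (bil A1 w w + bil A1 u b + bil A1 b u)) <= 10 * (N * s ^+ 3).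
  have -> : s * bil A1 D D - (s * bil A1 u u + s ^+ 2 * (2 * bil A1 u w) + s ^+ 3 * (bil A1 w w + bil A1 u b + bil A1 b u))
     = s * (bil A1 D D - (bil A1 u u + s * (bil A1 u w + bil A1 u w) + s ^+ 2 * (bil A1 w w + bil A1 u b + bil A1 b u))) by ring.
  rewrite -ler_norml normrM; move: s01 => /andP[s0 s1]; rewrite (ger0_norm s0).
  apply: (@le_trans _ _ (1 * (10 * (N * s ^+ 3)))); last by rewrite mul1r.
  by apply: ler_pM => //; rewrite ler_norml.
have e0 : bil A0 D D - (bil A0 u u + s * (2 * bil A0 u w) + s ^+ 2 * (bil A0 w w + 2 * bil A0 u b))
   = bil A0 D D - (bil A0 u u + s * (bil A0 u w + bil A0 u w) + s ^+ 2 * (bil A0 w w + bil A0 u b + bil A0 u b)) by ring.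
rewrite -e0 in s0'.
have := T A2 u w 3 isT h2 hu hw; have := T A2 w u 3 isT h2 hw hu; have := T A2 w w 4 isT h2 hw hw.
have := T A2 u b 4 isT h2 hu hb; have := T A2 b u 4 isT h2 hb hu.
have := T A1 w w 3 isT h1 hw hw; have := T A1 u b 3 isT h1 hu hb; have := T A1 b u 3 isT h1 hb hu.
rewrite !bilDm !bilZm -/N; move: s0' e1 e2 d3' Ns.
move: (bil A0 D D) (bil A1 D D) (bil A2 D D) (bil A3 D D) (bil A0 u u) (bil A0 u w) (bil A0 u b) (bil A1 u w) (bil A1 u u)
  (bil A0 w w) (bil A2 u u) (bil A2 u w) (bil A2 w u) (bil A2 w w) (bil A2 u b) (bil A2 b u) (bil A1 w w) (bil A1 u b) (bil A1 b u).
clearbody N; clear; do 19 (move=> ?).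
by do 4 (move=> /andP[? ?]); move=> ?; do 8 (move=> /andP[? ?]); apply/andP; split; lra.
Qed.

Lemma dir2_expand (d : nat) (U : set 'rV[R]_d) h x z1 z2 (a b : R) : open U -> smooth U h -> U x ->
  'D_(a *: z1 + b *: z2) ('D_(a *: z1 + b *: z2) h) x =
  a * (a * 'D_z1 ('D_z1 h) x + b * 'D_z1 ('D_z2 h) x) + b * (a * 'D_z2 ('D_z1 h) x + b * 'D_z2 ('D_z2 h) x) :> R.
Proof.
move=> oU sh Ux.
have E v : 'D_v ('D_(a *: z1 + b *: z2) h) x = a * 'D_v ('D_z1 h) x + b * 'D_v ('D_z2 h) x :> R.
  have s1 := smooth_dir z1 oU sh; have s2 := smooth_dir z2 oU sh.
  apply: etrans; first by apply: (derive_ext (g := fun y => a * 'D_z1 h y + b * 'D_z2 h y) v oU Ux) => y Uy; exact: (smooth_dirDl a b z1 z2 oU sh Uy).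
  have d1 : derivable (fun y => a * 'D_z1 h y) x v by exact: (smooth_derivable (v := v) oU (smoothZ a oU s1) Ux).
  have d2 : derivable (fun y => b * 'D_z2 h y) x v by exact: (smooth_derivable (v := v) oU (smoothZ b oU s2) Ux).
  apply: etrans; first exact: (deriveD d1 d2).
  have d1' : derivable ('D_z1 h) x v by exact: (smooth_derivable (v := v) oU s1 Ux).
  have d2' : derivable ('D_z2 h) x v by exact: (smooth_derivable (v := v) oU s2 Ux).
  by apply: f_equal2; [exact: (deriveZ a d1')|exact: (deriveZ b d2')].
apply: etrans; first exact: (smooth_dirDl a b z1 z2 oU (smooth_dir (a *: z1 + b *: z2) oU sh) Ux).
by rewrite (E z1) (E z2).
Qed.

Lemma taylor_jet_calc (s H Dz D1 D2 D11 D12 D21 D22 Q X S : R) : `|H - Dz - 2^-1 * Q| <= X ->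
  Dz = s * D1 + s ^+ 2 * D2 -> Q = s * (s * D11 + s ^+ 2 * D12) + s ^+ 2 * (s * D21 + s ^+ 2 * D22) ->
  - S <= s ^+ 3 * D12 <= S -> - S <= s ^+ 3 * D21 <= S -> - S <= s ^+ 4 * D22 <= S ->
  `|H - s * D1 - s ^+ 2 * (D2 + 2^-1 * D11)| <= X + 2 * S.
Proof.
move=> hX eD eQ /andP[a1 a2] /andP[a3 a4] /andP[a5 a6]; rewrite eD eQ in hX.
have e : H - s * D1 - s ^+ 2 * (D2 + 2^-1 * D11) = (H - (s * D1 + s ^+ 2 * D2) - 2^-1 * (s * (s * D11 + s ^+ 2 * D12) + s ^+ 2 * (s * D21 + s ^+ 2 * D22)))
  + 2^-1 * (s ^+ 3 * D12 + s ^+ 3 * D21 + s ^+ 4 * D22) by ring.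
rewrite e; apply: le_trans (ler_normD _ _) _; apply: lerD => //.
by rewrite ler_norml; apply/andP; split; lra.
Qed.

(** Taylor expansion along a displacement with a first-order part [z1] and a second-order part [z2]:
    the latter contributes at order [s ^ 2] only through the first derivative. *)
Lemma taylor_jet (d : nat) (U : set 'rV[R]_d) h x0 (r C Z s : R) x z1 z2 : open U -> smooth U h ->
  controlled U h x0 r C -> `|x - x0| < r -> `|x + (s *: z1 + s ^+ 2 *: z2) - x0| < r ->
  `|z1| <= Z -> `|z2| <= Z -> 0 <= s <= 1 ->
  `|h (x + (s *: z1 + s ^+ 2 *: z2)) - h x - s * 'D_z1 h x
     - s ^+ 2 * ('D_z2 h x + 2^-1 * 'D_z1 ('D_z1 h) x)| <= C * (8 * Z ^+ 3 + 2 * Z ^+ 2) * s ^+ 3.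
Proof.
move=> oU sh K hx hz h1 h2 s01; have Ux := ctrl_U K hx.
have [s0 s1] : 0 <= s /\ s <= 1 by case/andP: s01.
have Z0 : 0 <= Z by apply: le_trans h1. have C0 := ctrl_C K.
have T := taylor_3 K hx hz.
have E1 := smooth_dirDl s (s ^+ 2) z1 z2 oU sh Ux.
have E2 := dir2_expand z1 z2 s (s ^+ 2) oU sh Ux.
have b12 := ctrl_2 K z1 z2 hx; have b21 := ctrl_2 K z2 z1 hx; have b22 := ctrl_2 K z2 z2 hx.
have ZZ (a b : 'rV[R]_d) : `|a| <= Z -> `|b| <= Z -> C * `|a| * `|b| <= C * Z ^+ 2.
  by move=> ha hb; rewrite -mulrA ler_wpM2l// expr2; exact: ler_pM.
have c12 := le_trans b12 (ZZ _ _ h1 h2); have c21 := le_trans b21 (ZZ _ _ h2 h1); have c22 := le_trans b22 (ZZ _ _ h2 h2).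
have nz : `|s *: z1 + s ^+ 2 *: z2| <= 2 * Z * s.
  have k1 : `|s *: z1| <= s * Z by apply: norm_leZ => //; rewrite ger0_norm.
  have k2 : `|s ^+ 2 *: z2| <= s * Z.
    apply: norm_leZ => //; rewrite ger0_norm ?exprn_ge0// expr2; exact: ler_piMl.
  apply: le_trans (norm_leD k1 k2) _; have -> : s * Z + s * Z = 2 * Z * s by ring.
  exact: lexx.
have cub : C * `|s *: z1 + s ^+ 2 *: z2| ^+ 3 <= C * (8 * Z ^+ 3) * s ^+ 3.
  rewrite -mulrA ler_wpM2l//; have -> : 8 * Z ^+ 3 * s ^+ 3 = (2 * Z * s) ^+ 3 by ring.
  by apply: lerXn2r => //; rewrite nnegrE// !mulr_ge0.
have q1 := expr_bound (k := 3) s01 isT c12; have q2 := expr_bound (k := 3) s01 isT c21.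
have q3 := expr_bound (k := 4) s01 isT c22.
apply: le_trans (@taylor_jet_calc s _ _ _ _ _ _ _ _ _ _ _ T E1 E2 q1 q2 q3) _.
have -> : C * (8 * Z ^+ 3 + 2 * Z ^+ 2) * s ^+ 3 = C * (8 * Z ^+ 3) * s ^+ 3 + 2 * (C * Z ^+ 2 * s ^+ 3) by ring.
by rewrite lerD2r.
Qed.
End Jets.

Section VectorIdentity.
Variables (R : realType) (d : nat).

(** The chord between two displaced points, divided by [t] and sorted by powers of [s]. The terms
    still containing [t] are put in the last coefficient, bounded because it carries the factor
    [t / s ^ 3]. *)
Lemma step_vector (x u e G psi V dV rho V' : 'rV[R]_d) (phi kap nu s t : R) : s != 0 -> t != 0 ->
  V' = V + t *: dV + t ^+ 2 *: rho ->
  t^-1 *: ((x + t *: u + (s *: ((phi + kap * t) *: (e - t *: G))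
      + s ^+ 2 *: ((phi + kap * t) ^+ 2 *: (psi - nu *: V'))))
    - (x + (s *: (phi *: e) + s ^+ 2 *: (phi ^+ 2 *: (psi - nu *: V)))))
  = u + s *: (kap *: e - phi *: G)
    + s ^+ 2 *: ((2 * phi * kap) *: (psi - nu *: V) - (phi ^+ 2 * nu) *: dV)
    + s ^+ 3 *: ((t / s ^+ 3) *: (s ^+ 2 *: (kap ^+ 2 *: (psi - nu *: V')
        - (2 * phi * kap * nu) *: (dV + t *: rho) - (phi ^+ 2 * nu) *: rho) - (s * kap) *: G)).
Proof.
by move=> s0 t0 ->; apply/rowP => a; rewrite !mxE; field; rewrite s0 t0.
Qed.
Lemma row_sub3 (a b c : 'rV[R]_d) (t : R) k : (a - b - t *: c) 0 k = a 0 k - b 0 k - t * c 0 k.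
Proof. by rewrite !mxE. Qed.
Lemma mx_sub4 (a b c e : 'M[R]_d) (s t : R) i k :
  (a - b - s *: c - t *: e) i k = a i k - b i k - s * c i k - t * e i k.
Proof. by rewrite !mxE. Qed.
(** The crude common bound [W] dominates all coefficients occurring in [step_quad]; the factor 100
    is not optimized. *)
Lemma W_facts (B n2 : R) (W := 100 * (n2 + 1) * B ^+ 4) : 1 <= B -> 0 <= n2 ->
  [/\ B <= W, B ^+ 2 <= W, 2 * B ^+ 2 + B ^+ 3 <= W, 64 * B ^+ 4 + 8 * B ^+ 3 <= W &
   [/\ 2 * B + n2 * B ^+ 3 <= W, 8 * B + B ^+ 2 <= W &
     8 * B + 4 * (B ^+ 2 + B ^+ 3) + B ^+ 3 + 2 * (n2 * B ^+ 3) <= W]].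
Proof.
move=> B1 n20; have B0 : 0 <= B by apply: le_trans B1.
have p k : B ^+ k <= B ^+ k.+1 by rewrite exprS ler_peMl// exprn_ge0.
have p1 := p 1%N; have p2 := p 2%N; have p3 := p 3%N; rewrite expr1 in p1.
have q3 : n2 * B ^+ 3 <= n2 * B ^+ 4 by rewrite ler_wpM2l.
have q30 : 0 <= n2 * B ^+ 3 by rewrite mulr_ge0// exprn_ge0.
have EW : W = 100 * (n2 * B ^+ 4) + 100 * B ^+ 4 by rewrite /W; ring.
by rewrite EW; split; [lra|lra|lra|lra|split; lra].
Qed.
Lemma mx_addZ (a b : 'M[R]_d) (t : R) i k : (a + t *: b) i k = a i k + t * b i k.
Proof. by rewrite !mxE. Qed.
Lemma mx_remainder (a b c e : 'M[R]_d) (s t k : R) : k != 0 ->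
  a = b + s *: c + t *: e + k *: (k^-1 *: (a - b - s *: c - t *: e)).
Proof. by move=> k0; apply/matrixP => i j; rewrite !mxE; field. Qed.
End VectorIdentity.

(** * The squared length of a displaced step to second order *)

Section Step.
Variables (R : realType) (m : nat) (U : set 'rV[R]_(m + m)) (g : 'rV[R]_(m + m) -> 'M[R]_(m + m))
  (h : 'rV[R]_(m + m) -> R).
Local Notation n := (m + m)%N.
Local Notation J := (Jstd R m).
Hypothesis kc : kahler_chart U g.
Hypothesis sh : smooth U h.
Let oU := kc_open kc.
Let V := gradV g h.
(** This is [1 / (2 n)]. Each of the [4 n] displaced points drifts by [- nuc] times the gradient, at
    order [s ^ 2]; the total weight is 2. *)
Definition nuc : R := (n.*2)%:R^-1.

Record nice x0 (r B : R) : Prop := Nice {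
  nc_r : 0 < r; nc_B : 1 <= B; nc_U : forall y, `|y - x0| < r -> U y;
  nc_g : forall a b, controlled U (fun y => g y a b) x0 r B;
  nc_gi : forall a b, controlled U (fun y => invmx (g y) a b) x0 r B;
  nc_G : forall k i j, controlled U (christoffel g k i j) x0 r B;
  nc_V : forall k, controlled U (fun y => gradV g h y 0 k) x0 r B }.

Lemma nice_ex x0 : U x0 -> exists r B, nice x0 r B.
Proof.
move=> Ux.
have [r1 [B1 [r10 B10 HU H1]]] := controlled_all (F := fun ab : 'I_n * 'I_n => fun y => g y ab.1 ab.2) oU Ux
  (fun ab => kc_smooth kc ab.1 ab.2).
have [r2 [B2 [r20 B20 _ H2]]] := controlled_all (F := fun ab : 'I_n * 'I_n => fun y => invmx (g y) ab.1 ab.2) oU Ux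
  (fun ab => smooth_ginv kc ab.1 ab.2).
have [r3 [B3 [r30 B30 _ H3]]] := controlled_all (F := fun ab : 'I_n * 'I_n * 'I_n => christoffel g ab.1.1 ab.1.2 ab.2) oU Ux
  (fun ab => smooth_christoffel kc ab.1.1 ab.1.2 ab.2).
have [r4 [B4 [r40 B40 _ H4]]] := controlled_all (F := fun k : 'I_n => fun y => gradV g h y 0 k) oU Ux
  (fun k => smx_gradV kc sh 0 k).
pose r := Num.min (Num.min r1 r2) (Num.min r3 r4); pose B := 1 + B1 + B2 + B3 + B4.
have r0 : 0 < r by rewrite !lt_min r10 r20 r30.
have l1 : r <= r1 by rewrite !ge_min lexx.
have l2 : r <= r2 by rewrite !ge_min lexx !orbT.
have l3 : r <= r3 by rewrite !ge_min lexx !orbT.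
have l4 : r <= r4 by rewrite !ge_min lexx !orbT.
exists r, B; split=> //.
- by rewrite /B; lra.
- by move=> y hy; apply: HU; exact: lt_le_trans l1.
- by move=> a b; apply: (controlled_le (H1 (a, b)) r0 l1); rewrite /B; lra.
- by move=> a b; apply: (controlled_le (H2 (a, b)) r0 l2); rewrite /B; lra.
- by move=> k i j; apply: (controlled_le (H3 (k, i, j)) r0 l3); rewrite /B; lra.
- by move=> k; apply: (controlled_le (H4 k) r0 l4); rewrite /B; lra.
Qed.

(** [phi] is the profile of the variation along the path, and [psi] a second-order coordinate
    correction. Both second-order terms carry [phi ^ 2], so they vanish where the variation does. *)
Definition pt x (phi s : R) e psi : 'rV[R]_n :=
  x + (s *: (phi *: e) + s ^+ 2 *: (phi ^+ 2 *: (psi - nuc *: V x))).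

(** [stepw] and [stepb] are the coefficients of [s] and [s ^ 2] in the rescaled chord, [stepA2] the
    coefficient of [s ^ 2] in the metric at the displaced point, and [step1], [step2] those of the
    squared length. [stepw] has the form of a parallel field scaled by a profile with slope
    [kap]. *)
Definition stepw x u (phi kap : R) e := kap *: e - phi *: Gam g x u e.
Definition stepb x u (phi kap : R) psi :=
  (2 * phi * kap) *: (psi - nuc *: V x) - (phi ^+ 2 * nuc) *: dM V x u.
Definition stepA2 x (phi : R) e psi :=
  dM g x (phi ^+ 2 *: (psi - nuc *: V x)) + 2^-1 *: d2g g x (phi *: e) (phi *: e).
Definition step1 x u phi kap e : R := 2 * bil (g x) u (stepw x u phi kap e) + bil (dM g x (phi *: e)) u u.
Definition step2 x u phi kap e psi : R :=
  bil (g x) (stepw x u phi kap e) (stepw x u phi kap e) + 2 * bil (g x) u (stepb x u phi kap psi)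
  + 2 * bil (dM g x (phi *: e)) u (stepw x u phi kap e) + bil (stepA2 x phi e psi) u u.

Lemma nuc_bound : `|nuc| <= 1.
Proof.
rewrite /nuc; case: (n.*2) => [|k]; first by rewrite invr0 normr0.
by rewrite ger0_norm ?invr_ge0// invf_le1 ?ltr0Sn// ler1n.
Qed.

Lemma Gam_bound x u e (B : R) : 0 <= B -> (forall k i j, `|christoffel g k i j x| <= B) ->
  `|Gam g x u e| <= n%:R * n%:R * (`|u| * `|e| * B).
Proof.
move=> B0 H; apply: normv_le => [|k]; first by rewrite !mulr_ge0.
rewrite GamE_sum; apply: le_trans (ler_norm_sum _ _ _) _.
apply: (@le_trans _ _ (\sum_(p : 'I_n * 'I_n) (`|u| * `|e| * B))).
  apply: ler_sum => p _; rewrite normrM; apply: ler_pM; [by []|by []| |exact: H].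
  by rewrite normrM; apply: ler_pM => //; exact: normv_coord.
by rewrite sumr_const card_prod card_ord -natrM mulr_natl.
Qed.

Lemma dM_g_sym x z : U x -> (dM g x z)^T = dM g x z.
Proof.
move=> Ux; apply/matrixP => a b; rewrite mxE !dME.
by apply: (derive_ext z oU Ux) => y Uy; have [gs _] := kc_posdef kc Uy; have := congr1 (fun A : 'M[R]_n => A b a) gs; rewrite mxE.
Qed.

Lemma d2gE x z a b : d2g g x z z a b = 'D_z ('D_z (fun y => g y a b)) x.
Proof.
rewrite /d2g dME; congr ('D_z _ x); apply/funext => y; exact: dME.
Qed.

(** The chord expansion [step_vector] and the expansion of the metric at the displaced point are fed
    into [quad_expand]. The condition [t <= s ^ 3] sends all the effects of the finite step into the
    remainder. *)
Lemma step_quad x0 r B : nice x0 r B -> exists2 K : R, 0 <= K & forall x u e psi (phi kap s t : R),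
  `|x - x0| < r -> `|x + t *: u - x0| < r -> `|pt x phi s e psi - x0| < r ->
  `|u| <= B -> `|e| <= B -> `|psi| <= B -> `|phi| <= 1 -> `|kap| <= 2 -> 0 < s -> s <= 1 -> 0 < t -> t <= s ^+ 3 ->
  let D := t^-1 *: (pt (x + t *: u) (phi + kap * t) s (e - t *: Gam g x u e) psi - pt x phi s e psi) in
  `|D| <= K /\
  `|bil (g (pt x phi s e psi)) D D - (bil (g x) u u + s * step1 x u phi kap e + s ^+ 2 * step2 x u phi kap e psi)| <= K * s ^+ 3.
Proof.
move=> N; have B1 := nc_B N; have B0 : 0 <= B by apply: le_trans B1.
pose n2 : R := n%:R * n%:R; have n20 : 0 <= n2 by rewrite mulr_ge0.
pose W := 100 * (n2 + 1) * B ^+ 4.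
have W0 : 0 <= W by rewrite !mulr_ge0// ?addr_ge0// exprn_ge0.
exists (64 * (n%:R * n%:R * W ^+ 3) + 4 * W).
  by apply: addr_ge0; apply: mulr_ge0 => //; exact: (mulr_ge0 n20 (exprn_ge0 3 W0)).
move=> x u e psi phi kap s t hx hxt hP hu he hpsi hphi hkap s0 s1 t0 ts D.
have Ux := nc_U N hx.
set P := pt x phi s e psi in hP D *.
set G := Gam g x u e in D *.
have hG : `|G| <= n2 * B ^+ 3.
  apply: le_trans (Gam_bound u e B0 (fun k i j => ctrl_0 (nc_G N k i j) hx)) _.
  rewrite -/n2 ler_wpM2l// !exprS expr0 mulr1 mulrA; apply: ler_pM => //.
  exact: ler_pM.
have hV y : `|y - x0| < r -> `|V y| <= B.
  by move=> hy; apply: normv_le => // k; exact: (ctrl_0 (nc_V N k) hy).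
pose dV := dM V x u.
have hdV : `|dV| <= B ^+ 2.
  apply: normv_le => [|k]; first exact: exprn_ge0.
  rewrite dME; apply: le_trans (ctrl_1 (nc_V N k) u hx) _.
  by rewrite expr2 ler_wpM2l.
pose V' := V (x + t *: u).
pose rho := (t ^+ 2)^-1 *: (V' - V x - t *: dV).
have t20 : t ^+ 2 != 0 by rewrite expf_neq0// gt_eqF.
have hrho : `|rho| <= B ^+ 3.
  rewrite /rho normrZ ger0_norm ?invr_ge0 ?exprn_ge0 ?(ltW t0)// mulrC ler_pdivrMr ?exprn_gt0//.
  apply: normv_le => [|k]; first by rewrite mulr_ge0// exprn_ge0// ltW.
  have T := taylor_2 (nc_V N k) hx hxt.
  have E : 'D_(t *: u) (fun y => gradV g h y 0 k) x = t * 'D_u (fun y => gradV g h y 0 k) x :> R.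
    exact: (smooth_dirZ t u oU (smx_gradV kc sh 0 k) Ux).
  have -> : (V' - V x - t *: dV) 0 k = gradV g h (x + t *: u) 0 k - gradV g h x 0 k - t * 'D_u (fun y => gradV g h y 0 k) x.
    by rewrite row_sub3 dME.
  rewrite -E; apply: le_trans T _; rewrite normrZ (ger0_norm (ltW t0)) exprMn.
  have -> : B ^+ 3 * t ^+ 2 = B * (t ^+ 2 * B ^+ 2) by ring.
  apply: ler_wpM2l => //; apply: ler_wpM2l; first by rewrite exprn_ge0// ltW.
  by apply: lerXn2r => //; rewrite nnegrE.
have EV' : V' = V x + t *: dV + t ^+ 2 *: rho.
  by rewrite /rho scalerA mulfV// scale1r -[V' - V x - _]addrA -opprD [RHS]addrC subrK.
have nu1 := nuc_bound.
have one : `|1 : R| <= 1 by rewrite normr1.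
have mul1 (a b : R) : `|a| <= 1 -> `|b| <= 1 -> `|a * b| <= 1.
  by move=> ha hb; rewrite normrM -(mulr1 1); exact: ler_pM.
have two (a : R) : `|a| <= 1 -> `|2 * a| <= 2 by move=> ha; rewrite normrM ger0_norm// ler_piMr.
have s1n : `|s| <= 1 by rewrite ger0_norm// ltW.
have t1 : t <= 1 by apply: le_trans ts _; rewrite exprn_ile1// ltW.
have t1n : `|t| <= 1 by rewrite ger0_norm ?(ltW t0).
have tsn : `|t / s ^+ 3| <= 1.
  rewrite ger0_norm; last by rewrite divr_ge0 ?exprn_ge0 ?(ltW t0) ?(ltW s0).
  by rewrite ler_pdivrMr ?exprn_gt0// mul1r.
have sq (a : R) : `|a| <= 1 -> `|a ^+ 2| <= 1 by move=> ha; rewrite expr2; exact: mul1.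
have hc y : `|y - x0| < r -> `|psi - nuc *: V y| <= 2 * B.
  by move=> hy; have := norm_leB hpsi (norm_leZ nu1 (hV y hy)); rewrite mul1r; lra.
pose w := stepw x u phi kap e; pose b := stepb x u phi kap psi.
have hw : `|w| <= 2 * B + n2 * B ^+ 3.
  by have := norm_leB (norm_leZ hkap he) (norm_leZ hphi hG); rewrite !mul1r.
have mul2 (a c : R) : `|a| <= 1 -> `|c| <= 2 -> `|a * c| <= 2.
  by move=> ha hb; rewrite normrM -[X in _ <= X]mul1r; exact: ler_pM.
have tpk : `|2 * phi * kap| <= 4.
  rewrite -mulrA normrM ger0_norm//; have := mul2 _ _ hphi hkap; lra.
have pn : `|phi ^+ 2 * nuc| <= 1 by apply: mul1 => //; exact: sq.
have hb : `|b| <= 8 * B + B ^+ 2.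
  have := norm_leB (norm_leZ tpk (hc x hx)) (norm_leZ pn hdV); rewrite mul1r => h1.
  by apply: le_trans h1 _; lra.
pose rest := kap ^+ 2 *: (psi - nuc *: V') - (2 * phi * kap * nuc) *: (dV + t *: rho) - (phi ^+ 2 * nuc) *: rho.
have hrest : `|rest| <= 8 * B + 4 * (B ^+ 2 + B ^+ 3) + B ^+ 3.
  have tpkn : `|2 * phi * kap * nuc| <= 4.
    by rewrite normrM -[X in _ <= X]mulr1; exact: ler_pM.
  have sk : `|kap ^+ 2| <= 4.
    rewrite normrX expr2; have h4 := ler_pM (normr_ge0 kap) (normr_ge0 kap) hkap hkap.
    by apply: le_trans h4 _; lra.
  have h1 := norm_leZ sk (hc _ hxt).
  have h2 := norm_leZ tpkn (norm_leD hdV (norm_leZ t1n hrho)).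
  have h3 := norm_leZ pn hrho.
  have := norm_leB (norm_leB h1 h2) h3; rewrite !mul1r.
  by have -> : 4 * (2 * B) = 8 * B by ring.
pose r' := (t / s ^+ 3) *: (s ^+ 2 *: rest - (s * kap) *: G).
have hr' : `|r'| <= 8 * B + 4 * (B ^+ 2 + B ^+ 3) + B ^+ 3 + 2 * (n2 * B ^+ 3).
  have h1 := norm_leB (norm_leZ (sq s s1n) hrest) (norm_leZ (mul2 _ _ s1n hkap) hG).
  by have := norm_leZ tsn h1; rewrite !mul1r.
have ED : D = u + s *: w + s ^+ 2 *: b + s ^+ 3 *: r'.
  by apply: step_vector => //; rewrite gt_eqF.
pose z1 := phi *: e; pose z2 := phi ^+ 2 *: (psi - nuc *: V x).
have hz1' : `|z1| <= B by have := norm_leZ hphi he; rewrite mul1r.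
have hz1 : `|z1| <= 2 * B by apply: le_trans hz1' _; rewrite ler_peMl// ler1n.
have hz2 : `|z2| <= 2 * B by have := norm_leZ (sq phi hphi) (hc x hx); rewrite mul1r.
pose A3 := (s ^+ 3)^-1 *: (g P - g x - s *: dM g x z1 - s ^+ 2 *: stepA2 x phi e psi).
have s30 : s ^+ 3 != 0 by rewrite expf_neq0// gt_eqF.
have EA : g P = g x + s *: dM g x z1 + s ^+ 2 *: stepA2 x phi e psi + s ^+ 3 *: A3.
  exact: mx_remainder.
have HA a c : [/\ `|g x a c| <= W, `|dM g x z1 a c| <= W, `|stepA2 x phi e psi a c| <= W & `|A3 a c| <= W].
  have b0 := ctrl_0 (nc_g N a c) hx; have b1 := ctrl_1 (nc_g N a c) z1 hx; have b2 := ctrl_1 (nc_g N a c) z2 hx.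
  have b3 := ctrl_2 (nc_g N a c) z1 z1 hx.
  have E2 : stepA2 x phi e psi a c = 'D_z2 (fun y => g y a c) x + 2^-1 * 'D_z1 ('D_z1 (fun y => g y a c)) x.
    by rewrite /stepA2 mx_addZ dME d2gE.
  have T := taylor_jet oU (kc_smooth kc a c) (nc_g N a c) hx hP hz1 hz2 (s := s).
  have c1 : `|dM g x z1 a c| <= B ^+ 2.
    by rewrite dME; apply: le_trans b1 _; rewrite expr2 ler_wpM2l.
  have c2 : `|stepA2 x phi e psi a c| <= 2 * B ^+ 2 + B ^+ 3.
    rewrite E2; apply: norm_leD.
      apply: (le_trans b2); have -> : 2 * B ^+ 2 = B * (2 * B) by ring.
      by rewrite ler_wpM2l.
    rewrite normrM ger0_norm ?invr_ge0//; apply: (@le_trans _ _ (1 * B ^+ 3)); last by rewrite mul1r.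
    apply: ler_pM; [by rewrite invr_ge0|by []|by rewrite invf_le1// ler1n|].
    apply: le_trans b3 _; rewrite !exprS expr0 mulr1 -mulrA ler_wpM2l//; exact: ler_pM.
  have c3 : `|A3 a c| <= B * (8 * (2 * B) ^+ 3 + 2 * (2 * B) ^+ 2).
    rewrite /A3 mxE normrM ger0_norm ?invr_ge0 ?exprn_ge0 ?(ltW s0)// mulrC ler_pdivrMr ?exprn_gt0//.
    have s01 : 0 <= s <= 1 by rewrite ltW.
    have := T s01; have -> : (g P - g x - s *: dM g x z1 - s ^+ 2 *: stepA2 x phi e psi) a c =
      g P a c - g x a c - s * 'D_z1 (fun y => g y a c) x - s ^+ 2 * stepA2 x phi e psi a c.
      by rewrite mx_sub4 dME.
    by rewrite E2.
  have e3 : B * (8 * (2 * B) ^+ 3 + 2 * (2 * B) ^+ 2) = 64 * B ^+ 4 + 8 * B ^+ 3 by ring.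
  rewrite e3 in c3.
  split; [apply: le_trans b0 _|apply: le_trans c1 _|apply: le_trans c2 _|apply: le_trans c3 _];
    by have [? ? ? ? [? ? ?]] := W_facts B1 n20.
have Wu : `|u| <= W by apply: le_trans hu _; by have [? ? ? ? [? ? ?]] := W_facts B1 n20.
have Ww : `|w| <= W by apply: le_trans hw _; by have [? ? ? ? [? ? ?]] := W_facts B1 n20.
have Wb : `|b| <= W by apply: le_trans hb _; by have [? ? ? ? [? ? ?]] := W_facts B1 n20.
have Wr : `|r'| <= W by apply: le_trans hr' _; by have [? ? ? ? [? ? ?]] := W_facts B1 n20.
have K1 : 0 <= 64 * (n%:R * n%:R * W ^+ 3) by apply: mulr_ge0 => //; exact: (mulr_ge0 n20 (exprn_ge0 3 W0)).
split.
  have c1 : `|s ^+ 2| <= 1 by exact: sq.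
  have c3 : `|s ^+ 3| <= 1 by rewrite exprS; exact: mul1.
  have := norm_leD (norm_leD (norm_leD Wu (norm_leZ s1n Ww)) (norm_leZ c1 Wb)) (norm_leZ c3 Wr).
  rewrite -ED !mul1r => h1; apply: le_trans h1 _.
  have -> : W + W + W + W = 4 * W by ring.
  by rewrite lerDr.
have s01 : 0 <= s <= 1 by rewrite ltW.
have [gs _] := kc_posdef kc Ux.
have := quad_expand s01 EA ED gs (dM_g_sym z1 Ux) HA Wu Ww Wb Wr.
move=> h1; apply: le_trans h1 _; apply: ler_wpM2r; first by rewrite exprn_ge0// ltW.
by rewrite lerDl mulr_ge0.
Qed.
End Step.

Section Generic.
Variables (R : realType) (d : nat).
Lemma step2_calc (kap phi nu ee Ge GG Tw q v w Tq Gv D1 D2 : R) :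
  kap ^+ 2 * ee - 2 * kap * phi * Ge + phi ^+ 2 * GG + 2 * (2 * phi * kap * (q - nu * v) - phi ^+ 2 * nu * w)
  + 2 * (phi * Tw) + (phi ^+ 2 * (Tq - nu * (2 * Gv)) + 2^-1 * (phi ^+ 2 * D1)) + 0 * 0 +
  (kap ^+ 2 * ee - 2 * kap * phi * Ge + phi ^+ 2 * GG + 2 * (2 * phi * kap * (- q - nu * v) - phi ^+ 2 * nu * w)
  + 2 * (phi * (2 * (kap * Ge - phi * GG) - Tw)) + (phi ^+ 2 * (- Tq - nu * (2 * Gv)) + 2^-1 * (phi ^+ 2 * D2)) + 0 * 0) +
  (kap ^+ 2 * ee - 2 * kap * phi * Ge + phi ^+ 2 * GG + 2 * (2 * phi * kap * (q - nu * v) - phi ^+ 2 * nu * w)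
  + 2 * (phi * Tw) + (phi ^+ 2 * (Tq - nu * (2 * Gv)) + 2^-1 * (phi ^+ 2 * D1)) + 0 * 0) +
  (kap ^+ 2 * ee - 2 * kap * phi * Ge + phi ^+ 2 * GG + 2 * (2 * phi * kap * (- q - nu * v) - phi ^+ 2 * nu * w)
  + 2 * (phi * (2 * (kap * Ge - phi * GG) - Tw)) + (phi ^+ 2 * (- Tq - nu * (2 * Gv)) + 2^-1 * (phi ^+ 2 * D2)) + 0 * 0) =
  4 * kap ^+ 2 * ee - 4 * phi ^+ 2 * (GG - 4^-1 * (D1 + D2)) - 8 * nu * (2 * phi * kap * v + phi ^+ 2 * (w + Gv)).
Proof. by field. Qed.
Lemma quadN (a b : R) : a + b + - a + - b = 0. Proof. by ring. Qed.
Lemma mxZE (A : 'M[R]_d) (t : R) i k : (t *: A) i k = t * A i k. Proof. by rewrite mxE. Qed.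
Lemma mx_neg2 (A B : 'M[R]_d) (t : R) i k : (- (t *: (A + B))) i k = - t * A i k + - t * B i k.
Proof. by rewrite !mxE; ring. Qed.
Lemma mxNE (A : 'M[R]_d) i k : (- A) i k = - A i k. Proof. by rewrite mxE. Qed.
End Generic.

(** * Summation over the frame *)

Section FrameStep.
Variables (R : realType) (m : nat) (U : set 'rV[R]_(m + m)) (g : 'rV[R]_(m + m) -> 'M[R]_(m + m))
  (h : 'rV[R]_(m + m) -> R).
Local Notation n := (m + m)%N.
Local Notation J := (Jstd R m).
Hypothesis sc : soliton_chart U g h.
Let kc := sc_kc sc.
Let sh := sc_f sc.
Let oU := kc_open kc.
Let gs : smx U g := kc_smooth kc.
Let V := gradV g h.
Implicit Types (x u e psi : 'rV[R]_n).

(* With these signs the terms of order one in [e] and those linear in [psi] cancel. *)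
Definition sum4 (T : nmodType) (F : 'rV[R]_n -> 'rV[R]_n -> T) e psi : T :=
  F e psi + F (e *m J) (- psi) + F (- e) psi + F (- (e *m J)) (- psi).

Lemma stepwN x u phi kap e : stepw g x u phi kap (- e) = - stepw g x u phi kap e.
Proof. by rewrite /stepw scalerN /Gam mulNmx scalerN opprD. Qed.
Lemma stepwJ x u phi kap e : U x -> stepw g x u phi kap (e *m J) = stepw g x u phi kap e *m J.
Proof. by move=> Ux; rewrite /stepw (Gam_J kc Ux) mulmxBl -!scalemxAl. Qed.

Lemma sum4_step1 x u phi kap e psi : U x -> sum4 (fun e _ => step1 g x u phi kap e) e psi = 0.
Proof.
move=> Ux; have N a : step1 g x u phi kap (- a) = - step1 g x u phi kap a.
  rewrite /step1 stepwN bilNr scalerN -scaleN1r (dM_dirZ oU Ux (-1) _ gs) bilZm; ring.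
by rewrite /sum4 !N; exact: quadN.
Qed.

Lemma d2gZ x (a : R) e : U x -> d2g g x (a *: e) (a *: e) = a ^+ 2 *: d2g g x e e.
Proof.
move=> Ux; apply/matrixP => i j; rewrite mxZE [LHS]d2gE [d2g _ _ e e i j]d2gE.
have := dir2_expand e e a 0 oU (gs i j) Ux; rewrite scale0r addr0 !mul0r !addr0 => ->.
by rewrite mulrA -expr2.
Qed.

(** The terms in [psi] cancel by sign, and the mixed terms for [e] and [J e] combine by [cross_T]
    into products with [Gam]. These complete the second derivatives of the metric to [Zc], while the
    drift yields the Hessian. *)
Lemma sum4_step2 x u phi kap e psi : U x -> sum4 (step2 g h x u phi kap) e psi =
  4 * kap ^+ 2 * bil (g x) e e - 4 * phi ^+ 2 * bil (Zc g x u) e e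
  - 8 * nuc R m * (2 * phi * kap * 'D_u h x + phi ^+ 2 * bil (coord_hessian g h x) u u).
Proof.
move=> Ux; have gJJ a : bil (g x) (a *m J) (a *m J) = bil (g x) a a by rewrite -bil_mulr -bil_mull mulmxA; congr (bil _ a a); apply/hermitian_comm; exact: (kc_J kc Ux).
set w := stepw g x u phi kap e; set Ga := Gam g x u e.
have gww : bil (g x) (w *m J) (w *m J) = bil (g x) w w by exact: gJJ.
pose T (a b c : 'rV[R]_n) := bil (dM g x a) b c.
have TZ k a b c : T (k *: a) b c = k * T a b c by rewrite /T (dM_dirZ oU Ux k a gs) bilZm.
have TD a a' b c : T (a + a') b c = T a b c + T a' b c by rewrite /T (dM_dirD oU Ux a a' gs) bilDm.
have TN a b c : T (- a) b c = - T a b c by rewrite -scaleN1r TZ mulN1r.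
have cr : T e u w + T (e *m J) u (w *m J) = 2 * bil (g x) Ga w by exact: (cross_T kc Ux).
have co : T (V x) u u = 2 * bil (g x) (Gam g x u (V x)) u.
  have := Gam_compat kc Ux (V x) u u; rewrite (Gam_sym kc Ux (V x) u) (bil_gC kc Ux u) => hh.
  apply: (etrans hh); ring.
have Hs : bil (coord_hessian g h x) u u = bil (g x) u (dM V x u) + bil (g x) (Gam g x u (V x)) u.
  by rewrite (hessian_Nab kc Ux u u sh) /Nab bilDl (bil_gC kc Ux u).
have Du : 'D_u h x = bil (g x) u (V x) by rewrite -(bil_gradV kc Ux u sh) (bil_gC kc Ux u).
have NN a : d2g g x (- a) (- a) = d2g g x a a.
  by rewrite -scaleN1r (d2gZ _ _ Ux) sqrrN expr1n scale1r.
have Ew : bil (g x) w w = kap ^+ 2 * bil (g x) e e - 2 * kap * phi * bil (g x) Ga e + phi ^+ 2 * bil (g x) Ga Ga.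
  by rewrite /w /stepw -/Ga !(bilDl, bilDr, bilNl, bilNr, bilZl, bilZr) (bil_gC kc Ux e Ga); ring.
have Eg : bil (g x) Ga w = kap * bil (g x) Ga e - phi * bil (g x) Ga Ga.
  by rewrite /w /stepw -/Ga !(bilDr, bilNr, bilZr).
have S a q b : step2 g h x u phi kap a q = bil (g x) (stepw g x u phi kap a) (stepw g x u phi kap a)
   + 2 * (2 * phi * kap * (bil (g x) u q - nuc R m * bil (g x) u (V x)) - phi ^+ 2 * nuc R m * bil (g x) u (dM V x u))
   + 2 * (phi * T a u (stepw g x u phi kap a)) + (phi ^+ 2 * (T q u u - nuc R m * T (V x) u u)
   + 2^-1 * (phi ^+ 2 * bil (d2g g x a a) u u)) + 0 * b.
  rewrite /step2 /stepb /stepA2 -/V (d2gZ _ _ Ux) bilDm !bilZm -[bil (dM g x (phi *: a)) u _]/(T (phi *: a) u _).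
  rewrite -[bil (dM g x (phi ^+ 2 *: _)) u u]/(T (phi ^+ 2 *: (q - nuc R m *: V x)) u u) !TZ TD TN TZ.
  by rewrite !(bilDr, bilNr, bilZr); ring.
rewrite /sum4 !(S _ _ 0) (stepwN x u phi kap e) (stepwN x u phi kap (e *m J)) !(stepwJ u phi kap e Ux) -/w.
rewrite !bilNl !bilNr !TN !NN gww (bil_Zc kc u e Ux) Hs Du -/Ga Ew co.
have T1 : T e u (- w) = - T e u w by rewrite /T bilNr.
have T2 : T (e *m J) u (- (w *m J)) = - T (e *m J) u (w *m J) by rewrite /T bilNr.
rewrite T1 T2; have cr' : T (e *m J) u (w *m J) = 2 * (kap * bil (g x) Ga e - phi * bil (g x) Ga Ga) - T e u w.
  by rewrite -Eg -cr addrC addKr.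
rewrite cr'; clear S Ew Eg cr cr' T1 T2 co Hs Du NN TN TD TZ.
clearbody T Ga; move: (Gam g x u (V x)) (dM V x u) (V x) => GV DV VV.
move: (d2g g x e e) (d2g g x (e *m J) (e *m J)) (nuc R m) => D1 D2 nu.
rewrite !opprK; exact: step2_calc.
Qed.

Lemma normJ u : `|u *m J| <= n%:R * `|u|.
Proof.
apply: normv_le => [|j]; first exact: mulr_ge0.
rewrite mxE; apply: le_trans (ler_norm_sum _ _ _) _.
apply: (@le_trans _ _ (\sum_(k < n) `|u|)).
  apply: ler_sum => k _; rewrite normrM -[leRHS]mulr1; apply: ler_pM => //; first exact: normv_coord.
  rewrite /Jstd mxE; case: splitP => k' _; rewrite mxE; case: splitP => j' _; rewrite !mxE ?normr0//.
    by case: eqP => _; rewrite ?normr1 ?normr0.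
  by rewrite normrN; case: eqP => _; rewrite ?normr1 ?normr0.
by rewrite sumr_const card_ord mulr_natl.
Qed.

Lemma norm_delta (a : 'I_n) : `|delta_mx 0 a : 'rV[R]_n| <= 1.
Proof.
apply: normv_le => // k; rewrite mxE eqxx/=.
by case: eqP => _; rewrite ?normr1 ?normr0.
Qed.

Lemma Zc_bound x0 (r B : R) : nice U g h x0 r B -> exists2 K : R, 0 <= K & forall x u a b,
  `|x - x0| < r -> `|u| <= B -> `|Zc g x u a b| <= K.
Proof.
move=> N; have B1 := nc_B N; have B0 : 0 <= B by apply: le_trans B1.
pose n2 : R := n%:R * n%:R; have n20 : 0 <= n2 by rewrite mulr_ge0.
pose L := n2 * (B * 1 * B).
have L0 : 0 <= L by rewrite !mulr_ge0.
exists (n2 * B * L * L + (B * B * B + B * (n%:R * B) * (n%:R * B))).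
  by rewrite !addr_ge0// !mulr_ge0.
move=> x u a b hx hu; have Ux := nc_U N hx.
have hG e : `|e| <= 1 -> `|Gam g x u e| <= L.
  move=> he; apply: le_trans (Gam_bound u e B0 (fun k i j => ctrl_0 (nc_G N k i j) hx)) _.
  by rewrite -/n2 /L ler_wpM2l// ler_wpM2r//; exact: ler_pM.
have d2 z c : `|z| <= c -> `|d2g g x z z a b| <= B * c * c.
  move=> hz; rewrite d2gE; apply: le_trans (ctrl_2 (nc_g N a b) z z hx) _.
  by rewrite -!mulrA ler_wpM2l//; exact: ler_pM.
have -> : Zc g x u a b = bil (g x) (Gam g x u (delta_mx 0 a)) (Gam g x u (delta_mx 0 b))
   + (- 4^-1 * d2g g x u u a b + - 4^-1 * d2g g x (u *m J) (u *m J) a b).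
  rewrite /Gam -bil_mulr -bil_mull bil_delta /Zc [LHS]mxE; congr (_ + _).
    by rewrite mulmxA.
  exact: mx_neg2.
have q4 (X : R) : `|- 4^-1 * X| <= `|X|.
  have -> : `|- 4^-1 * X| = 4^-1 * `|X| by rewrite normrM normrN (ger0_norm (_ : 0 <= 4^-1)) ?invr_ge0.
  by rewrite ler_piMl// invf_le1// ler1n.
apply: norm_leD.
  apply: le_trans (bil_bound _ _ B0 (fun i j => ctrl_0 (nc_g N i j) hx)) _.
  rewrite -/n2; apply: ler_pM; [by rewrite !mulr_ge0|by []| |exact: hG (norm_delta b)].
  by rewrite ler_wpM2l ?mulr_ge0//; exact: hG (norm_delta a).
apply: norm_leD; apply: le_trans (q4 _) _; first exact: d2.
by apply: d2; apply: le_trans (normJ u) _; rewrite ler_wpM2l.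
Qed.

Lemma tr_small (k : nat) (Q A : 'M[R]_k) (q a : R) : 0 <= q -> 0 <= a -> (forall i j, `|Q i j| <= q) ->
  (forall i j, `|A i j| <= a) -> `|\tr (Q *m A)| <= k%:R * k%:R * (q * a).
Proof.
move=> q0 a0 hQ hA; rewrite /mxtrace; apply: le_trans (ler_norm_sum _ _ _) _.
apply: (@le_trans _ _ (\sum_(i < k) \sum_(j < k) q * a)).
  apply: ler_sum => i _; rewrite mxE; apply: le_trans (ler_norm_sum _ _ _) _.
  by apply: ler_sum => j _; rewrite normrM; exact: ler_pM.
rewrite !sumr_const !card_ord.
have -> (X : R) : X *+ k *+ k = k%:R * k%:R * X by rewrite -mulrA !mulr_natl.
exact: lexx.
Qed.

(* [4 * bracket] is the second variation of energy in the directions of a unitary frame. *)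
Definition bracket x u (phi kap : R) : R :=
  n%:R * kap ^+ 2 - 2 * phi * kap * 'D_u h x - 2^-1 * phi ^+ 2.

(** The trace of [Zc] is the Ricci curvature of [u], and [8 * nuc * n = 4] makes the drift add the
    Hessian with the same weight. The soliton equation replaces their sum by [1 / 2]. The defect [q]
    measures how far the frame is from being orthonormal. *)
Lemma frame_sum2 x0 (r B : R) : nice U g h x0 r B -> exists2 K : R, 0 <= K &
  forall x u (phi kap q : R) (E Psi : 'M[R]_n), `|x - x0| < r -> `|u| <= B -> bil (g x) u u = 1 ->
  `|phi| <= 1 -> `|kap| <= 2 -> 0 <= q -> (forall a b, `|(E^T *m E - invmx (g x)) a b| <= q) ->
  `|\sum_i sum4 (step2 g h x u phi kap) (row i E) (row i Psi) - 4 * bracket x u phi kap| <= K * q.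
Proof.
move=> N; have B1 := nc_B N; have B0 : 0 <= B by apply: le_trans B1.
have [Kz Kz0 HZ] := Zc_bound N.
have n20 : 0 <= n%:R * n%:R :> R by rewrite mulr_ge0.
exists (16 * (n%:R * n%:R * B) + 4 * (n%:R * n%:R * Kz)); first by rewrite addr_ge0// !mulr_ge0.
move=> x u phi kap q E Psi hx hu gu hphi hkap q0 hQ; have Ux := nc_U N hx.
set Q := E^T *m E - invmx (g x) in hQ.
have EQ : E^T *m E = invmx (g x) + Q by rewrite /Q addrC subrK.
have n0 : (0 < n)%N.
  rewrite lt0n; apply/eqP => nn; move: gu; rewrite bilE big1; last by move=> i _; have := ltn_ord i; rewrite {2}nn.
  by move=> /esym/eqP; rewrite oner_eq0.
have nun : 8 * nuc R m * n%:R = 4.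
  rewrite /nuc -muln2 natrM invfM; field.
  by rewrite -natrD pnatr_eq0 -lt0n.
have s1 : \sum_i bil (g x) (row i E) (row i E) = n%:R + \tr (Q *m g x).
  by rewrite -tr_frame EQ mulmxDl mxtraceD mulVmx ?(kc_unit kc)// mxtrace1.
have s2 : \sum_i bil (Zc g x u) (row i E) (row i E) = bil (coord_ricci g x) u u + \tr (Q *m Zc g x u).
  rewrite -tr_frame EQ mulmxDl mxtraceD; congr (_ + _).
  apply: (tr_Zc kc Ux); exact: (ricci_herm sc u u Ux).
have rh : bil (coord_ricci g x) u u + bil (coord_hessian g h x) u u = 2^-1.
  by rewrite -bilDm (sc_eq sc Ux) bilZm gu mulr1.
have b1 : `|\tr (Q *m g x)| <= n%:R * n%:R * (q * B) by apply: tr_small => // i j; exact: (ctrl_0 (nc_g N i j) hx).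
have b2 : `|\tr (Q *m Zc g x u)| <= n%:R * n%:R * (q * Kz) by apply: tr_small => // i j; exact: HZ.
rewrite (eq_bigr (fun i => 4 * kap ^+ 2 * bil (g x) (row i E) (row i E) - 4 * phi ^+ 2 * bil (Zc g x u) (row i E) (row i E)
  - 8 * nuc R m * (2 * phi * kap * 'D_u h x + phi ^+ 2 * bil (coord_hessian g h x) u u))); last first.
  by move=> i _; exact: sum4_step2.
rewrite !big_split/= !sumrN -!mulr_sumr s1 s2 sumr_const card_ord.
have e8 (X : R) : 8 * nuc R m * (X *+ n) = 4 * X by rewrite -nun -[X *+ n]mulr_natl; ring.
rewrite e8.
have -> : bil (coord_ricci g x) u u = 2^-1 - bil (coord_hessian g h x) u u by rewrite -rh addrK.
rewrite /bracket; move: b1 b2; move: (\tr (Q *m g x)) (\tr (Q *m Zc g x u)) (bil (coord_hessian g h x) u u) => X Y Hh b1 b2.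
have Dr : {du : R | du = 'D_u h x} by exists ('D_u h x).
case: Dr => du Edu; rewrite -Edu.
have -> : 4 * kap ^+ 2 * (n%:R + X) - 4 * phi ^+ 2 * (2^-1 - Hh + Y) - 4 * (2 * phi * kap * du + phi ^+ 2 * Hh)
  - 4 * (n%:R * kap ^+ 2 - 2 * phi * kap * du - 2^-1 * phi ^+ 2) = 4 * kap ^+ 2 * X - 4 * phi ^+ 2 * Y by field.
have k2 : `|4 * kap ^+ 2| <= 16.
  rewrite normrM normrX (ger0_norm (_ : 0 <= 4))// expr2; have := ler_pM (normr_ge0 kap) (normr_ge0 kap) hkap hkap; lra.
have p2 : `|4 * phi ^+ 2| <= 4.
  rewrite normrM normrX (ger0_norm (_ : 0 <= 4))// expr2; have := ler_pM (normr_ge0 phi) (normr_ge0 phi) hphi hphi; lra.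
have -> : (16 * (n%:R * n%:R * B) + 4 * (n%:R * n%:R * Kz)) * q = 16 * (n%:R * n%:R * (q * B)) + 4 * (n%:R * n%:R * (q * Kz)) by ring.
by apply: norm_leB; rewrite normrM; apply: ler_pM.
Qed.

Lemma mulmx_bound (k : nat) (A C : 'M[R]_k) (a c : R) : 0 <= a -> 0 <= c -> (forall i j, `|A i j| <= a) ->
  (forall i j, `|C i j| <= c) -> forall i j, `|(A *m C) i j| <= k%:R * (a * c).
Proof.
move=> a0 c0 hA hC i j; rewrite mxE; apply: le_trans (ler_norm_sum _ _ _) _.
apply: (@le_trans _ _ (\sum_(l < k) a * c)).
  by apply: ler_sum => l _; rewrite normrM; exact: ler_pM.
by rewrite sumr_const card_ord mulr_natl.
Qed.

Lemma gram_identity (k : nat) (E N Q Gi : 'M[R]_k) (t : R) : E^T *m E = Gi + Q ->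
  (E - t *: (E *m N))^T *m (E - t *: (E *m N)) =
  Gi - t *: (Gi *m N + N^T *m Gi) + (Q - t *: (N^T *m Q + Q *m N) + t ^+ 2 *: (N^T *m (Gi + Q) *m N)).
Proof.
move=> EQ; have e1 : (E - t *: (E *m N))^T *m (E - t *: (E *m N)) =
   E^T *m E - t *: (N^T *m (E^T *m E) + (E^T *m E) *m N) + t ^+ 2 *: (N^T *m (E^T *m E) *m N).
  have -> : (E - t *: (E *m N))^T = E^T - t *: (N^T *m E^T) by rewrite -trmx_mul; apply/matrixP => i j; rewrite !mxE.
  rewrite mulmxBl !mulmxBr -!scalemxAl -!scalemxAr !mulmxA scalerA -expr2.
  rewrite !scalerDr; move: (E^T *m E) (t *: _) (t *: _) (t ^+ 2 *: _) => a b c e.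
  by apply/matrixP => i j; rewrite !mxE; ring.
rewrite e1 EQ !mulmxDr !mulmxDl !scalerDr.
by apply/matrixP => i j; rewrite !mxE; ring.
Qed.

(** One Euler step of parallel transport. By compatibility of the connection with the metric, the
    first-order change of the Gram matrix is that of the inverse metric, so the defect grows only by
    a term proportional to [t * (q + t)]. *)
Lemma gram_step x0 (r B : R) : nice U g h x0 r B -> exists2 K : R, 0 <= K &
  forall x u (t q : R) (E : 'M[R]_n), `|x - x0| < r -> `|x + t *: u - x0| < r -> `|u| <= B ->
  0 <= t -> t <= 1 -> 0 <= q -> q <= 1 -> (forall a b, `|(E^T *m E - invmx (g x)) a b| <= q) ->
  let E' := E - t *: (E *m CM g x u) in
  forall a b, `|(E'^T *m E' - invmx (g (x + t *: u))) a b| <= q + K * t * (q + t).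
Proof.
move=> N; have B1 := nc_B N; have B0 : 0 <= B by apply: le_trans B1.
pose L := n%:R * (B * B); have L0 : 0 <= L by rewrite !mulr_ge0.
pose K := 2 * (n%:R * L) + n%:R * (n%:R * (L * (B + 1)) * L) + B * (B * B).
have K0 : 0 <= K by rewrite /K !addr_ge0// !mulr_ge0// addr_ge0.
exists K => // x u t q E hx hxt hu t0 t1 q0 q1 hQ E' a b; have Ux := nc_U N hx.
set Q := E^T *m E - invmx (g x) in hQ.
have EQ : E^T *m E = invmx (g x) + Q by rewrite /Q addrC subrK.
set C := CM g x u.
have hC i j : `|C i j| <= L.
  rewrite /C mxE; apply: le_trans (ler_norm_sum _ _ _) _.
  apply: (@le_trans _ _ (\sum_(l < n) B * B)).
    apply: ler_sum => l _; rewrite normrM; apply: ler_pM => //; last exact: (ctrl_0 (nc_G N j l i) hx).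
    exact: le_trans (normv_coord u l) hu.
  by rewrite /L mulr_natl sumr_const card_ord.
have hCT i j : `|C^T i j| <= L by rewrite mxE.
have -> : E'^T *m E' = invmx (g x) - t *: (invmx (g x) *m C + C^T *m invmx (g x)) + (Q - t *: (C^T *m Q + Q *m C) + t ^+ 2 *: (C^T *m (invmx (g x) + Q) *m C)).
  exact: gram_identity.
have dG : dM (ginv g) x u = - (invmx (g x) *m C + C^T *m invmx (g x)).
  rewrite (dM_ginv kc u Ux) -[dM g x u]/(dmx g x u) (dmx_compat kc Ux) /ginv -/C mulmxDr mulmxDl; congr (- _).
  rewrite !mulmxA mulVmx ?(kc_unit kc)// mul1mx -[invmx (g x) *m C *m _ *m _]mulmxA mulmxV ?(kc_unit kc)// mulmx1.
  by [].
have T := taylor_2 (nc_gi N a b) hx hxt.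
have E1 : 'D_(t *: u) (fun y => invmx (g y) a b) x = t * dM (ginv g) x u a b :> R.
  by rewrite dME; exact: (smooth_dirZ t u oU (smooth_ginv kc a b) Ux).
have nt : B * `|t *: u| ^+ 2 <= t ^+ 2 * (B * (B * B)).
  rewrite normrZ (ger0_norm t0) exprMn; have -> : t ^+ 2 * (B * (B * B)) = B * (t ^+ 2 * (B * B)) by ring.
  by apply: ler_wpM2l => //; apply: ler_wpM2l; [exact: exprn_ge0|rewrite expr2; exact: ler_pM].
have hq1 := mulmx_bound L0 q0 hCT hQ a b; have hq2 := mulmx_bound q0 L0 hQ hC a b.
have hS i j : `|(invmx (g x) + Q) i j| <= B + 1.
  rewrite mxE; apply: norm_leD; first exact: (ctrl_0 (nc_gi N i j) hx).
  exact: le_trans (hQ i j) q1.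
have B10 : 0 <= B + 1 by rewrite addr_ge0.
have h3 := mulmx_bound (mulr_ge0 (ler0n _ _) (mulr_ge0 L0 B10)) L0 (mulmx_bound L0 B10 hCT hS) hC a b.
move: T; rewrite E1 dG => T.
have [X EX] : exists X : R, X = (invmx (g x) *m C + C^T *m invmx (g x)) a b by eexists.
have T' : `|invmx (g (x + t *: u)) a b - invmx (g x) a b + t * X| <= t ^+ 2 * (B * (B * B)).
  apply: le_trans nt; apply: le_trans T.
  by rewrite mxNE -EX mulrN opprK.
have -> : (invmx (g x) - t *: (invmx (g x) *m C + C^T *m invmx (g x)) + (Q - t *: (C^T *m Q + Q *m C) + t ^+ 2 *: (C^T *m (invmx (g x) + Q) *m C))
    - invmx (g (x + t *: u))) a b =
  Q a b - (t * ((C^T *m Q) a b + (Q *m C) a b) - t ^+ 2 * (C^T *m (invmx (g x) + Q) *m C) a b)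
  - (invmx (g (x + t *: u)) a b - invmx (g x) a b + t * X).
  rewrite EX; move: (invmx (g x) *m C + C^T *m invmx (g x)) (C^T *m Q) (Q *m C) (C^T *m (invmx (g x) + Q) *m C) => Y1 Y2 Y3 Y4.
  by rewrite !mxE; ring.
have t2 : 0 <= t ^+ 2 by exact: exprn_ge0.
have h4 : `|t * ((C^T *m Q) a b + (Q *m C) a b)| <= t * (n%:R * (L * q) + n%:R * (q * L)).
  by rewrite normrM (ger0_norm t0) ler_wpM2l//; exact: norm_leD.
have h5 : `|t ^+ 2 * (C^T *m (invmx (g x) + Q) *m C) a b| <= t ^+ 2 * (n%:R * (n%:R * (L * (B + 1)) * L)).
  by rewrite normrM (ger0_norm t2) ler_wpM2l.
apply: le_trans (norm_leB (norm_leB (hQ a b) (norm_leB h4 h5)) T') _.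
have e : q + K * t * (q + t) - (q + (t * (n%:R * (L * q) + n%:R * (q * L)) + t ^+ 2 * (n%:R * (n%:R * (L * (B + 1)) * L))) + t ^+ 2 * (B * (B * B)))
  = t * q * (K - 2 * (n%:R * L)) + t ^+ 2 * (2 * (n%:R * L)) by rewrite /K; ring.
rewrite -subr_ge0 e addr_ge0 ?mulr_ge0// /K.
have -> : 2 * (n%:R * L) + n%:R * (n%:R * (L * (B + 1)) * L) + B * (B * B) - 2 * (n%:R * L) =
   n%:R * (n%:R * (L * (B + 1)) * L) + B * (B * B) by ring.
by rewrite addr_ge0// !mulr_ge0.
Qed.
End FrameStep.

Section Scalars.
Variables (R : realType).

Lemma mx_subE (d : nat) (A B : 'M[R]_d) i k : (A - B) i k = A i k - B i k. Proof. by rewrite !mxE. Qed.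

Lemma sc_small (s d t c : R) : 0 < s -> s < 1 -> 0 < d -> d <= s ^+ 3 / 2 -> 0 <= c -> s * (c + 1) < 4^-1 ->
  0 <= t -> t <= d + c * d ^+ 2 -> d <= t + c * t ^+ 2 ->
  [/\ t <= 2 * d, d <= 2 * t, 0 < t, t <= s ^+ 3 &
   [/\ t <= 1, `|d - t| <= 4 * (c * d ^+ 2), d <= s, s ^+ 3 <= s & d ^+ 2 <= d * s ^+ 3]].
Proof.
move=> s0 s1 d0 ds c0 sc t0' t_le d_le.
have s3 : s ^+ 3 <= s by rewrite exprS ler_piMr ?(ltW s0)// exprn_ile1// ltW.
have s30 : 0 < s ^+ 3 by rewrite exprn_gt0.
have cs : c * s <= 4^-1 by rewrite mulrDr mulr1 (mulrC s) in sc; lra.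
have cd : c * d <= 8^-1.
  have : c * d <= c * (s / 2) by rewrite ler_wpM2l//; lra.
  by rewrite mulrA; lra.
have cdd : c * d ^+ 2 <= 8^-1 * d by rewrite expr2 mulrA ler_wpM2r// ltW.
have t2d : t <= 2 * d by lra.
have ct : c * t <= 4^-1.
  have : c * t <= c * (2 * d) by rewrite ler_wpM2l.
  by rewrite (_ : c * (2 * d) = 2 * (c * d)); [lra|ring].
have ctt : c * t ^+ 2 <= 4^-1 * t by rewrite expr2 mulrA ler_wpM2r.
have ct4 : c * t ^+ 2 <= 4 * (c * d ^+ 2).
  have h1 : t ^+ 2 <= (2 * d) ^+ 2 by rewrite ler_pXn2r ?nnegrE//; lra.
  have h2 : c * t ^+ 2 <= c * (2 * d) ^+ 2 by rewrite ler_wpM2l.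
  by apply: le_trans h2 _; rewrite (_ : c * (2 * d) ^+ 2 = 4 * (c * d ^+ 2)) ?lexx//; ring.
have cdd0 : 0 <= c * d ^+ 2 by rewrite mulr_ge0// sqr_ge0.
split; [lra|lra|lra|lra|split; [lra| |lra|lra|]].
  by rewrite ler_norml; apply/andP; split; lra.
by rewrite expr2 ler_wpM2l ?(ltW d0)//; lra.
Qed.

Lemma sc_bracket (nn kap kap' phi du K4 c d t : R) : 0 <= nn -> 0 <= K4 -> 0 <= c -> 0 < d -> 0 < t -> d <= 2 * t ->
  `|d - t| <= 4 * (c * d ^+ 2) -> kap' = kap * (d / t) -> `|kap'| <= 2 -> `|kap| <= 1 -> `|phi| <= 1 -> `|du| <= K4 ->
  nn * kap' ^+ 2 - 2 * phi * kap' * du - 2^-1 * phi ^+ 2 <=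
  nn * kap ^+ 2 - 2 * phi * kap * du - 2^-1 * phi ^+ 2 + 8 * c * (3 * nn + 2 * K4) * d.
Proof.
move=> n0 K40 c0 d0 t0 d2t dif ek hk' hk hphi hdu.
have h2 : `|kap' - kap| <= 8 * (c * d).
  have -> : kap' - kap = kap * ((d - t) / t) by rewrite ek; field; rewrite gt_eqF.
  rewrite normrM -[X in _ <= X]mul1r; apply: ler_pM => //.
  rewrite normrM (ger0_norm (_ : 0 <= t^-1)) ?invr_ge0 ?(ltW t0)// ler_pdivrMr//.
  apply: le_trans dif _; have : c * d * d <= c * d * (2 * t) by rewrite ler_wpM2l// mulr_ge0// ltW.
  rewrite (_ : c * d ^+ 2 = c * d * d); last by ring.
  by rewrite (_ : 8 * (c * d) * t = 4 * (c * d * (2 * t))); [lra|ring].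
have h3 : `|nn * (kap' + kap) - 2 * phi * du| <= 3 * nn + 2 * K4.
  apply: norm_leB.
    rewrite normrM (ger0_norm n0) mulrC ler_wpM2r//.
    by have := norm_leD hk' hk; lra.
  rewrite -mulrA normrM ger0_norm// ler_wpM2l// normrM -[K4]mul1r; exact: ler_pM.
have h4 : (kap' - kap) * (nn * (kap' + kap) - 2 * phi * du) <= 8 * c * (3 * nn + 2 * K4) * d.
  apply: le_trans (ler_norm _) _; rewrite normrM.
  apply: le_trans (ler_pM (normr_ge0 _) (normr_ge0 _) h2 h3) _.
  by rewrite (_ : 8 * (c * d) * _ = 8 * c * (3 * nn + 2 * K4) * d) ?lexx//; ring.
rewrite -lerBlDl; apply: le_trans h4.
by rewrite le_eqVlt; apply/orP; left; apply/eqP; ring.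
Qed.

(** The square root is linearized from above by [nD <= (1 + nD ^ 2) / 2], sharp near 1. This is how
    an expansion of the squared length bounds the length itself. *)
Lemma sc_point (t s K1 B1 nPD nD b1 b2 : R) : 0 <= t -> t <= s ^+ 3 -> 0 <= K1 -> 0 <= B1 -> 0 <= nD ->
  0 <= nPD -> nPD <= t * K1 -> nD <= B1 * K1 -> nD ^+ 2 <= 1 + s * b1 + s ^+ 2 * b2 + K1 * s ^+ 3 ->
  (1 + B1 * nPD) * (t * nD) <= t + 2^-1 * t * (s * b1 + s ^+ 2 * b2) + t * s ^+ 3 * (2^-1 * K1 + B1 ^+ 2 * K1 ^+ 2).
Proof.
move=> t0 ts K10 B10 nD0 nP0 hnP hnD hq.
have amgm : nD <= 2^-1 * (1 + nD ^+ 2).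
  have := sqr_ge0 (nD - 1); rewrite (_ : (nD - 1) ^+ 2 = nD ^+ 2 - 2 * nD + 1); last by ring.
  lra.
have h3 : B1 * nPD <= B1 * (s ^+ 3 * K1).
  by rewrite ler_wpM2l//; apply: le_trans hnP _; rewrite ler_wpM2r.
have h4 : B1 * nPD * nD <= B1 * (s ^+ 3 * K1) * (B1 * K1) by apply: ler_pM => //; exact: mulr_ge0.
have h5 : t * (B1 * nPD * nD) <= t * (B1 * (s ^+ 3 * K1) * (B1 * K1)) by rewrite ler_wpM2l.
have h6 : t * nD <= t * (2^-1 * (2 + s * b1 + s ^+ 2 * b2 + K1 * s ^+ 3)) by rewrite ler_wpM2l//; lra.
have -> : (1 + B1 * nPD) * (t * nD) = t * nD + t * (B1 * nPD * nD) by ring.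
apply: le_trans (lerD h6 h5) _.
suff E : t * (2^-1 * (2 + s * b1 + s ^+ 2 * b2 + K1 * s ^+ 3)) + t * (B1 * (s ^+ 3 * K1) * (B1 * K1)) =
  t + 2^-1 * t * (s * b1 + s ^+ 2 * b2) + t * s ^+ 3 * (2^-1 * K1 + B1 ^+ 2 * K1 ^+ 2) by rewrite E.
by field.
Qed.

Lemma sum_affine (k : nat) (F : 'I_k -> R) (a b c : R) :
  \sum_i (a + b * F i + c) = a * k%:R + b * (\sum_i F i) + c * k%:R.
Proof. by rewrite !big_split/= -mulr_sumr !sumr_const card_ord !mulr_natr. Qed.

(** Every error is brought to the form constant times [d * s ^ 3], with [d] kept as a factor so that
    the errors of all steps add up to the total length times [s ^ 3]. *)
Lemma sc_final (nn c K6 K2 K7 B1 K3 s d t q qq S2 : R) : 0 <= nn -> 0 <= c -> 0 <= K6 -> 0 <= K2 -> 0 <= K7 -> 0 <= B1 ->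
  0 <= K3 -> 0 < s -> s < 1 -> 0 < d -> 0 <= t -> t <= 2 * d -> t <= d + c * d ^+ 2 -> `|d - t| <= 4 * (c * d ^+ 2) ->
  d <= s -> d ^+ 2 <= d * s ^+ 3 -> 0 <= q -> q <= s -> `|qq| <= B1 -> S2 <= 4 * qq + 4 * (K7 * d) + K2 * q ->
  4 * t * nn + 2^-1 * t * s ^+ 2 * S2 + 4 * (t * s ^+ 3 * K6) * nn <=
  4 * nn * d + 2 * s ^+ 2 * (d * qq) +
  (4 * (nn * c) + 8 * (nn * K6) + K2 + 4 * K7 + 8 * (B1 * c) + 4 * K3) * d * s ^+ 3.
Proof.
move=> nn0 c0 K60 K20 K70 B10 K30 s0 s1 d0 t0' t2d t_le dif dS d2s q0 qs hqq S2le.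
have s30 : 0 < s ^+ 3 by rewrite exprn_gt0.
have s20 : 0 <= s ^+ 2 by exact: sqr_ge0.
have d20 : 0 <= d ^+ 2 by exact: sqr_ge0.
have s0' := ltW s0; have d0' := ltW d0.
have ts2 : 0 <= 2^-1 * t * s ^+ 2 by rewrite !mulr_ge0//.
have i1 : 2^-1 * t * s ^+ 2 * S2 <= 2^-1 * t * s ^+ 2 * (4 * qq + 4 * (K7 * d) + K2 * q) by rewrite ler_wpM2l.
have i2 : t * qq <= d * qq + B1 * (4 * (c * d ^+ 2)).
  have : (t - d) * qq <= B1 * (4 * (c * d ^+ 2)).
    by apply: le_trans (ler_norm _) _; rewrite normrM mulrC distrC; exact: ler_pM.
  by rewrite mulrBl; lra.
have i3 : s ^+ 2 * (t * qq) <= s ^+ 2 * (d * qq) + 4 * (B1 * c) * (d * s ^+ 3).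
  have h1 : s ^+ 2 * (t * qq) <= s ^+ 2 * (d * qq + B1 * (4 * (c * d ^+ 2))) by rewrite ler_wpM2l.
  have h2 : s ^+ 2 * (B1 * (4 * (c * d ^+ 2))) <= 1 * (B1 * (4 * (c * (d * s ^+ 3)))).
    have u1 : 0 <= B1 * (4 * (c * d ^+ 2)) by rewrite !mulr_ge0//.
    have u2 : s ^+ 2 <= 1 by rewrite exprn_ile1// ltW.
    apply: ler_pM => //.
    by do 3 (apply: ler_wpM2l => //).
  rewrite mulrDr in h1; rewrite mul1r in h2; apply: le_trans h1 _; rewrite lerD2l; apply: le_trans h2 _.
  by rewrite (_ : B1 * (4 * (c * (d * s ^+ 3))) = 4 * (B1 * c) * (d * s ^+ 3)) ?lexx//; ring.
have i4 : 2^-1 * t * s ^+ 2 * (4 * (K7 * d)) <= 4 * K7 * (d * s ^+ 3).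
  have h1 : s ^+ 2 * d <= s ^+ 3 by rewrite [s ^+ 3]exprSr ler_wpM2l.
  have h2 : t * (s ^+ 2 * d) <= 2 * d * s ^+ 3 by apply: ler_pM => //; rewrite mulr_ge0// ltW.
  have h3 : 2 * K7 * (t * (s ^+ 2 * d)) <= 2 * K7 * (2 * d * s ^+ 3) by rewrite ler_wpM2l// mulr_ge0.
  rewrite (_ : 2^-1 * t * s ^+ 2 * (4 * (K7 * d)) = 2 * K7 * (t * (s ^+ 2 * d))); last by field.
  by apply: le_trans h3 _; rewrite (_ : 2 * K7 * (2 * d * s ^+ 3) = 4 * K7 * (d * s ^+ 3)) ?lexx//; ring.
have i5 : 2^-1 * t * s ^+ 2 * (K2 * q) <= K2 * (d * s ^+ 3).
  have h1 : s ^+ 2 * q <= s ^+ 3 by rewrite [s ^+ 3]exprSr ler_wpM2l.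
  have h2 : t * (s ^+ 2 * q) <= 2 * d * s ^+ 3 by apply: ler_pM => //; rewrite mulr_ge0.
  have h3 : 2^-1 * K2 * (t * (s ^+ 2 * q)) <= 2^-1 * K2 * (2 * d * s ^+ 3) by rewrite ler_wpM2l// mulr_ge0// invr_ge0.
  rewrite (_ : 2^-1 * t * s ^+ 2 * (K2 * q) = 2^-1 * K2 * (t * (s ^+ 2 * q))); last by ring.
  by apply: le_trans h3 _; rewrite (_ : 2^-1 * K2 * (2 * d * s ^+ 3) = K2 * (d * s ^+ 3)) ?lexx//; field.
have i6 : 4 * t * nn <= 4 * nn * d + 4 * (nn * c) * (d * s ^+ 3).
  have h1 : c * d ^+ 2 <= c * (d * s ^+ 3) by rewrite ler_wpM2l.
  have h2 : nn * t <= nn * (d + c * (d * s ^+ 3)) by rewrite ler_wpM2l//; lra.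
  rewrite (_ : 4 * t * nn = 4 * (nn * t)); last by ring.
  rewrite (_ : 4 * nn * d + _ = 4 * (nn * (d + c * (d * s ^+ 3)))); last by ring.
  by rewrite ler_wpM2l.
have i7 : 4 * (t * s ^+ 3 * K6) * nn <= 8 * (nn * K6) * (d * s ^+ 3).
  have h1 : t * s ^+ 3 <= 2 * d * s ^+ 3 by rewrite ler_wpM2r// ltW.
  have h2 : 4 * (nn * K6) * (t * s ^+ 3) <= 4 * (nn * K6) * (2 * d * s ^+ 3) by rewrite ler_wpM2l// !mulr_ge0.
  rewrite (_ : 4 * (t * s ^+ 3 * K6) * nn = 4 * (nn * K6) * (t * s ^+ 3)); last by ring.
  by apply: le_trans h2 _; rewrite (_ : 4 * (nn * K6) * (2 * d * s ^+ 3) = 8 * (nn * K6) * (d * s ^+ 3)) ?lexx//; ring.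
have e9 : 2^-1 * t * s ^+ 2 * (4 * qq + 4 * (K7 * d) + K2 * q) = 2 * (s ^+ 2 * (t * qq)) + 2^-1 * t * s ^+ 2 * (4 * (K7 * d)) + 2^-1 * t * s ^+ 2 * (K2 * q) by field.
rewrite e9 in i1.
have K3ds : 0 <= K3 * (d * s ^+ 3) by rewrite !mulr_ge0// ltW.
have e10 : (4 * (nn * c) + 8 * (nn * K6) + K2 + 4 * K7 + 8 * (B1 * c) + 4 * K3) * d * s ^+ 3 = 4 * (nn * c) * (d * s ^+ 3) + 8 * (nn * K6) * (d * s ^+ 3) + K2 * (d * s ^+ 3) + 4 * K7 * (d * s ^+ 3) + 2 * (4 * (B1 * c) * (d * s ^+ 3)) + 4 * (K3 * (d * s ^+ 3)).
  by ring.
have e12 : 2 * s ^+ 2 * (d * qq) = 2 * (s ^+ 2 * (d * qq)) by ring.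
rewrite e10 e12; apply: le_trans (lerD (lerD i6 i1) i7) _.
move: i3 i4 i5 K3ds; move: (s ^+ 2 * (t * qq)) (s ^+ 2 * (d * qq)) (4 * (B1 * c) * (d * s ^+ 3)) (2^-1 * t * s ^+ 2 * (4 * (K7 * d)))
  (4 * K7 * (d * s ^+ 3)) (2^-1 * t * s ^+ 2 * (K2 * q)) (K2 * (d * s ^+ 3)) (K3 * (d * s ^+ 3)) (4 * nn * d) (4 * (nn * c) * (d * s ^+ 3)) (8 * (nn * K6) * (d * s ^+ 3)).
by move=> a1 a2 a3 a4 a5 a6 a7 a8 a9 a10 a11; lra.
Qed.
End Scalars.

(** * The sum of distances along one step *)

Section LocalStep.
Variables (R : realType) (m : nat) (M : kahlerManifold R m) (f : M -> R).
Local Notation n := (m + m)%N.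
Local Notation J := (Jstd R m).
Hypothesis hsol : gradient_shrinking_KR_soliton f.
Let conn : connected [set: M]. Proof. by have [[]] := hsol. Qed.
Implicit Types (i j : chart_idx M) (p q : M) (x y u e psi : 'rV[R]_n).

Definition chart_fun i : 'rV[R]_n -> R := fun y => f (icoord i y).
Local Notation fi := chart_fun.

Record cball i x (r B : R) : Prop := CBall {
  cb_good : good i x r B; cb_nice : nice (im i) (met i) (fi i) x r B }.

Lemma good_leC i x (r B B' : R) : good i x r B -> B <= B' -> good i x r B'.
Proof.
move=> g BB; have B1 := gd_C g; split.
- exact: (gd_r g).
- exact: le_trans B1 BB.
- exact: (gd_im g).
- by move=> y v hy; apply: le_trans (gd_lo g v hy) _; rewrite ler_wpM2r// nrm_ge0.
- by move=> y v hy; apply: le_trans (gd_hi g v hy) _; rewrite ler_wpM2r.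
- move=> y y' v hy hy'; apply: le_trans (gd_var g v hy hy') _.
  by rewrite ler_wpM2r ?nrm_ge0// lerD2l ler_wpM2r.
Qed.

Lemma nice_le i x (r r' B B' : R) : nice (im i) (met i) (fi i) x r B -> 0 < r' -> r' <= r -> B <= B' ->
  nice (im i) (met i) (fi i) x r' B'.
Proof.
move=> N r0 rr BB; split=> //.
- exact: le_trans (nc_B N) BB.
- by move=> y hy; apply: (nc_U N); exact: lt_le_trans rr.
- by move=> a b; exact: controlled_le (nc_g N a b) r0 rr BB.
- by move=> a b; exact: controlled_le (nc_gi N a b) r0 rr BB.
- by move=> k a b; exact: controlled_le (nc_G N k a b) r0 rr BB.
- by move=> k; exact: controlled_le (nc_V N k) r0 rr BB.
Qed.

Lemma cball_ex i x : im i x -> exists r B, cball i x r B.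
Proof.
move=> Ux; have [r [C g]] := good_ex Ux.
have [r' [B N]] := nice_ex (chart_kc i) (sc_f (chart_sc i hsol)) Ux.
have r0 : 0 < Num.min r r' by rewrite lt_min (gd_r g) (nc_r N).
have C0 := gd_C g; have B0 := nc_B N.
exists (Num.min r r'), (C + B); split.
  apply: (good_le (good_leC g (_ : C <= C + B)) r0); last by rewrite ge_min lexx.
  by lra.
by apply: (nice_le N r0); [rewrite ge_min lexx orbT|lra].
Qed.

Definition pti i y (phi s : R) e psi : M := icoord i (pt (met i) (fi i) y phi s e psi).
Definition sdist p i y (phi s : R) (E Psi : 'M[R]_n) : R :=
  \sum_a sum4 (fun e psi => dist p (pti i y phi s e psi)) (row a E) (row a Psi).

Lemma gram_norm (k : nat) (E Gi : 'M[R]_k) (B q : R) : 0 <= q -> q <= 1 -> 1 <= B -> (forall a b, `|Gi a b| <= B) ->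
  (forall a b, `|(E^T *m E - Gi) a b| <= q) -> forall a, `|row a E| <= B + 1.
Proof.
move=> q0 q1 B1 hG hQ a; apply: normv_le => [|b]; first lra.
rewrite mxE; apply: le_of_sqr; first lra.
rewrite real_normK ?num_real//.
have h1 : E a b ^+ 2 <= (E^T *m E) b b.
  rewrite mxE (bigD1 a)//= mxE -expr2 lerDl sumr_ge0// => c _; by rewrite mxE -expr2 sqr_ge0.
have h2 : (E^T *m E) b b <= B + 1.
  have -> : (E^T *m E) b b = Gi b b + (E^T *m E - Gi) b b by rewrite mx_subE addrC subrK.
  have := hG b b; have := hQ b b; rewrite !ler_norml => /andP[_ ?] /andP[_ ?]; lra.
apply: le_trans h1 _; apply: le_trans h2 _; rewrite expr2 ler_peMl//; lra.
Qed.

Lemma dist_tri p q z : dist p z <= dist p q + dist q z. Proof. exact: (dist_triangle conn q p z). Qed.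

(** The first bound comes from [dist_good] with the metric frozen at [x] and [rho = 2 * B * d], the
    second from the coordinate segment as a competitor. *)
Lemma chord_bounds i x0 (r B : R) x x' (d := dist (icoord i x) (icoord i x')) (t := nrm i x (x' - x)) :
  good i x0 r B -> `|x - x0| < r / 2 -> `|x' - x0| < r / 2 -> 0 < d -> B * d < r / 2 ->
  t <= d + 4 * B ^+ 2 * d ^+ 2 /\ d <= t + 4 * B ^+ 2 * t ^+ 2.
Proof.
move=> g hx hx' d0 hd; have r0 := gd_r g; have B1 := gd_C g; have B0 := good_C0 g.
have hxr : `|x - x0| < r by lra.
have hxr' : `|x' - x0| < r by lra.
have Ux := gd_im g hxr; have Ux' := gd_im g hxr'.
have BB : 0 <= B ^+ 2 by exact: sqr_ge0.
have d20 : 0 <= B ^+ 2 * d ^+ 2 by rewrite mulr_ge0// sqr_ge0.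
have t20 : 0 <= B ^+ 2 * t ^+ 2 by rewrite mulr_ge0// sqr_ge0.
split.
  have rr : `|coord i (icoord i x) - x0| + B * dist (icoord i x) (icoord i x') < r.
    by rewrite coord_icoord// -/d; lra.
  have rho1 : `|coord i (icoord i x) - x| + B * dist (icoord i x) (icoord i x') < 2 * (B * d).
    have Bd : 0 < B * d by rewrite mulr_gt0//; lra.
    by rewrite coord_icoord// subrr normr0 add0r -/d; lra.
  have [_ [_ /(_ x (2 * (B * d)) hxr rho1)]] := dist_good conn g (icoord_dom Ux) rr.
  rewrite !coord_icoord// -/t -/d => h1; apply: le_trans h1 _.
  have -> : (1 + B * (2 * (B * d))) * d = d + 2 * (B ^+ 2 * d ^+ 2) by ring.
  by rewrite -(mulrA 4); lra.
have h1 := dist_seg conn g hxr hxr'; rewrite -/d -/t in h1; apply: le_trans h1 _.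
have h2 : `|x' - x| <= B * t by exact: (gd_lo g (x' - x) hxr).
have t0 : 0 <= t by exact: nrm_ge0.
have h3 : B * `|x' - x| <= B * (B * t) by rewrite ler_wpM2l.
have h4 : (1 + B * `|x' - x|) * t <= (1 + B * (B * t)) * t by rewrite ler_wpM2r// lerD2l.
apply: le_trans h4 _; have -> : (1 + B * (B * t)) * t = t + B ^+ 2 * t ^+ 2 by ring.
by rewrite -(mulrA 4); lra.
Qed.

Lemma pt_near i x0 (r B : R) x (phi s : R) e psi : nice (im i) (met i) (fi i) x0 r B -> `|x - x0| < r ->
  `|phi| <= 1 -> 0 <= s -> s <= 1 -> `|e| <= B -> `|psi| <= B ->
  `|pt (met i) (fi i) x phi s e psi - x| <= s * (3 * B).
Proof.
move=> N hx hphi s0 s1 he hpsi; have B1 := nc_B N; have B0 : 0 <= B by lra.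
have hV : `|gradV (met i) (fi i) x| <= B.
  by apply: normv_le => // k; exact: (ctrl_0 (nc_V N k) hx).
have p2 : `|phi ^+ 2| <= 1 by rewrite normrX exprn_ile1.
have s2 : `|s ^+ 2| <= s by rewrite ger0_norm ?sqr_ge0// expr2 ler_piMl.
have h1 := norm_leZ p2 (norm_leB hpsi (norm_leZ (nuc_bound R m) hV)).
have sn : `|s| <= s by rewrite ger0_norm.
have := norm_leD (norm_leZ sn (norm_leZ hphi he)) (norm_leZ s2 h1).
rewrite /pt [x + _]addrC addrK !mul1r => h2; apply: le_trans h2 _.
by have -> : s * B + s * (B + B) = s * (3 * B) by ring.
Qed.

Lemma sum4D (F G : 'rV[R]_n -> 'rV[R]_n -> R) e psi :
  sum4 (fun e psi => F e psi + G e psi) e psi = sum4 F e psi + sum4 G e psi.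
Proof. by rewrite /sum4; ring. Qed.

(* One step along a minimizing chain, comparing the 4n variation points at its two ends. *)
Lemma local_step i x0 (r B B1 : R) : cball i x0 r B -> n%:R * (B + 1) + (B + 1) <= B1 ->
  exists2 K : R, 0 <= K & exists2 s1 : R, 0 < s1 & forall p x x' (phi kap s q qq : R) (E Psi : 'M[R]_n),
  `|x - x0| < r / 2 -> `|x' - x0| < r / 2 -> 0 < s -> s < s1 ->
  let d := dist (icoord i x) (icoord i x') in
  0 < d -> d <= s ^+ 3 / 2 -> `|phi| <= 1 -> `|kap| <= 1 -> 0 <= q -> q <= s -> (forall a, `|row a Psi| <= B1) ->
  (forall a b, `|(E^T *m E - invmx (met i x)) a b| <= q) -> `|qq| <= B1 ->
  (forall u, bil (met i x) u u = 1 -> bracket (fi i) x u phi kap <= qq) ->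
  exists E' : 'M[R]_n,
    (forall a b, `|(E'^T *m E' - invmx (met i x')) a b| <= q + K * d * (q + d)) /\
    sdist p i x' (phi + kap * d) s E' Psi <= sdist p i x phi s E Psi + 4 * n%:R * d + 2 * s ^+ 2 * (d * qq) + K * d * s ^+ 3.
Proof.
move=> cb hB1; have g := cb_good cb; have N := cb_nice cb; have B_1 := gd_C g; have B0 := good_C0 g.
have sc := chart_sc i hsol; have kc := chart_kc i; have sh := sc_f sc; have r0 := gd_r g.
have nB : 0 <= n%:R * (B + 1) by rewrite mulr_ge0//; lra.
have BB : B <= B1 by lra.
have B10 : 0 <= B1 by lra.
have N1 := nice_le N r0 (lexx r) BB; have g1 := good_leC g BB.
have [K1 K10 SQ] := step_quad kc sh N1.
have [K2 K20 FS] := frame_sum2 sc N1.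
have [K3 K30 GS] := gram_step sc N1.
pose K4 := n%:R * n%:R * B1 * B1 * B1.
have K40 : 0 <= K4 by rewrite !mulr_ge0.
pose c := 4 * B ^+ 2; have c0 : 0 <= c by rewrite mulr_ge0// sqr_ge0.
pose K6 := 2^-1 * K1 + B1 ^+ 2 * K1 ^+ 2.
have K60 : 0 <= K6 by rewrite addr_ge0// mulr_ge0// ?invr_ge0 ?sqr_ge0.
pose K7 := 8 * c * (3 * n%:R + 2 * K4).
have K70 : 0 <= K7 by rewrite !mulr_ge0// addr_ge0// mulr_ge0.
pose K5 := 4 * (n%:R * c) + 8 * (n%:R * K6) + K2 + 4 * K7 + 8 * (B1 * c) + 4 * K3.
have nc0 : 0 <= n%:R * c by rewrite mulr_ge0.
have nK60 : 0 <= n%:R * K6 by rewrite mulr_ge0.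
have Bc0 : 0 <= B1 * c by rewrite mulr_ge0.
have K50 : 0 <= K5 by rewrite /K5; lra.
exists K5 => //.
have D0 : 0 < 3 * B1 + K1 + 1 by lra.
(* The second bound keeps all displaced points in the ball of radius [r]; the third is the smallness
   assumption of [sc_small]. *)
pose s1 := Num.min 1 (Num.min (r / 2 / (3 * B1 + K1 + 1)) (4^-1 / (c + 1))).
have s10 : 0 < s1 by rewrite !lt_min ltr01 !divr_gt0//; lra.
exists s1 => // p x x' phi kap s q qq E Psi hx hx' s0 ss1 d d0 ds hphi hkap q0 qs hPsi hQ hqq hbr.
have [sa [sb sd]] : s < 1 /\ s < r / 2 / (3 * B1 + K1 + 1) /\ s < 4^-1 / (c + 1).
  by move: ss1; rewrite !lt_min => /and3P[].
have hr2 : r / 2 < r by rewrite ltr_pdivrMr// ltr_pMr// ltr1n.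
have hxr := lt_trans hx hr2; have hxr' := lt_trans hx' hr2.
have Ux := gd_im g hxr; have Ux' := gd_im g hxr'.
have s0' := ltW s0; have sa' := ltW sa.
have sb' : s * (3 * B1 + K1) < r / 2.
  have : s * (3 * B1 + K1 + 1) < r / 2 by rewrite -ltr_pdivlMr.
  by apply: le_lt_trans; rewrite ler_wpM2l// lerDl.
have sc4 : s * (c + 1) < 4^-1 by rewrite -ltr_pdivlMr// ltr_wpDl.
have Bs : s * B <= s * (3 * B1 + K1).
  rewrite ler_wpM2l//; apply: le_trans BB _; apply: ler_wpDr => //.
  by rewrite ler_peMl// ler1n.
have s3 : s ^+ 3 <= s by rewrite exprS ler_piMr// exprn_ile1.
have dS' : d <= s by apply: le_trans ds _; rewrite ler_pdivrMr//; apply: le_trans s3 _; rewrite ler_peMr// ler1n.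
have Bd : B * d < r / 2.
  by apply: le_lt_trans sb'; apply: le_trans Bs; rewrite mulrC ler_wpM2r.
pose dl := x' - x; have exd : x + dl = x' by rewrite addrC subrK.
pose t := nrm i x dl.
have [t_le d_le] := chord_bounds g hx hx' d0 Bd; rewrite -/d -/t -/c in t_le d_le.
have t0' : 0 <= t by exact: nrm_ge0.
have [t2d d2t t0 ts [t1 dif dS _ d2s]] := sc_small s0 sa d0 ds c0 sc4 t0' t_le d_le.
pose u := t^-1 *: dl; have tu : t *: u = dl by rewrite /u scalerA mulfV ?scale1r// gt_eqF.
have xtu : x + t *: u = x' by rewrite tu.
have nu : nrm i x u = 1 by rewrite /u nrmZ -/t ger0_norm ?invr_ge0// mulVf// gt_eqF.
have gu : bil (met i x) u u = 1 by rewrite -(nrm_sqr u Ux) nu expr1n.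
have hu : `|u| <= B1 by apply: le_trans BB; have := gd_lo g u hxr; rewrite nu mulr1.
(* The profile varies by [kap * d] in terms of distance, but the chord is parametrized by [t]; this
   slope gives the same increment over the chord. *)
pose kap' := kap * (d / t).
have dt2 : d / t <= 2 by rewrite ler_pdivrMr.
have dt0 : 0 <= d / t by rewrite divr_ge0// ltW.
have hkap' : `|kap'| <= 2.
  by rewrite /kap' normrM (ger0_norm dt0) -[X in _ <= X]mul1r; apply: ler_pM.
have ekt : kap' * t = kap * d by rewrite /kap' -mulrA divfK// gt_eqF.
have hbE := gram_norm q0 (le_trans qs (ltW sa)) B_1 (fun a b => ctrl_0 (nc_gi N a b) hxr) hQ.
have hE a : `|row a E| <= B1 by apply: le_trans (hbE a) _; apply: le_trans hB1; rewrite lerDr.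
have hEJ a : `|row a E *m J| <= B1.
  apply: le_trans (normJ _) _; apply: le_trans (_ : n%:R * (B + 1) <= B1); first by rewrite ler_wpM2l.
  by apply: le_trans hB1; rewrite lerDl addr_ge0.
(* One Euler step of parallel transport of the frame. *)
pose E' := E - t *: (E *m CM (met i) x u).
exists E'; split.
  move=> a b; have := GS x u t q E hxr; rewrite xtu => /(_ hxr' hu t0' t1 q0 (le_trans qs (ltW sa)) hQ a b) h1.
  apply: le_trans h1 _; rewrite lerD2l.
  have h2 : K3 * t * (q + t) <= K3 * (2 * d) * (q + 2 * d).
    apply: ler_pM; [by rewrite mulr_ge0|by rewrite addr_ge0|by rewrite ler_wpM2l|by rewrite lerD2l].
  apply: le_trans h2 _.
  have dq : 0 <= d * q by rewrite mulr_ge0// ltW.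
  have dd : 0 <= d * d by rewrite mulr_ge0// ltW.
  have h3 : K3 * (2 * d) * (q + 2 * d) <= 4 * K3 * d * (q + d).
    rewrite -subr_ge0 (_ : _ - _ = 2 * (K3 * (d * q))); last by ring.
    by rewrite mulr_ge0// mulr_ge0.
  apply: le_trans h3 _; rewrite ler_wpM2r ?addr_ge0 ?(ltW d0)// ler_wpM2r ?(ltW d0)//.
  by rewrite /K5 lerDr !addr_ge0// mulr_ge0.
(* The bound for the length of the chord between displaced points, to be added to the distance by
   the triangle inequality. *)
pose W e psi := t + 2^-1 * t * (s * step1 (met i) x u phi kap' e + s ^+ 2 * step2 (met i) (fi i) x u phi kap' e psi) + t * s ^+ 3 * K6.
have PS e psi : `|e| <= B1 -> `|psi| <= B1 ->
    dist p (pti i x' (phi + kap * d) s (e - t *: Gam (met i) x u e) psi) <= dist p (pti i x phi s e psi) + W e psi.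
  move=> he hpsi; apply: le_trans (dist_tri _ (pti i x phi s e psi) _) _; rewrite lerD2l.
  set P := pt (met i) (fi i) x phi s e psi; rewrite /pti -/P.
  set P' := pt (met i) (fi i) x' _ _ _ _.
  have hPx : `|P - x| <= s * (3 * B1) by exact: (pt_near N1 hxr hphi (ltW s0) (ltW sa) he hpsi).
  have tri (a b z : 'rV[R]_n) : `|a - z| <= `|b - z| + `|a - b|.
    have -> : a - z = (a - b) + (b - z) by rewrite addrA subrK.
    by rewrite [leRHS]addrC ler_normD.
  have hP : `|P - x0| < r.
    apply: le_lt_trans (tri P x x0) _; rewrite [r]splitr; apply: ltrD => //.
    by apply: le_lt_trans hPx _; apply: le_lt_trans sb'; rewrite ler_wpM2l// lerDl.
  have [hD hq] : `|t^-1 *: (P' - P)| <= K1 /\ `|bil (met i P) (t^-1 *: (P' - P)) (t^-1 *: (P' - P)) - (bil (met i x) u u + s * step1 (met i) x u phi kap' e + s ^+ 2 * step2 (met i) (fi i) x u phi kap' e psi)| <= K1 * s ^+ 3.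
    have := SQ x u e psi phi kap' s t hxr; rewrite xtu ekt -/P -/P'.
    by apply => //; exact: ltW.
  set D := t^-1 *: (P' - P) in hD hq; have PD : P' - P = t *: D by rewrite /D scalerA mulfV ?scale1r// gt_eqF.
  have nPD : `|P' - P| <= t * K1 by rewrite PD normrZ (ger0_norm t0') ler_wpM2l.
  have hP' : `|P' - x0| < r.
    apply: le_lt_trans (tri P' P x0) _; apply: le_lt_trans (lerD (tri P x x0) (lexx _)) _.
    rewrite -addrA [r]splitr; apply: ltr_leD => //.
    apply: le_trans (ltW sb'); rewrite mulrDr; apply: lerD => //.
    by apply: le_trans nPD _; rewrite ler_wpM2r//; apply: le_trans ts _.
  have h1 := dist_seg conn g1 hP hP'.
  rewrite PD nrmZ (ger0_norm t0') in h1.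
  set nD := nrm i P D in h1; have nD0 : 0 <= nD by exact: nrm_ge0.
  have nDK : nD <= B1 * K1 by apply: le_trans (gd_hi g1 D hP) _; rewrite ler_wpM2l.
  have nD2 : nD ^+ 2 <= 1 + s * step1 (met i) x u phi kap' e + s ^+ 2 * step2 (met i) (fi i) x u phi kap' e psi + K1 * s ^+ 3.
    rewrite nrm_sqr; last exact: (gd_im g hP).
    move: hq; rewrite gu ler_norml => /andP[_]; rewrite lerBlDl.
    by [].
  apply: le_trans h1 _; apply: sc_point => //.
  by rewrite -PD.
have rowE' a : row a E' = row a E - t *: Gam (met i) x u (row a E).
  by rewrite /E' linearB/= linearZ/= row_mul.
have hPsiN a : `|- row a Psi| <= B1 by rewrite normrN.
have S4 a : sum4 (fun e psi => dist p (pti i x' (phi + kap * d) s e psi)) (row a E') (row a Psi)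
   <= sum4 (fun e psi => dist p (pti i x phi s e psi)) (row a E) (row a Psi) + sum4 W (row a E) (row a Psi).
  rewrite -sum4D rowE'; set e := row a E; set psi := row a Psi.
  have GJ : (e - t *: Gam (met i) x u e) *m J = e *m J - t *: Gam (met i) x u (e *m J).
    by rewrite (Gam_J kc Ux) mulmxBl -scalemxAl.
  have GN v : - (v - t *: Gam (met i) x u v) = - v - t *: Gam (met i) x u (- v).
    by rewrite /Gam mulNmx scalerN opprB opprK addrC.
  rewrite /sum4 GJ !GN; apply: lerD; [apply: lerD; [apply: lerD|]|]; apply: PS; rewrite ?normrN//; try exact: hE; try exact: hEJ; exact: hPsi.
have sW a : sum4 W (row a E) (row a Psi) = 4 * t + 2^-1 * t * s ^+ 2 * sum4 (step2 (met i) (fi i) x u phi kap') (row a E) (row a Psi) + 4 * (t * s ^+ 3 * K6).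
  have h1 := sum4_step1 sc u phi kap' (row a E) (row a Psi) Ux.
  have calc (a1 a2 a3 a4 b1 b2 b3 b4 k : R) : t + 2^-1 * t * (s * a1 + s ^+ 2 * b1) + k + (t + 2^-1 * t * (s * a2 + s ^+ 2 * b2) + k) +
      (t + 2^-1 * t * (s * a3 + s ^+ 2 * b3) + k) + (t + 2^-1 * t * (s * a4 + s ^+ 2 * b4) + k) =
      4 * t + 2^-1 * t * (s * (a1 + a2 + a3 + a4)) + 2^-1 * t * s ^+ 2 * (b1 + b2 + b3 + b4) + 4 * k by clear; ring.
  have -> : sum4 W (row a E) (row a Psi) = 4 * t + 2^-1 * t * (s * sum4 (fun e _ => step1 (met i) x u phi kap' e) (row a E) (row a Psi))
     + 2^-1 * t * s ^+ 2 * sum4 (step2 (met i) (fi i) x u phi kap') (row a E) (row a Psi) + 4 * (t * s ^+ 3 * K6).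
    exact: calc.
  by rewrite h1 mulr0 mulr0 addr0.
have tot : sdist p i x' (phi + kap * d) s E' Psi <= sdist p i x phi s E Psi + (4 * t * n%:R
   + 2^-1 * t * s ^+ 2 * (\sum_a sum4 (step2 (met i) (fi i) x u phi kap') (row a E) (row a Psi)) + 4 * (t * s ^+ 3 * K6) * n%:R).
  have -> : sdist p i x phi s E Psi + (4 * t * n%:R + 2^-1 * t * s ^+ 2 * (\sum_a sum4 (step2 (met i) (fi i) x u phi kap') (row a E) (row a Psi)) + 4 * (t * s ^+ 3 * K6) * n%:R)
    = \sum_a (sum4 (fun e psi => dist p (pti i x phi s e psi)) (row a E) (row a Psi) + sum4 W (row a E) (row a Psi)).
    rewrite [RHS]big_split/=; apply: f_equal2 => //; rewrite (eq_bigr _ (fun a _ => sW a)) sum_affine.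
    by [].
  by apply: ler_sum => a _; exact: S4.
have FSx := FS x u phi kap' q E Psi hxr hu gu hphi hkap' q0 hQ.
set S2 := \sum_a sum4 (step2 _ _ _ _ _ _) _ _ in tot FSx.
have nn0 : (0 : R) <= n%:R by exact: ler0n.
have [du Edu] : exists du : R, du = 'D_u (fi i) x by eexists.
have hdu : `|du| <= K4.
  rewrite Edu -(bil_gradV kc Ux u sh).
  have hV : `|gradV (met i) (fi i) x| <= B1 by apply: normv_le => // k; exact: (ctrl_0 (nc_V N1 k) hxr).
  apply: le_trans (bil_bound _ _ B10 (fun a b => ctrl_0 (nc_g N1 a b) hxr)) _.
  rewrite /K4; apply: ler_pM => //; first by rewrite !mulr_ge0.
  by apply: ler_pM => //; rewrite !mulr_ge0.
have br : bracket (fi i) x u phi kap' <= qq + K7 * d.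
  apply: le_trans (_ : bracket (fi i) x u phi kap + K7 * d <= _); last by rewrite lerD2r; exact: hbr.
  rewrite /bracket -Edu; exact: (sc_bracket nn0 K40 c0 d0 t0 d2t dif (erefl kap') hkap' hkap hphi hdu).
have S2le : S2 <= 4 * qq + 4 * (K7 * d) + K2 * q.
  move: FSx; rewrite ler_norml lerBlDl => /andP[_ h1]; apply: le_trans h1 _.
  by rewrite lerD2r -mulrDr ler_wpM2l.
apply: le_trans tot _; rewrite -!addrA lerD2l !addrA.
exact: (sc_final nn0 c0 K60 K20 K70 B10 K30 s0 sa d0 t0' t2d t_le dif dS d2s q0 qs hqq S2le).
Qed.
End LocalStep.

(** * Second-order jets of the distance *)

Section Gram.
Variables (R : realType).

(** Closed form of the recursion of [gram_step], as [gqS] shows: [q + h] is multiplied by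
    [1 + K * h] at each step. *)
Definition gq (a h K : R) (k : nat) : R := (a + h) * (1 + K * h) ^+ k - h.
Lemma gqS a h K k : gq a h K k.+1 = gq a h K k + K * h * (gq a h K k + h).
Proof. by rewrite /gq exprS; ring. Qed.
Lemma gq_ge a h K k : 0 <= a -> 0 <= h -> 0 <= K -> a <= gq a h K k.
Proof.
move=> a0 h0 K0; rewrite /gq -[X in X <= _](addrK h) lerD2r ler_peMr ?addr_ge0//.
by rewrite exprn_ege1// lerDl mulr_ge0.
Qed.
(** Discrete Gronwall inequality: over a chain of bounded total length the defect stays of order
    [s ^ 3]. *)
Lemma gq_le a h K k (C s T : R) : 0 <= C -> 0 <= a -> 0 <= h -> 0 <= K -> 0 <= s -> a <= C * s ^+ 3 -> h <= s ^+ 3 ->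
  K * h * k%:R <= T -> gq a h K k <= (C + 1) * expR T * s ^+ 3.
Proof.
move=> C0 a0 h0 K0 s0 ha hh hT; apply: le_trans (_ : (a + h) * (1 + K * h) ^+ k <= _); first by rewrite /gq gerBl.
have s3 : 0 <= s ^+ 3 by exact: exprn_ge0.
have Kh : 0 <= K * h by exact: mulr_ge0.
have E1 : (1 + K * h) ^+ k <= expR T.
  apply: le_trans (_ : expR (K * h) ^+ k <= _).
    by apply: lerXn2r; rewrite ?nnegrE ?expR_ge0 ?addr_ge0// expR_ge1Dx.
  by rewrite -expRM_natl ler_expR mulrC.
have h1 : a + h <= (C + 1) * s ^+ 3 by rewrite mulrDl mul1r lerD.
rewrite -mulrA [expR T * _]mulrC mulrA; apply: ler_pM => //; first exact: addr_ge0.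
by rewrite exprn_ge0// addr_ge0.
Qed.
Lemma step_count (D e : R) : 0 <= D -> 0 < e -> exists N, D / N.+1%:R <= e.
Proof.
move=> D0 e0; exists (Num.truncn (D / e)).
by rewrite ler_pdivrMr// mulrC -ler_pdivrMr// ltW// truncnS_gt.
Qed.
End Gram.

Section Chain.
Variables (R : realType) (m : nat) (M : kahlerManifold R m) (f : M -> R).
Local Notation n := (m + m)%N.
Local Notation J := (Jstd R m).
Hypothesis hsol : gradient_shrinking_KR_soliton f.
Let conn : connected [set: M]. Proof. by have [[]] := hsol. Qed.
Let compl : complete_metric M. Proof. by have [] := hsol. Qed.
Implicit Types (i j : chart_idx M) (p q : M).
Local Notation fi := (chart_fun f).
Local Notation sdist := (sdist f).
Local Notation cball := (cball f).

(* An upper barrier for [dist p]: when [phi = 1] it says that the drift Laplacian of [dist p] is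
   at most [eta] at [icoord i x], in the sense of support functions. *)
Definition jet p i (x : 'rV[R]_n) (phi eta : R) : Prop := exists C s0 : R, [/\ 0 <= C, 0 < s0 &
  forall s, 0 < s -> s < s0 -> exists E Psi : 'M[R]_n,
   [/\ forall a b, `|(E^T *m E - invmx (met i x)) a b| <= C * s ^+ 3, forall a, `|row a Psi| <= C &
     sdist p i x phi s E Psi <= 4 * n%:R * dist p (icoord i x) + 2 * s ^+ 2 * eta + C * s ^+ 3]].

(** With [phi = 0] all displaced points are [p] itself, and any orthonormal frame will do. *)
Lemma jet_start p i : dom i p -> jet p i (coord i p) 0 0.
Proof.
move=> dp; have Ux := im_coord dp.
have [E hE] := orthonormal_frame (kc_posdef (chart_kc i) Ux).
exists 0, 1; split=> // s s0 _; exists E, 0; split.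
- by move=> a b; rewrite (frame_gram hE) subrr mxE normr0 mul0r.
- by move=> a; rewrite row0 normr0.
rewrite coordK// (dist_refl conn) mulr0 !mul0r !addr0 mulr0.
have P0 e psi : dist p (pti f i (coord i p) 0 s e psi) = 0.
  by rewrite /pti /pt expr0n/= !scale0r !scaler0 !addr0 coordK// (dist_refl conn).
by rewrite /sdist big1// => a _; rewrite /sum4 !P0 !addr0.
Qed.

(** With [phi = 0] the sum is exactly [4 n] times the distance, so a negative [eta] is impossible
    for small [s]. *)
Lemma jet_end p i y eta : dom i y -> jet p i (coord i y) 0 eta -> 0 <= eta.
Proof.
move=> dy [C [s0 [C0 s00 H]]]; rewrite leNgt; apply/negP => eta0.
pose s := Num.min (s0 / 2) (- eta / (C + 1)).
have s_gt0 : 0 < s by rewrite lt_min !divr_gt0//; lra.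
have s_lt : s < s0 by rewrite gt_min; apply/orP; left; lra.
have [E [Psi [_ _]]] := H s s_gt0 s_lt.
have P0 e psi : dist p (pti f i (coord i y) 0 s e psi) = dist p y.
  by rewrite /pti /pt expr0n/= !scale0r !scaler0 !addr0 coordK.
have -> : sdist p i (coord i y) 0 s E Psi = 4 * n%:R * dist p y.
  rewrite /sdist (eq_bigr (fun=> 4 * dist p y)); last by move=> a _; rewrite /sum4 !P0; ring.
  by rewrite sumr_const card_ord -mulr_natl; ring.
rewrite coordK// -addrA lerDl => h1.
have sC : s * C < - eta.
  have : s * (C + 1) <= - eta by rewrite -ler_pdivlMr ?ge_min ?lexx ?orbT//; lra.
  by lra.
have s2 : 0 < s ^+ 2 by rewrite exprn_gt0.
have h2 : s ^+ 2 * (2 * eta + s * C) < 0 by rewrite pmulr_rlt0//; lra.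
by move: h1; rewrite (_ : _ + _ = s ^+ 2 * (2 * eta + s * C)); [lra|ring].
Qed.

Lemma dist_mid_step (y y' z : M) (t h : R) : dist y z = t -> dist z y' = dist y y' - t -> 0 <= h -> t + h <= dist y y' ->
  exists z', [/\ dist z z' = h, dist z' y' = dist y y' - (t + h) & dist y z' = t + h].
Proof.
move=> yz zy h0 th; have [|z' [zz' z'y]] := dist_mid conn compl (_ : 0 <= h <= dist z y').
  by rewrite h0 zy lerBrDl.
rewrite zy in z'y; exists z'; split=> //; first by rewrite z'y opprD addrA.
have h1 := dist_triangle conn z y z'; have h2 := dist_triangle conn z' y y'; lra.
Qed.

Lemma sc_chainend (n4 dp0 D s eta qq C K A S0 S1 : R) : 0 <= A -> 0 <= s -> S0 <= n4 * dp0 + 2 * s ^+ 2 * eta + C * s ^+ 3 ->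
  S1 <= S0 + n4 * D + 2 * s ^+ 2 * (D * qq) + K * D * s ^+ 3 ->
  S1 <= n4 * (dp0 + D) + 2 * s ^+ 2 * (eta + qq * D) + (C + A + K * D) * s ^+ 3.
Proof.
move=> A0 s0 h0 h1; apply: le_trans h1 _.
have h2 : 0 <= A * s ^+ 3 by rewrite mulr_ge0// exprn_ge0.
have -> : n4 * (dp0 + D) + 2 * s ^+ 2 * (eta + qq * D) + (C + A + K * D) * s ^+ 3 =
  (n4 * dp0 + 2 * s ^+ 2 * eta + C * s ^+ 3) + n4 * D + 2 * s ^+ 2 * (D * qq) + K * D * s ^+ 3 + A * s ^+ 3 by ring.
by rewrite -[X in X <= _]addr0; apply: lerD => //; do 3 rewrite lerD2r.
Qed.

(** [local_step] is iterated along exact intermediate points of equal spacing [h], within one chart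
    ball. The number of steps depends on [s], but the constants do not. *)
Lemma local_chain i x0 (r B : R) p y y' (phi kap eta qq : R) (D := dist y y') :
  cball i x0 r B -> dom i y -> `|coord i y - x0| < r / 4 -> B * D < r / 4 -> dist p y + D = dist p y' ->
  `|kap| <= 1 -> (forall t, 0 <= t -> t <= D -> `|phi + kap * t| <= 1) ->
  (forall z t, 0 <= t -> t <= D -> dist y z = t -> dist z y' = D - t -> dom i z -> forall u,
     bil (met i (coord i z)) u u = 1 -> bracket (fi i) (coord i z) u (phi + kap * t) kap <= qq) ->
  jet p i (coord i y) phi eta -> dom i y' /\ jet p i (coord i y') (phi + kap * D) (eta + qq * D).
Proof.
move=> cb dy hy hD add hkap hphi hbr [C [s0 [C0 s00 HC]]].
have g := cb_good cb; have r0 := gd_r g; have B_1 := gd_C g; have B0 := good_C0 g.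
have D0 : 0 <= D by exact: (dist_ge0 conn).
have near z : dist y z <= D -> dom i z /\ `|coord i z - x0| < r / 2.
  move=> hz; have Bz : B * dist y z <= B * D by rewrite ler_wpM2l.
  have rr : `|coord i y - x0| + B * dist y z < r by lra.
  have [dz [h1 _]] := dist_good conn g dy rr; split=> //.
  have -> : coord i z - x0 = (coord i z - coord i y) + (coord i y - x0) by rewrite addrA subrK.
  by apply: le_lt_trans (ler_normD _ _) _; lra.
have [dy' _] := near y' (lexx _); split=> //.
have eq0 z : dist y z <= D -> dist z y' = 0 -> z = y'.
  move=> hz hzy; have [dz hz2] := near z hz.
  have rr : `|coord i z - x0| + B * dist z y' < r by rewrite hzy mulr0 addr0; lra.
  have [_ [h1 _]] := dist_good conn g dz rr; move: h1; rewrite hzy mulr0 normr_le0 subr_eq0 => /eqP h1.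
  by rewrite -(coordK dz) -h1 coordK.
have [D_eq0|D_neq0] := eqVneq D 0.
  have -> : y' = y by apply/esym/eq0; rewrite ?(dist_refl conn).
  by rewrite D_eq0 !mulr0 !addr0; exists C, s0.
have Dp : 0 < D by rewrite lt_neqAle eq_sym D_neq0.
(* One bound for the frames, the corrections [Psi] and [qq], as [local_step] requires. *)
pose B1 := n%:R * (B + 1) + (B + 1) + C + `|qq|.
have hB1 : n%:R * (B + 1) + (B + 1) <= B1 by rewrite /B1 -addrA lerDl addr_ge0.
have nB : (0 : R) <= n%:R * (B + 1) by rewrite mulr_ge0//; lra.
have qB1 : `|qq| <= B1 by rewrite /B1 lerDr; lra.
have CB1 : C <= B1 by rewrite /B1; have := normr_ge0 qq; lra.
have [K K0 [s1 s10 LS]] := local_step hsol cb hB1.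
pose A := (C + 1) * expR (K * D).
have A0 : 0 <= A by rewrite mulr_ge0 ?expR_ge0//; lra.
(* The bounds 1 and [1 / (A + 1)] on [s] give [A * s ^ 3 <= s], which keeps the defect of the frame
   below [s] all along the chain. *)
exists (C + A + K * D), (Num.min s0 (Num.min s1 (Num.min 1 (A + 1)^-1))).
have KD : 0 <= K * D by exact: mulr_ge0.
have AK : A <= C + A + K * D by rewrite addrAC lerDr addr_ge0.
have CK : C <= C + A + K * D by rewrite -addrA lerDl addr_ge0.
split; [lra|by rewrite !lt_min s00 s10 ltr01 invr_gt0; lra|].
move=> s s_0; rewrite !lt_min => /and4P[ss0 ss1 sl1 sA].
have [E0 [Psi [hE0 hPsi hS0]]] := HC s s_0 ss0.
have s3 : 0 < s ^+ 3 by rewrite exprn_gt0.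
have s32 : 0 < s ^+ 3 / 2 by lra.
(* Steps of length at most [s ^ 3 / 2]; taking [N.+1] of them excludes an empty subdivision. *)
have [N hN] := step_count D0 s32.
set h := D / N.+1%:R in hN.
have h0 : 0 < h by rewrite divr_gt0.
have Nh : N.+1%:R * h = D by rewrite mulrC divfK// pnatr_eq0.
have hs3 : h <= s ^+ 3 by lra.
have As : A * s ^+ 3 <= s.
  have h1 : s * (A + 1) < 1 by rewrite -ltr_pdivlMr ?mul1r//; lra.
  have h2 : A * s <= 1 by lra.
  have h3 : A * s * s <= 1 * 1 by apply: ler_pM => //; [rewrite mulr_ge0//; exact: ltW|exact: ltW|exact: ltW].
  by rewrite exprSr mulrA expr2 mulrA ler_piMl//; [exact: ltW|lra].
pose q k := gq (C * s ^+ 3) h K k.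
have Cs : 0 <= C * s ^+ 3 by rewrite mulr_ge0// ltW.
have kh k : (k <= N.+1)%N -> k%:R * h <= D by move=> kN; rewrite -Nh ler_pM2r// ler_nat.
have qA k : (k <= N.+1)%N -> q k <= A * s ^+ 3.
  move=> kN; apply: gq_le => //; try exact: ltW.
  by rewrite -mulrA ler_wpM2l// mulrC kh.
have q_ge k : 0 <= q k by apply: (le_trans Cs); exact: (gq_ge k Cs (ltW h0) K0).
have claim k : (k <= N.+1)%N -> exists z E, [/\ dist y z = k%:R * h, dist z y' = D - k%:R * h,
    forall a b, `|(E^T *m E - invmx (met i (coord i z))) a b| <= q k &
    sdist p i (coord i z) (phi + kap * (k%:R * h)) s E Psi <= sdist p i (coord i y) phi s E0 Psi +
      4 * n%:R * (k%:R * h) + 2 * s ^+ 2 * ((k%:R * h) * qq) + K * (k%:R * h) * s ^+ 3].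
  elim: k => [|k IH] kN.
    exists y, E0; rewrite ?(mul0r, mulr0) ?addr0 subr0 (dist_refl conn); split=> //.
    by move=> a b; apply: le_trans (hE0 a b) _; exact: (gq_ge _ Cs (ltW h0) K0).
  have [z [E [yz zy hE hS]]] := IH (ltnW kN).
  have k1 : k.+1%:R * h = k%:R * h + h by rewrite -natr1 mulrDl mul1r.
  have khD : k%:R * h + h <= D by rewrite -k1; exact: kh.
  have kh0 : 0 <= k%:R * h by rewrite mulr_ge0// ltW.
  have [z' [zz' z'y yz'']] := dist_mid_step yz zy (ltW h0) khD.
  have yz' : dist y z' = k.+1%:R * h by rewrite yz'' k1.
  have khD' : k%:R * h <= D by apply: le_trans khD; rewrite lerDl ltW.
  have yzD : dist y z <= D by rewrite yz.
  have [dz hz] := near z yzD.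
  have yzD' : dist y z' <= D by rewrite yz'' .
  have [dz' hz'] := near z' yzD'.
  have := LS p (coord i z) (coord i z') (phi + kap * (k%:R * h)) kap s (q k) qq E Psi hz hz' s_0 ss1.
  rewrite !coordK// zz'; case => //.
  - by apply: hphi => //; apply: le_trans khD; rewrite lerDl ltW.
  - exact: le_trans (qA k (ltnW kN)) As.
  - by move=> a; exact: le_trans (hPsi a) CB1.
  - by move=> u hu; apply: (hbr z (k%:R * h)) => //; apply: le_trans khD; rewrite lerDl ltW.
  move=> E' [hE' hS']; exists z', E'; split=> //.
  - by rewrite z'y k1.
  - by move=> a b; apply: le_trans (hE' a b) _; rewrite /q gqS.
  have -> : phi + kap * (k.+1%:R * h) = phi + kap * (k%:R * h) + kap * h by rewrite k1 mulrDr addrA.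
  apply: le_trans hS' _; rewrite k1; move: hS.
  have calc (S S' a b c d e : R) : S' <= S + a * b + c * (b * d) + e * b * s ^+ 3 ->
     S' + a * h + c * (h * d) + e * h * s ^+ 3 <= S + a * (b + h) + c * ((b + h) * d) + e * (b + h) * s ^+ 3.
    move=> h1; rewrite -subr_ge0; move: h1; rewrite -subr_ge0.
    by congr (0 <= _); ring.
  exact: calc.
have [z [E [yz zy hE hS]]] := claim N.+1 (leqnn _).
rewrite Nh in yz zy hS; rewrite subrr in zy.
have zy' : z = y' by apply: eq0 => //; rewrite yz.
rewrite zy' in hE hS; exists E, Psi; split.
- move=> a b; apply: le_trans (hE a b) _; apply: le_trans (qA _ (leqnn _)) _.
  exact: ler_wpM2r (ltW s3) _ _ AK.
- by move=> a; exact: le_trans (hPsi a) CK.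
rewrite coordK// in hS0; rewrite coordK// -add; exact: sc_chainend A0 (ltW s_0) hS0 hS.
Qed.
End Chain.

(** * Change of holomorphic chart *)

Section ChartChange.
Variables (R : realType) (m : nat) (M : kahlerManifold R m) (f : M -> R).
Local Notation n := (m + m)%N.
Local Notation J := (Jstd R m).
Hypothesis hsol : gradient_shrinking_KR_soliton f.
Let conn : connected [set: M]. Proof. by have [[]] := hsol. Qed.
Implicit Types (i j : chart_idx M) (p q : M).
Local Notation fi := (chart_fun f).
Local Notation sdist := (sdist f).
Local Notation cball := (cball f).

Lemma smx_tran i j : smx (ov i j) (@tran _ _ M i j).
Proof. by move=> a k; rewrite ord1; exact: tran_smooth. Qed.

Lemma dM_tran i j y v : ov i j y -> dM (@tran _ _ M i j) y v = v *m jac (@tran _ _ M i j) y.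
Proof.
move=> oy; apply/rowP => k; rewrite dME (smoothDE _ (@ov_open _ _ M i j) (@tran_smooth _ _ M i j k) oy).
by rewrite mxE; apply: eq_bigr => a _; rewrite mxE.
Qed.

Lemma jac_J i j y : ov i j y -> J *m jac (@tran _ _ M i j) y = jac (@tran _ _ M i j) y *m J.
Proof. by move=> oy; exact: transition_holomorphic. Qed.

(** The second differential of the transition map; it is the obstruction to displaced points being
    independent of the chart. *)
Definition tran2 i j x v : 'rV[R]_n := dM (fun y => dM (@tran _ _ M i j) y v) x v.

(** The transition map is holomorphic, so its second differential is complex bilinear. This matches
    the opposite signs of [psi] at [e] and [J e] in [sum4], and allows the term to be absorbed in
    [psi]. *)
Lemma tran2_J i j x v : ov i j x -> tran2 i j x (v *m J) = - tran2 i j x v.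
Proof.
move=> ox; have oU := @ov_open _ _ M i j; have st := @smx_tran i j.
have E w y : ov i j y -> dM (@tran _ _ M i j) y (w *m J) = dM (@tran _ _ M i j) y w *m J.
  by move=> oy; rewrite !dM_tran// -mulmxA jac_J// mulmxA.
have F w z : dM (fun y => dM (@tran _ _ M i j) y (w *m J)) x z = dM (fun y => dM (@tran _ _ M i j) y w) x z *m J.
  rewrite (dM_ext oU ox z (fun y oy => E w y oy)).
  have := dM_mul oU ox z (smx_dM oU w st) (smx_const (ov i j) J); rewrite dM_const mulmx0 addr0.
  by move=> ->.
rewrite /tran2 F (dM_Schwarz oU _ _ ox st) F mulJJ; by [].
Qed.

Lemma tran2N i j x v : ov i j x -> tran2 i j x (- v) = tran2 i j x v.
Proof.
move=> ox; have oU := @ov_open _ _ M i j; have st := @smx_tran i j.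
have F w : w = (-1 : R) *: (- w) :> 'rV[R]_n by rewrite scaleN1r opprK.
have G w : - w = (-1 : R) *: w :> 'rV[R]_n by rewrite scaleN1r.
have h1 : dM (fun y => dM (@tran _ _ M i j) y (- v)) x (- v) = dM (fun y => (-1) *: dM (@tran _ _ M i j) y v) x (- v).
  by apply: (dM_ext oU ox) => y oy; rewrite G (dM_dirZ oU oy _ _ st).
rewrite /tran2 h1 [X in dM _ _ X]G.
have s2 : smx (ov i j) (fun y => dM (@tran _ _ M i j) y v) by exact: smx_dM.
have h2 : dM (fun y => (-1) *: dM (@tran _ _ M i j) y v) x v = (-1) *: dM (fun y => dM (@tran _ _ M i j) y v) x v.
  have := dM_mul oU ox v s2 (smx_const (ov i j) ((-1)%:M)).
  rewrite dM_const mulmx0 addr0 mul_mx_scalar => <-.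
  by apply: (dM_ext oU ox) => y _; rewrite mul_mx_scalar.
have s3 : smx (ov i j) (fun y => (-1) *: dM (@tran _ _ M i j) y v).
  move=> a b; apply: (smooth_ext oU _ (smoothZ (-1) oU (s2 a b))) => y _; by rewrite [RHS]mxE.
by rewrite (dM_dirZ oU ox _ _ s3) h2 scalerA mulrNN mulr1 scale1r.
Qed.

Lemma gradV_tran i j x : ov i j x ->
  gradV (met i) (fi i) x *m jac (@tran _ _ M i j) x = gradV (met j) (fi j) (tran i j x).
Proof.
move=> ox; have [Ux dj] := (ovE i j x).1 ox; have Uj := tran_im ox.
have sI := sc_f (chart_sc i hsol); have sJ := sc_f (chart_sc j hsol).
apply: (bil_g_inj (chart_kc j) Uj) => X.
have uA : jac (@tran _ _ M i j) x \in unitmx.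
  have := met_transition ox; have uG := kc_unit (chart_kc i) Ux => E.
  by rewrite E !unitmx_mul in uG; case/andP: uG => /andP[].
pose w := X *m invmx (jac (@tran _ _ M i j) x).
have -> : X = w *m jac (@tran _ _ M i j) x by rewrite /w mulmxKV.
rewrite (met_tran _ _ ox) (bil_gradV (chart_kc i) Ux _ sI) (bil_gradV (chart_kc j) Uj _ sJ).
have [dL e1L] := line_is_derive x w 0.
have L0 : x + (0 : R) *: w = x by rewrite scale0r addr0.
have dL1 : derive1 (fun s : R => x + s *: w) 0 = w by rewrite derive1E e1L.
have U0 : ov i j ((fun s : R => x + s *: w) 0) by rewrite /= L0.
have [dT T1] := curve_chain (@ov_open _ _ M i j) U0 (@tran_smooth _ _ M i j) dL.
have Ui0 : im i ((fun s : R => x + s *: w) 0) by rewrite /= L0.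
have Uj0 : im j ((tran i j \o (fun s : R => x + s *: w)) 0) by rewrite /= L0.
have h1 := curve_chain_scalar (@im_open _ _ M i) Ui0 sI dL.
have h2 := curve_chain_scalar (@im_open _ _ M j) Uj0 sJ dT.
rewrite T1 dL1 /= L0 in h2; rewrite dL1 /= L0 in h1.
have nE : \forall s \near (0 : R), (fi i \o (fun s : R => x + s *: w)) s = (fi j \o (tran i j \o (fun s : R => x + s *: w))) s.
  have n1 : \forall s \near (0 : R), ov i j (x + s *: w).
    have := @seg_near R m x (x + w) 0 (ov i j) (@ov_open _ _ M i j); rewrite (addrC x w) addrK L0; exact.
  by apply: filterS n1 => s os; rewrite /= /chart_fun icoord_tran.
have hE := near_eq_derive (1 : R) nE.
have [_ <-] := h1; have [_ <-] := h2.
by rewrite hE.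
Qed.

Lemma ginv_tran i j x : ov i j x -> invmx (met j (tran i j x)) =
  (jac (@tran _ _ M i j) x)^T *m invmx (met i x) *m jac (@tran _ _ M i j) x.
Proof.
move=> ox; have [Ux dj] := (ovE i j x).1 ox.
set A := jac _ x; set G := met j _; have E : met i x = A *m G *m A^T := met_transition ox.
have := kc_unit (chart_kc i) Ux; rewrite E !unitmx_mul => /andP[/andP[uA uG] uAT].
have F : A^T *m invmx (A *m G *m A^T) *m A *m G = 1%:M.
  have H : invmx (A *m G *m A^T) *m (A *m G *m A^T) = 1%:M by rewrite mulVmx// !unitmx_mul uA uG.
  have H2 : A^T *m (invmx (A *m G *m A^T) *m (A *m G *m A^T)) *m invmx A^T = 1%:M by rewrite H mulmx1 mulmxV.
  by rewrite -[RHS]H2 -!mulmxA mulmxV// mulmx1.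
by rewrite -[RHS]mulmx1 -(mulmxV uG) mulmxA F mul1mx.
Qed.

Lemma tran2E i j x v k : tran2 i j x v 0 k = 'D_v ('D_v (fun y => tran i j y 0 k)) x.
Proof. by rewrite /tran2 dME; congr ('D_v _ x); apply/funext => y; exact: dME. Qed.

Lemma row_close (d : nat) (a b c e g : 'rV[R]_d) (s K : R) : 0 <= K ->
  (forall k, `|a 0 k - b 0 k - s * c 0 k - s ^+ 2 * (e 0 k + 2^-1 * g 0 k)| <= K) ->
  `|a - (b + (s *: c + s ^+ 2 *: (e + 2^-1 *: g)))| <= K.
Proof.
move=> K0 H; apply: normv_le => // k; move: (H k); rewrite !mxE.
by move: (a 0 k) (b 0 k) (c 0 k) (e 0 k) (g 0 k) => A B C E G; congr (`| _ | <= _); ring.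
Qed.

(** The displacement transforms by the differential of the transition map, and half the second
    differential is added to [psi]; the gradient drift is tensorial by [gradV_tran]. Hence the two
    displaced points are at a distance of order [s ^ 3]. *)
Lemma tran_pt i j x (Z : R) : ov i j x -> 0 <= Z -> exists2 K : R, 0 <= K & exists2 s0 : R, 0 < s0 &
  forall p (phi s : R) e psi, 0 < s -> s < s0 -> `|phi| <= 1 -> `|e| <= Z -> `|psi| <= Z ->
  dist p (pti f j (tran i j x) phi s (e *m jac (@tran _ _ M i j) x) (psi *m jac (@tran _ _ M i j) x + 2^-1 *: tran2 i j x e))
  <= dist p (pti f i x phi s e psi) + K * s ^+ 3.
Proof.
move=> ox Z0; have [Ux dj] := (ovE i j x).1 ox; have Uj := tran_im ox.
have oU := @ov_open _ _ M i j.
have [r [C [r0 C0 HU HC]]] := controlled_all oU ox (@tran_smooth _ _ M i j).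
have [rj [Cj g]] := good_ex Uj; have rj0 := gd_r g; have Cj1 := gd_C g.
set T := tran i j x in g *; set A := jac _ x; set V := gradV (met i) (fi i) x.
pose W := Z + `|V|; have W0 : 0 <= W by rewrite addr_ge0.
pose K1 := C * (8 * W ^+ 3 + 2 * W ^+ 2).
have K10 : 0 <= K1 by rewrite mulr_ge0// addr_ge0// mulr_ge0// exprn_ge0.
pose C1 := C * (2 * W) + K1; have C10 : 0 <= C1 by rewrite addr_ge0// !mulr_ge0.
have Cj0 : 0 <= Cj by lra.
have CK : 0 <= Cj * K1 by exact: mulr_ge0.
exists ((1 + Cj * K1) * (Cj * K1)); first by rewrite mulr_ge0// addr_ge0.
exists (Num.min 1 (Num.min (r / (2 * W + 1)) (rj / (C1 + K1 + 1)))).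
  by rewrite !lt_min ltr01 !divr_gt0//; lra.
move=> p phi s e psi s0; rewrite !lt_min => /and3P[s1 sr sj] hphi he hpsi.
have s0' := ltW s0; have s1' := ltW s1.
have s3s : s ^+ 3 <= s by rewrite exprS ler_piMr// exprn_ile1.
have s2s : s ^+ 2 <= s by rewrite expr2 ler_piMr.
have s3 : 0 <= s ^+ 3 by exact: exprn_ge0.
have hphi2 : `|phi ^+ 2| <= 1 by rewrite normrX exprn_ile1.
pose z1 := phi *: e; pose z2 := phi ^+ 2 *: (psi - nuc R m *: V).
have hz1 : `|z1| <= W.
  by rewrite -[W]mul1r; apply: norm_leZ => //; apply: le_trans he _; rewrite lerDl.
have hz2 : `|z2| <= W.
  rewrite -[W]mul1r; apply: norm_leZ => //; apply: norm_leB => //.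
  by rewrite -[`|V|]mul1r; apply: norm_leZ => //; exact: nuc_bound.
have dz : `|s *: z1 + s ^+ 2 *: z2| <= s * (2 * W).
  have -> : s * (2 * W) = s * W + s * W by ring.
  apply: norm_leD; first by apply: norm_leZ => //; rewrite ger0_norm.
  by apply: norm_leZ => //; rewrite ger0_norm ?exprn_ge0.
have sr' : s * (2 * W) < r.
  by have := sr; rewrite ltr_pdivlMr; lra.
have hP : `|x + (s *: z1 + s ^+ 2 *: z2) - x| < r by rewrite addrC addKr; exact: le_lt_trans sr'.
have hx : `|x - x| < r by rewrite subrr normr0.
set P := x + (s *: z1 + s ^+ 2 *: z2) in hP.
have oP := HU P hP.
(* The second-order Taylor polynomial of the transition map at the displaced point; by [EQ] below it
   is exactly the displaced point of the other chart. *)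
pose Q := T + (s *: (z1 *m A) + s ^+ 2 *: (z2 *m A + 2^-1 *: (phi ^+ 2 *: tran2 i j x e))).
have PQ : `|tran i j P - Q| <= K1 * s ^+ 3.
  apply: row_close => [|k]; first by rewrite mulr_ge0.
  have := taylor_jet oU (@tran_smooth _ _ M i j k) (HC k) hx hP hz1 hz2 (_ : 0 <= s <= 1).
  rewrite s0' s1' => /(_ isT).
  have D1 w : 'D_w (fun y => tran i j y 0 k) x = (w *m A) 0 k by rewrite -(dM_tran w ox) dME.
  rewrite !D1; have -> : 'D_z1 ('D_z1 (fun y => tran i j y 0 k)) x = (phi ^+ 2 *: tran2 i j x e) 0 k.
    rewrite [RHS]mxE tran2E.
    have := dir2_expand e e phi 0 oU (@tran_smooth _ _ M i j k) ox; rewrite scale0r addr0 !mul0r !addr0 mulrA -expr2.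
    by move=> <-.
  by [].
have EQ : pt (met j) (fi j) T phi s (e *m A) (psi *m A + 2^-1 *: tran2 i j x e) = Q.
  rewrite /pt -(gradV_tran ox) -/V -/A /Q /z1 /z2 -!scalemxAl mulmxBl -scalemxAl.
  congr (_ + (_ + _ *: _)); rewrite addrAC scalerDr; congr (_ + _).
  by rewrite !scalerA mulrC.
rewrite /pti EQ -[pt (met i) (fi i) x phi s e psi]/P -(icoord_tran oP).
have tP : `|tran i j P - T| <= s * C1.
  apply: normv_le => [|k]; first by rewrite mulr_ge0.
  have := taylor_1 (HC k) hx hP; rewrite !mxE => h1; apply: le_trans h1 _.
  apply: le_trans (_ : C * (s * (2 * W)) <= _); first by rewrite ler_wpM2l.
  by rewrite mulrCA ler_wpM2l// /C1 lerDl.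
have sj' : s * (C1 + K1) < rj by have := sj; rewrite ltr_pdivlMr; lra.
have ht : `|tran i j P - T| < rj.
  by apply: le_lt_trans sj'; apply: le_trans tP _; rewrite ler_wpM2l// lerDl.
have PQ' : `|Q - tran i j P| <= K1 * s ^+ 3 by rewrite distrC.
have hQ : `|Q - T| < rj.
  have -> : Q - T = (Q - tran i j P) + (tran i j P - T) by rewrite addrA subrK.
  apply: le_lt_trans (norm_leD PQ' tP) _; apply: le_lt_trans sj'.
  by rewrite [s * (C1 + K1)]mulrDr [leRHS]addrC lerD2r [leRHS]mulrC ler_wpM2l.
apply: le_trans (dist_triangle conn (icoord j (tran i j P)) _ _) _; rewrite lerD2l.
apply: le_trans (dist_seg conn g ht hQ) _.
rewrite -(mulrA (1 + Cj * K1)); apply: ler_pM.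
- by rewrite addr_ge0// mulr_ge0.
- exact: nrm_ge0.
- rewrite lerD2l ler_wpM2l//; apply: le_trans PQ' _; rewrite ler_piMr// exprn_ile1//.
apply: le_trans (gd_hi g _ ht) _; rewrite -mulrA ler_wpM2l//.
Qed.

Lemma le4 (a1 a2 a3 a4 b1 b2 b3 b4 k : R) : a1 <= b1 + k -> a2 <= b2 + k -> a3 <= b3 + k -> a4 <= b4 + k ->
  a1 + a2 + a3 + a4 <= b1 + b2 + b3 + b4 + 4 * k.
Proof. by lra. Qed.

Lemma sc_add3 (S S0 a b c h k : R) : S <= S0 + k -> S0 <= a + b + c -> 0 <= h -> S <= a + b + (h + c + k).
Proof. by lra. Qed.

Lemma jet_chart p i j y (phi eta : R) : dom i y -> dom j y -> `|phi| <= 1 ->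
  jet f p i (coord i y) phi eta -> jet f p j (coord j y) phi eta.
Proof.
move=> di dj hphi [C [s0 [C0 s00 HC]]].
have ox : ov i j (coord i y) := ov_coord di dj; set x := coord i y in HC ox *.
have Tx : tran i j x = coord j y by rewrite /tran coordK.
have Ux := im_coord di; set A := jac (@tran _ _ M i j) x.
have [r [B cb]] := cball_ex hsol Ux; have g := cb_good cb; have N := cb_nice cb.
have B1 := gd_C g; have B0 := good_C0 g.
have hxr : `|coord i y - coord i y| < r by rewrite subrr normr0 (gd_r g).
pose a0 := \sum_a \sum_b `|A a b|.
have a00 : 0 <= a0 by apply: sumr_ge0 => a _; exact: sumr_ge0.
have hA a b : `|A a b| <= a0.
  rewrite /a0 (bigD1 a)//= (bigD1 b)//= -addrA lerDl addr_ge0// ?sumr_ge0// => c _; exact: sumr_ge0.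
pose Z := n%:R * (B + 1) + (B + 1) + C.
have nB : (0 : R) <= n%:R * (B + 1) by rewrite mulr_ge0//; lra.
have Z0 : 0 <= Z by rewrite /Z; lra.
have [K K0 [s1 s10 HK]] := tran_pt ox Z0.
have oU := @ov_open _ _ M i j.
have [r2 [C2 [r20 C20 HU H2]]] := controlled_all oU ox (@tran_smooth _ _ M i j).
have hx2 : `|x - x| < r2 by rewrite subrr normr0.
pose P0 := n%:R * a0 * C + C2 * Z * Z.
have P00 : 0 <= P0 by rewrite addr_ge0// !mulr_ge0.
pose G0 := n%:R * (n%:R * (a0 * C) * a0); have G00 : 0 <= G0 by rewrite !mulr_ge0.
exists (P0 + G0 + C + 4 * n%:R * K), (Num.min s0 (Num.min s1 (Num.min 1 (C + 1)^-1))).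
have nK : 0 <= 4 * n%:R * K by rewrite !mulr_ge0.
split; [lra|by rewrite !lt_min s00 s10 ltr01 invr_gt0; lra|].
move=> s s_0; rewrite !lt_min => /and4P[ss0 ss1 sl1 sC].
have [E [Psi [hE hPsi hS]]] := HC s s_0 ss0.
have s3 : 0 <= s ^+ 3 by rewrite exprn_ge0// ltW.
have Cs1 : C * s ^+ 3 <= 1.
  have h1 : s * (C + 1) < 1 by rewrite -ltr_pdivlMr ?mul1r//; lra.
  have h2 : s ^+ 3 <= s by rewrite exprS ler_piMr ?(ltW s_0)// exprn_ile1// ltW.
  have h3 : C * s ^+ 3 <= C * s by rewrite ler_wpM2l.
  by lra.
have hbE := gram_norm (mulr_ge0 C0 s3) Cs1 B1 (fun a b => ctrl_0 (nc_gi N a b) hxr) hE.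
have hEZ a : `|row a E| <= Z by apply: le_trans (hbE a) _; rewrite /Z; lra.
have hEJ a : `|row a E *m J| <= Z.
  apply: le_trans (normJ _) _; apply: le_trans (_ : n%:R * (B + 1) <= _); first by rewrite ler_wpM2l.
  by rewrite /Z; lra.
have hPZ a : `|row a Psi| <= Z by apply: le_trans (hPsi a) _; rewrite /Z; lra.
pose E' := E *m A; pose Psi' := \matrix_a (row a Psi *m A + 2^-1 *: tran2 i j x (row a E)).
exists E', Psi'; split.
- have -> : E'^T *m E' - invmx (met j (coord j y)) = A^T *m (E^T *m E - invmx (met i x)) *m A.
    by rewrite -Tx (ginv_tran ox) /E' trmx_mul -/A mulmxBr mulmxBl !mulmxA.
  move=> a b; have Cs : 0 <= C * s ^+ 3 by rewrite mulr_ge0.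
  have hAT c e : `|A^T c e| <= a0 by rewrite mxE.
  have h1 := mulmx_bound a00 Cs hAT hE.
  have nC : 0 <= n%:R * (a0 * (C * s ^+ 3)) by rewrite mulr_ge0// mulr_ge0.
  apply: le_trans (mulmx_bound nC a00 h1 hA a b) _.
  have -> : n%:R * (n%:R * (a0 * (C * s ^+ 3)) * a0) = G0 * s ^+ 3 by rewrite /G0; ring.
  by rewrite ler_wpM2r//; lra.
- move=> a; rewrite rowK; apply: le_trans (_ : P0 <= _); last by lra.
  apply: norm_leD.
    apply: normv_le => [|k]; first by rewrite !mulr_ge0.
    rewrite mxE; apply: le_trans (ler_norm_sum _ _ _) _.
    have -> : n%:R * a0 * C = \sum_(b < n) (C * a0) by rewrite sumr_const card_ord -mulr_natl; ring.
    apply: ler_sum => b _; rewrite normrM; apply: ler_pM => //.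
    exact: le_trans (normv_coord _ _) (hPsi a).
  have -> : C2 * Z * Z = 2^-1 * (2 * (C2 * Z * Z)) by field.
  apply: norm_leZ; first by rewrite ger0_norm.
  apply: le_trans (_ : C2 * Z * Z <= _); last by rewrite ler_peMl ?ler1n// !mulr_ge0.
  apply: normv_le => [|k]; first by rewrite !mulr_ge0.
  rewrite tran2E; apply: le_trans (ctrl_2 (H2 k) _ _ hx2) _.
  by apply: ler_pM => //; [rewrite mulr_ge0|rewrite ler_wpM2l].
have S4 a : sum4 (fun e psi => dist p (pti f j (coord j y) phi s e psi)) (row a E') (row a Psi')
   <= sum4 (fun e psi => dist p (pti f i x phi s e psi)) (row a E) (row a Psi) + 4 * (K * s ^+ 3).
  rewrite rowK row_mul /sum4; set e := row a E; set psi := row a Psi.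
  have he : `|e| <= Z := hEZ a; have heJ : `|e *m J| <= Z := hEJ a; have hp : `|psi| <= Z := hPZ a.
  have heN : `|- e| <= Z by rewrite normrN.
  have heJN : `|- (e *m J)| <= Z by rewrite normrN.
  have hpN : `|- psi| <= Z by rewrite normrN.
  have h1 := HK p phi s e psi s_0 ss1 hphi he hp.
  have h2 := HK p phi s _ _ s_0 ss1 hphi heJ hpN.
  have h3 := HK p phi s _ _ s_0 ss1 hphi heN hp.
  have h4 := HK p phi s _ _ s_0 ss1 hphi heJN hpN.
  have NT : - psi *m A + 2^-1 *: - tran2 i j x e = - (psi *m A + 2^-1 *: tran2 i j x e).
    by rewrite mulNmx scalerN opprD.
  have JA : e *m J *m A = e *m A *m J by rewrite -mulmxA jac_J// mulmxA.
  rewrite Tx in h1 h2 h3 h4.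
  rewrite tran2_J// -/A NT JA in h2; rewrite tran2N// mulNmx in h3.
  rewrite tran2N// tran2_J// -/A NT mulNmx JA in h4.
  exact: le4 h1 h2 h3 h4.
have tot : sdist p j (coord j y) phi s E' Psi' <= sdist p i x phi s E Psi + 4 * n%:R * K * s ^+ 3.
  have -> : sdist p i x phi s E Psi + 4 * n%:R * K * s ^+ 3 =
     \sum_a (sum4 (fun e psi => dist p (pti f i x phi s e psi)) (row a E) (row a Psi) + 4 * (K * s ^+ 3)).
    by rewrite big_split/= sumr_const card_ord -mulr_natl; congr (_ + _); ring.
  by apply: ler_sum => a _; exact: S4.
rewrite /x coordK// in hS; rewrite coordK//.
have h5 : 0 <= (P0 + G0) * s ^+ 3 by rewrite mulr_ge0// addr_ge0.
have -> : (P0 + G0 + C + 4 * n%:R * K) * s ^+ 3 = (P0 + G0) * s ^+ 3 + C * s ^+ 3 + 4 * n%:R * K * s ^+ 3 by ring.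
exact: sc_add3 tot hS h5.
Qed.
End ChartChange.

(** * Barriers for the distance and the lower bound for the gradient *)

Section Global.
Variables (R : realType) (m : nat) (M : kahlerManifold R m) (f : M -> R).
Local Notation n := (m + m)%N.
Local Notation J := (Jstd R m).
Hypothesis hsol : gradient_shrinking_KR_soliton f.
Let conn : connected [set: M]. Proof. by have [[]] := hsol. Qed.
Let compl : complete_metric M. Proof. by have [] := hsol. Qed.
Implicit Types (i j : chart_idx M) (p q : M).
Local Notation fi := (chart_fun f).
Local Notation sdist := (sdist f).
Local Notation cball := (cball f).
Local Notation jet := (jet f).

Definition St p y (phi eta : R) : Prop := forall i, dom i y -> jet p i (coord i y) phi eta.

Lemma St_start p : St p p 0 0. Proof. by move=> i di; exact: jet_start. Qed.
Lemma St_end p y eta : St p y 0 eta -> 0 <= eta.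
Proof. by move=> /(_ _ (dom_chart_at y)); exact: (jet_end (dom_chart_at y)). Qed.

(** A Lebesgue number: a length [lam] such that a path of length [lam] from any point of [A] fits in
    one controlled chart ball. *)
Lemma uniform_ball (A : set M) : compact A -> exists2 lam : R, 0 < lam & forall z, A z ->
  exists i x0 (r B : R), [/\ cball i x0 r B, dom i z, `|coord i z - x0| < r / 4 & B * lam < r / 4].
Proof.
move=> cA; pose P (B : set M) := exists2 lam : R, 0 < lam & forall z, B z ->
  exists i x0 (r B : R), [/\ cball i x0 r B, dom i z, `|coord i z - x0| < r / 4 & B * lam < r / 4].
apply: (@compact_ind _ A P cA).
- by exists 1.
- move=> B C [l l0 HB] [k k0 HC]; exists (Num.min l k); first by rewrite lt_min l0.
  move=> z [/HB|/HC] [i [x0 [r [B1 [cb dz hz hl]]]]]; exists i, x0, r, B1; split=> //;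
    apply: le_lt_trans hl; rewrite ler_wpM2l ?(good_C0 (cb_good cb))// ge_min lexx ?orbT//.
- by move=> B C BC [l l0 HC]; exists l => // z /BC; exact: HC.
move=> z _; have dz := dom_chart_at z; set i := chart_at z in dz *.
have [r [B cb]] := cball_ex hsol (im_coord dz).
have g := cb_good cb; have r0 := gd_r g; have B1 := gd_C g.
exists [set q | dom i q /\ `|coord i q - coord i z| < r / 4].
  have r4 : 0 < r / 4 by lra.
  have r4r : r / 4 <= r by lra.
  by apply: (good_nbhs (good_le g r4 r4r) dz); rewrite subrr normr0.
exists (r / 4 / (2 * B)); first by rewrite !divr_gt0//; lra.
move=> q [dq hq]; exists i, (coord i z), r, B; split=> //.
rewrite mulrA ltr_pdivrMr; last by lra.
have : 0 < B * r by rewrite mulr_gt0//; lra.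
lra.
Qed.

(** The piece from [y] to [y'] is cut by intermediate points into parts that fit in controlled chart
    balls. Each part is handled by [local_chain], and [jet_chart] makes the result available in all
    charts before the next one. *)
Lemma St_move p y y' (phi kap eta qq : R) (D := dist y y') : dist p y + D = dist p y' -> `|kap| <= 1 ->
  (forall t, 0 <= t -> t <= D -> `|phi + kap * t| <= 1) ->
  (forall z t i, 0 <= t -> t <= D -> dist y z = t -> dist z y' = D - t -> dom i z -> forall u,
     bil (met i (coord i z)) u u = 1 -> bracket (fi i) (coord i z) u (phi + kap * t) kap <= qq) ->
  St p y phi eta -> St p y' (phi + kap * D) (eta + qq * D).
Proof.
move=> add hkap hphi hbr S0.
have D0 : 0 <= D by exact: (dist_ge0 conn).
have [lam lam0 HL] := uniform_ball (ball_compact conn compl (p := y) (rho := D)).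
have [N hN] := step_count D0 lam0; set h := D / N.+1%:R in hN.
have h0 : 0 <= h by rewrite divr_ge0.
have Nh : N.+1%:R * h = D by rewrite mulrC divfK// pnatr_eq0.
have kh k : (k <= N.+1)%N -> k%:R * h <= D.
  by move=> kN; rewrite -[X in _ <= X]Nh ler_wpM2r// ler_nat.
have claim k : (k <= N.+1)%N -> exists z, [/\ dist y z = k%:R * h, dist z y' = D - k%:R * h &
   St p z (phi + kap * (k%:R * h)) (eta + qq * (k%:R * h))].
  elim: k => [|k IH] kN.
    by exists y; rewrite mul0r !mulr0 !addr0 subr0 (dist_refl conn).
  have [z [yz zy Sz]] := IH (ltnW kN).
  have k1 : k.+1%:R * h = k%:R * h + h by rewrite -natr1 mulrDl mul1r.
  have khD : k%:R * h + h <= D by rewrite -k1; exact: kh.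
  have kh0 : 0 <= k%:R * h by rewrite mulr_ge0.
  have khD' : k%:R * h <= D by apply: le_trans khD; rewrite lerDl.
  have [z' [zz' z'y yz']] := dist_mid_step hsol yz zy h0 khD.
  exists z'; split; [by rewrite k1|by rewrite k1|].
  have yzD : dist y z <= D by rewrite yz.
  have [i [x0 [r [B [cb dz hz hB]]]]] := HL z yzD.
  have addz : dist p z + dist z z' = dist p z'.
    apply/eqP; rewrite eq_le dist_triangle// andbT zz'.
    have t1 := dist_triangle conn y p z; have t2 := dist_triangle conn z' p y'.
    rewrite yz in t1; rewrite z'y -add -/D in t2; lra.
  have hB' : B * dist z z' < r / 4.
    by rewrite zz'; apply: le_lt_trans hB; rewrite ler_wpM2l// (good_C0 (cb_good cb)).
  have inD t : 0 <= t -> t <= dist z z' -> k%:R * h + t <= D.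
    by rewrite zz' => _ th; apply: le_trans khD; rewrite lerD2l.
  have [||dz' jz'] := local_chain hsol cb dz hz hB' addz hkap (phi := phi + kap * (k%:R * h)) (qq := qq) _ _ (Sz i dz).
  - move=> t t0 th; rewrite -addrA -mulrDr; apply: hphi; first exact: addr_ge0.
    exact: inD.
  - move=> w t t0 th zw wz' dw u hu.
    rewrite -addrA -mulrDr; apply: (hbr w _ i) => //; first exact: addr_ge0.
    + exact: inD.
    + apply/eqP; rewrite eq_le; apply/andP; split.
        by rewrite -yz -zw; exact: dist_triangle.
      have := dist_triangle conn w y z'; rewrite wz' yz' zz'; lra.
    + apply/eqP; rewrite eq_le; apply/andP; split.
        have := dist_triangle conn z' w y'; rewrite wz' z'y zz' -/D; lra.
      have := dist_triangle conn w z y'; rewrite zw zy -/D; lra.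
  move=> j dj; have hp1 : `|phi + kap * (k%:R * h) + kap * dist z z'| <= 1.
    rewrite -addrA -mulrDr; apply: hphi; first by rewrite addr_ge0// zz'.
    by rewrite zz'.
  have := jet_chart hsol dz' dj hp1 jz'; rewrite zz' k1 !mulrDr !addrA; exact.
have [z [yz zy Sz]] := claim N.+1 (leqnn _); rewrite Nh in yz zy Sz; rewrite subrr in zy.
have zy' : z = y'.
  have yzD : dist y z <= D by rewrite yz.
  have [i [x0 [r [B [cb dz hz hB]]]]] := HL z yzD.
  have r0 := gd_r (cb_good cb).
  have rr : `|coord i z - x0| + B * dist z y' < r by rewrite zy mulr0 addr0; lra.
  have [dy' [h1 _]] := dist_good conn (cb_good cb) dz rr; move: h1; rewrite zy mulr0 normr_le0 subr_eq0 => /eqP h1.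
  by rewrite -(coordK dz) -h1 coordK.
by rewrite -zy'.
Qed.

Definition grad_le (b : R) p : Prop := forall i u, dom i p -> bil (met i (coord i p)) u u = 1 ->
  `|'D_u (fi i) (coord i p)| <= b.

Lemma bracket_grad (b phi kap : R) i z u : 0 <= b -> grad_le b z -> dom i z -> bil (met i (coord i z)) u u = 1 ->
  `|phi| <= 1 -> `|kap| <= 1 -> bracket (fi i) (coord i z) u phi kap <= n%:R + 2 * b.
Proof.
move=> b0 hb dz hu hphi hkap; rewrite /bracket; have := hb i u dz hu.
move: ('D_u _ _) => du hdu.
have h1 : n%:R * kap ^+ 2 <= n%:R by rewrite ler_piMr// -real_normK ?num_real// exprn_ile1.
have h2 : `|2 * phi * kap * du| <= 2 * b.
  rewrite -!mulrA normrM ger0_norm// ler_wpM2l// normrM -[b]mul1r; apply: ler_pM => //.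
  by rewrite normrM -[b]mul1r; apply: ler_pM.
have h3 : 0 <= 2^-1 * phi ^+ 2 by rewrite mulr_ge0// sqr_ge0.
move: h2; rewrite ler_norml => /andP[h2 _]; lra.
Qed.

(** The profile rises linearly from 0 to 1 on the first unit of length, at cost at most [n + 2 * b],
    and then stays 1. There the bracket is [- 1 / 2] per unit of length. *)
Lemma St_far p (b : R) : 0 <= b -> (forall q, dist p q <= 1 -> grad_le b q) ->
  forall y, 1 <= dist p y -> St p y 1 (n%:R + 2 * b - (dist p y - 1) / 2).
Proof.
move=> b0 hb y hy.
have [|p1 [pp1 p1y]] := dist_mid conn compl (_ : 0 <= 1 <= dist p y); first by rewrite ler01.
have S1 : St p p1 1 (n%:R + 2 * b).
  suff H : St p p1 (0 + 1 * dist p p1) (0 + (n%:R + 2 * b) * dist p p1) by move: H; rewrite pp1 !mulr1 !add0r.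
  apply: St_move; [by rewrite (dist_refl conn) add0r|by rewrite normr1| | |exact: St_start].
  - by move=> t t0; rewrite pp1 add0r mul1r => t1; rewrite ger0_norm.
  - move=> z t i t0; rewrite pp1 => t1 pz _ dz u hu; apply: bracket_grad => //; first by apply: hb; rewrite pz.
      by rewrite add0r mul1r ger0_norm.
    by rewrite normr1.
suff H : St p y (1 + 0 * dist p1 y) (n%:R + 2 * b + (- 2^-1) * dist p1 y).
  by move: H; rewrite p1y mul0r addr0 mulNr (mulrC 2^-1).
apply: St_move S1; [by rewrite pp1 p1y addrC subrK|by rewrite normr0| |].
- by move=> t _ _; rewrite mul0r addr0 normr1.
move=> z t i _ _ _ _ _ u _; rewrite mul0r addr0 /bracket expr0n/= mulr0 mulr0 mul0r subr0 sub0r expr1n mulr1.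
by [].
Qed.

Lemma St_le p y (phi eta eta' : R) : eta <= eta' -> St p y phi eta -> St p y phi eta'.
Proof.
move=> le S i di; have [C [s0 [C0 s00 H]]] := S i di; exists C, s0; split=> // s s1 s2.
have [E [Psi [h1 h2 h3]]] := H s s1 s2; exists E, Psi; split=> //; apply: le_trans h3 _.
by rewrite lerD2r lerD2l ler_wpM2l// mulr_ge0// sqr_ge0.
Qed.

(** The profile is brought back to 0 on the last unit of length, at cost at most [n + 2 * b']. By
    [St_end] the total is nonnegative, so a long distance forces a large gradient near one of the
    ends. *)
Lemma dist_grad_bound p (b : R) : 0 <= b -> (forall q, dist p q <= 1 -> grad_le b q) ->
  forall y (b' : R), 2 <= dist p y -> 0 <= b' -> (forall q, dist y q <= 1 -> grad_le b' q) ->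
  (dist p y - 2) / 2 <= 2 * n%:R + 2 * b + 2 * b'.
Proof.
move=> b0 hb y b' hy b'0 hb'.
have [|z [pz zy]] := dist_mid conn compl (_ : 0 <= dist p y - 1 <= dist p y); first by apply/andP; split; lra.
have zy1 : dist z y = 1 by rewrite zy; lra.
have S1 := @St_far p b b0 hb z; rewrite pz in S1.
have h1 : 1 <= dist p y - 1 by lra.
have {}S1 := S1 h1.
have hw w t : dist z w = t -> dist w y = 1 - t -> 0 <= t -> grad_le b' w.
  by move=> zw wy t0; apply: hb'; rewrite dist_sym wy; lra.
suff H : St p y (1 + (-1) * dist z y) (n%:R + 2 * b - (dist p y - 1 - 1) / 2 + (n%:R + 2 * b') * dist z y).
  by move: H; rewrite zy1 !mulr1 subrr => /St_end; lra.
apply: St_move S1; [by rewrite pz zy1 subrK| | |].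
- by rewrite normrN normr1.
- move=> t t0; rewrite zy1 => t1; rewrite mulN1r ler_norml; apply/andP; split; lra.
move=> w t i t0; rewrite zy1 => t1 zw wy dw u hu; apply: bracket_grad => //.
- exact: (hw w t).
- by rewrite mulN1r ler_norml; apply/andP; split; lra.
- by rewrite normrN normr1.
Qed.
End Global.

(** * Chart independence and the soliton identity *)

Section Invariance.
Variables (R : realType) (m : nat) (M : kahlerManifold R m) (f : M -> R).
Local Notation n := (m + m)%N.
Local Notation J := (Jstd R m).
Hypothesis hsol : gradient_shrinking_KR_soliton f.
Let conn : connected [set: M]. Proof. by have [[]] := hsol. Qed.
Implicit Types (i j : chart_idx M) (p q : M).
Local Notation fi := (chart_fun f).
Local Notation tr_ i j := (@tran _ _ M i j).
Let sfi i : smooth (im i) (fi i). Proof. exact: (sc_f (chart_sc i hsol)). Qed.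

Lemma dir_tran i j x (h : 'rV[R]_n -> R) u : ov i j x -> smooth (im j) h ->
  'D_u (fun y => h (tr_ i j y)) x = 'D_(u *m jac (tr_ i j) x) h (tr_ i j x).
Proof.
move=> ox sh; have [dT eT] := row_diff (@ov_open _ _ M i j) ox (@tran_smooth _ _ M i j).
have dh := smooth_diff (@im_open _ _ M j) sh (tran_im ox).
have dc : differentiable (h \o tr_ i j) x by exact: differentiable_comp.
have dv : derivable (h \o tr_ i j) (x + (0 : R) *: u) u by rewrite scale0r addr0; exact: diff_derivable.
have h1 := line_derivable dv.
have [dL e1L] := line_is_derive x u 0.
have L0 : x + (0 : R) *: u = x by rewrite scale0r addr0.
have dL1 : derive1 (fun s : R => x + s *: u) 0 = u by rewrite derive1E e1L.
have U0 : ov i j ((fun s : R => x + s *: u) 0) by rewrite /= L0.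
have [dC T1] := curve_chain (@ov_open _ _ M i j) U0 (@tran_smooth _ _ M i j) dL.
have Uj0 : im j ((tr_ i j \o (fun s : R => x + s *: u)) 0) by rewrite /= L0; exact: tran_im.
have h2 := curve_chain_scalar (@im_open _ _ M j) Uj0 sh dC.
rewrite T1 dL1 /= L0 in h2; rewrite L0 in h1.
have [_ e1] := h1; have [_ e2] := h2.
exact: etrans (esym e1) e2.
Qed.

Lemma fi_tran i j y : ov i j y -> fi i y = fi j (tr_ i j y).
Proof. by move=> oy; rewrite /chart_fun icoord_tran. Qed.

Lemma dir_fi_tran i j x u : ov i j x -> 'D_u (fi i) x = 'D_(u *m jac (tr_ i j) x) (fi j) (tr_ i j x).
Proof.
by move=> ox; rewrite -(dir_tran u ox (sfi j)); apply: (derive_ext u (@ov_open _ _ M i j) ox) => y; exact: fi_tran.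
Qed.

Lemma gradm_tran i j y : ov i j y -> gradm (fi i) y = gradm (fi j) (tr_ i j y) *m (jac (tr_ i j) y)^T.
Proof.
move=> oy; have [Uy dj] := (ovE i j y).1 oy; apply/rowP => k.
have h1 := gradmE (@im_open _ _ M i) (delta_mx 0 k) Uy (sfi i).
have h2 := gradmE (@im_open _ _ M j) (delta_mx 0 k *m jac (tr_ i j) y) (tran_im oy) (sfi j).
rewrite -(dir_fi_tran _ oy) -h1 trmx_mul mulmxA in h2.
have pick (v : 'rV[R]_n) : (v *m (delta_mx 0 k : 'rV[R]_n)^T) 0 0 = v 0 k.
  rewrite mxE (bigD1 k)//= big1 ?addr0; first by rewrite !mxE !eqxx mulr1.
  by move=> a /negPf ak; rewrite !mxE eqxx /= ak mulr0.
by rewrite !pick in h2.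
Qed.

Lemma jac_unit i j y : ov i j y -> jac (tr_ i j) y \in unitmx.
Proof.
move=> oy; have [Uy dj] := (ovE i j y).1 oy; have := kc_unit (chart_kc i) Uy.
by rewrite (met_transition oy) !unitmx_mul => /andP[/andP[]].
Qed.

Lemma smx_jac i j : smx (ov i j) (jac (tr_ i j)).
Proof.
move=> a b; apply: (smooth_ext (@ov_open _ _ M i j) _ (smooth_partial a (@tran_smooth _ _ M i j b))) => y _.
by rewrite mxE.
Qed.

Lemma d2_fi_tran i j x v : ov i j x -> 'D_v ('D_v (fi i)) x =
  bil (D2 (fi j) (tr_ i j x)) (v *m jac (tr_ i j) x) (v *m jac (tr_ i j) x)
  + (gradm (fi j) (tr_ i j x) *m (tran2 i j x v)^T) 0 0.
Proof.
move=> ox; have oO := @ov_open _ _ M i j; have st := @smx_tran _ _ M i j.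
have sG : smx (ov i j) (fun y => gradm (fi j) (tr_ i j y)).
  have s1 : smx (ov i j) (fun y => invmx (jac (tr_ i j) y)^T).
    apply: (smooth_invmx oO) => [y oy|]; first by rewrite unitmx_tr jac_unit.
    exact: (smx_tr oO (@smx_jac i j)).
  have s2 : smx (ov i j) (gradm (fi i)).
    have ss : smooth (ov i j) (fi i).
      have oO' := @im_open _ _ M i; have si := sfi i.
      have sub : ov i j `<=` im i by move=> y /ovE[].
      by move=> k; have := si k; elim: k (fi i) => [|k IH] F /=; [move=> H y /sub; exact: H|move=> [H1 H2]; split=> [a y /sub|a]; [exact: H1|exact: IH]].
    exact: (smx_gradm oO ss).
  move=> a b; apply: (smooth_ext oO _ (smx_mul oO s2 s1 a b)) => y oy.
  by rewrite (gradm_tran oy) mulmxK// unitmx_tr jac_unit.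
have E1 y : ov i j y -> 'D_v (fi i) y = (gradm (fi j) (tr_ i j y) *m (dM (tr_ i j) y v)^T) 0 0.
  move=> oy; rewrite (dir_fi_tran v oy) dM_tran//.
  by rewrite (gradmE (@im_open _ _ M j) _ (tran_im oy) (sfi j)).
rewrite (derive_ext v oO ox E1).
have sT := smx_dM oO v st.
have E2 := dM_mul oO ox v sG (smx_tr oO sT).
have E3 := dME (fun y => gradm (fi j) (tr_ i j y) *m (dM (tr_ i j) y v)^T) x v 0 0.
rewrite dM_tr in E2; rewrite -E3 E2.
have E4 : dM (fun y => gradm (fi j) (tr_ i j y)) x v = (v *m jac (tr_ i j) x) *m D2 (fi j) (tr_ i j x).
  rewrite -(dM_gradm (@im_open _ _ M j) _ (tran_im ox) (sfi j)).
  apply/rowP => k; apply: (etrans (dME _ _ _ _ _)); apply: (etrans _ (esym (dME _ _ _ _ _))).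
  exact: (dir_tran v ox (smx_gradm (@im_open _ _ M j) (sfi j) 0 k)).
rewrite E4 dM_tran// /bil; exact: mxE.
Qed.

Lemma tr_frame_d2 i x (E : 'M[R]_n) h : im i x -> E *m met i x *m E^T = 1%:M -> smooth (im i) h ->
  lap (met i) h x = \sum_a 'D_(row a E) ('D_(row a E) h) x.
Proof.
move=> Ux hE sh; have -> : lap (met i) h x = \tr (invmx (met i x) *m D2 h x) by [].
rewrite -(frame_gram hE) tr_frame; apply: eq_bigr => a _.
exact: (bil_D2 (@im_open _ _ M i)).
Qed.

(** Real parts and imaginary parts of holomorphic functions are harmonic for a Kaehler metric: the
    matrix of second derivatives of a coordinate of the transition map changes sign under [J], by
    polarization of [tran2_J], so its trace vanishes. *)
Lemma sum_tran2 i j x (E : 'M[R]_n) : ov i j x -> E *m met i x *m E^T = 1%:M ->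
  \sum_a tran2 i j x (row a E) = 0.
Proof.
move=> ox hE; have [Ux dj] := (ovE i j x).1 ox; have oO := @ov_open _ _ M i j.
apply/rowP => k; rewrite summxE mxE.
have sk := @tran_smooth _ _ M i j k.
rewrite (eq_bigr (fun a => bil (D2 (fun y => tr_ i j y 0 k) x) (row a E) (row a E))); last first.
  by move=> a _; rewrite tran2E (bil_D2 oO _ _ ox sk).
rewrite -tr_frame (frame_gram hE); apply: (tr_anti (chart_sc i hsol) Ux).
set D := D2 _ x; have DT : D^T = D := D2_sym oO ox sk.
have q v : bil D v v = tran2 i j x v 0 k by rewrite tran2E (bil_D2 oO _ _ ox sk).
have DT' u v : bil D u v = bil D v u by rewrite -bilT DT.
apply: bil_eq => u v; rewrite bil_mulr bil_mull -scaleN1r bilZm.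
have pol (a b : 'rV[R]_n) : bil D a b = 2^-1 * (bil D (a + b) (a + b) - bil D a a - bil D b b).
  rewrite bilDl !bilDr (DT' b a).
  by move: (bil D a a) (bil D a b) (bil D b b) => A1 A2 A3; field.
have N w : tran2 i j x (w *m J) 0 k = - tran2 i j x w 0 k by rewrite tran2_J// [LHS]mxE.
have NB w : bil D (w *m J) (w *m J) = - bil D w w by exact: (etrans (q _) (etrans (N w) (congr1 -%R (esym (q w))))).
clearbody D.
rewrite pol (pol u v) -mulmxDl !NB.
by move: (bil D (u + v) (u + v)) (bil D u u) (bil D v v) => a1 a2 a3; ring.
Qed.

Lemma lap_tran i j x : ov i j x -> lap (met i) (fi i) x = lap (met j) (fi j) (tr_ i j x).
Proof.
move=> ox; have [Ux dj] := (ovE i j x).1 ox.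
have [E hE] := orthonormal_frame (kc_posdef (chart_kc i) Ux).
rewrite (tr_frame_d2 Ux hE (sfi i)) (eq_bigr _ (fun a _ => d2_fi_tran _ ox)) big_split/=.
have -> : \sum_a (gradm (fi j) (tr_ i j x) *m (tran2 i j x (row a E))^T) 0 0 = 0.
  have E0 : (gradm (fi j) (tr_ i j x) *m (\sum_a tran2 i j x (row a E))^T) 0 0 = 0.
    by rewrite sum_tran2// trmx0 mulmx0 mxE.
  by rewrite -[RHS]E0 linear_sum/= mulmx_sumr summxE.
rewrite addr0; have hE' : (E *m jac (tr_ i j) x) *m met j (tr_ i j x) *m (E *m jac (tr_ i j) x)^T = 1%:M.
  by rewrite trmx_mul -[RHS]hE (met_transition ox) !mulmxA.
rewrite (tr_frame_d2 (tran_im ox) hE' (sfi j)); apply: eq_bigr => a _.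
by rewrite row_mul (bil_D2 (@im_open _ _ M j) _ _ (tran_im ox) (sfi j)).
Qed.

Definition NG p := normgrad (met (chart_at p)) (fi (chart_at p)) (coord (chart_at p) p).

Lemma NGE i p : dom i p -> NG p = normgrad (met i) (fi i) (coord i p).
Proof.
move=> di; have dk := dom_chart_at p; rewrite /NG; set k := chart_at p in dk *.
have ox := ov_coord di dk; have T : tr_ i k (coord i p) = coord k p by rewrite /tran coordK.
by rewrite /normgrad -T -(gradV_tran hsol ox) (met_tran _ _ ox).
Qed.

Lemma scalE i p : dom i p -> scalar_curvature p = n%:R / 2 - lap (met i) (fi i) (coord i p).
Proof.
move=> di; have dk := dom_chart_at p; rewrite /scalar_curvature; set k := chart_at p in dk *.
rewrite (scal_lap (chart_sc k hsol) (im_coord dk)).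
have ox := ov_coord di dk; have T : tr_ i k (coord i p) = coord k p by rewrite /tran coordK.
by rewrite (lap_tran ox) T.
Qed.

Lemma chart_continuous (H : M -> R) i p h : dom i p -> smooth (im i) h -> (forall q, dom i q -> H q = h (coord i q)) ->
  {for p, continuous H}.
Proof.
move=> di sh E; have n1 : \forall q \near p, dom i q by apply: open_nbhs_nbhs; split=> //; exact: dom_open.
have c1 : {for p, continuous (h \o coord i)}.
  by apply: continuous_comp; [exact: coord_continuous|exact: (smooth_continuous sh (im_coord di))].
move=> A; rewrite /= E// => /c1 h1.
by apply: filterS2 n1 h1 => q dq /=; rewrite E.
Qed.

Lemma f_continuous p : {for p, continuous f}.
Proof. by apply: (chart_continuous (dom_chart_at p) (sfi _)) => q dq; rewrite /chart_fun coordK. Qed.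
Lemma NG_continuous p : {for p, continuous NG}.
Proof.
apply: (chart_continuous (dom_chart_at p) (smooth_normgrad (chart_sc _ hsol))) => q dq.
exact: NGE.
Qed.
Lemma scal_continuous p : {for p, continuous (@scalar_curvature _ _ M)}.
Proof.
apply: (chart_continuous (dom_chart_at p) (smoothB (@im_open _ _ M _) (smooth_cst _ _) (smooth_lap (chart_kc _) (sfi _)))) => q dq.
exact: scalE.
Qed.

Lemma NG_ge0 p : 0 <= NG p.
Proof. exact: (bil_sqr_ge0 _ (kc_posdef (chart_kc _) (im_coord (dom_chart_at p)))). Qed.

Lemma NG_grad_le p : grad_le f (Num.sqrt (NG p)) p.
Proof.
move=> i u di hu; have Ux := im_coord di; rewrite -(bil_gradV (chart_kc i) Ux u (sfi i)).
have := nrm_CS (gradV (met i) (fi i) (coord i p)) u Ux; rewrite {2}/nrm hu sqrtr1 mulr1.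
by rewrite (NGE di).
Qed.

Lemma zero_dir_const i x (r : R) h : smooth (im i) h -> (forall y, `|y - x| < r -> im i y) ->
  (forall y u, im i y -> 'D_u h y = 0) -> forall y, `|y - x| < r -> h y = h x.
Proof.
move=> sh HU h0 y hy; have r0 : 0 < r := le_lt_trans (normr_ge0 _) hy.
have inU t : 0 <= t <= 1 -> im i (x + (t * 1) *: (y - x)).
  move=> /andP[t0 t1]; apply: HU; rewrite mulr1 addrC addKr normrZ ger0_norm//.
  by apply: le_lt_trans hy; rewrite ler_piMl.
have [t t01] := @line_mvt R n h x (y - x) 1 (fun t t01 => smooth_derivable (@im_open _ _ M i) sh (inU t t01)).
rewrite (h0 _ _ (inU t t01)) mulr0 scale1r addrCA subrr addr0 => /eqP; rewrite subr_eq0 => /eqP.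
by [].
Qed.

Lemma loc_const_const (H : M -> R) : (forall p, exists2 A, nbhs p A & forall q, A q -> H q = H p) ->
  exists c, forall p, H p = c.
Proof.
move=> loc; have [[p0 _] _] : [set: M] !=set0 /\ connected [set: M] by have [] := hsol.
exists (H p0); pose B := [set p | H p = H p0].
have oB : open B.
  by rewrite openE => p Bp; have [A nA HA] := loc p; apply: filterS nA => q /HA; rewrite /B /= => ->.
have cB : closed B.
  rewrite -[B]setCK; apply: open_closedC; rewrite openE => p nBp.
  by have [A nA HA] := loc p; apply: filterS nA => q /HA E; rewrite /B /= E.
have BT : B = setT.
  by apply: conn; [exists p0|exists B => //; rewrite setTI|exists B => //; rewrite setTI].
by move=> p; have : B p by rewrite BT.
Qed.

Lemma soliton_identity : exists c, forall p, f p - scalar_curvature p - NG p = c.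
Proof.
apply: loc_const_const => p; set i := chart_at p; have di : dom i p := dom_chart_at p.
have Ux := im_coord di; have [r [C g]] := good_ex Ux; have r0 := gd_r g; have sc := chart_sc i hsol.
pose h y := fi i y + lap (met i) (fi i) y - normgrad (met i) (fi i) y.
have sh : smooth (im i) h.
  apply: (smoothB (@im_open _ _ M i)); last exact: (smooth_normgrad sc).
  apply: (smoothD (@im_open _ _ M i)) => //; exact: (smooth_lap (chart_kc i) (sfi i)).
have E q : dom i q -> f q - scalar_curvature q - NG q = h (coord i q) - n%:R / 2.
  by move=> dq; rewrite (scalE dq) (NGE dq) /h /chart_fun coordK//; ring.
exists [set q | dom i q /\ `|coord i q - coord i p| < r].
  by apply: (good_nbhs g di); rewrite subrr normr0.
move=> q [dq hq]; have Z : h (coord i q) = h (coord i p).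
  apply: (zero_dir_const sh (gd_im g) _ hq) => y u Uy; exact: (d_invariant sc u Uy).
exact: (etrans (E q dq) (etrans (congr1 (fun t => t - n%:R / 2) Z) (esym (E p di)))).
Qed.

End Invariance.

(** * Maximum principle *)

Section Scalars28.
Variables (R : realType).

(** For [x] of absolute value at most [1 / 6], the inverse square of [1 - x] is at most
    [1 + 2 * x + 4 * x ^+ 2], because [x ^+ 2 * (1 - 6 * x + 4 * x ^+ 2)] is nonnegative. This
    linearizes the cut-off weight at a maximum point. *)
Lemma sc_weight (u U a x : R) : 0 < U -> 0 < a -> `|x| <= 6^-1 -> u * (a - a * x) ^+ 2 <= U * a ^+ 2 ->
  u <= U * (1 + 2 * x + 4 * x ^+ 2).
Proof.
move=> U0 a0 hx h; rewrite ler_norml in hx; case/andP: hx => hx1 hx2.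
have a2 : 0 < a ^+ 2 by rewrite exprn_gt0.
have h1 : u * (1 - x) ^+ 2 <= U.
  by rewrite -(ler_pM2r a2); apply: le_trans h; rewrite (_ : u * (a - a * x) ^+ 2 = u * (1 - x) ^+ 2 * a ^+ 2) ?lexx//; ring.
have q0 : 0 < (1 - x) ^+ 2 by rewrite exprn_gt0//; lra.
rewrite -(ler_pM2r q0); apply: le_trans h1 _.
have -> : U * (1 + 2 * x + 4 * x ^+ 2) * (1 - x) ^+ 2 = U + U * (x ^+ 2 * (1 - 6 * x + 4 * x ^+ 2)) by ring.
rewrite lerDl mulr_ge0 ?(ltW U0)// mulr_ge0 ?sqr_ge0//.
by have := sqr_ge0 x; lra.
Qed.

Lemma sc_limit (X Y K s0 : R) : 0 <= K -> 0 < s0 -> (forall s, 0 < s -> s < s0 -> s ^+ 2 * X <= s ^+ 2 * Y + K * s ^+ 3) -> X <= Y.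
Proof.
move=> K0 s00 H; rewrite leNgt; apply/negP => h.
pose s := Num.min (s0 / 2) ((X - Y) / (2 * (K + 1))).
have K1 : 0 < 2 * (K + 1) by lra.
have XY : 0 < X - Y by lra.
have sp : 0 < s by rewrite lt_min !divr_gt0.
have ss : s < s0 by rewrite gt_min; apply/orP; left; lra.
have h1 := H s sp ss; have s2 : 0 < s ^+ 2 by rewrite exprn_gt0.
have h2 : X <= Y + K * s.
  by rewrite -(ler_pM2l s2); apply: le_trans h1 _; rewrite (_ : s ^+ 2 * (Y + K * s) = s ^+ 2 * Y + K * s ^+ 3) ?lexx//; ring.
have h3 : s * (2 * (K + 1)) <= X - Y by rewrite -ler_pdivlMr// ge_min lexx orbT.
have h4 : 0 <= s * K by rewrite mulr_ge0// ltW.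
lra.
Qed.

Lemma sc_square (w C s W Z bee bez bzz : R) : 0 <= C -> 0 <= s -> s <= 1 -> 0 <= W -> 0 <= Z -> 0 <= w -> w <= s * W ->
  `|bee| <= Z -> `|bez| <= Z -> `|bzz| <= Z ->
  (1 + C * w) ^+ 2 * (s ^+ 2 * bee + 2 * s ^+ 3 * bez + s ^+ 4 * bzz) <=
  s ^+ 2 * bee + (3 * Z + (2 * C * W + C ^+ 2 * W ^+ 2) * (4 * Z)) * s ^+ 3.
Proof.
move=> C0 s0 s1 W0 Z0 w0 hw; rewrite !ler_norml => /andP[e1 e2] /andP[f1 f2] /andP[g1 g2].
have s2 : 0 <= s ^+ 2 by exact: sqr_ge0.
have s3 : 0 <= s ^+ 3 by exact: exprn_ge0.
have s4 : 0 <= s ^+ 4 by exact: exprn_ge0.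
have s43 : s ^+ 4 <= s ^+ 3 by rewrite exprSr ler_piMr.
have s32 : s ^+ 3 <= s ^+ 2 by rewrite exprSr ler_piMr.
set Q := s ^+ 2 * bee + 2 * s ^+ 3 * bez + s ^+ 4 * bzz.
have b1 : s ^+ 3 * bez <= s ^+ 3 * Z by rewrite ler_wpM2l.
have b2 : s ^+ 4 * bzz <= s ^+ 3 * Z by apply: le_trans (_ : s ^+ 4 * Z <= _); [rewrite ler_wpM2l|rewrite ler_wpM2r].
have b3 : s ^+ 2 * bee <= s ^+ 2 * Z by rewrite ler_wpM2l.
have b4 : s ^+ 3 * Z <= s ^+ 2 * Z by rewrite ler_wpM2r.
have Q1 : Q <= s ^+ 2 * bee + 3 * Z * s ^+ 3 by rewrite /Q; lra.
have Q2 : Q <= 4 * Z * s ^+ 2 by rewrite /Q; lra.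
have -> : (1 + C * w) ^+ 2 * Q = Q + (2 * C * w + C ^+ 2 * w ^+ 2) * Q by ring.
have c1 : 2 * C * w + C ^+ 2 * w ^+ 2 <= (2 * C * W + C ^+ 2 * W ^+ 2) * s.
  have d1 : C * w <= C * (s * W) by rewrite ler_wpM2l.
  have d2 : w ^+ 2 <= (s * W) ^+ 2 by rewrite ler_pXn2r ?nnegrE// mulr_ge0.
  have d3 : C ^+ 2 * w ^+ 2 <= C ^+ 2 * (s * W) ^+ 2 by rewrite ler_wpM2l ?sqr_ge0.
  have d4 : C ^+ 2 * (s * W) ^+ 2 <= C ^+ 2 * W ^+ 2 * s.
    rewrite (_ : C ^+ 2 * (s * W) ^+ 2 = C ^+ 2 * W ^+ 2 * s ^+ 2); last by ring.
    by rewrite ler_wpM2l ?mulr_ge0 ?sqr_ge0// expr2 ler_piMr.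
  have -> : (2 * C * W + C ^+ 2 * W ^+ 2) * s = 2 * (C * (s * W)) + C ^+ 2 * W ^+ 2 * s by ring.
  lra.
have c0 : 0 <= 2 * C * w + C ^+ 2 * w ^+ 2 by rewrite addr_ge0 ?mulr_ge0 ?sqr_ge0.
have c2 : (2 * C * w + C ^+ 2 * w ^+ 2) * Q <= (2 * C * W + C ^+ 2 * W ^+ 2) * s * (4 * Z * s ^+ 2).
  apply: le_trans (ler_wpM2l c0 Q2) _; apply: ler_wpM2r => //.
  by rewrite !mulr_ge0.
have -> : s ^+ 2 * bee + (3 * Z + (2 * C * W + C ^+ 2 * W ^+ 2) * (4 * Z)) * s ^+ 3 =
  s ^+ 2 * bee + 3 * Z * s ^+ 3 + (2 * C * W + C ^+ 2 * W ^+ 2) * s * (4 * Z * s ^+ 2) by ring.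
exact: lerD.
Qed.
End Scalars28.

Section MaxPrinciple.
Variables (R : realType) (m : nat) (M : kahlerManifold R m) (f : M -> R).
Local Notation n := (m + m)%N.
Local Notation J := (Jstd R m).
Hypothesis hsol : gradient_shrinking_KR_soliton f.
Let conn : connected [set: M]. Proof. by have [[]] := hsol. Qed.
Implicit Types (i j : chart_idx M) (p q : M).
Local Notation fi := (chart_fun f).
Local Notation sdist := (sdist f).
Local Notation cball := (cball f).

Lemma bil_quad (d : nat) (A : 'M[R]_d) (e z : 'rV[R]_d) (s : R) : bil A z e = bil A e z ->
  bil A (s *: e + s ^+ 2 *: z) (s *: e + s ^+ 2 *: z) = s ^+ 2 * bil A e e + 2 * s ^+ 3 * bil A e z + s ^+ 4 * bil A z z.
Proof.
move=> sy; rewrite bilDl !bilDr !bilZl !bilZr sy.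
by move: (bil A e e) (bil A e z) (bil A z z) => a1 a2 a3; ring.
Qed.

(** The displaced points with [phi = 1] serve as second-order test points: the drift makes the
    expansions of [h] add up to a drift Laplacian. *)
Lemma pt_expand i x (h : 'rV[R]_n -> R) (Z : R) : im i x -> smooth (im i) h -> 0 <= Z ->
  exists2 K : R, 0 <= K & exists2 s0 : R, 0 < s0 & forall s e psi (y := icoord i x) (P := pti f i x 1 s e psi),
  0 < s -> s < s0 -> `|e| <= Z -> `|psi| <= Z ->
  [/\ dom i P, dist y P <= K * s, dist y P ^+ 2 <= s ^+ 2 * bil (met i x) e e + K * s ^+ 3 &
   `|h (coord i P) - h x - s * 'D_e h x
     - s ^+ 2 * ('D_psi h x - nuc R m * 'D_(gradV (met i) (fi i) x) h x + 2^-1 * 'D_e ('D_e h) x)| <= K * s ^+ 3].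
Proof.
move=> Ux sh Z0; have oU := @im_open _ _ M i.
have [r1 [C1 K1]] := smooth_controlled oU sh Ux.
have [r2 [C2 g]] := good_ex Ux; have C21 := gd_C g; have C20 := good_C0 g; have r20 := gd_r g.
set V := gradV (met i) (fi i) x.
pose W := Z + `|V|; have W0 : 0 <= W by rewrite addr_ge0.
have C10 := ctrl_C K1; have r10 := ctrl_r K1.
pose k1 := C1 * (8 * W ^+ 3 + 2 * W ^+ 2).
have k10 : 0 <= k1 by rewrite mulr_ge0// addr_ge0// mulr_ge0// exprn_ge0.
pose b := C2 ^+ 2 * W ^+ 2; have b0 : 0 <= b by rewrite mulr_ge0 ?sqr_ge0.
pose k2 := 3 * b + (2 * C2 * (2 * W) + C2 ^+ 2 * (2 * W) ^+ 2) * (4 * b).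
have k20 : 0 <= k2 by rewrite !(addr_ge0, mulr_ge0)// ?sqr_ge0.
pose k3 := (1 + C2 * (2 * W)) * (C2 * (2 * W)).
have k30 : 0 <= k3 by rewrite !(addr_ge0, mulr_ge0).
exists (k1 + k2 + k3); first by rewrite addr_ge0// addr_ge0.
pose r := Num.min r1 r2; have r0 : 0 < r by rewrite lt_min r10.
exists (Num.min 1 (r / (2 * W + 1))); first by rewrite lt_min ltr01 divr_gt0//; lra.
move=> s e psi y P s0; rewrite lt_min => /andP[s1 sr] he hpsi.
have s0' := ltW s0; have s1' := ltW s1.
have s2s : s ^+ 2 <= s by rewrite expr2 ler_piMr.
pose z := psi - nuc R m *: V.
have he' : `|e| <= W by apply: le_trans he _; rewrite lerDl.
have hz : `|z| <= W.
  apply: norm_leB => //; rewrite -[`|V|]mul1r; apply: norm_leZ => //; exact: nuc_bound.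
pose w := s *: e + s ^+ 2 *: z.
have hw : `|w| <= s * (2 * W).
  have -> : s * (2 * W) = s * W + s * W by ring.
  apply: norm_leD; first by apply: norm_leZ => //; rewrite ger0_norm.
  by apply: norm_leZ => //; rewrite ger0_norm ?exprn_ge0.
have sr' : s * (2 * W) < r by have := sr; rewrite ltr_pdivlMr; lra.
have EP : pt (met i) (fi i) x 1 s e psi = x + w by rewrite /pt scale1r expr1n scale1r.
have wr : `|x + w - x| < r by rewrite addrC addKr; exact: le_lt_trans sr'.
have [wr1 wr2] : `|x + w - x| < r1 /\ `|x + w - x| < r2 by move: wr; rewrite lt_min => /andP[].
have x1 : `|x - x| < r1 by rewrite subrr normr0.
have x2 : `|x - x| < r2 by rewrite subrr normr0.
have UP := gd_im g wr2; have EPw : P = icoord i (x + w) by rewrite /P /pti EP.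
have s3 : 0 <= s ^+ 3 by exact: exprn_ge0.
have xw : x + w - x = w by rewrite addrC addKr.
have ds := dist_seg conn g x2 wr2; rewrite xw -/y -EPw in ds.
have nw : nrm i x w <= C2 * (s * (2 * W)) by apply: le_trans (gd_hi g w x2) _; rewrite ler_wpM2l.
split.
- by rewrite EPw; exact: icoord_dom.
- apply: le_trans ds _; apply: le_trans (_ : (1 + C2 * (2 * W)) * (C2 * (s * (2 * W))) <= _).
    apply: ler_pM => //; [by rewrite addr_ge0// mulr_ge0|exact: nrm_ge0|].
    rewrite lerD2l ler_wpM2l//; apply: le_trans hw _; by rewrite ler_piMl// mulr_ge0.
  rewrite (_ : _ * _ = k3 * s); last by rewrite /k3; ring.
  by rewrite ler_wpM2r// lerDr addr_ge0.
- apply: le_trans (_ : ((1 + C2 * `|w|) * nrm i x w) ^+ 2 <= _).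
    rewrite ler_pXn2r ?nnegrE ?(dist_ge0 conn)//.
    by rewrite mulr_ge0 ?nrm_ge0// addr_ge0// mulr_ge0.
  rewrite exprMn nrm_sqr//.
  have -> : bil (met i x) w w = s ^+ 2 * bil (met i x) e e + 2 * s ^+ 3 * bil (met i x) e z + s ^+ 4 * bil (met i x) z z.
    by rewrite /w; apply: bil_quad; rewrite -bilT (met_sym Ux).
  have bb a1 a2 : `|a1| <= W -> `|a2| <= W -> `|bil (met i x) a1 a2| <= b.
    move=> h1 h2; apply: le_trans (nrm_CS a1 a2 Ux) _.
    rewrite (_ : b = (C2 * W) * (C2 * W)); last by rewrite /b; ring.
    apply: ler_pM; rewrite ?nrm_ge0//; [apply: le_trans (gd_hi g a1 x2) _|apply: le_trans (gd_hi g a2 x2) _]; by rewrite ler_wpM2l.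
  have W2 : 0 <= 2 * W by rewrite mulr_ge0.
  apply: le_trans (sc_square C20 s0' s1' W2 b0 (normr_ge0 w) hw (bb e e he' he') (bb e z he' hz) (bb z z hz hz)) _.
  by rewrite -/k2 lerD2l ler_wpM2r//; lra.
have T := taylor_jet oU sh K1 x1 wr1 he' hz (_ : 0 <= s <= 1).
rewrite s0' s1' in T; have {}T := T isT.
have Dz : 'D_z h x = 'D_psi h x - nuc R m * 'D_V h x.
  have -> : z = 1 *: psi + (- nuc R m) *: V by rewrite scale1r scaleNr.
  by rewrite (smooth_dirDl 1 (- nuc R m) psi V oU sh Ux) mul1r mulNr.
rewrite EPw coord_icoord// -Dz; apply: le_trans T _.
by rewrite -/k1 ler_wpM2r// -addrA lerDl addr_ge0.
Qed.

Lemma sc_four (hx h1 h2 h3 h4 e1 e2 p v D1 D2 N K s Uv a : R) (d1 d2 d3 d4 q1 q2 q3 q4 : R) :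
  `|h1 - hx - s * e1 - s ^+ 2 * (p - N * v + 2^-1 * D1)| <= K ->
  `|h2 - hx - s * e2 - s ^+ 2 * (- p - N * v + 2^-1 * D2)| <= K ->
  `|h3 - hx - s * (- e1) - s ^+ 2 * (p - N * v + 2^-1 * D1)| <= K ->
  `|h4 - hx - s * (- e2) - s ^+ 2 * (- p - N * v + 2^-1 * D2)| <= K ->
  h1 - hx <= Uv * (2 * (d1 / a) + 4 * (q1 / a ^+ 2)) -> h2 - hx <= Uv * (2 * (d2 / a) + 4 * (q2 / a ^+ 2)) ->
  h3 - hx <= Uv * (2 * (d3 / a) + 4 * (q3 / a ^+ 2)) -> h4 - hx <= Uv * (2 * (d4 / a) + 4 * (q4 / a ^+ 2)) ->
  s ^+ 2 * (D1 + D2 - 4 * N * v) <=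
  Uv * (2 / a * (d1 + d2 + d3 + d4) + 4 / a ^+ 2 * (q1 + q2 + q3 + q4)) + 4 * K.
Proof.
rewrite !ler_norml => /andP[A1 _] /andP[A2 _] /andP[A3 _] /andP[A4 _] B1 B2 B3 B4.
have -> : Uv * (2 / a * (d1 + d2 + d3 + d4) + 4 / a ^+ 2 * (q1 + q2 + q3 + q4)) =
  Uv * (2 * (d1 / a) + 4 * (q1 / a ^+ 2)) + Uv * (2 * (d2 / a) + 4 * (q2 / a ^+ 2)) +
  Uv * (2 * (d3 / a) + 4 * (q3 / a ^+ 2)) + Uv * (2 * (d4 / a) + 4 * (q4 / a ^+ 2)) by ring.
move: A1 A2 A3 A4 B1 B2 B3 B4.
move: (Uv * (2 * (d1 / a) + 4 * (q1 / a ^+ 2))) (Uv * (2 * (d2 / a) + 4 * (q2 / a ^+ 2)))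
  (Uv * (2 * (d3 / a) + 4 * (q3 / a ^+ 2))) (Uv * (2 * (d4 / a) + 4 * (q4 / a ^+ 2))) => b1 b2 b3 b4 A1 A2 A3 A4 B1 B2 B3 B4.
have -> : s ^+ 2 * (D1 + D2 - 4 * N * v) = (s * e1 + s ^+ 2 * (p - N * v + 2^-1 * D1)) + (s * e2 + s ^+ 2 * (- p - N * v + 2^-1 * D2))
  + (s * (- e1) + s ^+ 2 * (p - N * v + 2^-1 * D1)) + (s * (- e2) + s ^+ 2 * (- p - N * v + 2^-1 * D2)) by field.
lra.
Qed.
End MaxPrinciple.

Section Scalars29.
Variables (R : realType).
Lemma sc_lin0 (a b c d : R) : a + (-1) * b = 0 -> a = c + 1 * d -> c + d - b = 0.
Proof. by lra. Qed.
Lemma sc_shrink (nn L LL LN DL T : R) : 0 < nn -> L + LL - LN = 0 -> LN = DL + 2 * T -> L ^+ 2 <= nn * T ->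
  L - nn / 2 + 2 / nn * (L - nn / 2) ^+ 2 <= LL - DL.
Proof.
move=> n0 E3 E4 E5; have -> : LL - DL = 2 * T - L by lra.
have h1 : 2 / nn * L ^+ 2 <= 2 * T by rewrite mulrAC ler_pdivrMr// -mulrA ler_wpM2l// mulrC.
have -> : L - nn / 2 + 2 / nn * (L - nn / 2) ^+ 2 = 2 / nn * L ^+ 2 - L by field; rewrite gt_eqF.
by rewrite lerD2r.
Qed.
Lemma sc_add4 (a : R) : a + a + a + a = 4 * a. Proof. by ring. Qed.
Lemma sc_sub4 (a1 a2 a3 a4 b : R) : a1 - b + (a2 - b) + (a3 - b) + (a4 - b) = a1 + a2 + a3 + a4 - 4 * b.
Proof. by ring. Qed.
Lemma nuc_cancel (k : nat) (v : R) : (0 < k)%N -> k%:R * (4 * (k.*2)%:R^-1 * v) = 2 * v.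
Proof.
move=> k0; have : k%:R != 0 :> R by rewrite pnatr_eq0 -lt0n.
by rewrite -mul2n natrM; move: (k%:R) => x x0; field.
Qed.
End Scalars29.

(** * The scalar curvature inequality and the comparison at a maximum *)

Section ShrinkIneq.
Variables (R : realType) (m : nat).
Local Notation n := (m + m)%N.
Local Notation J := (Jstd R m).
Variables (U : set 'rV[R]_n) (g : 'rV[R]_n -> 'M[R]_n) (f : 'rV[R]_n -> R).
Hypothesis sc : soliton_chart U g f.
Let kc := sc_kc sc.
Let sf : smooth U f := sc_f sc.
Let oU := kc_open kc.

Lemma D2_lin x (a b : 'rV[R]_n -> R) (c : R) : U x -> smooth U a -> smooth U b ->
  D2 (fun y => a y + c * b y) x = D2 a x + c *: D2 b x.
Proof.
move=> Ux sa sb; have sbc := smoothZ c oU sb.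
have E v y : U y -> 'D_v (fun y => a y + c * b y) y = 'D_v a y + c * 'D_v b y.
  by move=> Uy; rewrite (derive_add oU Uy v sa sbc) (derive_scale oU Uy c v sb).
apply: bil_eq => u v; have sva := smooth_dir v oU sa; have svb := smooth_dir v oU sb.
have X : 'D_u (fun y => 'D_v a y + c * 'D_v b y) x = 'D_u ('D_v a) x + c * 'D_u ('D_v b) x.
  by rewrite (derive_add oU Ux u sva (smoothZ c oU svb)) (derive_scale oU Ux c u svb).
rewrite bilDm bilZm; apply: etrans (bil_D2 oU u v Ux (smoothD oU sa sbc)) _.
apply: etrans (derive_ext u oU Ux (E v)) _; apply: etrans X _.
exact: (congr2 (fun s t => s + c * t) (esym (bil_D2 oU u v Ux sa)) (esym (bil_D2 oU u v Ux sb))).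
Qed.

Lemma lap_lin x (a b : 'rV[R]_n -> R) (c : R) : U x -> smooth U a -> smooth U b ->
  lap g (fun y => a y + c * b y) x = lap g a x + c * lap g b x.
Proof.
move=> Ux sa sb; have -> : lap g (fun y => a y + c * b y) x = \tr (invmx (g x) *m D2 (fun y => a y + c * b y) x) by [].
by rewrite (D2_lin c Ux sa sb) mulmxDr -scalemxAr mxtraceD mxtraceZ.
Qed.

Lemma lap_zero x (a : 'rV[R]_n -> R) : U x -> smooth U a -> (forall y u, U y -> 'D_u a y = 0) -> lap g a x = 0.
Proof.
move=> Ux sa H; have D0 : D2 a x = 0.
  apply: bil_eq => u v; rewrite (bil_D2 oU u v Ux sa) (derive_ext u oU Ux (fun y => H y v)) derive_cst.
  by rewrite /bil mulmx0 mul0mx mxE.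
have -> : lap g a x = \tr (invmx (g x) *m D2 a x) by [].
by rewrite D0 mulmx0 mxtrace0.
Qed.

(** Here [h] is minus the scalar curvature. The Laplacian of the constant of [d_invariant], combined
    with [bochner], gives the drift Laplacian of [h], and the squared norm of the Hessian is at
    least the squared trace divided by [n]. *)
Lemma shrink_ineq x (h := fun y => lap g f y + (-1) * (n%:R / 2)) : (0 < m)%N -> U x ->
  h x + 2 / n%:R * h x ^+ 2 <= lap g h x - 'D_(gradV g f x) h x.
Proof.
move=> m0 Ux; have sL := smooth_lap kc sf; have sN := smooth_normgrad sc.
have sk : smooth U (fun _ : 'rV[R]_n => n%:R / 2 : R) := smooth_cst U _.
have n0 : (0 : R) < n%:R by rewrite ltr0n addn_gt0 m0.
have E1 : lap g h x = lap g (lap g f) x.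
  rewrite (lap_lin (-1) Ux sL sk) (lap_zero Ux sk) ?mulr0 ?addr0// => y u _; exact: derive_cst.
have E2 : 'D_(gradV g f x) h x = 'D_(gradV g f x) (lap g f) x.
  rewrite (derive_add oU Ux _ sL (smoothZ (-1) oU sk)) (derive_scale oU Ux (-1) _ sk) derive_cst.
  by rewrite mulr0 addr0.
have sfL : smooth U (fun y => f y + 1 * lap g f y).
  by apply: (smooth_ext oU _ (smoothD oU sf sL)) => y _; rewrite mul1r.
have E3 : lap g f x + lap g (lap g f) x - lap g (normgrad g f) x = 0.
  have Z1 := lap_lin (-1) Ux sfL sN; have Z2 := lap_lin 1 Ux sf sL.
  have Z0 : lap g (fun y => f y + 1 * lap g f y + (-1) * normgrad g f y) x = 0.
    apply: (lap_zero Ux) => [|y u Uy]; first exact: (smoothD oU sfL (smoothZ (-1) oU sN)).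
    apply: etrans (d_invariant sc u Uy); apply: (derive_ext u oU Uy) => z _.
    by rewrite mul1r mulN1r.
  exact: sc_lin0 (etrans (esym Z1) Z0) Z2.
have E4 := bochner sc Ux.
have [E hE] := orthonormal_frame (kc_posdef kc Ux).
have E5 := tr_sqr_ge (frame_gram hE) (hessian_sym kc Ux sf); rewrite (tr_hessian kc Ux sf) in E5.
rewrite E1 E2; have -> : h x = lap g f x - n%:R / 2 by rewrite /h mulN1r.
move: E3 E4 E5; move: (lap g f x) (lap g (lap g f) x) (lap g (normgrad g f) x) ('D_(gradV g f x) (lap g f) x) (\tr _) => L LL LN DL T E3 E4 E5.
exact: sc_shrink n0 E3 E4 E5.
Qed.
End ShrinkIneq.

Section JetMax.
Variables (R : realType) (m : nat) (M : kahlerManifold R m) (f : M -> R).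
Local Notation n := (m + m)%N.
Local Notation J := (Jstd R m).
Hypothesis hsol : gradient_shrinking_KR_soliton f.
Let conn : connected [set: M]. Proof. by have [[]] := hsol. Qed.
Implicit Types (i j : chart_idx M) (p q : M).
Local Notation fi := (chart_fun f).
Local Notation sdist := (sdist f).

Lemma sum_ineq (k : nat) (al de be : 'I_k -> R) (s2 c Uv k1 d0 k2 ka : R) :
  (forall a, s2 * (al a - c) <= Uv * (k1 * (de a - d0) + k2 * (4 * (s2 * be a + ka))) + 4 * ka) ->
  s2 * (\sum_a al a - k%:R * c) <= Uv * (k1 * (\sum_a de a - k%:R * d0) + k2 * (4 * (s2 * (\sum_a be a) + k%:R * ka))) + 4 * (k%:R * ka).
Proof.
move=> H; have cst (z : R) : k%:R * z = \sum_(a < k) z by rewrite sumr_const card_ord mulr_natl.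
rewrite !cst -!sumrB !mulr_sumr -!big_split/= !mulr_sumr -!big_split/= !mulr_sumr -!big_split/=.
exact: ler_sum.
Qed.

Lemma sc_jetmax (s Uv a lp v eta nn sd d0 tD tDJ tg C K4 K : R) : 0 < s -> s < 1 -> 0 < Uv -> 0 < a -> 0 <= K4 ->
  0 <= K -> 0 <= nn ->
  lp - K4 * s ^+ 3 <= tD -> lp - K4 * s ^+ 3 <= tDJ -> tg <= nn + K4 * s ^+ 3 ->
  sd <= nn * (4 * d0) + 2 * s ^+ 2 * eta + C * s ^+ 3 ->
  s ^+ 2 * (tD + tDJ - 2 * v) <= Uv * (2 / a * (sd - nn * (4 * d0)) + 4 / a ^+ 2 * (4 * (s ^+ 2 * tg + nn * (K * s ^+ 3)))) + 4 * (nn * (K * s ^+ 3)) ->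
  s ^+ 2 * (2 * (lp - v)) <= s ^+ 2 * (Uv * (4 * eta / a + 16 * nn / a ^+ 2)) +
    (2 * K4 + Uv * (2 / a * C + 16 / a ^+ 2 * (K4 + nn * K)) + 4 * (nn * K)) * s ^+ 3.
Proof.
move=> s0 s1 U0 a0 K40 K0 nn0 h1 h2 h3 h4 h5.
have s20 : 0 <= s ^+ 2 by exact: sqr_ge0.
have s30 : 0 <= s ^+ 3 by rewrite exprn_ge0// ltW.
have s21 : s ^+ 2 <= 1 by rewrite exprn_ile1// ltW.
have KS : 0 <= K4 * s ^+ 3 by exact: mulr_ge0.
have g1 : s ^+ 2 * (K4 * s ^+ 3) <= K4 * s ^+ 3 by rewrite ler_piMl.
have g2 : s ^+ 2 * (2 * lp - 2 * (K4 * s ^+ 3) - 2 * v) <= s ^+ 2 * (tD + tDJ - 2 * v).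
  by rewrite ler_wpM2l//; lra.
have g3 : s ^+ 2 * tg <= s ^+ 2 * nn + K4 * s ^+ 3.
  by apply: le_trans (ler_wpM2l s20 h3) _; rewrite mulrDr lerD2l.
have i1 : 2 / a * (sd - nn * (4 * d0)) <= 2 / a * (2 * s ^+ 2 * eta + C * s ^+ 3).
  by rewrite ler_wpM2l ?divr_ge0 ?(ltW a0)//; lra.
have i2 : 4 / a ^+ 2 * (4 * (s ^+ 2 * tg + nn * (K * s ^+ 3))) <= 4 / a ^+ 2 * (4 * (s ^+ 2 * nn + K4 * s ^+ 3 + nn * (K * s ^+ 3))).
  by rewrite ler_wpM2l ?divr_ge0 ?sqr_ge0// ler_wpM2l// lerD2r.
have i3 := ler_wpM2l (ltW U0) (lerD i1 i2).
have -> : s ^+ 2 * (2 * (lp - v)) = s ^+ 2 * (2 * lp - 2 * (K4 * s ^+ 3) - 2 * v) + 2 * (s ^+ 2 * (K4 * s ^+ 3)) by ring.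
have j1 := le_trans g2 (le_trans h5 (lerD i3 (lexx _))).
have -> : s ^+ 2 * (Uv * (4 * eta / a + 16 * nn / a ^+ 2)) +
    (2 * K4 + Uv * (2 / a * C + 16 / a ^+ 2 * (K4 + nn * K)) + 4 * (nn * K)) * s ^+ 3 =
  Uv * (2 / a * (2 * s ^+ 2 * eta + C * s ^+ 3) + 4 / a ^+ 2 * (4 * (s ^+ 2 * nn + K4 * s ^+ 3 + nn * (K * s ^+ 3)))) + 4 * (nn * (K * s ^+ 3)) + 2 * (K4 * s ^+ 3).
  by field; rewrite gt_eqF.
apply: lerD; first exact: j1.
by rewrite ler_wpM2l.
Qed.

Lemma tr_perturb (k : nat) (E Gi A : 'M[R]_k) (q a : R) : 0 <= q -> 0 <= a -> (forall b c, `|(E^T *m E - Gi) b c| <= q) ->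
  (forall b c, `|A b c| <= a) -> `|\tr (E^T *m E *m A) - \tr (Gi *m A)| <= k%:R * k%:R * (q * a).
Proof.
by move=> q0 a0 hQ hA; rewrite -raddfB/= -mulmxBl; exact: tr_small.
Qed.

Lemma sum2_ge (k : nat) (F : 'I_k -> 'I_k -> R) b c : (forall b c, 0 <= F b c) -> F b c <= \sum_b \sum_c F b c.
Proof.
move=> F0; rewrite (bigD1 b)//= (bigD1 c)//= -addrA lerDl addr_ge0// ?sumr_ge0// => d _; exact: sumr_ge0.
Qed.

(** At a local maximum of [(h - B')] times the squared cut-off, the values of [h] at the [4 n] test
    points are bounded through their distances to [p]. The sum of these distances is controlled by
    the barrier, which bounds the drift Laplacian of [h] without differentiating the distance. *)
Lemma jet_max p i y (eta Uv a B' rho : R) (h : 'rV[R]_n -> R) (x := coord i y) : (0 < m)%N ->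
  dom i y -> jet f p i x 1 eta -> smooth (im i) h -> Uv = h x - B' -> 0 < Uv -> 0 < a -> 0 < rho ->
  (forall q, dom i q -> dist y q < rho ->
     (h (coord i q) - B') * (a - (dist p q - dist p y)) ^+ 2 <= Uv * a ^+ 2) ->
  2 * (lap (met i) h x - 'D_(gradV (met i) (fi i) x) h x) <= Uv * (4 * eta / a + 16 * n%:R / a ^+ 2).
Proof.
move=> m0 di [C [s0 [C0 s00 HC]]] sh EU U0 a0 rho0 Hmax.
have Ux : im i x := im_coord di; have kc := chart_kc i; have oU := @im_open _ _ M i.
have n0 : (0 : R) < n%:R by rewrite ltr0n addn_gt0 m0.
have [r [B cb]] := cball_ex hsol Ux; have g := cb_good cb; have N := cb_nice cb.
have B1 := gd_C g; have B0 := good_C0 g.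
have hxr : `|x - x| < r by rewrite subrr normr0 (gd_r g).
pose Z := n%:R * (B + 1) + (B + 1) + C.
have nB : (0 : R) <= n%:R * (B + 1) by rewrite mulr_ge0//; lra.
have Z0 : 0 <= Z by rewrite /Z; lra.
have [K K0 [s1 s10 HK]] := pt_expand hsol Ux sh Z0.
set V := gradV (met i) (fi i) x in HK *.
pose D := D2 h x; pose DJ := J *m D *m J^T.
pose aA := \sum_b \sum_c (`|D b c| + `|DJ b c| + `|met i x b c|).
have hA b c : [/\ `|D b c| <= aA, `|DJ b c| <= aA & `|met i x b c| <= aA].
  have T0 b' c' : 0 <= `|D b' c'| + `|DJ b' c'| + `|met i x b' c'| by rewrite !addr_ge0.
  have le : `|D b c| + `|DJ b c| + `|met i x b c| <= aA.
    exact: (sum2_ge (F := fun b c => `|D b c| + `|DJ b c| + `|met i x b c|)).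
  split; apply: le_trans le; first by rewrite -addrA lerDl addr_ge0.
    by rewrite addrAC lerDr addr_ge0.
  by rewrite lerDr addr_ge0.
have aA0 : 0 <= aA.
  by apply: sumr_ge0 => b _; apply: sumr_ge0 => c _; rewrite !addr_ge0.
pose K4 := n%:R * n%:R * (C * aA); have K40 : 0 <= K4 by rewrite !mulr_ge0.
pose KF := 2 * K4 + Uv * (2 / a * C + 16 / a ^+ 2 * (K4 + n%:R * K)) + 4 * (n%:R * K).
have KF0 : 0 <= KF.
  by rewrite /KF !(addr_ge0, mulr_ge0)// ?invr_ge0 ?sqr_ge0// ltW.
(* The bound with [rho] keeps the test points where the maximality is known, and the one with
   [a / 6] makes the relative change of the cut-off small enough for [sc_weight]. *)
pose sm := Num.min s0 (Num.min s1 (Num.min 1 (Num.min (C + 1)^-1 (Num.min (rho / (K + 1)) (a / 6 / (K + 1)))))).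
have sm0 : 0 < sm.
  by rewrite !lt_min s00 s10 ltr01 invr_gt0 !divr_gt0//; lra.
apply: (sc_limit KF0 sm0) => s s_0; rewrite !lt_min => /andP[ss0 /andP[ss1 /andP[sl1 /and3P[sC sr sa]]]].
have [E [Psi [hE hPsi hS]]] := HC s s_0 ss0.
have s3 : 0 <= s ^+ 3 by rewrite exprn_ge0// ltW.
have sC1 : s * (C + 1) < 1 by rewrite -ltr_pdivlMr ?mul1r//; lra.
have Cs1 : C * s ^+ 3 <= 1.
  have h2 : s ^+ 3 <= s by rewrite exprS ler_piMr ?(ltW s_0)// exprn_ile1// ltW.
  have h3 : C * s ^+ 3 <= C * s by rewrite ler_wpM2l.
  by apply: le_trans h3 _; lra.
have Kp : 0 < K + 1 by lra.
have Ks1 : K * s < rho by move: sr; rewrite ltr_pdivlMr//; lra.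
have Ks2 : K * s <= a / 6 by move: sa; rewrite ltr_pdivlMr//; lra.
have Cs0 : 0 <= C * s ^+ 3 by exact: mulr_ge0.
have hbE := gram_norm Cs0 Cs1 B1 (fun a b => ctrl_0 (nc_gi N a b) hxr) hE.
have hEZ b : `|row b E| <= Z by apply: le_trans (hbE b) _; rewrite /Z; lra.
have hEJ b : `|row b E *m J| <= Z.
  apply: le_trans (normJ _) _; apply: le_trans (_ : n%:R * (B + 1) <= _); first by rewrite ler_wpM2l.
  by rewrite /Z; lra.
have hPZ b : `|row b Psi| <= Z by apply: le_trans (hPsi b) _; rewrite /Z; lra.
have yE : icoord i x = y by rewrite /x coordK.
pose q e := s ^+ 2 * bil (met i x) e e + K * s ^+ 3.
pose dl e psi := dist p (pti f i x 1 s e psi) - dist p y.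
have key e psi : `|e| <= Z -> `|psi| <= Z ->
    `|h (coord i (pti f i x 1 s e psi)) - h x - s * 'D_e h x - s ^+ 2 * ('D_psi h x - nuc R m * 'D_V h x + 2^-1 * 'D_e ('D_e h) x)| <= K * s ^+ 3 /\
    h (coord i (pti f i x 1 s e psi)) - h x <= Uv * (2 * (dl e psi / a) + 4 * (q e / a ^+ 2)).
  move=> he hpsi; have [dP dist1 dist2 T] := HK s e psi s_0 ss1 he hpsi; split=> //.
  set P := pti f i x 1 s e psi in dP dist1 dist2 T *; rewrite yE in dist1 dist2.
  have dl1 : `|dl e psi| <= dist y P.
    rewrite /dl -/P ler_norml; have t1 := dist_triangle conn y p P; have t2 := dist_triangle conn P p y.
    by rewrite (dist_sym P y) in t2; apply/andP; split; lra.
  have hx6 : `|dl e psi / a| <= 6^-1.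
    rewrite normrM normfV (gtr0_norm a0) ler_pdivrMr// mulrC; exact: le_trans dl1 (le_trans dist1 Ks2).
  have w1 := Hmax P dP (le_lt_trans dist1 Ks1).
  have w2 : (h (coord i P) - B') * (a - a * (dl e psi / a)) ^+ 2 <= Uv * a ^+ 2.
    have -> : a * (dl e psi / a) = dist p P - dist p y by rewrite mulrC divfK// gt_eqF.
    exact: w1.
  have w3 := sc_weight U0 a0 hx6 w2.
  have w4 : (dl e psi / a) ^+ 2 <= q e / a ^+ 2.
    rewrite expr_div_n ler_wpM2r ?invr_ge0 ?sqr_ge0//; apply: le_trans dist2.
    by rewrite -real_normK ?num_real// ler_pXn2r ?nnegrE// (dist_ge0 conn).
  have w5 : Uv * (1 + 2 * (dl e psi / a) + 4 * (dl e psi / a) ^+ 2) <= Uv * (1 + 2 * (dl e psi / a) + 4 * (q e / a ^+ 2)).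
    by rewrite ler_pM2l// lerD2l ler_wpM2l.
  have := le_trans w3 w5; rewrite -addrA mulrDr mulr1 {1}EU; move: (Uv * (_ + _)) => w6; lra.
have DN u : 'D_(- u) h x = - 'D_u h x.
  by rewrite -scaleN1r (smooth_dirZ (-1) u oU sh Ux) mulN1r.
have DD e : 'D_e ('D_e h) x = bil D e e by rewrite (bil_D2 oU _ _ Ux sh).
have DDJ e : bil D (e *m J) (e *m J) = bil DJ e e by rewrite /DJ bil_mulr bil_mull.
have gJ e : bil (met i x) (e *m J) (e *m J) = bil (met i x) e e.
  by rewrite -bil_mulr -bil_mull mulmxA (met_hermitian Ux).
have S4 b : s ^+ 2 * ((bil D (row b E) (row b E) + bil DJ (row b E) (row b E)) - 4 * nuc R m * 'D_V h x) <=
   Uv * (2 / a * (sum4 (fun e psi => dist p (pti f i x 1 s e psi)) (row b E) (row b Psi) - 4 * dist p y)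
     + 4 / a ^+ 2 * (4 * (s ^+ 2 * bil (met i x) (row b E) (row b E) + K * s ^+ 3))) + 4 * (K * s ^+ 3).
  set e := row b E; set psi := row b Psi.
  have he : `|e| <= Z := hEZ b; have heJ : `|e *m J| <= Z := hEJ b; have hp : `|psi| <= Z := hPZ b.
  have heN : `|- e| <= Z by rewrite normrN.
  have heJN : `|- (e *m J)| <= Z by rewrite normrN.
  have hpN : `|- psi| <= Z by rewrite normrN.
  have [T1 W1] := key _ _ he hp; have [T2 W2] := key _ _ heJ hpN.
  have [T3 W3] := key _ _ heN hp; have [T4 W4] := key _ _ heJN hpN.
  rewrite !DD in T1 T2 T3 T4; rewrite !DN in T2 T3 T4.
  have NN u (A : 'M[R]_n) : bil A (- u) (- u) = bil A u u by rewrite bilNl bilNr opprK.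
  rewrite NN in T3; rewrite NN DDJ in T4; rewrite DDJ in T2.
  have := sc_four T1 T2 T3 T4 W1 W2 W3 W4; rewrite /q /dl !NN gJ /sum4 sc_add4 sc_sub4; exact.
have := sum_ineq S4; rewrite big_split/=.
have n_gt0 : (0 < n)%N by rewrite addn_gt0 m0.
rewrite (nuc_cancel _ n_gt0).
rewrite -!tr_frame => fin.
have cA b c := let: And3 x1 _ _ := hA b c in x1.
have cB b c := let: And3 _ x1 _ := hA b c in x1.
have cC b c := let: And3 _ _ x1 := hA b c in x1.
have P1 := tr_perturb Cs0 aA0 hE cA; have P2 := tr_perturb Cs0 aA0 hE cB; have P3 := tr_perturb Cs0 aA0 hE cC.
rewrite (tr_ginv_J kc Ux) in P2; rewrite mulVmx ?(kc_unit kc)// mxtrace1 in P3.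
have EK : n%:R * n%:R * (C * s ^+ 3 * aA) = K4 * s ^+ 3 by rewrite /K4; ring.
rewrite EK !ler_norml in P1 P2 P3.
have EL : \tr (invmx (met i x) *m D) = lap (met i) h x by [].
rewrite EL in P1 P2.
apply: (sc_jetmax s_0 sl1 U0 a0 K40 K0 (ltW n0) _ _ _ _ fin).
- by case/andP: P1 => P1 _; rewrite lerBlDr -lerBlDl -opprB lerNl.
- by case/andP: P2 => P2 _; rewrite lerBlDr -lerBlDl -opprB lerNl.
- by case/andP: P3 => _ P3; rewrite -lerBlDl.
by move: hS; rewrite yE mulrA (mulrC n%:R 4).
Qed.

End JetMax.

(** * Properness of the potential *)

Section Scalars30.
Variables (R : realType).

Lemma sc_quad (e c1 c2 : R) : 0 < e -> 0 <= c1 -> 0 <= c2 -> (forall t, 0 < t -> e * t ^+ 2 <= c1 * t + c2) -> False.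
Proof.
move=> e0 c10 c20 H; pose t := (c1 + c2) / e + 1.
have q0 : 0 <= (c1 + c2) / e by rewrite divr_ge0 ?addr_ge0// ltW.
have t1 : 1 <= t by rewrite /t lerDr.
have t0 : 0 < t by lra.
have et : e * t = c1 + c2 + e by rewrite /t mulrDr mulr1 mulrC divfK// gt_eqF.
have := H t t0; rewrite expr2 mulrA et !mulrDl.
have h1 : c2 <= c2 * t by rewrite ler_peMr.
have h2 : 0 < e * t by rewrite mulr_gt0.
lra.
Qed.

Lemma sc_uv (nn C0 a A B' Uv X : R) : 0 < nn -> 0 <= C0 -> 0 < a -> a <= A -> 0 <= B' -> 0 < Uv ->
  (Uv + B') + 2 / nn * (Uv + B') ^+ 2 <= X -> 2 * X <= Uv * (4 * C0 / a + 16 * nn / a ^+ 2) ->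
  Uv * a ^+ 2 <= nn * C0 * A + 4 * nn ^+ 2.
Proof.
move=> n0 C00 a0 aA B0 U0 h1 h2; have a2 : 0 < a ^+ 2 by rewrite exprn_gt0.
have q1 : 2 / nn * Uv ^+ 2 <= 2 / nn * (Uv + B') ^+ 2.
  by rewrite ler_wpM2l ?divr_ge0 ?(ltW n0)// ler_pXn2r ?nnegrE ?addr_ge0 ?(ltW U0)// lerDl.
have q2 : 2 * (2 / nn * Uv ^+ 2) <= Uv * (4 * C0 / a + 16 * nn / a ^+ 2) by lra.
(* Multiplication by this factor cancels one power of [Uv] and leaves [Uv * a ^+ 2] on the left. *)
have c0 : 0 < nn * a ^+ 2 / (4 * Uv) by rewrite divr_gt0// mulr_gt0.
have := ler_wpM2r (ltW c0) q2.
have -> : 2 * (2 / nn * Uv ^+ 2) * (nn * a ^+ 2 / (4 * Uv)) = Uv * a ^+ 2 by field; rewrite !gt_eqF.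
have -> : Uv * (4 * C0 / a + 16 * nn / a ^+ 2) * (nn * a ^+ 2 / (4 * Uv)) = nn * C0 * a + 4 * nn ^+ 2.
  by field; rewrite !gt_eqF.
have nC : 0 <= nn * C0 by rewrite mulr_ge0// ltW.
by move=> q3; apply: le_trans q3 _; rewrite lerD2r ler_wpM2l.
Qed.

Lemma sc_wpos (u a : R) : 0 < u * a ^+ 2 -> 0 <= a -> 0 < u /\ 0 < a.
Proof.
move=> h a0; have u0 : 0 < u.
  by rewrite ltNge; apply/negP => u0; move: h; rewrite ltNge mulr_le0_ge0// sqr_ge0.
split=> //; rewrite lt_neqAle a0 andbT; apply/eqP => ea; move: h.
by rewrite -ea expr0n/= mulr0 ltxx.
Qed.
End Scalars30.

Section Proper.
Variables (R : realType) (m : nat) (M : kahlerManifold R m) (f : M -> R).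
Local Notation n := (m + m)%N.
Local Notation J := (Jstd R m).
Hypothesis hsol : gradient_shrinking_KR_soliton f.
Hypothesis m_gt0 : (0 < m)%N.
Let conn : connected [set: M]. Proof. by have [[]] := hsol. Qed.
Let compl : complete_metric M. Proof. by have [] := hsol. Qed.
Implicit Types (i j : chart_idx M) (p q : M).
Local Notation fi := (chart_fun f).
Local Notation NG := (NG f).

Lemma grad_bound_ball p0 (rho : R) : exists2 b : R, 0 <= b & forall q, dist p0 q <= rho -> grad_le f b q.
Proof.
have [|b b0 hb] := @compact_ubound _ R _ (fun q => Num.sqrt (NG q)) (ball_compact conn compl (p := p0) (rho := rho)).
  move=> q _; apply: (@continuous_comp _ _ _ NG Num.sqrt); [exact: NG_continuous|exact: sqrt_continuous].
by exists b => // q hq i u di hu; apply: le_trans (NG_grad_le hsol di hu) _; exact: hb.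
Qed.

(** The bound [B'] is reached already on the unit ball. If minus the scalar curvature exceeded [B']
    at [y1], its excess times a squared cut-off of radius [A] would have a maximum outside the unit
    ball, where the barrier applies; the maximum would then grow at most linearly in [A], but its
    value at [y1] grows quadratically. *)
Lemma scal_lower : exists2 B : R, 0 <= B & forall p : M, - scalar_curvature p <= B.
Proof.
have [[p0 _] _] : [set: M] !=set0 /\ connected [set: M] by have [] := hsol.
have n0 : (0 : R) < n%:R by rewrite ltr0n addn_gt0 m_gt0.
pose u (q : M) := - scalar_curvature q.
have cu q : {for q, continuous u} by apply: continuousN; exact: (scal_continuous hsol).
have [B' B'0 hB'] := @compact_ubound _ R _ u (ball_compact conn compl (p := p0) (rho := 1)) (fun q _ => cu q).
have [b b0 hb] := grad_bound_ball p0 1.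
exists B' => // y1; rewrite leNgt; apply/negP => hy1.
pose d1 := dist p0 y1; have d10 : 0 <= d1 := dist_ge0 conn p0 y1.
pose C0 := n%:R + 2 * b; have C00 : 0 <= C0 by rewrite addr_ge0 ?mulr_ge0// ltW.
have e0 : 0 < u y1 - B' by rewrite subr_gt0.
(* A positive multiple of [t ^ 2] cannot stay below an affine function of [t]. *)
apply: (@sc_quad R (u y1 - B') (n%:R * C0) (n%:R * C0 * d1 + 4 * n%:R ^+ 2) e0).
- by rewrite mulr_ge0// ltW.
- by rewrite addr_ge0 ?mulr_ge0 ?sqr_ge0 ?(ltW n0).
move=> t t0; pose A := d1 + t.
(* The cut-off vanishes at distance [A] from [p0] and equals [t ^ 2] at [y1]. *)
pose w q := (u q - B') * (A - dist p0 q) ^+ 2.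
have cw q : {for q, continuous (fun q => - w q)}.
  apply: continuousN; apply: (@continuousM R M).
    by apply: (@continuousB R _ M); [exact: cu|exact: cst_continuous].
  rewrite [X in {for _, continuous X}](_ : _ = (fun q => (A - dist p0 q) * (A - dist p0 q))); last first.
    by apply/funext => z; rewrite expr2.
  by apply: (@continuousM R M); apply: (@continuousB R _ M); [exact: cst_continuous|exact: dist_continuous|exact: cst_continuous|exact: dist_continuous].
have [||y hy hmin] := @compact_argmin _ R _ (fun q => - w q) (ball_compact conn compl (p := p0) (rho := A)).
- by exists y1 => /=; rewrite -/d1 /A; lra.
- by move=> q _; exact: cw.
have wmax q : dist p0 q <= A -> w q <= w y by move=> hq; have := hmin q hq; rewrite lerN2.
have wy1 : (u y1 - B') * t ^+ 2 <= w y.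
  have -> : (u y1 - B') * t ^+ 2 = w y1 by rewrite /w -/d1 /A addrAC subrr add0r.
  by apply: wmax; rewrite -/d1 /A lerDl ltW.
have wy0 : 0 < w y by apply: lt_le_trans wy1; rewrite mulr_gt0// exprn_gt0.
have aA0 : 0 <= A - dist p0 y by rewrite subr_ge0.
have [U0 a0] := sc_wpos wy0 aA0.
have d1y : 1 < dist p0 y.
  by rewrite ltNge; apply/negP => h; have := hB' y h; rewrite leNgt -subr_gt0 U0.
have S1 := St_far hsol b0 hb (ltW d1y).
have S2 : St f p0 y 1 C0 by apply: (St_le _ S1); rewrite gerBl divr_ge0// subr_ge0 ltW.
pose i := chart_at y; have di : dom i y := dom_chart_at y.
have oU := @im_open _ _ M i; have sfi := sc_f (chart_sc i hsol).
pose h x := lap (met i) (fi i) x + (-1) * (n%:R / 2).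
have sh : smooth (im i) h by apply: (smoothD oU); [exact: (smooth_lap (chart_kc i) sfi)|exact: (smoothZ (-1) oU (smooth_cst _ _))].
have hE q : dom i q -> h (coord i q) = u q by move=> dq; rewrite /u (scalE hsol dq) /h; ring.
have EU : u y - B' = h (coord i y) - B' by rewrite hE.
have HM q : dom i q -> dist y q < A - dist p0 y -> (h (coord i q) - B') * (A - dist p0 y - (dist p0 q - dist p0 y)) ^+ 2 <= (u y - B') * (A - dist p0 y) ^+ 2.
  move=> dq hq; rewrite hE//.
  have -> : A - dist p0 y - (dist p0 q - dist p0 y) = A - dist p0 q by ring.
  apply: wmax; have := dist_triangle conn y p0 q; move: hq; rewrite ltrBrDl => h1 h2; exact: le_trans h2 (ltW h1).
have H := jet_max hsol m_gt0 di (S2 i di) sh EU U0 a0 a0 HM.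
have SI := shrink_ineq (chart_sc i hsol) m_gt0 (im_coord di).
have hyE : h (coord i y) = (u y - B') + B' by rewrite hE// subrK.
have aA : A - dist p0 y <= A by rewrite gerBl (dist_ge0 conn).
have fin := sc_uv n0 C00 a0 aA B'0 U0.
rewrite -hyE in fin.
have {}fin := fin _ SI H.
apply: le_trans wy1 _; apply: le_trans fin _.
by rewrite /A mulrDr (addrC (_ * d1)) -addrA.
Qed.

Lemma sqrt_derive (F : R -> R) (t dF : R) : 0 < F t -> is_derive t (1 : R) F dF ->
  is_derive t (1 : R) (fun s => Num.sqrt (F s)) ((2 * Num.sqrt (F t))^-1 * dF).
Proof.
move=> F0 hF; have hs := is_derive1_sqrt F0.
exact: (is_derive1_comp hs hF).
Qed.

Lemma curve_f_derive (c : R -> M) (t : R) : C1_curve c -> 0 <= t <= 1 ->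
  exists2 df : R, is_derive t (1 : R) (f \o c) df & `|df| <= Num.sqrt (NG (c t)) * speed c t.
Proof.
move=> cc t01; set i := chart_at (c t); have di : dom i (c t) := dom_chart_at (c t).
have [cont /(_ i di)[nd _]] := cc t t01; have nD := dom_near cont di.
have dc := nbhs_singleton nd; have Ux := im_coord di.
have sfi := sc_f (chart_sc i hsol).
have h1 := curve_chain_scalar (@im_open _ _ M i) (c := coord i \o c) Ux sfi dc.
set v := derive1 _ t in h1.
exists ('D_v (fi i) (coord i (c t))).
  have nE : \forall s \near t, (fi i \o (coord i \o c)) s = (f \o c) s.
    by apply: filterS nD => s ds; rewrite /= /chart_fun coordK.
  exact: (near_eq_is_derive nE h1).
have sp : speed c t = nrm i (coord i (c t)) v by apply: speed_chart.
rewrite sp -(bil_gradV (chart_kc i) Ux v sfi).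
apply: le_trans (nrm_CS _ _ Ux) _.
by rewrite (NGE hsol di).
Qed.

(** Along a curve the derivative of the square root of [f + C] is at most half the speed, by the
    hypothesis on the gradient. Adding a positive [e] avoids the zeros of [f + C]. *)
Lemma sqrt_lipschitz (C : R) : (forall p, NG p <= f p + C) -> forall p q,
  Num.sqrt (f q + C) <= Num.sqrt (f p + C) + 2^-1 * dist p q.
Proof.
move=> hC; have F0 p : 0 <= f p + C by apply: le_trans (hC p); exact: NG_ge0.
have key (e : R) p q l : 0 < e -> path_length p q l -> Num.sqrt (f q + C + e) <= Num.sqrt (f p + C + e) + 2^-1 * l.
  move=> e0; elim=> [{}p|c {}q {}l cc _ IH]; first by rewrite mulr0 addr0.
  have [G aG] := antider_ex cc; rewrite (antider_length cc aG).
  pose hh t := Num.sqrt (f (c t) + C + e).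
  have Fe t : 0 < f (c t) + C + e by rewrite ltr_wpDl.
  have [df Hdf] : exists df : R -> R, forall t : R, 0 <= t <= 1 ->
      is_derive t (1 : R) (f \o c) (df t) /\ `|df t| <= Num.sqrt (NG (c t)) * speed c t.
    have ex (t : R) : exists d : R, 0 <= t <= 1 -> is_derive t (1 : R) (f \o c) d /\ `|d| <= Num.sqrt (NG (c t)) * speed c t.
      have [t01|nt] := boolP (0 <= t <= 1); last by exists 0.
      by have [d h1 h2] := curve_f_derive cc t01; exists d.
    by have [F HF] := choice ex; exists F.
  have D1 : `|hh 1 - hh 0| <= 2^-1 * G 1 - 2^-1 * G 0.
    apply: (@deriv_le R hh (fun t => 2^-1 * G t) (fun t => (2 * hh t)^-1 * df t) (fun t => 2^-1 * speed c t)) => //.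
    - move=> t t01; have [h1 _] := Hdf t t01; apply: (@sqrt_derive (fun t => f (c t) + C + e)) => //.
      have h2 : is_derive t (1 : R) ((f \o c) + cst (C + e)) (df t + 0) by apply: is_deriveD.
      rewrite addr0 in h2; move: h2; rewrite (_ : (f \o c) + cst (C + e) = (fun t => f (c t) + C + e))//.
      by apply/funext => s; rewrite /= addrA.
    - move=> t t01; have h1 := aG t t01.
      have := is_deriveZ 2^-1 h1; exact.
    - move=> t t01; have [_ h2] := Hdf t t01.
      have hp : 0 < hh t by rewrite sqrtr_gt0.
      rewrite normrM ger0_norm ?invr_ge0 ?mulr_ge0 ?(ltW hp)// invfM -mulrA ler_wpM2l//.
      rewrite mulrC ler_pdivrMr// mulrC; apply: le_trans h2 _; rewrite ler_wpM2r ?speed_ge0//.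
      rewrite ler_sqrt; last by exact: ltW.
      by apply: le_trans (hC _) _; rewrite lerDl ltW.
  apply: le_trans IH _; rewrite mulrDr addrA lerD2r -/(hh 1) -/(hh 0).
  move: D1; rewrite ler_norml => /andP[_]; rewrite lerBlDl => D1; apply: le_trans D1 _.
  by rewrite mulrBr.
move=> p q; apply/ler_addgt0Pr => e e0.
have [l hl hl2] := dist_approx conn p q e0.
(* Adding [e ^ 2 / 4] under the square root changes it by at most [e / 2]. *)
have h1 := key (4^-1 * e ^+ 2) p q l; have e2 : 0 < 4^-1 * e ^+ 2 by rewrite mulr_gt0// exprn_gt0.
have {}h1 := h1 e2 hl.
have sq : Num.sqrt (f p + C + 4^-1 * e ^+ 2) <= Num.sqrt (f p + C) + 2^-1 * e.
  have r0 := sqrtr_ge0 (f p + C).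
  apply: le_of_sqr; first by rewrite addr_ge0 ?mulr_ge0// ltW.
  rewrite sqr_sqrtr; last by rewrite addr_ge0 ?(ltW e2).
  have -> : (Num.sqrt (f p + C) + 2^-1 * e) ^+ 2 = Num.sqrt (f p + C) ^+ 2 + 4^-1 * e ^+ 2 + Num.sqrt (f p + C) * e by field.
  by rewrite sqr_sqrtr// lerDl mulr_ge0// ltW.
have mono : Num.sqrt (f q + C) <= Num.sqrt (f q + C + 4^-1 * e ^+ 2) by rewrite ler_wsqrtr// lerDl ltW.
by apply: le_trans mono _; apply: le_trans h1 _; lra.
Qed.

(** If [f y <= c], the Lipschitz bound keeps the gradient bounded on the unit ball around [y], and
    [dist_grad_bound] then bounds the distance of [y] to a fixed point. Sublevel sets are closed
    subsets of compact balls. *)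
Lemma f_proper (c : R) : compact [set p | f p <= c].
Proof.
have [[p0 _] _] : [set: M] !=set0 /\ connected [set: M] by have [] := hsol.
have [B B0 hB] := scal_lower; have [k hk] := soliton_identity hsol.
have hC p : NG p <= f p + (B - k) by have := hk p; have := hB p; lra.
have lip := sqrt_lipschitz hC; set C := B - k in hC lip.
have [b b0 hb] := grad_bound_ball p0 1.
(* The bound of [dist_grad_bound] solved for the distance, with some room. *)
pose rho := 2 + 4 * (n%:R + b + Num.sqrt (c + C) + 1).
have s0 := sqrtr_ge0 (c + C).
have sub : [set p | f p <= c] `<=` [set p | dist p0 p <= rho].
  move=> y /= hy; have [h2|h2] := leP (dist p0 y) 2.
    by apply: le_trans h2 _; rewrite /rho lerDl mulr_ge0// !addr_ge0.
  have syc : Num.sqrt (f y + C) <= Num.sqrt (c + C) by rewrite ler_wsqrtr// lerD2r.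
  (* The square root of [f + C] increases by at most [1 / 2] over a unit distance. *)
  pose b' := Num.sqrt (c + C) + 2^-1; have b'0 : 0 <= b' by rewrite addr_ge0.
  have hb' q : dist y q <= 1 -> grad_le f b' q.
    move=> hq i u di hu; apply: le_trans (NG_grad_le hsol di hu) _.
    have l1 := lip y q; have : Num.sqrt (NG q) <= Num.sqrt (f q + C) by rewrite ler_wsqrtr.
    by rewrite /b'; lra.
  have := dist_grad_bound hsol b0 hb (ltW h2) b'0 hb'; rewrite /rho /b'; lra.
apply: (subclosed_compact _ (ball_compact conn compl (p := p0) (rho := rho)) sub).
rewrite -[[set p | _]]/(f @^-1` [set z | z <= c]).
by apply: preimage_closed => [q _|]; [exact: f_continuous|exact: closed_le].
Qed.
End Proper.

(** * Level sets and the mountain pass *)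

Section Joined.
Variables (T : topologicalType).
(** Compact connected sets replace paths: they are easy to glue, and a continuous function attains
    its minimum on them, which allows a level to be raised slightly in [Up_joined]. *)
Definition joined (A : set T) y z := exists G : set T, [/\ compact G, connected G, G `<=` A, G y & G z].
Lemma joined_sym A y z : joined A y z -> joined A z y.
Proof. by move=> [G [h1 h2 h3 h4 h5]]; exists G. Qed.
Lemma joined_trans A x y z : joined A x y -> joined A y z -> joined A x z.
Proof.
move=> [G [g1 g2 g3 g4 g5]] [H [h1 h2 h3 h4 h5]]; exists (G `|` H); split.
- exact: compactU.
- by apply: connectedU => //; exists y.
- by rewrite subUset.
- by left.
- by right.
Qed.
Lemma joined_sub A B y z : A `<=` B -> joined A y z -> joined B y z.
Proof. by move=> AB [G [h1 h2 h3 h4 h5]]; exists G; split=> //; exact: subset_trans AB. Qed.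
Lemma joined_curve (R : realType) (phi : R -> T) A : (forall t : R, 0 <= t <= 1 -> {for t, continuous phi} /\ A (phi t)) ->
  joined A (phi 0) (phi 1).
Proof.
move=> H; have cw : {within `[(0 : R), 1], continuous phi}.
  apply: continuous_in_subspaceT => t; rewrite inE /= in_itv/= => /H[]; by [].
exists (phi @` `[(0 : R), 1]%classic); split.
- by apply: continuous_compact => //; exact: segment_compact.
- by apply: connected_continuous_connected => //; exact: segment_connected.
- by move=> z [t]; rewrite /= in_itv/= => /H[_ ?] <-.
- by exists 0 => //=; rewrite in_itv/= lexx ler01.
- by exists 1 => //=; rewrite in_itv/= lexx ler01.
Qed.
End Joined.

(** * Local structure of the sets above a level *)

Section Local.
Variables (R : realType) (m : nat) (M : kahlerManifold R m) (f : M -> R).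
Local Notation n := (m + m)%N.
Local Notation J := (Jstd R m).
Hypothesis hsol : gradient_shrinking_KR_soliton f.
Implicit Types (i j : chart_idx M) (p q : M).
Local Notation fi := (chart_fun f).

Lemma seg_joined i (A : set M) (y y' : 'rV[R]_n) :
  (forall t : R, 0 <= t <= 1 -> im i (y + t *: (y' - y)) /\ A (icoord i (y + t *: (y' - y)))) ->
  joined A (icoord i y) (icoord i y').
Proof.
move=> H; have := @joined_curve M R (fun t => icoord i (y + t *: (y' - y))) A.
rewrite scale0r addr0 scale1r (addrC y (y' - y)) subrK; apply => t t01; have [Ut At] := H t t01; split=> //.
apply: (@continuous_comp _ _ _ (fun t : R => y + t *: (y' - y)) (icoord i)).
  have [dL _] := line_is_derive y (y' - y) t.
  by apply: differentiable_continuous; apply/derivable1_diffP.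
exact: icoord_continuous.
Qed.

Lemma ball_conv (x0 y y' : 'rV[R]_n) (r t : R) : `|y - x0| < r -> `|y' - x0| < r -> 0 <= t <= 1 ->
  `|y + t *: (y' - y) - x0| < r.
Proof.
move=> h1 h2 t01; apply: ball_segment => //.
by have -> : y + (y' - y) = y' by rewrite addrC subrK.
Qed.

(** [W] is a set of escape vectors whose tips [x0 + w] lie at height at least [c + k]. A point [y]
    above the level and near [x0] moves along some [w] to [y + w], then slides to [x0 + w]; the
    slide loses less than [k] in height. The tips are joined by hypothesis. *)
Lemma local_core i x0 (r C c k rho1 : R) (W : set 'rV[R]_n) : controlled (im i) (fi i) x0 r C -> 0 < k -> 0 < rho1 ->
  (forall w, W w -> `|w| < r / 2 /\ c + k <= fi i (x0 + w)) ->
  (forall w w', W w -> W w' -> joined [set q | c < f q] (icoord i (x0 + w)) (icoord i (x0 + w'))) ->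
  (forall y, `|y - x0| < rho1 -> c < fi i y -> exists2 w, W w & forall t : R, 0 <= t <= 1 -> c < fi i (y + t *: w)) ->
  exists2 rho : R, 0 < rho & forall y z, `|y - x0| < rho -> `|z - x0| < rho -> c < fi i y -> c < fi i z ->
    joined [set q | c < f q] (icoord i y) (icoord i z).
Proof.
move=> K k0 rho10 HW HJ HY; have r0 := ctrl_r K; have C0 := ctrl_C K.
pose rho := Num.min rho1 (Num.min (r / 2) (k / (C + 1))).
have rhop : 0 < rho by rewrite !lt_min rho10 !divr_gt0//; lra.
have leg y : `|y - x0| < rho -> c < fi i y -> exists2 w, W w & joined [set q | c < f q] (icoord i y) (icoord i (x0 + w)).
  rewrite !lt_min => /and3P[h1 h2 h3] hy; have [w Ww hw] := HY y h1 hy; exists w => //.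
  have [wr hk] := HW w Ww.
  have inb (v : 'rV[R]_n) : `|v - x0| < r / 2 -> `|v + w - x0| < r.
    move=> hv; rewrite addrAC [r]splitr; apply: le_lt_trans (ler_normD _ _) _; exact: ltrD.
  have yr : `|y - x0| < r by apply: lt_trans h2 _; lra.
  have yw : `|y + w - x0| < r := inb y h2.
  apply: (@joined_trans _ _ _ (icoord i (y + w))).
    apply: seg_joined => t t01; split; first by apply: (ctrl_U K); exact: ball_conv.
    by rewrite (addrC y w) addrK; exact: hw.
  apply: seg_joined => t t01.
  have zt : `|(y + t *: (x0 - y)) - x0| < rho.
    by apply: ball_conv => //; rewrite ?subrr ?normr0// !lt_min h1 h2.
  set y' := y + t *: (x0 - y) in zt.
  have -> : y + w + t *: (x0 + w - (y + w)) = y' + w.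
    by rewrite /y' opprD addrACA subrr addr0 addrAC.
  move: zt; rewrite !lt_min => /and3P[z1 z2 z3].
  have y'w := inb y' z2; have Uy'w := ctrl_U K y'w; split=> //=.
  have xw : `|x0 + w - x0| < r by rewrite addrC addKr; apply: lt_trans wr _; lra.
  have e1 : x0 + w + (y' - x0) = y' + w by rewrite addrC addrA subrK.
  have := taylor_1 K (y := x0 + w) (v := y' - x0) xw; rewrite e1 => /(_ y'w) T.
  have hC : C * `|y' - x0| < k.
    move: z3; rewrite ltr_pdivlMr; last by lra.
    have := normr_ge0 (y' - x0); rewrite mulrDr mulr1 mulrC; lra.
  rewrite -[f _]/(fi i (y' + w)); move: T; rewrite ler_norml => /andP[T _]; lra.
exists rho => // y z hy hz cy cz; have [w Ww jw] := leg y hy cy; have [w' Ww' jw'] := leg z hz cz.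
exact: joined_trans jw (joined_trans (HJ w w' Ww Ww') (joined_sym jw')).
Qed.

Lemma cont_ge (h : 'rV[R]_n -> R) x0 (b : R) : {for x0, continuous h} -> b < h x0 ->
  exists2 rho : R, 0 < rho & forall y, `|y - x0| < rho -> b < h y.
Proof.
move=> ch hb; apply/nbhs_norm_ex.
have h0 : 0 < h x0 - b by rewrite subr_gt0.
have /cvgrPdist_lt := ch => /(_ _ h0); apply: filterS => y /=; rewrite ltr_norml => /andP[_]; lra.
Qed.

(** The joining set may leave the small ball; it only has to stay above the level of [x0]. *)
Definition hill i x0 := exists2 rho : R, 0 < rho & forall y z, `|y - x0| < rho -> `|z - x0| < rho ->
  fi i x0 < fi i y -> fi i x0 < fi i z -> joined [set q | fi i x0 < f q] (icoord i y) (icoord i z).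
Definition nomax i x0 := forall e : R, 0 < e -> exists2 z, im i z /\ `|z - x0| < e & fi i x0 < fi i z.

Lemma sc_reg (mu C t tau nu : R) : 0 < mu -> 0 <= C -> 0 <= t -> t <= tau -> tau * (2 * (C * nu ^+ 2 + 1)) <= mu ->
  C * (t * nu) ^+ 2 <= t * (mu / 2).
Proof.
move=> mu0 C0 t0 tt h; have n2 : 0 <= C * nu ^+ 2 by rewrite mulr_ge0// sqr_ge0.
rewrite (_ : C * (t * nu) ^+ 2 = t * (t * (C * nu ^+ 2))); last by ring.
rewrite ler_wpM2l//; have : t * (C * nu ^+ 2) <= tau * (C * nu ^+ 2) by rewrite ler_wpM2r.
have : 0 <= tau by exact: le_trans t0 tt.
lra.
Qed.

(** At a regular point one escape vector suffices: near [x0] the function increases along short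
    multiples of [v]. *)
Lemma local_regular i x0 v : im i x0 -> 0 < 'D_v (fi i) x0 -> hill i x0 /\ nomax i x0.
Proof.
move=> Ux; have sfi := sc_f (chart_sc i hsol); have oU := @im_open _ _ M i.
have [mu Emu] : exists mu : R, mu = 'D_v (fi i) x0 by eexists.
rewrite -Emu => mu0.
have [r [C K]] := smooth_controlled oU sfi Ux; have r0 := ctrl_r K; have C0 := ctrl_C K.
have [rho1 rho10 H1] : exists2 rho : R, 0 < rho & forall y, `|y - x0| < rho -> mu / 2 < 'D_v (fi i) y.
  apply: cont_ge; first exact: (smooth_continuous (smooth_dir v oU sfi) Ux).
  by rewrite -Emu; lra.
pose nu := `|v|; have nu0 : 0 <= nu by exact: normr_ge0.
have n2 : 0 <= C * nu ^+ 2 by rewrite mulr_ge0// sqr_ge0.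
pose tau := Num.min (r / 4 / (nu + 1)) (mu / (2 * (C * nu ^+ 2 + 1))).
have tau0 : 0 < tau by rewrite lt_min !divr_gt0//; lra.
have tnu t : 0 <= t -> t <= tau -> `|t *: v| < r / 2.
  move=> t0 tt; rewrite normrZ ger0_norm//.
  have : t * (nu + 1) <= r / 4 by rewrite -ler_pdivlMr; [apply: le_trans tt _; rewrite ge_min lexx|lra].
  by rewrite -/nu; lra.
have tmu : tau * (2 * (C * nu ^+ 2 + 1)) <= mu by rewrite -ler_pdivlMr; [rewrite ge_min lexx orbT|lra].
have inc y t : `|y - x0| < rho1 -> `|y - x0| < r / 2 -> 0 <= t -> t <= tau -> fi i y + t * ('D_v (fi i) y - mu / 2) <= fi i (y + t *: v).
  move=> hy hyr t0 tt; have ty := tnu t t0 tt.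
  have yr : `|y - x0| < r by lra.
  have yt : `|y + t *: v - x0| < r.
    rewrite addrAC [r]splitr; apply: le_lt_trans (ler_normD _ _) _; exact: ltrD.
  have := taylor_2 K yr yt; rewrite (smooth_dirZ t v oU sfi (ctrl_U K yr)) normrZ (ger0_norm t0) -/nu.
  have := sc_reg mu0 C0 t0 tt tmu; move: (C * _) ('D_v _ y) => a b h1; rewrite ler_norml => /andP[h2 _].
  by rewrite /chart_fun mulrBr; lra.
have x0r : `|x0 - x0| < rho1 by rewrite subrr normr0.
have x0r2 : `|x0 - x0| < r / 2 by rewrite subrr normr0; lra.
have up t : 0 <= t -> t <= tau -> fi i x0 + t * (mu / 2) <= fi i (x0 + t *: v).
  move=> t0 tt; have := inc x0 t x0r x0r2 t0 tt; rewrite -Emu.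
  by rewrite (_ : mu - mu / 2 = mu / 2)//; lra.
split; last first.
  move=> e e0; pose t := Num.min tau (e / (2 * (nu + 1))).
  have t0 : 0 < t by rewrite lt_min tau0 divr_gt0//; lra.
  have tt : t <= tau by rewrite ge_min lexx.
  exists (x0 + t *: v); last first.
    by apply: lt_le_trans (up t (ltW t0) tt); rewrite ltrDl mulr_gt0//; lra.
  split; first by apply: (ctrl_U K); rewrite addrC addKr; apply: lt_trans (tnu t (ltW t0) tt) _; lra.
  rewrite addrC addKr normrZ gtr0_norm// -/nu.
  have : t * (2 * (nu + 1)) <= e by rewrite -ler_pdivlMr; [rewrite ge_min lexx orbT|lra].
  have := mulr_ge0 (ltW t0) nu0; lra.
have k0 : 0 < tau * (mu / 2) by rewrite mulr_gt0//; lra.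
have rho20 : 0 < Num.min rho1 (r / 2) by rewrite lt_min rho10; lra.
apply: (@local_core i x0 r C (fi i x0) (tau * (mu / 2)) (Num.min rho1 (r / 2)) [set tau *: v] K k0 rho20).
- by move=> w ->; split; [apply: tnu => //; exact: ltW|apply: up => //; exact: ltW].
- move=> w w' -> ->; have h := up tau (ltW tau0) (lexx tau).
  have hU : im i (x0 + tau *: v).
    by apply: (ctrl_U K); rewrite addrC addKr; apply: lt_trans (tnu tau (ltW tau0) (lexx _)) _; lra.
  apply: seg_joined => t _; rewrite subrr scaler0 addr0; split=> //=.
  by apply: lt_le_trans h; rewrite ltrDl.
move=> y; rewrite lt_min => /andP[hy hyr] cy; exists (tau *: v) => // t /andP[t0 t1].
rewrite scalerA; have tt : t * tau <= tau by rewrite ler_piMl// ltW.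
have tt0 : 0 <= t * tau by rewrite mulr_ge0// ltW.
apply: lt_le_trans (inc y (t * tau) hy hyr tt0 tt); apply: (lt_le_trans cy).
by rewrite lerDl mulr_ge0// subr_ge0 ltW// H1.
Qed.
End Local.

Section Critical.
Variables (R : realType) (m : nat) (M : kahlerManifold R m) (f : M -> R).
Local Notation n := (m + m)%N.
Local Notation J := (Jstd R m).
Hypothesis hsol : gradient_shrinking_KR_soliton f.
Let conn : connected [set: M]. Proof. by have [[]] := hsol. Qed.
Implicit Types (i j : chart_idx M) (p q : M).
Local Notation fi := (chart_fun f).

Lemma sc_crit (la C t tau nu : R) : 0 < la -> 0 <= C -> 0 <= nu -> 0 <= t -> t <= tau -> tau * (8 * (C * nu ^+ 3) + 1) <= la ->
  C * (t * nu) ^+ 3 <= t ^+ 2 * (la / 8).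
Proof.
move=> la0 C0 nu0 t0 tt h; have n2 : 0 <= C * nu ^+ 3 by rewrite mulr_ge0// exprn_ge0.
rewrite (_ : C * (t * nu) ^+ 3 = t ^+ 2 * (t * (C * nu ^+ 3))); last by ring.
rewrite ler_wpM2l ?sqr_ge0//; have : t * (C * nu ^+ 3) <= tau * (C * nu ^+ 3) by rewrite ler_wpM2r.
have : 0 <= tau by exact: le_trans t0 tt.
lra.
Qed.

(* The function increases quadratically in all directions of the plane of [e] and [e'], which joins
   [tau *: e] to [tau *: - e] within [f > f x0]. *)
Lemma local_critical i x0 (e e' : 'rV[R]_n) (la : R) : im i x0 -> (forall u, 'D_u (fi i) x0 = 0) ->
  (forall a b : R, 'D_(a *: e + b *: e') ('D_(a *: e + b *: e') (fi i)) x0 = (a ^+ 2 + b ^+ 2) * la) -> 0 < la -> hill f i x0 /\ nomax f i x0.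
Proof.
move=> Ux cr Q la0; have sfi := sc_f (chart_sc i hsol); have oU := @im_open _ _ M i.
have [r [C K]] := smooth_controlled oU sfi Ux; have r0 := ctrl_r K; have C0 := ctrl_C K.
have [rho1 rho10 H1] : exists2 rho : R, 0 < rho & forall y, `|y - x0| < rho -> la / 2 < 'D_e ('D_e (fi i)) y.
  apply: cont_ge; first exact: (smooth_continuous (smooth_dir e oU (smooth_dir e oU sfi)) Ux).
  have := Q 1 0; rewrite scale1r scale0r addr0 expr1n expr0n /= addr0 mul1r => ->.
  by rewrite ltr_pdivrMr// ltr_pMr// ltr1n.
pose nu := `|e| + `|e'|; have nu0 : 0 <= nu by rewrite addr_ge0.
have n3 : 0 <= C * nu ^+ 3 by rewrite mulr_ge0// exprn_ge0.
pose tau := Num.min (r / 4 / (nu + 1)) (la / (8 * (C * nu ^+ 3) + 1)).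
have tau0 : 0 < tau by rewrite lt_min !divr_gt0//; lra.
have tla : tau * (8 * (C * nu ^+ 3) + 1) <= la by rewrite -ler_pdivlMr; [rewrite ge_min lexx orbT|lra].
have tnu (t : R) (v : 'rV[R]_n) : `|v| <= nu -> 0 <= t -> t <= tau -> `|t *: v| < r / 2.
  move=> hv t0 tt; rewrite normrZ ger0_norm//.
  have : t * (nu + 1) <= r / 4 by rewrite -ler_pdivlMr; [apply: le_trans tt _; rewrite ge_min lexx|lra].
  have : t * `|v| <= t * nu by rewrite ler_wpM2l.
  by lra.
have T3 (y : 'rV[R]_n) (t : R) (v : 'rV[R]_n) : `|y - x0| < r / 2 -> `|v| <= nu -> 0 <= t -> t <= tau ->
    fi i y + t * 'D_v (fi i) y + t ^+ 2 * (2^-1 * 'D_v ('D_v (fi i)) y - la / 8) <= fi i (y + t *: v).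
  move=> hyr hv t0 tt; have ty := tnu t v hv t0 tt.
  have yr : `|y - x0| < r by lra.
  have yt : `|y + t *: v - x0| < r.
    rewrite addrAC [r]splitr; apply: le_lt_trans (ler_normD _ _) _; exact: ltrD.
  have Uy := ctrl_U K yr; have := taylor_3 K yr yt; rewrite (smooth_dirZ t v oU sfi Uy).
  have := dir2_expand v v t 0 oU sfi Uy; rewrite scale0r addr0 !mul0r !addr0 mulrA -expr2 => ->.
  have h1 : C * `|t *: v| ^+ 3 <= t ^+ 2 * (la / 8).
    apply: le_trans (sc_crit la0 C0 nu0 t0 tt tla); rewrite normrZ ger0_norm// ler_wpM2l//.
    by rewrite ler_pXn2r ?nnegrE ?mulr_ge0// ler_wpM2l.
  rewrite /chart_fun; move: (C * _) ('D_v _ y) ('D_v _ y) h1 => a b d h1; rewrite ler_norml => /andP[h2 _].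
  rewrite mulrBr; lra.
have x0r2 : `|x0 - x0| < r / 2 by rewrite subrr normr0; lra.
have up (a b t : R) : `|a| <= 1 -> `|b| <= 1 -> 2^-1 <= a ^+ 2 + b ^+ 2 -> 0 <= t -> t <= tau ->
    fi i x0 + t ^+ 2 * (la / 8) <= fi i (x0 + t *: (a *: e + b *: e')).
  move=> ha hb hab t0 tt.
  have hv : `|a *: e + b *: e'| <= nu.
    by apply: norm_leD; [rewrite -[`|e|]mul1r|rewrite -[`|e'|]mul1r]; exact: norm_leZ.
  apply: le_trans (T3 x0 t _ x0r2 hv t0 tt); rewrite cr mulr0 addr0 lerD2l ler_wpM2l ?sqr_ge0//.
  rewrite Q.
  have : 2^-1 * la <= (a ^+ 2 + b ^+ 2) * la by rewrite ler_wpM2r// ltW.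
  lra.
have he : `|e| <= nu by rewrite lerDl.
have inU (a b t : R) : `|a| <= 1 -> `|b| <= 1 -> 0 <= t -> t <= tau -> im i (x0 + t *: (a *: e + b *: e')).
  move=> ha hb t0 tt; have hv : `|a *: e + b *: e'| <= nu.
    by apply: norm_leD; [rewrite -[`|e|]mul1r|rewrite -[`|e'|]mul1r]; exact: norm_leZ.
  apply: (ctrl_U K); rewrite addrC addKr; apply: lt_trans (tnu t _ hv t0 tt) _; lra.
have c1 : `|1 : R| <= 1 by rewrite normr1.
have c0 : `|0 : R| <= 1 by rewrite normr0.
have q1 : (2^-1 : R) <= 1 ^+ 2 + 0 ^+ 2 by rewrite expr1n expr0n/= addr0; lra.
have E1 (t : R) : t *: (1 *: e + 0 *: e') = t *: e by rewrite scale1r scale0r addr0.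
split; last first.
  move=> d d0; pose t := Num.min tau (d / (2 * (nu + 1))).
  have t0 : 0 < t by rewrite lt_min tau0 divr_gt0//; lra.
  have tt : t <= tau by rewrite ge_min lexx.
  exists (x0 + t *: (1 *: e + 0 *: e')).
    split; first exact: (inU 1 0 t c1 c0 (ltW t0) tt).
    rewrite addrC addKr E1 normrZ gtr0_norm//.
    have h1 : t * `|e| <= t * nu by rewrite ler_wpM2l// ltW.
    have h2 : t * (2 * (nu + 1)) <= d by rewrite -ler_pdivlMr; [rewrite ge_min lexx orbT|lra].
    have := mulr_ge0 (ltW t0) nu0; lra.
  apply: lt_le_trans (up 1 0 t c1 c0 q1 (ltW t0) tt); rewrite ltrDl mulr_gt0 ?exprn_gt0//; lra.
have k0 : 0 < tau ^+ 2 * (la / 8) by rewrite mulr_gt0 ?exprn_gt0//; lra.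
have rho20 : 0 < Num.min rho1 (r / 2) by rewrite lt_min rho10; lra.
have cN1 : `|-1 : R| <= 1 by rewrite normrN normr1.
have EN1 (t : R) : t *: ((-1) *: e + 0 *: e') = t *: (- e) by rewrite scaleN1r scale0r addr0.
have qN1 : (2^-1 : R) <= (-1) ^+ 2 + 0 ^+ 2 by rewrite sqrrN expr1n expr0n/= addr0; lra.
have tau0' := ltW tau0; have tt := lexx tau.
have upj (a b : R) : `|a| <= 1 -> `|b| <= 1 -> 2^-1 <= a ^+ 2 + b ^+ 2 -> fi i x0 < f (icoord i (x0 + tau *: (a *: e + b *: e'))).
  by move=> ha hb hab; apply: lt_le_trans (up a b tau ha hb hab tau0' tt); rewrite ltrDl.
have JJ : joined [set q | fi i x0 < f q] (icoord i (x0 + tau *: e)) (icoord i (x0 + tau *: (- e))).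
  (* On the segment from [s *: e] to [e'] the coefficients satisfy [(1 - t) ^ 2 + t ^ 2 >= 1 / 2],
     the threshold of [up]. A corner at [e'] avoids passing through the critical point. *)
  have leg (s : R) : s ^+ 2 = 1 -> joined [set q | fi i x0 < f q] (icoord i (x0 + tau *: (s *: e))) (icoord i (x0 + tau *: e')).
    move=> s2; apply: seg_joined => t /andP[t0 t1].
    have hs : `|s| <= 1 by apply: le_of_sqr => //; rewrite real_normK ?num_real// s2 expr1n.
    have -> : x0 + tau *: (s *: e) + t *: (x0 + tau *: e' - (x0 + tau *: (s *: e))) = x0 + tau *: (((1 - t) * s) *: e + t *: e').
      by apply/rowP => k; rewrite !mxE; ring.
    have ha : `|(1 - t) * s| <= 1.
      rewrite normrM -[1]mulr1; apply: ler_pM => //; rewrite ger0_norm; lra.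
    have hb : `|t| <= 1 by rewrite ger0_norm.
    split; first exact: inU.
    apply: upj => //; rewrite exprMn s2 mulr1.
    have := sqr_ge0 (2 * t - 1); rewrite (_ : (2 * t - 1) ^+ 2 = 2 * ((1 - t) ^+ 2 + t ^+ 2) - 1); [lra|ring].
  have l1 := leg 1 (expr1n _ _); have l2 := leg (-1); rewrite sqrrN expr1n in l2; have {}l2 := l2 erefl.
  rewrite scale1r in l1; rewrite scaleN1r in l2; exact: joined_trans l1 (joined_sym l2).
rewrite /hill; refine (@local_core _ _ _ f i x0 r C (fi i x0) (tau ^+ 2 * (la / 8)) (Num.min rho1 (r / 2)) [set w | w = tau *: e \/ w = tau *: (- e)] K k0 rho20 _ _ _).
- move=> w [->|->]; split; try (by apply: tnu => //; rewrite normrN).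
  + by rewrite -E1; exact: up.
  + by rewrite -EN1; exact: up.
- have self w : fi i x0 < f (icoord i (x0 + w)) -> im i (x0 + w) -> joined [set q | fi i x0 < f q] (icoord i (x0 + w)) (icoord i (x0 + w)).
    by move=> h1 h2; apply: seg_joined => t _; rewrite subrr scaler0 addr0.
  have s1 : joined [set q | fi i x0 < f q] (icoord i (x0 + tau *: e)) (icoord i (x0 + tau *: e)).
    by apply: self; rewrite -E1; [exact: upj|exact: inU].
  have s2 : joined [set q | fi i x0 < f q] (icoord i (x0 + tau *: (- e))) (icoord i (x0 + tau *: (- e))).
    by apply: self; rewrite -EN1; [exact: upj|exact: inU].
  move=> w w' h h'; case: h => ->; case: h' => ->; [exact: s1|exact: JJ|exact: (joined_sym JJ)|exact: s2].
move=> y; rewrite lt_min => /andP[hy hyr] cy.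
have Uy : im i y by apply: (ctrl_U K); lra.
have line (v : 'rV[R]_n) : `|v| <= nu -> 0 <= 'D_v (fi i) y -> la / 2 < 'D_v ('D_v (fi i)) y ->
    forall t : R, 0 <= t <= 1 -> fi i x0 < fi i (y + t *: (tau *: v)).
  move=> hv d1 d2 t /andP[t0 t1]; rewrite scalerA.
  have tt1 : t * tau <= tau by rewrite ler_piMl.
  have tt0 : 0 <= t * tau by rewrite mulr_ge0.
  apply: (lt_le_trans cy); apply: le_trans (T3 y (t * tau) v hyr hv tt0 tt1).
  rewrite -addrA lerDl addr_ge0 ?mulr_ge0 ?sqr_ge0//.
  by move: ('D_v ('D_v (fi i)) y) d2 => d d2; lra.
(* The sign of [e] is chosen so that [f] does not decrease to first order at [y]; positivity of the
   second derivative then makes the whole segment stay above the level. *)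
have [d1|d1] := leP 0 ('D_e (fi i) y).
  exists (tau *: e); [by left|exact: line d1 (H1 y hy)].
exists (tau *: (- e)); first by right.
have heN : `|- e| <= nu by rewrite normrN.
apply: line => //.
  by rewrite -scaleN1r (smooth_dirZ (-1) e oU sfi Uy) mulN1r oppr_ge0 ltW.
have -> : - e = (-1) *: e + 0 *: e by rewrite scaleN1r scale0r addr0.
rewrite (dir2_expand e e (-1) 0 oU sfi Uy) !mul0r !addr0 !mulN1r opprK; exact: H1.
Qed.

Hypothesis m_gt0 : (0 < m)%N.
Variable alpha : R.
Hypothesis hscal : forall p : M, scalar_curvature p <= alpha.
Hypothesis halpha : alpha < n%:R / 2 - 1.

Lemma sc_lap (nn L al : R) : nn / 2 - L <= al -> al < nn / 2 - 1 -> 0 < L. Proof. by lra. Qed.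

(** At a critical point the positive Laplacian yields a frame vector [e] with positive second
    derivative. By [J]-invariance the Hessian takes the same value at [J e] and vanishes on the
    pair, so it is a positive multiple of the identity on the plane of [e] and [J e]. *)
Lemma chart_local i p (x := coord i p) : dom i p -> hill f i x /\ nomax f i x.
Proof.
move=> di; have Ux : im i x := im_coord di; have sfi := sc_f (chart_sc i hsol); have oU := @im_open _ _ M i.
have kc := chart_kc i; have sc := chart_sc i hsol.
have [[v hv]|ncr] := pselect (exists v, 'D_v (fi i) x != 0).
  have [d Ed] : exists d : R, d = 'D_v (fi i) x by eexists.
  rewrite -Ed in hv; have [pos|neg] := ltP 0 d.
    by apply: (local_regular hsol Ux (v := v)); rewrite -[X in _ < X]Ed.
  apply: (local_regular hsol Ux (v := - v)).
  by rewrite -scaleN1r (smooth_dirZ (-1) v oU sfi Ux) mulN1r -[X in - X]Ed oppr_gt0 lt_neqAle hv.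
have cr u : 'D_u (fi i) x = 0.
  by apply/eqP; apply/negPn/negP => h; apply: ncr; exists u.
have [E hE] := orthonormal_frame (kc_posdef kc Ux).
have lap0 : 0 < lap (met i) (fi i) x.
  have h := hscal p; rewrite (scalE hsol di) in h; exact: sc_lap h halpha.
have [a ha] : exists a, 0 < 'D_(row a E) ('D_(row a E) (fi i)) x.
  apply: contrapT => nex; move: lap0; rewrite (tr_frame_d2 Ux hE sfi) ltNge => /negP; apply.
  by apply: sumr_le0 => a _; rewrite leNgt; apply/negP => h; apply: nex; exists a.
set e := row a E in ha; pose H := coord_hessian (met i) (fi i) x.
have HE u w : 'D_u ('D_w (fi i)) x = bil H u w.
  by rewrite /H (bil_hessian kc Ux u w sfi) cr subr0.
have HJ u w : bil H (u *m J) (w *m J) = bil H u w.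
  by rewrite -bil_mulr -bil_mull mulmxA ((hermitian_comm H).2 (sc_J sc Ux)).
have HT u w : bil H u w = bil H w u by rewrite -[LHS]bilT (hessian_sym kc Ux sfi).
have H0 : bil H e (e *m J) = 0.
  have h1 := HJ e (e *m J); rewrite mulJJ bilNr HT in h1.
  by move: h1; move: (bil H e (e *m J)) => b; lra.
apply: (local_critical (e := e) (e' := e *m J) (la := 'D_e ('D_e (fi i)) x) Ux cr _ ha) => a0 b0.
rewrite !HE bilDl !bilDr !bilZl !bilZr HJ (HT (e *m J)) H0.
by move: (bil H e e) => b; ring.
Qed.

Lemma local_manifold p : (forall e : R, 0 < e -> exists2 z, dist p z < e & f p < f z) /\
  exists2 d : R, 0 < d & forall y z, dist p y < d -> dist p z < d -> f p < f y -> f p < f z ->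
    joined [set q | f p < f q] y z.
Proof.
pose i := chart_at p; have di : dom i p := dom_chart_at p; have Ux := im_coord di.
have [[rho rho0 hl] nm] := chart_local di.
have fp : fi i (coord i p) = f p by rewrite /chart_fun coordK.
split.
  move=> e e0; have np := nbhs_dist conn p e0.
  have nb : nbhs (coord i p) (icoord i @^-1` [set q | dist p q < e]).
    by apply: (icoord_continuous Ux); rewrite coordK.
  have [r r0 hr] := (nbhs_norm_ex _ _).1 nb.
  by have [z [Uz hz] fz] := nm r r0; exists (icoord i z); [exact: hr|rewrite -fp].
have [r [C g]] := good_ex Ux; have r0 := gd_r g.
have r10 : 0 < Num.min r rho by rewrite lt_min r0.
have xx : `|coord i p - coord i p| < Num.min r rho by rewrite subrr normr0.
have nn := good_nbhs (good_le g r10 (_ : Num.min r rho <= r)) di xx.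
rewrite ge_min lexx in nn; have {}nn := nn isT.
have [d d0 hd] := dist_nbhs conn nn; exists d => // y z /hd[dy hy] /hd[dz hz] fy fz.
move: hy hz; rewrite !lt_min => /andP[_ hy] /andP[_ hz].
have := hl (coord i y) (coord i z) hy hz; rewrite fp /chart_fun !coordK//; exact.
Qed.
End Critical.

(** * Connectedness of the sets above a level, and ends *)

Section Mountain.
Variables (R : realType) (m : nat) (M : kahlerManifold R m) (f : M -> R).
Local Notation n := (m + m)%N.
Hypothesis hsol : gradient_shrinking_KR_soliton f.
Let conn : connected [set: M]. Proof. by have [[]] := hsol. Qed.
Let compl : complete_metric M. Proof. by have [] := hsol. Qed.
Implicit Types (p q : M).
Hypothesis m_gt0 : (0 < m)%N.
Variable alpha : R.
Hypothesis hscal : forall p : M, scalar_curvature p <= alpha.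
Hypothesis halpha : alpha < n%:R / 2 - 1.

Local Notation Up c := [set q | c < f q].
Let fc p : {for p, continuous f} := f_continuous hsol (p := p).

Lemma Up_open c : open (Up c).
Proof.
rewrite -[Up c]/(f @^-1` [set z | c < z]); apply: open_comp; last exact: open_gt.
by move=> p _; exact: fc.
Qed.

Lemma joined_near (A : set M) p : open A -> A p -> exists2 d : R, 0 < d & forall q, dist p q < d -> joined A p q.
Proof.
move=> oA Ap; pose i := chart_at p; have di : dom i p := dom_chart_at p; have Ux := im_coord di.
have [r [C g]] := good_ex Ux; have r0 := gd_r g.
have nb : nbhs (coord i p) (icoord i @^-1` A).
  by apply: (icoord_continuous Ux); rewrite coordK//; apply: open_nbhs_nbhs.
have [r' r'0 hr'] := (nbhs_norm_ex _ _).1 nb.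
have rm : 0 < Num.min r r' by rewrite lt_min r0.
have xx : `|coord i p - coord i p| < Num.min r r' by rewrite subrr normr0.
have le : Num.min r r' <= r by rewrite ge_min lexx.
have [d d0 hd] := dist_nbhs conn (good_nbhs (good_le g rm le) di xx).
exists d => // q /hd[dq hq]; rewrite -(coordK di) -(coordK dq).
apply: seg_joined => t t01; have := ball_conv xx hq t01; rewrite lt_min => /andP[h1 h2].
by split; [exact: (gd_im g)|exact: hr'].
Qed.

Lemma joined_all p q : joined [set: M] p q.
Proof.
pose B := [set z | joined [set: M] p z].
have oB : open B.
  rewrite openE => z Bz; have [d d0 hd] := joined_near openT (I : [set: M] z).
  apply: filterS (nbhs_dist conn z d0) => w /hd; exact: joined_trans.
have cB : closed B.
  rewrite -[B]setCK; apply: open_closedC; rewrite openE => z nBz.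
  have [d d0 hd] := joined_near openT (I : [set: M] z).
  apply: filterS (nbhs_dist conn z d0) => w /hd h1 h2; apply: nBz; exact: joined_trans h2 (joined_sym h1).
have BT : B = setT.
  apply: conn; [|by exists B => //; rewrite setTI|by exists B => //; rewrite setTI].
  by have [d d0 hd] := joined_near openT (I : [set: M] p); exists p; apply: hd; rewrite (dist_refl conn).
have : B q by rewrite BT.
by [].
Qed.

Lemma joined_refl (A : set M) p : open A -> A p -> joined A p p.
Proof. by move=> oA Ap; have [d d0 hd] := joined_near oA Ap; apply: hd; rewrite (dist_refl conn). Qed.

(** A connected set cannot meet both of two disjoint open sets that cover it. *)
Lemma joined_split (A B C : set M) p q : open A -> open B -> A `&` B = set0 -> C `<=` A `|` B -> A p -> B q -> ~ joined C p q.
Proof.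
move=> oA oB AB0 CAB Ap Bq [G [cG coG GC Gp Gq]].
have GA : G `&` A = G.
  apply: coG; first by exists p.
    by exists A => //; rewrite setIC.
  exists (~` B); first exact: open_closedC.
  apply/seteqP; split=> z [Gz Az]; split=> //.
    by move=> Bz; have : (A `&` B) z by []; rewrite AB0.
  by case: (CAB z (GC z Gz)).
have [_ Aq] : (G `&` A) q by rewrite GA.
by have : (A `&` B) q by []; rewrite AB0.
Qed.

(** The radius given by [local_manifold] at each point of the level set is made uniform by
    compactness of the sublevel set. Points off the level impose no condition. *)
Lemma uniform_level c : exists2 d : R, 0 < d & forall x, f x = c -> forall y z, dist x y < d -> dist x z < d ->
  c < f y -> c < f z -> joined (Up c) y z.
Proof.
pose P (S : set M) := exists2 d : R, 0 < d & forall x, S x -> f x = c -> forall y z, dist x y < d -> dist x z < d ->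
  c < f y -> c < f z -> joined (Up c) y z.
have [d d0 hd] : P [set p | f p <= c].
  apply: (@compact_ind _ [set p | f p <= c] P (f_proper hsol m_gt0 (c := c))).
  - by exists 1.
  - move=> S1 S2 [d d0 h1] [e e0 h2]; exists (Num.min d e); first by rewrite lt_min d0.
    move=> x [Sx|Sx] fx y z; rewrite !lt_min => /andP[a1 a2] /andP[b1 b2] fy fz; [exact: (h1 x)|exact: (h2 x)].
  - by move=> S1 S2 S12 [d d0 h]; exists d => // x /S12; exact: h.
  move=> x0 _; have [fx0|nfx0] := eqVneq (f x0) c.
    have [_ [d d0 hd]] := local_manifold hsol hscal halpha x0.
    have d2 : 0 < d / 2 by lra.
    exists [set q | dist x0 q < d / 2]; first exact: nbhs_dist.
    exists (d / 2) => // x xx0 _ y z hy hz fy fz; rewrite -fx0; apply: hd; rewrite ?fx0//.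
      by apply: le_lt_trans (dist_triangle conn x x0 y) _; move: xx0 => /=; lra.
    by apply: le_lt_trans (dist_triangle conn x x0 z) _; move: xx0 => /=; lra.
  exists [set q | f q != c]; last by exists 1 => // x /= /eqP.
  have h0 : 0 < `|f x0 - c| by rewrite normr_gt0 subr_eq0.
  have /cvgrPdist_lt := fc (p := x0) => /(_ _ h0); apply: filterS => q /= hq; apply/eqP => fq.
  by move: hq; rewrite fq ltxx.
by exists d => // x fx; apply: hd => //=; rewrite fx.
Qed.

(* No small ball centred on the level [c] meets both sides of a splitting of [f > c], so each side
   can be thickened across the level set without meeting the other one. *)
Lemma no_split c p q : c < f p -> c < f q -> (forall c', c' < c -> joined (Up c') p q) -> joined (Up c) p q.
Proof.
move=> cp cq Hj; apply: contrapT => nj.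
pose A := [set y | joined (Up c) p y]; pose B := [set y | c < f y /\ ~ joined (Up c) p y].
have subA y : A y -> c < f y by move=> [G [_ _ GU _ Gy]]; exact: GU.
have oA : open A.
  rewrite openE => y Ay; have [d d0 hd] := joined_near (Up_open c) (subA y Ay).
  by apply: filterS (nbhs_dist conn y d0) => w /hd; exact: joined_trans.
have oB : open B.
  rewrite openE => y [cy ny]; have [d d0 hd] := joined_near (Up_open c) (cy : Up c y).
  apply: filterS (nbhs_dist conn y d0) => w /hd h; split; first by have [G [_ _ GU _ Gw]] := h; exact: GU.
  by move=> h2; apply: ny; exact: joined_trans h2 (joined_sym h).
have Ap : A p by exact: joined_refl (Up_open c) cp.
have Bq : B q by [].
have AB y : c < f y -> A y \/ B y by move=> cy; have [h|h] := pselect (A y); [left|right].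
have nAB y y' : A y -> B y' -> ~ joined (Up c) y y'.
  by move=> Ay [_ ny'] h; apply: ny'; exact: joined_trans Ay h.
have [d d0 hd] := uniform_level c.
have d3 : 0 < d / 3 by lra.
(* Small balls around the points of the level set that are approached by [S]. The radius [d / 3]
   leaves room for the triangle inequalities in [key]. *)
pose near (S : set M) := [set z | exists x, [/\ f x = c, dist x z < d / 3 & exists2 y, S y & dist x y < d / 3]].
have onear S : open (near S).
  rewrite openE => z [x [fx xz Sy]]; have e0 : 0 < d / 3 - dist x z by rewrite subr_gt0.
  apply: filterS (nbhs_dist conn z e0) => w hw; exists x; split=> //.
  by apply: le_lt_trans (dist_triangle conn z x w) _; move: hw => /=; lra.
have key x x' y y' : f x = c -> f x' = c -> dist x x' < 2 * (d / 3) -> dist x y < d / 3 -> dist x' y' < d / 3 ->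
    A y -> B y' -> False.
  move=> fx fx' xx' xy xy' Ay By'; apply: (nAB y y' Ay By'); apply: (hd x fx) => //.
  - by apply: lt_trans xy _; lra.
  - by apply: le_lt_trans (dist_triangle conn x' x y') _; lra.
  - exact: subA.
  - by case: By'.
have xx0 (x : M) : dist x x < 2 * (d / 3) by rewrite (dist_refl conn); lra.
have disj : (A `|` near A) `&` (B `|` near B) = set0.
  apply/seteqP; split=> // z [[Az|[x [fx xz [y Ay xy]]]] [Bz|[x' [fx' xz' [y' By' xy']]]]].
  - by apply: (nAB z z Az Bz); apply: (joined_refl (Up_open c)); exact: subA.
  - exact: (key x' x' z y' fx' fx' (xx0 x') xz' xy' Az By').
  - exact: (key x x y z fx fx (xx0 x) xy xz Ay Bz).
  apply: (key x x' y y' fx fx' _ xy xy' Ay By').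
  by apply: le_lt_trans (dist_triangle conn z x x') _; rewrite (dist_sym z x'); lra.
(* The points not above the level [c] that are far from the level set form a compact set on which
   [f] is less than [c]. Its maximum gives a level [c'] below [c] above which only the thickened
   sides occur. *)
pose Q := [set z | f z <= c /\ forall x, f x = c -> d / 3 <= dist x z].
have cQ : compact Q.
  apply: (subclosed_compact _ (f_proper hsol m_gt0 (c := c))); last by move=> z [].
  have -> : Q = [set z | f z <= c] `&` \bigcap_(x in [set x | f x = c]) [set z | d / 3 <= dist x z].
    by apply/seteqP; split=> z [h1 h2]; split=> // x fx; exact: h2.
  apply: closedI.
    rewrite -[[set z | _]]/(f @^-1` [set z | z <= c]).
    by apply: preimage_closed => [z _|]; [exact: fc|exact: closed_le].
  apply: closed_bigI => x _; rewrite -[[set z | _]]/(dist x @^-1` [set z | d / 3 <= z]).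
  by apply: preimage_closed => [z _|]; [exact: dist_continuous|exact: closed_ge].
have [c' c'c hQ] : exists2 c', c' < c & forall z, Q z -> f z <= c'.
  have [[z0 Qz0]|nQ] := pselect (Q !=set0); last first.
    by exists (c - 1); [lra|move=> z Qz; exfalso; apply: nQ; exists z].
  have cf z : Q z -> {for z, continuous (fun z => - f z)} by move=> _; apply: continuousN; exact: fc.
  have [z1 [fz1 hz1] hmin] := @compact_argmin _ R _ (fun z => - f z) cQ (ex_intro _ z0 Qz0) cf.
  exists (f z1); last by move=> z Qz; have := hmin z Qz; rewrite lerN2.
  rewrite lt_neqAle fz1 andbT; apply/eqP => e.
  by have := hz1 z1 e; rewrite (dist_refl conn) leNgt d3.
apply: (@joined_split (A `|` near A) (B `|` near B) (Up c') p q) => //; last exact: Hj.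
- by apply: openU.
- by apply: openU.
- move=> z /= cz; have [cz'|zc] := ltP c (f z).
    by have [h|h] := AB z cz'; [left; left|right; left].
  have [x fx xz] : exists2 x, f x = c & dist x z < d / 3.
    apply: contrapT => nx; have : Q z.
      by split=> // x fx; rewrite leNgt; apply/negP => h; apply: nx; exists x.
    by move=> /hQ; rewrite leNgt cz.
  have [nm _] := local_manifold hsol hscal halpha x; have [y xy] := nm _ d3; rewrite fx => fy.
  have [Ay|By] := AB y fy; [left|right]; right; exists x; split=> //; by exists y.
- by left.
- by left.
Qed.

(** Let [s] be the supremum of the levels above which [p] and [q] are joined. It is attained by
    [no_split], and the joining set, being compact, has a minimum of [f] strictly greater than [s],
    so a higher level also works: a contradiction. *)
Lemma Up_joined c p q : c < f p -> c < f q -> joined (Up c) p q.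
Proof.
move=> cp cq; apply: contrapT => nj.
pose S := [set c' : R | joined (Up c') p q].
have down c1 c2 : c1 <= c2 -> S c2 -> S c1.
  by move=> c12; apply: joined_sub => z /=; exact: le_lt_trans.
have Sne : S !=set0.
  have [G [cG coG _ Gp Gq]] := joined_all p q.
  have [z Gz hz] := @compact_argmin _ R _ f cG (ex_intro _ p Gp) (fun x _ => fc (p := x)).
  exists (f z - 1); exists G; split=> // w Gw /=; have := hz w Gw; lra.
have ubS : ubound S c.
  move=> c1 Sc1; rewrite leNgt; apply/negP => h; apply: nj; exact: down (ltW h) Sc1.
have supS : has_sup S by split=> //; exists c.
pose s := sup S; have sc : s <= c by exact: ge_sup.
have Sl c' : c' < s -> S c'.
  move=> h; have e0 : 0 < s - c' by rewrite subr_gt0.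
  have [c2 Sc2 hc2] := sup_adherent e0 supS; apply: (down c' c2) => //; rewrite -/s in hc2; lra.
have Ss : S s by apply: no_split => //; [exact: le_lt_trans cp|exact: le_lt_trans cq].
have [G [cG coG GU Gp Gq]] := Ss.
have [z Gz hz] := @compact_argmin _ R _ f cG (ex_intro _ p Gp) (fun x _ => fc (p := x)).
have sz : s < f z := GU z Gz.
have S2 : S ((s + f z) / 2).
  exists G; split=> // w Gw /=; have := hz w Gw; lra.
have := sup_upper_bound supS S2; rewrite -/s; lra.
Qed.

Lemma Up_connected c : connected (Up c).
Proof.
move=> B [p Bp] [C oC EC] [D cD ED]; apply/seteqP; split=> [z|q cq]; first by rewrite EC => -[].
have cp : c < f p by move: Bp; rewrite EC => -[].
have [G [cG coG GU Gp Gq]] := Up_joined cp cq.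
have GB : G `&` B = G.
  apply: coG; first by exists p.
    exists C => //; rewrite EC; apply/seteqP; split=> z; first by move=> [? []].
    by move=> [Gz Cz]; split=> //; split=> //; exact: GU.
  exists D => //; rewrite ED; apply/seteqP; split=> z; first by move=> [? []].
  by move=> [Gz Cz]; split=> //; split=> //; exact: GU.
by have [] : (G `&` B) q by rewrite GB.
Qed.

Lemma bounded_compact (A : set M) : compact A -> dist_bounded A.
Proof.
move=> cA; have [[p0 _] _] : [set: M] !=set0 /\ connected [set: M] by have [] := hsol.
have [b b0 hb] := @compact_ubound _ R _ (dist p0) cA (fun q _ => dist_continuous conn (p := p0) (q := q)).
exists (b + b) => p q /hb h1 /hb h2; apply: le_trans (dist_triangle conn p0 p q) _.
by rewrite dist_sym lerD.
Qed.

(** [M] is unbounded: otherwise it would be a compact ball and [f] would attain a maximum, which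
    [local_manifold] excludes. *)
Lemma not_bounded_union (A B : set M) : (forall p, A p \/ B p) -> compact A -> dist_bounded B -> False.
Proof.
move=> AB cA [r hr]; have [[p0 _] _] : [set: M] !=set0 /\ connected [set: M] by have [] := hsol.
have [b b0 hb] := @compact_ubound _ R _ (dist p0) cA (fun q _ => dist_continuous conn (p := p0) (q := q)).
have [rho hrho] : exists rho, forall p, dist p0 p <= rho.
  have [[q Bq]|nB] := pselect (B !=set0); last first.
    by exists b => p; have [/hb//|Bp] := AB p; exfalso; apply: nB; exists p.
  exists (b + (dist p0 q + `|r|)) => p.
  have d0 := dist_ge0 conn p0 q; have r0 := ler_norm r; have r1 := normr_ge0 r.
  have [/hb h|Bp] := AB p; first lra.
  have := dist_triangle conn q p0 p; have := hr q p Bq Bp; lra.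
have cf z : [set p | dist p0 p <= rho] z -> {for z, continuous (fun z => - f z)} by move=> _; apply: continuousN; exact: fc.
have [z _ hmin] := @compact_argmin _ R _ (fun z => - f z) (ball_compact conn compl (p := p0) (rho := rho)) (ex_intro _ p0 (hrho p0)) cf.
have [nm _] := local_manifold hsol hscal halpha z; have [y _ fy] := nm 1 ltr01.
by have := hmin y (hrho y); rewrite lerN2 leNgt fy.
Qed.

(** A level [c] above the maximum of [f] on [K] is chosen. The connected set above [c] lies in a
    single component of the complement of [K], and a component that misses it is contained in a
    compact sublevel set, hence bounded. *)
Lemma one_end : connected_at_infinity M.
Proof.
move=> K cK; have [c c0 hc] := @compact_ubound _ R _ f cK (fun x _ => fc (p := x)).
have UK : Up c `<=` ~` K by move=> z /= cz Kz; have := hc z Kz; rewrite leNgt cz.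
have cover p : f p <= c \/ Up c p by case: (leP (f p) c) => h; [left|right].
have cL := f_proper hsol m_gt0 (c := c).
have [p cp] : Up c !=set0.
  apply: contrapT => nU; apply: (not_bounded_union (A := [set p | f p <= c]) (B := set0)) => //.
    by move=> p; have [h|h] := cover p; [left|exfalso; apply: nU; exists p].
  by exists 0.
have sub : Up c `<=` connected_component (~` K) p.
  by apply: connected_component_max => //; exact: Up_connected.
exists (connected_component (~` K) p); split.
  split; first by exists p => //; exact: UK.
  move=> [r hr]; apply: (not_bounded_union (A := [set p | f p <= c]) (B := Up c)) => //.
  by exists r => x y /sub hx /sub hy; exact: hr.
move=> C [[q Kq EC] nb]; rewrite EC.
have [z [Cz cz]] : exists z, C z /\ Up c z.
  apply: contrapT => nz; apply: nb; have [r hr] := bounded_compact cL; exists r => x y Cx Cy.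
  by apply: hr; [case: (cover x) => // h; exfalso; apply: nz; exists x|case: (cover y) => // h; exfalso; apply: nz; exists y].
rewrite EC in Cz.
by rewrite (same_connected_component Cz) (same_connected_component (sub z cz)).
Qed.
End Mountain.

Theorem corollary3p5 (R : realType) (m n : nat) (hn : n = (m + m)%N)
    (M : kahlerManifold R m) (f : M -> R) (alpha : R)
    (hsol : gradient_shrinking_KR_soliton f)
    (hscal : forall p : M, scalar_curvature p <= alpha)
    (halpha : alpha < n%:R / 2 - 1) :
  connected_at_infinity M.
Proof.
(* In dimension zero the scalar curvature is an empty sum, while [alpha] would be less than -1. *)
subst n; case: (posnP m) => [m0|m_gt0]; last exact: (one_end hsol m_gt0 hscal halpha).
have [[[p _] _] _ _ _ _] := hsol; exfalso.
have := hscal p; have -> : scalar_curvature p = 0.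
  rewrite /scalar_curvature /coord_scal /mxtrace big1// => a; exfalso.
  by case: a => k hk; move: (hk); rewrite m0.
by move: halpha; rewrite m0 mul0r sub0r; lra.
Qed.
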